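(* Let $x$ and $y$ be complex random variables with zero mean and unit variance. Let $X_n = (x_{ij})_{1\le i,j\le n}$ and $Y_n = (y_{ij})_{1\le i,j\le n}$ be $n\times n$ random matrices whose entries $x_{ij}$, $y_{ij}$ are iid copies of $x$ and $y$, respectively. For each $n$, let $M_n$ be a deterministic $n\times n$ complex matrix such that $$\sup_n \frac{1}{n^2}\|M_n\|_2^2 < \infty .$$ Let $A_n := M_n + X_n$ and $B_n := M_n + Y_n$. Then $\mu_{\frac{1}{\sqrt n}A_n} - \mu_{\frac{1}{\sqrt n}B_n}$ converges in probability to zero. If furthermore the ESDs $$\mu_{(\frac{1}{\sqrt n}M_n - zI)(\frac{1}{\sqrt n}M_n - zI)^*}$$ converge to a limit as $n\to\infty$ for (Lebesgue) almost every $z\in\mathbb{C}$, then $\mu_{\frac{1}{\sqrt n}A_n} - \mu_{\frac{1}{\sqrt n}B_n}$ converges almost surely to zero.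
   Context: For an $n\times n$ complex matrix $A$ with eigenvalues $\lambda_1,\dots,\lambda_n$ (counted with algebraic multiplicity), the empirical spectral distribution (ESD) $\mu_A$ is the probability measure $\mu_A=\frac1n\sum_{i=1}^n\delta_{\lambda_i}$ on $\mathbb{C}$ (equivalently, $\mu_A(s,t)=\frac1n|\{i:\mathrm{Re}\,\lambda_i\le s,\ \mathrm{Im}\,\lambda_i\le t\}|$). $\|A\|_2:=\mathrm{trace}(AA^* )^{1/2}$ is the Hilbert-Schmidt norm, and $I$ is the identity matrix. Zero mean and unit variance means $\mathbf{E}x=0$, $\mathbf{E}|x|^2=1$. Measures are given the vague topology: deterministic measures $\mu_n$ converge to $\mu$ if $\int f\,d\mu_n\to\int f\,d\mu$ for every continuous compactly supported $f:\mathbb{C}\to\mathbb{R}$. For random probability measures $\mu_n,\mu_n'$ on $\mathbb{C}$: $\mu_n-\mu_n'$ converges in probability to zero if for every continuous compactly supported $f$ the random variable $\int f\,d\mu_n-\int f\,d\mu_n'$ converges to $0$ in probability; it converges almost surely to zero if with probability $1$, $\int f\,d\mu_n-\int f\,d\mu_n'\to0$ for all such $f$. For all $n$, the matrices $X_n$ are the upper-left $n\times n$ blocks of a single infinite array $(x_{ij})_{i,j\ge1}$ of iid copies of $x$, and likewise the $Y_n$ are blocks of a single infinite array $(y_{ij})_{i,j\ge1}$ of iid copies of $y$. *)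

(* Defs.v *)
From mathcomp Require Import all_boot all_order all_algebra finmap.
From mathcomp Require Import all_classical all_reals all_analysis.
From mathcomp Require Import spectral complex.

Set Implicit Arguments.
Unset Strict Implicit.
Unset Printing Implicit Defensive.

Import Order.TTheory GRing.Theory Num.Theory.
Import numFieldNormedType.Exports.

Local Open Scope classical_set_scope.
Local Open Scope ring_scope.
Local Open Scope complex_scope.

(* The topology of C is the one given by the modulus; the library attaches it
   to the alias R[i]^o of R[i]. *)
Definition borelC (R : realType) := g_sigma_algebraType (@open (R[i])^o).

Section complex_random_variables.
Context d (T : measurableType d) (R : realType) (P : probability T R).

(* In \bar R, an expectation that is the difference of two infinities evaluates
   to -oo, so these equations entail the integrability of both parts. *)
Definition zero_mean (x : T -> R[i]) :=
  ('E_P[fun w => complex.Re (x w)] = 0%:E)%E /\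
  ('E_P[fun w => complex.Im (x w)] = 0%:E)%E.

Definition unit_variance (x : T -> R[i]) :=
  ('E_P[fun w => (Normc.normc (x w) ^+ 2)%R] = 1%:E)%E.

Definition mutually_independent d' (T' : measurableType d') (I : choiceType)
    (X : I -> {RV P >-> T'}) :=
  forall (J : {fset I}) (A : I -> set T'), (forall i, measurable (A i)) ->
    P (\bigcap_(i in [set` J]) (X i @^-1` A i)) =
    (\prod_(i <- J) P (X i @^-1` A i))%E.

Definition iid_copies (X : nat -> nat -> {RV P >-> borelC R})
    d' (T' : measurableType d') (P' : probability T' R)
    (x : {RV P' >-> borelC R}) :=
  mutually_independent (fun k : nat * nat => X k.1 k.2) /\
  forall i j (A : set (borelC R)), measurable A ->
    distribution P (X i j) A = distribution P' x A.

Definition random_mx (X : nat -> nat -> T -> R[i]) n (w : T) : 'M[R[i]]_n :=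
  \matrix_(i < n, j < n) X i j w.

End complex_random_variables.

Section spectral_distributions.
Context (R : realType).

Definition eigenvalues n (A : 'M[R[i]]_n) : seq R[i] :=
  sval (closed_field_poly_normal (char_poly A)).

(* char_poly A is monic of degree n, so eigenvalues A has exactly n terms. *)
Definition esd n (A : 'M[R[i]]_n) : {measure set (borelC R) -> \bar R} :=
  mscale (n%:R^-1)%:nng
    (msum (fun i => \d_((eigenvalues A)`_i : borelC R)) n).

Definition hs_norm n (A : 'M[R[i]]_n) : R :=
  Num.sqrt (complex.Re (\tr (A *m (A ^t*)%sesqui))).

Definition div_sqrt n (A : 'M[R[i]]_n) : 'M[R[i]]_n :=
  ((Num.sqrt (n%:R : R))^-1)%:C *: A.

Definition shifted_gram n (A : 'M[R[i]]_n) (z : R[i]) : 'M[R[i]]_n :=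
  (A - z%:M) *m ((A - z%:M) ^t*)%sesqui.

End spectral_distributions.

Section vague_convergence.
Context (R : realType).

Definition Cc (f : (R[i])^o -> R) :=
  continuous f /\ compact (closure [set z | f z != 0]).

(* The integrals are taken in \bar R, so that nothing has to be assumed of nu:
   convergence forces it to be finite on compact sets. *)
Definition vague_cvg (mu : nat -> {measure set (borelC R) -> \bar R})
    (nu : {measure set (borelC R) -> \bar R}) :=
  forall f, Cc f ->
    (\int[mu n]_z (f z)%:E)%E @[n --> \oo] --> (\int[nu]_z (f z)%:E)%E.

Definition ae_C (Q : R[i] -> Prop) :=
  {ae (@lebesgue_measure R \x @lebesgue_measure R)%E,
    forall p, Q (p.1 +i* p.2)}.

Context d (T : measurableType d) (P : probability T R).
Implicit Types mu : nat -> T -> {measure set (borelC R) -> \bar R}.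

Definition cvg_diff_in_probability mu mu' :=
  forall f, Cc f -> forall e : R, 0 < e ->
    P [set w | e <= `|\int[mu n w]_z f z - \int[mu' n w]_z f z|]
      @[n --> \oo] --> 0%:E.

Definition cvg_diff_almost_surely mu mu' :=
  {ae P, forall w, forall f, Cc f ->
    (\int[mu n w]_z f z - \int[mu' n w]_z f z) @[n --> \oo] --> (0 : R)}.

End vague_convergence.

(* Main.v *)
Require Import Defs.
From HB Require Import structures.
From mathcomp Require Import all_boot all_order all_algebra finmap.
From mathcomp Require Import all_classical all_reals all_analysis.
From mathcomp Require Import measurable_realfun.
From mathcomp Require Import spectral complex ring lra zify.

Set Implicit Arguments.
Unset Strict Implicit.
Unset Printing Implicit Defensive.

Import Order.TTheory GRing.Theory Num.Theory.
Import numFieldNormedType.Exports.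

Local Open Scope classical_set_scope.
Local Open Scope ring_scope.

(* For fixed z, the means of ln |det (A_n / sqrt n - z)| and ln |det (B_n / sqrt n - z)|
   over n differ by a quantity tending to 0 almost surely, whatever the matrices M_n:
   for L^40 <= n < (L+1)^40 the squared determinant is the Gram determinant of the first
   n - L^20 rows times the squared distances of the other rows to the span of their
   predecessors.  A regularised logarithm of the first factor has bounded differences, so
   it concentrates; its expectation moves by o(n) when the rows of X are replaced one by
   one by rows of Y, because a quadratic form in a random row is close to its mean.  The
   distances are bounded below by a maximal-minor form of Odlyzko's argument and, for the
   last rows, by Littlewood-Offord bounds over a net of normal vectors.  Borel-Cantelli
   concludes, so the convergence of the spectra of the shifts of M_n plays no role.

   For the spectra, the mean of ln |w - .| over the vertices of a regular N-gon of radius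
   rho and centre c is within (1 + ell) / N of ln max (|w - c|, rho), where ell has a
   second moment bounded in w when rho is averaged over an interval.  Differences of such
   means for two radii therefore approximate a radial bump, Fubini and uniform
   integrability transfer the almost sure convergence to the bumps, and lattice
   combinations of bumps are uniformly dense in the test functions. *)

(** * Random arrays and resampling *)

(** Almost sure convergence under two moments needs failure probabilities summable in n, which
    dictates the scales. With n about L^40 a block holds O(L^39) values of n, so O(L^-41) per n sums
    to O(L^-2). Odlyzko's bound (1 - beta)^(n - k) is negligible while n - k >= L; each of the last
    L rows must fail with probability O(L^-42). There a normal vector w of the previous rows, with
    largest coordinate 1, is coarsened in stages. If many coordinates of w form no clump of L^12
    nearly equal values, the next row is nearly orthogonal to w with probability at most L^-42.
    Otherwise w is close to a net point with at most L^29 values off few coordinates; if that has no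
    clumps of L^24, its small-ball probability L^-30 per row beats the L^29 choices per coordinate.
    The next net has at most L^17 values against L^-18, the last one is sparse and faces 1 - beta.
    The rest of the entropy, n^O(L^39), loses to a geometric factor in about L^40 rows. The
    regularised block has n - L^20 rows: its resolvent keeps trace L^20, far above ln n, so a
    quadratic form in a row is close to its mean, while the other L^20 rows cost o(n). *)

Section arrays.
Context (R : realType).

Definition arr_gen : set (set (nat -> nat -> borelC R)) :=
  [set B | exists (i j : nat) (A : set (borelC R)),
    measurable A /\ B = [set a | A (a i j)]].

Definition Arr := g_sigma_algebraType arr_gen.

Lemma measurable_coord i j : measurable_fun setT (fun a : Arr => a i j).
Proof.
move=> _ A mA; rewrite setTI; apply: sub_sigma_algebra.
by exists i, j, A.
Qed.

Lemma measurable_to_Arr d (T : measurableType d) (X : T -> Arr) :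
  (forall i j, measurable_fun setT (fun w => X w i j)) ->
  measurable_fun setT X.
Proof.
move=> mX; apply: (@measurability _ _ _ Arr setT X arr_gen) => //.
move=> _ [B [i [j [A [mA ->]]]] <-].
exact: (mX i j measurableT A mA).
Qed.

(* Merging two independent copies of an iid array along any set of positions does
   not change the law (merge_law); this replaces conditioning throughout. *)
Definition amerge (S : pred (nat * nat)) (p : Arr * Arr) : Arr :=
  fun i j => if S (i, j) then p.1 i j else p.2 i j.

Lemma measurable_merge S : measurable_fun setT (amerge S).
Proof.
apply: measurable_to_Arr => i j; rewrite /amerge; case: (S (i, j)).
- exact: (measurableT_comp (measurable_coord i j) measurable_fst).
- exact: (measurableT_comp (measurable_coord i j) measurable_snd).
Qed.

HB.instance Definition _ S := isMeasurableFun.Build _ _ _ _ (amerge S) (measurable_merge S).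

Definition indep_law (Q : probability Arr R) :=
  forall (J : {fset nat * nat}) (A : nat * nat -> set (borelC R)),
    (forall i, measurable (A i)) ->
    Q (\bigcap_(i in [set` J]) [set a | A i (a i.1 i.2)]) =
    (\prod_(i <- J) Q [set a | A i (a i.1 i.2)])%E.

Definition cyl (J : {fset nat * nat}) (A : nat * nat -> set (borelC R)) :
    set Arr := \bigcap_(i in [set` J]) [set a | A i (a i.1 i.2)].

Definition cyls : set (set Arr) :=
  [set B | exists (J : {fset nat * nat}) (A : nat * nat -> set (borelC R)),
    (forall i, measurable (A i)) /\ B = cyl J A].

Lemma measurable_coord_set i (A : set (borelC R)) : measurable A ->
  measurable ([set a : Arr | A (a i.1 i.2)]).
Proof. by move=> mA; rewrite -[X in measurable X]setTI; exact: measurable_coord. Qed.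

Lemma measurable_cyl J A : (forall i, measurable (A i)) -> measurable (cyl J A).
Proof.
move=> mA; apply: fin_bigcap_measurable; first exact: finite_fset.
by move=> i _; exact: measurable_coord_set.
Qed.

Lemma cyl_setI : setI_closed cyls.
Proof.
move=> _ _ [J1 [A1 [mA1 ->]]] [J2 [A2 [mA2 ->]]].
exists (J1 `|` J2)%fset,
  (fun i => (if i \in J1 then A1 i else setT) `&` (if i \in J2 then A2 i else setT)).
split.
  by move=> i; apply: measurableI; case: ifP.
rewrite /cyl; apply/seteqP; split => a /=.
- move=> [h1 h2] i /= ; rewrite in_fsetU => /orP[iJ|iJ]; split.
  + by rewrite iJ; exact: h1.
  + by case: ifPn => // iJ2; exact: h2.
  + by case: ifPn => // iJ2; exact: h1.
  + by rewrite iJ; exact: h2.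
- move=> h; split => i /= iJ.
  + by have := h i; rewrite /= in_fsetU iJ => /(_ isT)[].
  + by have := h i; rewrite /= in_fsetU iJ orbT => /(_ isT)[].
Qed.

Lemma cyls_gen : @measurable _ Arr = <<s cyls >>.
Proof.
apply/seteqP; split.
- apply: smallest_sub; first exact: smallest_sigma_algebra.
  move=> _ [i [j [A [mA ->]]]]; apply: sub_sigma_algebra.
  exists [fset (i, j)]%fset, (fun=> A); split => //.
  rewrite /cyl; apply/seteqP; split => a /=.
    by move=> h k /=; rewrite in_fset1 => /eqP ->.
  by move=> /(_ (i, j)) /=; rewrite in_fset1 eqxx; exact.
- apply: smallest_sub; first exact: sigma_algebra_measurable.
  by move=> _ [J [A [mA ->]]]; exact: measurable_cyl.
Qed.

Lemma Arr_measure_unique (m1 m2 : {measure set Arr -> \bar R}) :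
  m1 setT = 1%E ->
  (forall J A, (forall i, measurable (A i)) -> m1 (cyl J A) = m2 (cyl J A)) ->
  forall E, measurable E -> m1 E = m2 E.
Proof.
move=> m11 h; apply: (measure_unique cyls (fun=> setT)).
- exact: cyls_gen.
- exact: cyl_setI.
- move=> n; exists fset0, (fun=> setT); split => //.
  by rewrite /cyl; apply/seteqP; split => // a _ i.
- by rewrite bigcup_const.
- by move=> _ [J [A [mA ->]]]; exact: h.
- by move=> n; rewrite m11 ltry.
Qed.

Section merge.
Context (Q : probability Arr R) (Qi : indep_law Q).

(** Both sides are probability measures, so cylinders suffice. The constraints of a cylinder on
    positions in [S] fall on the first copy, the others on the second, and by independence both
    sides are the same product over positions. *)
Lemma merge_law (S : pred (nat * nat)) (E : set Arr) : measurable E ->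
  Q E = (Q \x Q)%E (amerge S @^-1` E).
Proof.
move=> mE.
apply: (@Arr_measure_unique Q (distribution (Q \x Q)%E (amerge S))) => //.
  exact: probability_setT.
move=> J A mA; rewrite [LHS](Qi J mA) /distribution /= /pushforward /cyl.
set J1 := [fset i in J | S i]%fset; set J2 := [fset i in J | ~~ S i]%fset.
have -> : amerge S @^-1` (\bigcap_(i in [set` J]) [set a | A i (a i.1 i.2)]) =
   (\bigcap_(i in [set` J1]) [set a : Arr | A i (a i.1 i.2)]) `*`
   (\bigcap_(i in [set` J2]) [set a : Arr | A i (a i.1 i.2)]).
  apply/seteqP; split => -[a b] /=.
  - move=> h; split => -[i j] /=; rewrite !inE /= => /andP[iJ iS].
    + by have := h (i, j) iJ; rewrite /amerge /= iS.
    + by have := h (i, j) iJ; rewrite /amerge /= (negbTE iS).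
  - move=> [h1 h2] [i j] /= iJ; rewrite /amerge /=; case: ifPn => iS.
    + by apply: (h1 (i, j)); rewrite /= !inE /= iJ iS.
    + by apply: (h2 (i, j)); rewrite /= !inE /= iJ iS.
rewrite product_measure1E; last 2 first.
- by apply: fin_bigcap_measurable; [exact: finite_fset|move=> i _; exact: measurable_coord_set].
- by apply: fin_bigcap_measurable; [exact: finite_fset|move=> i _; exact: measurable_coord_set].
rewrite [X in (_ = X * _)%E](Qi J1 mA) [X in (_ = _ * X)%E](Qi J2 mA).
rewrite (bigID S)/=; congr (_ * _)%E.
- by rewrite big_fset_condE; apply: eq_fbigl => i; rewrite !inE.
- by rewrite big_fset_condE; apply: eq_fbigl => i; rewrite !inE.
Qed.

Local Open Scope ereal_scope.

Lemma integral_merge_prod S (F : Arr -> \bar R) : measurable_fun setT F ->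
  (forall a, 0 <= F a) ->
  \int[Q]_a F a = \int[(Q \x Q)]_p F (amerge S p).
Proof.
move=> mF F0; rewrite -(ge0_integral_distribution (amerge S))//.
apply: eq_measure_integral => A mA _; exact: merge_law.
Qed.

Lemma integrable_merge S (F : Arr -> \bar R) : Q.-integrable setT F ->
  (Q \x Q).-integrable setT (F \o amerge S).
Proof.
move=> /integrableP[mF iF]; apply/integrableP; split.
  by apply: measurableT_comp => //; exact: measurable_merge.
have <- : \int[Q]_x `|F x| = \int[(Q \x Q)]_x `|(F \o amerge S) x|.
  by apply: (@integral_merge_prod S (fun x => `|F x|)) => //; exact: measurableT_comp.
exact: iF.
Qed.

(** Fubini on the two copies: the inner integral is the conditional expectation of [F] given the
    entries at positions in [S], realised as an explicit function of [a]. *)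
Lemma integral_merge_int S (F : Arr -> \bar R) : Q.-integrable setT F ->
  \int[Q]_a F a = \int[Q]_a \int[Q]_b F (amerge S (a, b)).
Proof.
move=> iF; have iFS := integrable_merge S iF.
rewrite [RHS](@integral12_prod_meas1 _ _ _ _ _ Q Q (F \o amerge S))//.
rewrite -(integral_distribution (X := amerge S))//; last exact: measurable_int iF.
apply: eq_measure_integral => A mA _; exact: merge_law.
Qed.

End merge.
End arrays.

(** * Complex moduli and componentwise measurability *)

Section cabs.
Context (R : realType).
Implicit Types z w : R[i].

(** The norm of [R[i]] is itself an element of [R[i]]; a real-valued modulus makes ordered-field
    reasoning over [R] available. *)
Definition cabs z : R := Normc.normc z.

Lemma cabs_normr z : `|z| = (cabs z)%:C%C.
Proof. by case: z. Qed.

Lemma cabs_ge0 z : 0 <= cabs z.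
Proof. by rewrite -ler0c -cabs_normr normr_ge0. Qed.

Lemma cabs_eq0 z : (cabs z == 0) = (z == 0).
Proof.
rewrite -(normr_eq0 z) cabs_normr; apply/eqP/eqP => [->|] //.
by move/(congr1 (@complex.Re R)).
Qed.

Lemma cabs_gt0 z : (0 < cabs z) = (z != 0).
Proof. by rewrite lt0r cabs_ge0 andbT cabs_eq0. Qed.

Lemma cabs0 : cabs 0 = 0.
Proof. by apply/eqP; rewrite cabs_eq0. Qed.

Lemma cabsM z w : cabs (z * w) = cabs z * cabs w.
Proof. exact: Normc.normcM. Qed.

Lemma cabsD z w : cabs (z + w) <= cabs z + cabs w.
Proof. exact: le_normcD. Qed.

Lemma cabsN z : cabs (- z) = cabs z.
Proof. exact: normcN. Qed.

Lemma cabsB z w : cabs (z - w) = cabs (w - z).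
Proof. by rewrite -cabsN opprB. Qed.

Lemma cabs_triB z w : cabs (z - w) <= cabs z + cabs w.
Proof. by rewrite (le_trans (cabsD _ _))// cabsN. Qed.

Lemma cabs_tri3 z w u : cabs (z - w) <= cabs (z - u) + cabs (u - w).
Proof. by rewrite (le_trans _ (cabsD _ _))// addrA subrK. Qed.

Lemma cabs_sum I (r : seq I) (P : pred I) (F : I -> R[i]) :
  cabs (\sum_(i <- r | P i) F i) <= \sum_(i <- r | P i) cabs (F i).
Proof.
elim/big_ind2 : _ => //; first by rewrite cabs0.
by move=> x1 x2 y1 y2 h1 h2; rewrite (le_trans (cabsD _ _))// lerD.
Qed.

Lemma cabs1 : cabs 1 = 1.
Proof. exact: Normc.normc1. Qed.

Lemma cabs_prod I (r : seq I) (P : pred I) (F : I -> R[i]) :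
  cabs (\prod_(i <- r | P i) F i) = \prod_(i <- r | P i) cabs (F i).
Proof. by rewrite (big_morph cabs cabsM cabs1). Qed.

Lemma cabsX z n : cabs (z ^+ n) = cabs z ^+ n.
Proof. by elim: n => [|n IH]; rewrite ?expr0 ?cabs1// !exprS cabsM IH. Qed.

Lemma cabs_sqr z : cabs z ^+ 2 = complex.Re z ^+ 2 + complex.Im z ^+ 2.
Proof.
case: z => a b; rewrite /cabs /= sqr_sqrtr//.
by rewrite addr_ge0 ?sqr_ge0.
Qed.

Lemma cabsE z : cabs z = Num.sqrt (complex.Re z ^+ 2 + complex.Im z ^+ 2).
Proof. by case: z. Qed.

Lemma cabs_real (x : R) : cabs x%:C%C = `|x|.
Proof. by rewrite cabsE /= expr0n addr0 sqrtr_sqr. Qed.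

Lemma Re_le_cabs z : `|complex.Re z| <= cabs z.
Proof.
by rewrite cabsE -sqrtr_sqr ler_sqrt ?lerDl ?sqr_ge0// addr_ge0 ?sqr_ge0.
Qed.

Lemma Im_le_cabs z : `|complex.Im z| <= cabs z.
Proof.
by rewrite cabsE -sqrtr_sqr ler_sqrt ?lerDr ?sqr_ge0// addr_ge0 ?sqr_ge0.
Qed.

Lemma cabs_le_ReIm z : cabs z <= `|complex.Re z| + `|complex.Im z|.
Proof.
rewrite -(ler_pXn2r (n := 2))// ?nnegrE ?addr_ge0 ?cabs_ge0//.
rewrite cabs_sqr sqrrD !real_normK ?num_real// lerD2r lerDl.
by rewrite mulrn_wge0// mulr_ge0.
Qed.

Lemma cabs_conj z : cabs (Num.conj_op z) = cabs z.
Proof. by apply: complexI; rewrite -!cabs_normr norm_conjC. Qed.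

Lemma conjCE z : Num.conj_op z = conjc z.
Proof. by []. Qed.

Lemma ReD z w : complex.Re (z + w) = complex.Re z + complex.Re w.
Proof. by case: z; case: w. Qed.
Lemma ImD z w : complex.Im (z + w) = complex.Im z + complex.Im w.
Proof. by case: z; case: w. Qed.
Lemma ReN z : complex.Re (- z) = - complex.Re z.
Proof. by case: z. Qed.
Lemma ImN z : complex.Im (- z) = - complex.Im z.
Proof. by case: z. Qed.
Lemma ReM z w : complex.Re (z * w) =
  complex.Re z * complex.Re w - complex.Im z * complex.Im w.
Proof. by case: z; case: w. Qed.
Lemma ImM z w : complex.Im (z * w) =
  complex.Re z * complex.Im w + complex.Im z * complex.Re w.
Proof. by case: z => a b; case: w => c d /=; rewrite addrC mulrC addrC. Qed.
Lemma Re_sum I (r : seq I) (P : pred I) (F : I -> R[i]) :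
  complex.Re (\sum_(i <- r | P i) F i) = \sum_(i <- r | P i) complex.Re (F i).
Proof. exact: (big_morph (@complex.Re R) ReD). Qed.
Lemma Im_sum I (r : seq I) (P : pred I) (F : I -> R[i]) :
  complex.Im (\sum_(i <- r | P i) F i) = \sum_(i <- r | P i) complex.Im (F i).
Proof. exact: (big_morph (@complex.Im R) ImD). Qed.

Lemma mulJ_cabs z : z * Num.conj_op z = (cabs z ^+ 2)%:C%C.
Proof. by rewrite -normCK cabs_normr rmorphXn. Qed.

End cabs.

Section cmeas.
Context (R : realType) d (T : measurableType d).

(** Measurability by components is stable under ring operations and conjugation by real-variable
    facts alone, which carries it to determinants and Gram matrices; [cmeas_comp] links it to the
    Borel structure [borelC]. *)
Definition cmeas (f : T -> R[i]) :=
  measurable_fun setT (fun x => complex.Re (f x)) /\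
  measurable_fun setT (fun x => complex.Im (f x)).

Lemma cmeas_cst c : cmeas (fun=> c).
Proof. by split; exact: measurable_cst. Qed.

Lemma cmeasD f g : cmeas f -> cmeas g -> cmeas (fun x => f x + g x).
Proof.
move=> [f1 f2] [g1 g2]; split.
  by under eq_fun do rewrite ReD; exact: measurable_funD.
by under eq_fun do rewrite ImD; exact: measurable_funD.
Qed.

Lemma cmeasN f : cmeas f -> cmeas (fun x => - f x).
Proof.
move=> [f1 f2]; split.
  by under eq_fun do rewrite ReN; exact: measurable_funN.
by under eq_fun do rewrite ImN; exact: measurable_funN.
Qed.

Lemma cmeasB f g : cmeas f -> cmeas g -> cmeas (fun x => f x - g x).
Proof. by move=> mf mg; apply: cmeasD => //; exact: cmeasN. Qed.

Lemma cmeasM f g : cmeas f -> cmeas g -> cmeas (fun x => f x * g x).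
Proof.
move=> [f1 f2] [g1 g2]; split.
  under eq_fun do rewrite ReM.
  by apply: measurable_funB; exact: measurable_funM.
under eq_fun do rewrite ImM.
by apply: measurable_funD; exact: measurable_funM.
Qed.

Lemma cmeas_conj f : cmeas f -> cmeas (fun x => Num.conj_op (f x)).
Proof.
move=> [f1 f2]; split.
  by under eq_fun => x do (rewrite conjCE (_ : complex.Re _ = complex.Re (f x)); [|by case: (f x)]).
under eq_fun => x do (rewrite conjCE (_ : complex.Im _ = - complex.Im (f x)); [|by case: (f x)]).
exact: measurable_funN.
Qed.

Lemma cmeas_sum I (r : seq I) (P : pred I) (F : I -> T -> R[i]) :
  (forall i, cmeas (F i)) -> cmeas (fun x => \sum_(i <- r | P i) F i x).
Proof.
move=> mF; elim: r => [|i r IH].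
  by under eq_fun do rewrite big_nil; exact: cmeas_cst.
under eq_fun do rewrite big_cons.
by case: (P i) => //; exact: cmeasD.
Qed.

Lemma cmeas_prod I (r : seq I) (P : pred I) (F : I -> T -> R[i]) :
  (forall i, cmeas (F i)) -> cmeas (fun x => \prod_(i <- r | P i) F i x).
Proof.
move=> mF; elim: r => [|i r IH].
  by under eq_fun do rewrite big_nil; exact: cmeas_cst.
under eq_fun do rewrite big_cons.
by case: (P i) => //; exact: cmeasM.
Qed.

Lemma cmeas_det n (A : T -> 'M[R[i]]_n) :
  (forall i j, cmeas (fun x => A x i j)) -> cmeas (fun x => \det (A x)).
Proof.
move=> mA; rewrite /determinant; apply: cmeas_sum => s.
by apply: cmeasM; [exact: cmeas_cst|apply: cmeas_prod => i].
Qed.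

Lemma cmeas_mulmx m n p (A : T -> 'M[R[i]]_(m, n)) (B : T -> 'M[R[i]]_(n, p)) :
  (forall i j, cmeas (fun x => A x i j)) ->
  (forall i j, cmeas (fun x => B x i j)) ->
  forall i j, cmeas (fun x => (A x *m B x) i j).
Proof.
move=> mA mB i j; under eq_fun do rewrite mxE.
by apply: cmeas_sum => k; exact: cmeasM.
Qed.

Lemma measurable_cabs f : cmeas f -> measurable_fun setT (fun x => cabs (f x)).
Proof.
move=> [f1 f2]; under eq_fun do rewrite cabsE.
apply: (measurableT_comp (f := @Num.sqrt R)).
  by apply: continuous_measurable_fun; exact: sqrt_continuous.
by apply: measurable_funD; exact: measurable_funX.
Qed.

Lemma measurable_fun_sumR I (r : seq I) (P : pred I) (F : I -> T -> R) :
  (forall i, measurable_fun setT (F i)) ->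
  measurable_fun setT (fun x => \sum_(i <- r | P i) F i x).
Proof.
move=> mF; elim: r => [|i r IH].
  by under eq_fun do rewrite big_nil; exact: measurable_cst.
under eq_fun do rewrite big_cons.
by case: (P i) => //; exact: measurable_funD.
Qed.

Lemma measurable_fun_prodR I (r : seq I) (P : pred I) (F : I -> T -> R) :
  (forall i, measurable_fun setT (F i)) ->
  measurable_fun setT (fun x => \prod_(i <- r | P i) F i x).
Proof.
move=> mF; elim: r => [|i r IH].
  by under eq_fun do rewrite big_nil; exact: measurable_cst.
under eq_fun do rewrite big_cons.
by case: (P i) => //; exact: measurable_funM.
Qed.

Lemma measurable_ltRR (f g : T -> R) : measurable_fun setT f ->
  measurable_fun setT g -> measurable [set x | f x < g x].
Proof.
move=> mf mg; have := measurable_fun_ltr mf mg.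
move=> /(_ measurableT [set true] I); by rewrite setTI.
Qed.

Lemma measurable_leRR (f g : T -> R) : measurable_fun setT f ->
  measurable_fun setT g -> measurable [set x | f x <= g x].
Proof.
move=> mf mg; have := measurable_fun_ler mf mg.
move=> /(_ measurableT [set true] I); by rewrite setTI.
Qed.

End cmeas.

Section borelC.
Context (R : realType).

Lemma borelC_continuous (f : (R[i])^o -> R) : continuous f ->
  measurable_fun setT (f : borelC R -> R).
Proof.
move=> cf.
apply: (measurability _ (RGenOpens.measurableE R)).
move=> _ [_ [x [y ->]] <-]; rewrite setTI; apply: sub_sigma_algebra.
move/continuousP : cf; apply; exact: interval_open.
Qed.

Lemma lipschitz_continuousC (f : (R[i])^o -> R) (k : R) :
  (forall z w, `|f z - f w| <= k * cabs (z - w)) -> continuous f.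
Proof.
move=> fk z; apply/(@cvgrPdist_le _ _ _ _ (nbhs_filter (z : (R[i])^o))) => e e0; near=> w.
have k1 : 0 < `|k| + 1 by rewrite ltr_wpDl.
apply: (le_trans (fk _ _)).
apply: (@le_trans _ _ ((`|k| + 1) * cabs (z - w))).
  by rewrite ler_wpM2r ?cabs_ge0// (le_trans (ler_norm k))// lerDl.
rewrite -ler_pdivlMl//.
rewrite -lecR -cabs_normr.
near: w.
exists ((`|k| + 1)^-1 * e)%:C%C => /=.
  by rewrite ltcR mulr_gt0// invr_gt0.
by move=> w /= /ltW.
Unshelve. all: by end_near. Qed.

Lemma cmeas_borelC : @cmeas R _ (borelC R) id.
Proof.
split; apply: borelC_continuous; apply: (@lipschitz_continuousC _ 1) => z w;
  rewrite mul1r.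
- by rewrite -ReN -ReD Re_le_cabs.
- by rewrite -ImN -ImD Im_le_cabs.
Qed.

Lemma cmeas_comp d (T : measurableType d) (f : T -> borelC R) :
  measurable_fun setT f -> cmeas (f : T -> R[i]).
Proof.
move=> mf; case: cmeas_borelC => m1 m2; split.
- exact: (measurableT_comp m1 mf).
- exact: (measurableT_comp m2 mf).
Qed.

Lemma cmeas_compl d d' (T : measurableType d) (T' : measurableType d')
  (f : T' -> R[i]) (g : T -> T') : cmeas f -> measurable_fun setT g ->
  cmeas (fun x => f (g x)).
Proof.
by move=> [m1 m2] mg; split; [exact: (measurableT_comp m1)|exact: (measurableT_comp m2)].
Qed.

End borelC.

(** * Real-valued expectations and probabilities *)

Section expectation.
Context (R : realType) d (T : measurableType d) (P : probability T R).
Implicit Types (f g : T -> R) (A B : set T).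

(** [Ex] and [Pr] are real numbers, with a default value when the extended integral is not finite;
    [itg] records when [Ex] is the true integral, and [EFin_Ex] and [EFin_Pr] lead back to extended
    reals. *)
Definition itg f := P.-integrable setT (EFin \o f).
Definition Ex f : R := \int[P]_x f x.
Definition Pr A : R := fine (P A).

Lemma itg_meas f : itg f -> measurable_fun setT f.
Proof. by move=> /integrableP[mf _]; exact/measurable_EFinP. Qed.

Lemma itg_dom f g : measurable_fun setT f -> (forall x, `|f x| <= g x) ->
  itg g -> itg f.
Proof.
move=> mf fg; apply: le_integrable => //; first exact/measurable_EFinP.
by move=> x _; rewrite /= lee_fin (le_trans (fg _))// ler_norm.
Qed.

Lemma itg_cst c : itg (fun=> c).
Proof. exact: finite_measure_integrable_cst. Qed.

Lemma itg_bounded f M : measurable_fun setT f -> (forall x, `|f x| <= M) -> itg f.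
Proof. by move=> mf fM; apply: (itg_dom mf fM); exact: itg_cst. Qed.

Lemma itgD f g : itg f -> itg g -> itg (fun x => f x + g x).
Proof.
move=> mf mg; rewrite /itg.
by rewrite (_ : EFin \o _ = (EFin \o f) \+ (EFin \o g))%E//; exact: integrableD.
Qed.

Lemma itgZ c f : itg f -> itg (fun x => c * f x).
Proof.
move=> mf; rewrite /itg.
by rewrite (_ : EFin \o _ = (fun x => c%:E * (EFin \o f) x)%E)//; exact: integrableZl.
Qed.

Lemma itgN f : itg f -> itg (fun x => - f x).
Proof. by move=> /(itgZ (-1)); congr itg; apply/funext => x; rewrite mulN1r. Qed.

Lemma itgB f g : itg f -> itg g -> itg (fun x => f x - g x).
Proof. by move=> mf mg; apply: itgD => //; exact: itgN. Qed.

Lemma itg_sum I (r : seq I) (Q : pred I) (F : I -> T -> R) :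
  (forall i, itg (F i)) -> itg (fun x => \sum_(i <- r | Q i) F i x).
Proof.
move=> mF; elim: r => [|i r IH].
  by under eq_fun do rewrite big_nil; exact: itg_cst.
under eq_fun do rewrite big_cons.
by case: (Q i) => //; exact: itgD.
Qed.

Lemma ExD f g : itg f -> itg g -> Ex (fun x => f x + g x) = Ex f + Ex g.
Proof. by move=> mf mg; rewrite /Ex RintegralD. Qed.

Lemma ExB f g : itg f -> itg g -> Ex (fun x => f x - g x) = Ex f - Ex g.
Proof. by move=> mf mg; rewrite /Ex RintegralB. Qed.

Lemma ExZ c f : itg f -> Ex (fun x => c * f x) = c * Ex f.
Proof. by move=> mf; rewrite /Ex RintegralZl. Qed.

Lemma ExN f : itg f -> Ex (fun x => - f x) = - Ex f.
Proof.
move=> mf; rewrite -[RHS]mulN1r -ExZ//.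
by apply: eq_Rintegral => x _; rewrite mulN1r.
Qed.

Lemma Ex_cst c : Ex (fun=> c) = c.
Proof.
by rewrite /Ex /Rintegral integral_cst//= probability_setT mule1.
Qed.

Lemma Ex_sum I (r : seq I) (Q : pred I) (F : I -> T -> R) :
  (forall i, itg (F i)) ->
  Ex (fun x => \sum_(i <- r | Q i) F i x) = \sum_(i <- r | Q i) Ex (F i).
Proof.
move=> mF; elim: r => [|i r IH].
  by rewrite big_nil -[RHS]Ex_cst; apply: eq_Rintegral => x _; rewrite big_nil.
rewrite big_cons -IH; case: ifPn => Qi.
  rewrite -ExD//; last exact: itg_sum.
  by apply: eq_Rintegral => x _; rewrite big_cons Qi.
by apply: eq_Rintegral => x _; rewrite big_cons (negbTE Qi).
Qed.

Lemma le_Ex f g : itg f -> itg g -> (forall x, f x <= g x) -> Ex f <= Ex g.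
Proof. by move=> mf mg fg; apply: le_Rintegral. Qed.

Lemma eq_Ex f g : f =1 g -> Ex f = Ex g.
Proof. by move=> fg; apply: eq_Rintegral => x _. Qed.

Lemma eq_itg f g : f =1 g -> itg f -> itg g.
Proof. by move=> /funext ->. Qed.

Lemma Ex_ge0 f : (forall x, 0 <= f x) -> 0 <= Ex f.
Proof. by move=> f0; apply: Rintegral_ge0. Qed.

Lemma EFin_Ex f : itg f -> (Ex f)%:E = (\int[P]_x (f x)%:E)%E.
Proof. by move=> mf; rewrite /Ex /Rintegral fineK// integrable_fin_num. Qed.

Lemma EFin_Pr A : measurable A -> (Pr A)%:E = P A.
Proof. by move=> mA; rewrite /Pr fineK// fin_num_measure. Qed.

Lemma Pr_Ex A : measurable A -> Pr A = Ex (\1_A).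
Proof.
by move=> mA; rewrite /Pr /Ex /Rintegral integral_indic// setIT.
Qed.

Lemma itg_indic A : measurable A -> itg (\1_A).
Proof.
move=> mA; apply: (@itg_bounded _ 1); first exact: measurable_indic.
by move=> x; rewrite indicE; case: (_ \in _); rewrite /= ?normr1 ?normr0.
Qed.

Lemma Pr_ge0 A : 0 <= Pr A.
Proof. by rewrite /Pr fine_ge0. Qed.

Lemma le_Pr A B : measurable A -> measurable B -> A `<=` B -> Pr A <= Pr B.
Proof.
move=> mA mB AB; rewrite -lee_fin !EFin_Pr//.
by apply: le_measure; rewrite ?inE.
Qed.

Lemma Pr_le1 A : measurable A -> Pr A <= 1.
Proof. by move=> mA; rewrite -lee_fin EFin_Pr// probability_le1. Qed.

Lemma Pr_setC A : measurable A -> Pr (~` A) = 1 - Pr A.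
Proof.
by move=> mA; apply: EFin_inj; rewrite EFinB !EFin_Pr ?probability_setC//; exact: measurableC.
Qed.

Lemma Pr_setU A B : measurable A -> measurable B -> Pr (A `|` B) <= Pr A + Pr B.
Proof.
move=> mA mB; rewrite -lee_fin EFinD !EFin_Pr//; [exact: measureU2|exact: measurableU].
Qed.

Lemma Pr_bigcup (I : finType) (F : I -> set T) : (forall i, measurable (F i)) ->
  Pr [set x | exists i : I, F i x] <= \sum_i Pr (F i).
Proof.
move=> mF.
have mU (s : seq I) : measurable [set x | exists2 i, i \in s & F i x].
  rewrite (_ : [set x | _] = \bigcup_(i in [set` s]) F i).
    by apply: fin_bigcup_measurable => //; exact: finite_seq.
  by apply/seteqP; split => x /= [i si Fi]; exists i.
have H (s : seq I) : Pr [set x | exists2 i, i \in s & F i x] <= \sum_(i <- s) Pr (F i).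
  elim: s => [|i s IH].
    rewrite big_nil (_ : [set x | _] = set0); last first.
      by apply/seteqP; split => x //= -[].
    by rewrite /Pr measure0.
  rewrite big_cons (_ : [set x | _] = F i `|` [set x | exists2 i, i \in s & F i x]).
    by apply: (le_trans (Pr_setU _ _)) => //; rewrite lerD2l.
  apply/seteqP; split => x /=.
    move=> [j]; rewrite inE => /predU1P[->|js] Fj; [by left|by right; exists j].
  by move=> [Fi|[j js Fj]]; [exists i => //; rewrite mem_head|exists j => //; rewrite inE js orbT].
rewrite (_ : [set x | _] = [set x | exists2 i, i \in index_enum I & F i x]).
  exact: H.
apply/seteqP; split => x /= [k]; last by exists k.
by exists k => //; rewrite mem_index_enum.
Qed.

Lemma markovP f t : itg f -> (forall x, 0 <= f x) -> 0 < t ->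
  Pr [set x | t <= f x] <= Ex f / t.
Proof.
move=> mf f0 t0; rewrite ler_pdivlMr// mulrC.
have mA : measurable [set x | t <= f x].
  by apply: measurable_leRR; [exact: measurable_cst|exact: itg_meas].
rewrite Pr_Ex// -ExZ; last exact: itg_indic.
apply: le_Ex => //; first by apply: itgZ; exact: itg_indic.
move=> x; rewrite indicE; case: (boolP (x \in _)); last by rewrite mulr0.
by rewrite inE /= mulr1.
Qed.

End expectation.

Section ExMerge.
Context (R : realType) (Q : probability (Arr R) R) (Qi : indep_law Q).

Lemma measurable_merge_snd S (a : Arr R) : measurable_fun setT (fun b : Arr R => amerge S (a, b)).
Proof.
exact: (measurableT_comp (measurable_merge S) (pair1_measurable _)).
Qed.

Lemma measurable_merge_fst S (b : Arr R) : measurable_fun setT (fun a : Arr R => amerge S (a, b)).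
Proof.
exact: (measurableT_comp (measurable_merge S) (pair2_measurable _)).
Qed.

Lemma Ex_merge_itg S f : itg Q f -> (forall a, itg Q (fun b => f (amerge S (a, b)))) ->
  itg Q (fun a => Ex Q (fun b => f (amerge S (a, b)))).
Proof.
move=> mf mfa.
have H := integrable_fubini_F (integrable_merge Qi S mf).
apply: eq_integrable H => //= a _.
by rewrite /fubini_F /= EFin_Ex.
Qed.

Lemma Ex_merge S f : itg Q f -> (forall a, itg Q (fun b => f (amerge S (a, b)))) ->
  Ex Q f = Ex Q (fun a => Ex Q (fun b => f (amerge S (a, b)))).
Proof.
move=> mf mfa; apply: EFin_inj; rewrite EFin_Ex// EFin_Ex; last exact: Ex_merge_itg.
rewrite (@integral_merge_int _ _ Qi S (EFin \o f))//.
by apply: eq_integral => a _; rewrite /= EFin_Ex.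
Qed.

Lemma itg_bounded_merge S (f : Arr R -> R) M a : measurable_fun setT f -> (forall x, `|f x| <= M) ->
  itg Q (fun b => f (amerge S (a, b))).
Proof.
move=> mf fM; apply: (@itg_bounded _ _ _ _ _ M) => //.
by apply: measurableT_comp => //; exact: measurable_merge_snd.
Qed.

(** Conditioning on the entries in [S]: off an exceptional set [B] the conditional probability is at
    most [r]. [B] is tested on the whole conditioning array [a], so it may be any event; on [B] the
    trivial bound 1 is used. *)
Lemma Pr_merge_le S (E B : set (Arr R)) (r : R) : measurable E -> measurable B ->
  0 <= r ->
  (forall a, ~ B a -> Pr Q [set b | E (amerge S (a, b))] <= r) ->
  Pr Q E <= Pr Q B + r.
Proof.
move=> mE mB r0 h; rewrite Pr_Ex// (Ex_merge (S := S)); last 2 first.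
- exact: itg_indic.
- move=> a; apply: (@itg_bounded_merge _ _ 1); first exact: measurable_indic.
  by move=> x; rewrite indicE; case: (_ \in _); rewrite /= ?normr1 ?normr0.
have mEa a : measurable [set b | E (amerge S (a, b))].
  by rewrite -[X in measurable X]setTI; exact: (measurable_merge_snd S a).
have -> : Pr Q B + r = Ex Q (fun a => \1_B a + r).
  by rewrite ExD ?Ex_cst ?Pr_Ex//; [exact: itg_indic|exact: itg_cst].
have EE a : Ex Q (fun b => \1_E (amerge S (a, b))) = Pr Q [set b | E (amerge S (a, b))].
  by rewrite Pr_Ex//; apply: eq_Ex => b; rewrite !indicE.
apply: le_Ex.
- apply: Ex_merge_itg; first exact: itg_indic.
  move=> a; apply: (@itg_bounded_merge _ _ 1); first exact: measurable_indic.
  by move=> x; rewrite indicE; case: (_ \in _); rewrite /= ?normr1 ?normr0.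
- by apply: itgD; [exact: itg_indic|exact: itg_cst].
- move=> a; rewrite EE indicE; case: (boolP (a \in B)) => aB.
    by rewrite (le_trans (Pr_le1 _ _))// lerDl.
  by rewrite add0r; apply: h; move/negP : aB => + /mem_set.
Qed.

End ExMerge.

Section ExProd.
Context (R : realType) d1 d2 (T1 : measurableType d1) (T2 : measurableType d2).
Context (P1 : probability T1 R) (P2 : probability T2 R).

(** A bound on [f] makes every section integrable, whereas Fubini's theorem alone gives almost every
    one. *)
Lemma Ex_prod (f : T1 * T2 -> R) M : measurable_fun setT f ->
  (forall p, `|f p| <= M) ->
  [/\ Ex (P1 \x P2)%E f = Ex P1 (fun x => Ex P2 (fun y => f (x, y))),
      forall x, itg P2 (fun y => f (x, y)) &
      itg P1 (fun x => Ex P2 (fun y => f (x, y)))].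
Proof.
move=> mf fM.
have iy x : itg P2 (fun y => f (x, y)).
  apply: (@itg_bounded _ _ _ _ _ M) => //.
  exact: (measurableT_comp mf (pair1_measurable _)).
have iP : itg (P1 \x P2)%E f by exact: itg_bounded fM.
have i1 : itg P1 (fun x => Ex P2 (fun y => f (x, y))).
  apply: eq_integrable (integrable_fubini_F iP) => //= x _.
  by rewrite /fubini_F /= EFin_Ex.
split => //; apply: EFin_inj; rewrite EFin_Ex// EFin_Ex//.
rewrite -(@integral12_prod_meas1 _ _ _ _ _ P1 P2 (EFin \o f))//.
by apply: eq_integral => x _; rewrite /fubini_F /= EFin_Ex.
Qed.

Lemma Ex_prod_swap (f : T1 * T2 -> R) M : measurable_fun setT f ->
  (forall p, `|f p| <= M) ->
  [/\ Ex (P1 \x P2)%E f = Ex P2 (fun y => Ex P1 (fun x => f (x, y))),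
      forall y, itg P1 (fun x => f (x, y)) &
      itg P2 (fun y => Ex P1 (fun x => f (x, y)))].
Proof.
move=> mf fM.
have iy y : itg P1 (fun x => f (x, y)).
  apply: (@itg_bounded _ _ _ _ _ M) => //.
  exact: (measurableT_comp mf (pair2_measurable _)).
have iP : itg (P1 \x P2)%E f by exact: itg_bounded fM.
have i1 : itg P2 (fun y => Ex P1 (fun x => f (x, y))).
  apply: (@itg_bounded _ _ _ _ _ M).
    apply/measurable_EFinP; apply: eq_measurable_fun (measurable_fubini_G iP).
    by move=> y _; rewrite /fubini_G /= EFin_Ex.
  move=> y; rewrite ler_norml -[- M](Ex_cst P1) -{2}[M](Ex_cst P1).
  by apply/andP; split; apply: le_Ex => //; try exact: itg_cst;
    move=> x; have := fM (x, y); rewrite ler_norml => /andP[].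
split => //; apply: EFin_inj; rewrite EFin_Ex// EFin_Ex//.
rewrite -(@integral21_prod_meas1 _ _ _ _ _ P1 P2 (EFin \o f))//.
by apply: eq_integral => x _; rewrite /fubini_G /= EFin_Ex.
Qed.

End ExProd.

Lemma half_expR (R : realType) (u p0 : R) : u <= 1 -> p0 <= u ->
  0 <= 1 + (2^-1 - 1) * u <= expR (- (p0 / 2)).
Proof.
move=> u1 pu; have -> : 1 + (2^-1 - 1) * u = 1 - u / 2 by field.
apply/andP; split; first lra.
by apply: le_trans (expR_ge1Dx _); lra.
Qed.

(** * Independent entries and Chernoff bounds *)

Section iid.
Context (R : realType) (mu : probability (borelC R) R) (Q : probability (Arr R) R).

Definition iid_law := indep_law Q /\
  forall i j (A : set (borelC R)), measurable A -> Q [set a | A (a i j)] = mu A.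

Hypothesis iidQ : iid_law.

Let Qi : indep_law Q := iidQ.1.

Lemma Ex_coord i j (h : borelC R -> R) : itg mu h ->
  itg Q (fun a => h (a i j)) /\ Ex Q (fun a => h (a i j)) = Ex mu h.
Proof.
move=> ih; have mh := itg_meas ih.
have mc := @measurable_coord R i j.
pose c : {mfun Arr R >-> borelC R} :=
  HB.pack (fun a : Arr R => a i j) (isMeasurableFun.Build _ _ _ _ _ mc).
have muE A : measurable A -> distribution Q c A = mu A by exact: iidQ.2.
have i1 : itg Q (fun a => h (a i j)).
  apply/integrableP; split.
    by apply/measurable_EFinP; exact: measurableT_comp.
  move/integrableP : ih => [mh'].
  apply: le_lt_trans.
  have -> : (\int[mu]_x `|(EFin \o h) x| = \int[distribution Q c]_x `|(EFin \o h) x|)%E.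
    by apply: eq_measure_integral => A mA _; first [exact: muE|apply/esym; exact: muE].
  by rewrite ge0_integral_distribution//; apply: measurableT_comp.
split => //; apply: EFin_inj; rewrite !EFin_Ex//.
have -> : (\int[mu]_x (h x)%:E = \int[distribution Q c]_x (EFin \o h) x)%E.
  by apply: eq_measure_integral => A mA _; first [exact: muE|apply/esym; exact: muE].
by rewrite integral_distribution//; exact/measurable_EFinP.
Qed.

(** Induction on [s]: merging along the single position [p] makes the factor at [p] a function of
    the first copy and all the others functions of the second. *)
Lemma Ex_indep_prod (s : seq (nat * nat)) (h : nat * nat -> borelC R -> R) M :
  uniq s -> 0 <= M -> (forall p, measurable_fun setT (h p)) ->
  (forall p x, `|h p x| <= M) ->
  Ex Q (fun a => \prod_(p <- s) h p (a p.1 p.2)) = \prod_(p <- s) Ex mu (h p).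
Proof.
move=> us M0 mh hM.
have mhc p : measurable_fun setT (fun a : Arr R => h p (a p.1 p.2)).
  by apply: (measurableT_comp (mh p)); exact: measurable_coord.
have mprod (t : seq (nat * nat)) : measurable_fun setT (fun a : Arr R => \prod_(p <- t) h p (a p.1 p.2)).
  exact: measurable_fun_prodR.
have bprod (t : seq (nat * nat)) (a : Arr R) : `|\prod_(p <- t) h p (a p.1 p.2)| <= M ^+ size t.
  elim: t => [|p t IH]; first by rewrite big_nil expr0 normr1.
  by rewrite big_cons normrM exprS ler_pM.
elim: s us => [|p s IH] /=.
  move=> _; rewrite big_nil -[RHS](Ex_cst Q 1).
  by apply: eq_Ex => a; rewrite big_nil.
move=> /andP[ps us]; rewrite big_cons -IH//.
have [i1 <-] := Ex_coord p.1 p.2 (itg_bounded mu (mh p) (hM p)).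
rewrite [LHS](Ex_merge Qi (S := pred1 p)); last 2 first.
- exact: (itg_bounded Q (mprod (p :: s)) (bprod (p :: s))).
- by move=> a; exact: (@itg_bounded_merge _ Q (pred1 p) _ _ a (mprod (p :: s)) (bprod (p :: s))).
rewrite mulrC -ExZ//; apply: eq_Ex => a.
rewrite mulrC -ExZ; last exact: (itg_bounded Q (mprod s) (bprod s)).
apply: eq_Ex => b; rewrite big_cons; congr (_ * _).
  by rewrite /amerge /= -surjective_pairing eqxx.
rewrite big_seq [RHS]big_seq; apply: eq_bigr => q qs.
rewrite /amerge /= -surjective_pairing; case: eqP => // qp.
by rewrite -qp qs in ps.
Qed.

Lemma Ex_indep_prod2 (s : seq (nat * nat))
    (h : nat * nat -> borelC R * borelC R -> R) M :
  uniq s -> 0 <= M -> (forall p, measurable_fun setT (h p)) ->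
  (forall p x, `|h p x| <= M) ->
  Ex (Q \x Q)%E (fun ab => \prod_(p <- s) h p (ab.1 p.1 p.2, ab.2 p.1 p.2)) =
  \prod_(p <- s) Ex (mu \x mu)%E (h p).
Proof.
move=> us M0 mh hM.
have mco p : measurable_fun setT
    (fun ab : Arr R * Arr R => h p (ab.1 p.1 p.2, ab.2 p.1 p.2)).
  apply: (measurableT_comp (mh p)); apply: measurable_fun_pair.
  - exact: (measurableT_comp (measurable_coord p.1 p.2) measurable_fst).
  - exact: (measurableT_comp (measurable_coord p.1 p.2) measurable_snd).
have mprod : measurable_fun setT
   (fun ab : Arr R * Arr R => \prod_(p <- s) h p (ab.1 p.1 p.2, ab.2 p.1 p.2)).
  exact: measurable_fun_prodR.
have bprod (ab : Arr R * Arr R) : `|\prod_(p <- s) h p (ab.1 p.1 p.2, ab.2 p.1 p.2)| <= M ^+ size s.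
  elim: s {us mprod} => [|p t IH]; first by rewrite big_nil expr0 normr1.
  by rewrite big_cons normrM exprS ler_pM.
have [-> _ _] := Ex_prod Q Q mprod bprod.
pose k p x := Ex mu (fun y => h p (x, y)).
transitivity (Ex Q (fun a => \prod_(p <- s) k p (a p.1 p.2))).
  apply: eq_Ex => a.
  rewrite (@Ex_indep_prod s (fun p y => h p (a p.1 p.2, y)) M)//.
  by move=> p; exact: (measurableT_comp (mh p) (pair1_measurable _)).
rewrite (@Ex_indep_prod s k M)//.
- by apply: eq_bigr => p _; have [-> _ _] := Ex_prod mu mu (mh p) (hM p).
- by move=> p; have [_ _ /itg_meas] := Ex_prod mu mu (mh p) (hM p).
- move=> p x; have [_ i2 _] := Ex_prod mu mu (mh p) (hM p).
  rewrite ler_norml; apply/andP; split.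
    rewrite -[- M](Ex_cst mu); apply: le_Ex => //; first exact: itg_cst.
    by move=> y; have := hM p (x, y); rewrite ler_norml => /andP[].
  rewrite -[M](Ex_cst mu); apply: le_Ex => //; first exact: itg_cst.
  by move=> y; have := hM p (x, y); rewrite ler_norml => /andP[].
Qed.

Section count.
Context d (T : measurableType d) (P : probability T R) (I : eqType).
Variables (s : seq I) (B : I -> set T).
Hypothesis mB : forall p, measurable (B p).

Lemma measurable_count : measurable_fun setT
  (fun x => (count (fun p => x \in B p) s)%:R : R).
Proof.
have cntE x : (count (fun p => x \in B p) s)%:R = \sum_(p <- s) \1_(B p) x :> R.
  by rewrite -sum1_count natr_sum [LHS]big_mkcond; apply: eq_bigr => p _; rewrite indicE; case: (_ \in _).
rewrite (funext cntE); apply: measurable_fun_sumR => p; exact: measurable_indic.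
Qed.

Lemma measurable_count_ge m : measurable [set x | (m <= count (fun p => x \in B p) s)%N].
Proof.
rewrite (_ : [set x | _] = [set x | m%:R <= (count (fun p => x \in B p) s)%:R :> R]).
  by apply: measurable_leRR; [exact: measurable_cst|exact: measurable_count].
by apply/seteqP; split => x /=; rewrite ler_nat.
Qed.

Lemma measurable_count_lt m : measurable [set x | (count (fun p => x \in B p) s < m)%N].
Proof.
rewrite (_ : [set x | _] = [set x | (count (fun p => x \in B p) s)%:R < m%:R :> R]).
  by apply: measurable_ltRR; [exact: measurable_count|exact: measurable_cst].
by apply/seteqP; split => x /=; rewrite ltr_nat.
Qed.

(** The exponential of a count is a product of one factor per position, so [Ex_indep_prod2] computes
    its expectation; the two Chernoff bounds below use the bases 2 and 1/2. *)
Lemma pow_countE (c : R) x : c ^+ (count (fun p => x \in B p) s) =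
  \prod_(p <- s) (1 + (c - 1) * \1_(B p) x).
Proof.
elim: s => [|p t IH] /=; first by rewrite big_nil.
rewrite big_cons exprD IH; congr (_ * _); rewrite indicE.
case: (x \in B p) => /=; first by rewrite expr1 mulr1 addrC subrK.
by rewrite expr0 mulr0 addr0.
Qed.

Lemma itg_pow_count (c : R) : 0 < c ->
  itg P (fun x => c ^+ (count (fun p => x \in B p) s)).
Proof.
move=> c0; apply: (@itg_bounded _ _ _ _ _ ((1 + c) ^+ size s)).
  rewrite (funext (pow_countE c)); apply: measurable_fun_prodR => p.
  apply: measurable_funD; first exact: measurable_cst.
  by apply: measurable_funM; [exact: measurable_cst|exact: measurable_indic].
have c1 := ltW c0; move=> x; rewrite ger0_norm ?exprn_ge0//.
apply: (@le_trans _ _ ((1 + c) ^+ (count (fun p => x \in B p) s))).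
  by apply: lerXn2r; rewrite ?nnegrE; lra.
by apply: ler_weXn2l; [lra|exact: count_size].
Qed.

End count.

Definition prB (B : nat * nat -> set (borelC R * borelC R)) (p : nat * nat) :
    set (Arr R * Arr R) :=
  (fun ab => (ab.1 p.1 p.2, ab.2 p.1 p.2)) @^-1` B p.

Lemma measurable_prB B p : (forall p, measurable (B p)) -> measurable (prB B p).
Proof.
move=> mB; rewrite -[X in measurable X]setTI.
have : measurable_fun setT (fun ab : Arr R * Arr R =>
    ((ab.1 p.1 p.2, ab.2 p.1 p.2) : borelC R * borelC R)).
  apply: measurable_fun_pair.
  - exact: (measurableT_comp (@measurable_coord R p.1 p.2) measurable_fst).
  - exact: (measurableT_comp (@measurable_coord R p.1 p.2) measurable_snd).
exact.
Qed.

Lemma Ex_pow_count (s : seq (nat * nat)) (B : nat * nat -> set (borelC R * borelC R)) (c : R) :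
  0 < c -> uniq s -> (forall p, measurable (B p)) ->
  Ex (Q \x Q)%E (fun ab => c ^+ (count (fun p => ab \in prB B p) s)) =
    \prod_(p <- s) (1 + (c - 1) * Pr (mu \x mu)%E (B p)).
Proof.
move=> c0 us mB; rewrite (eq_Ex _ (pow_countE s (prB B) c)).
pose h (p : nat * nat) (x : borelC R * borelC R) : R := 1 + (c - 1) * \1_(B p) x.
have mh p : measurable_fun setT (h p).
  apply: measurable_funD; first exact: measurable_cst.
  by apply: measurable_funM; [exact: measurable_cst|exact: measurable_indic].
have hM p x : `|h p x| <= 1 + c.
  rewrite /h indicE; case: (_ \in _) => /=; rewrite ?mulr1 ?mulr0 ger0_norm; lra.
have := @Ex_indep_prod2 s h (1 + c) us ltac:(lra) mh hM.
rewrite (_ : Ex _ _ = Ex (Q \x Q)%E (fun x => \prod_(p <- s) (1 + (c - 1) * \1_(prB B p) x))); last first.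
  by apply: eq_Ex => x; apply: eq_bigr => p _; rewrite /h !indicE.
move=> ->; apply: eq_bigr => p _.
rewrite /h ExD; [|exact: itg_cst|by apply: itgZ; exact: itg_indic].
by rewrite Ex_cst ExZ ?Pr_Ex//; exact: itg_indic.
Qed.

Lemma chernoff_up (s : seq (nat * nat)) (B : nat * nat -> set (borelC R * borelC R)) q (m : nat) :
  uniq s -> (forall p, measurable (B p)) ->
  \sum_(p <- s) Pr (mu \x mu)%E (B p) <= q ->
  Pr (Q \x Q)%E [set ab | (m <= count (fun p => ab \in prB B p) s)%N] <= expR q / 2 ^+ m.
Proof.
move=> us mB qs.
have mB' p := measurable_prB p mB.
have i1 := @itg_pow_count _ _ (Q \x Q)%E _ s _ mB' 2 ltac:(by []).
have -> : [set ab : Arr R * Arr R | (m <= count (fun p => ab \in prB B p) s)%N] =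
  [set ab | (2 ^+ m <= 2 ^+ (count (fun p => ab \in prB B p) s) :> R)].
  by apply/seteqP; split => ab /=; rewrite ler_eXn2l// ltr1n.
apply: (le_trans (markovP i1 (fun ab => exprn_ge0 _ _) (exprn_gt0 _ _))) => //.
rewrite ler_pM2r ?invr_gt0 ?exprn_gt0// Ex_pow_count//.
apply: (@le_trans _ _ (\prod_(p <- s) expR (Pr (mu \x mu)%E (B p)))).
  apply: ler_prod => p _; have := Pr_ge0 (mu \x mu)%E (B p) => P0.
  rewrite (_ : 2 - 1 = 1); last by ring.
  by rewrite mul1r expR_ge1Dx addr_ge0.
by rewrite -expR_sum ler_expR.
Qed.

Lemma chernoff_low (s : seq (nat * nat)) (B : nat * nat -> set (borelC R * borelC R)) p0 (m : nat) :
  uniq s -> (forall p, measurable (B p)) ->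
  (forall p, p0 <= Pr (mu \x mu)%E (B p)) ->
  Pr (Q \x Q)%E [set ab | (count (fun p => ab \in prB B p) s < m)%N] <=
    2 ^+ m * expR (- (p0 * (size s)%:R / 2)).
Proof.
move=> us mB ps.
have mB' p := measurable_prB p mB.
have i1 := @itg_pow_count _ _ (Q \x Q)%E _ s _ mB' (2^-1) ltac:(by rewrite invr_gt0).
apply: (@le_trans _ _ (Pr (Q \x Q)%E [set ab : Arr R * Arr R |
   (2^-1) ^+ m <= (2^-1) ^+ (count (fun p => ab \in prB B p) s) :> R])).
  apply: le_Pr.
  - exact: measurable_count_lt.
  - by apply: measurable_leRR; [exact: measurable_cst|exact: itg_meas i1].
  - by move=> ab /= ?; rewrite ler_iXn2l ?invr_gt0 ?invf_lt1 ?ltr1n// ltnW.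
have h0 : 0 < 2^-1 :> R by rewrite invr_gt0.
apply: (le_trans (markovP i1 (fun ab => exprn_ge0 _ (ltW h0)) (exprn_gt0 _ h0))) => //.
rewrite exprVn invrK mulrC ler_pM2l ?exprn_gt0// Ex_pow_count ?invr_gt0//.
apply: (@le_trans _ _ (\prod_(p <- s) expR (- (p0 / 2)))).
  apply: ler_prod => p _.
  by apply: half_expR; [exact: Pr_le1|exact: ps].
rewrite -expR_sum ler_expR big_const_seq count_predT iter_addr_0 mulNrn.
by have -> : p0 * (size s)%:R / 2 = p0 / 2 *+ size s by rewrite mulrAC mulr_natr.
Qed.

End iid.

(** * Gram determinants and regularised inverses *)

(** Sylvester's identity, read off two block triangular factorisations of [K]: its Schur complements
    with respect to the two identity blocks. *)
Lemma det_1addmx (C : comNzRingType) m n (A : 'M[C]_(n, m)) (B : 'M[C]_(m, n)) :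
  \det (1%:M + A *m B) = \det (1%:M + B *m A).
Proof.
pose K := block_mx (1%:M : 'M[C]_n) (- A) B (1%:M : 'M[C]_m).
have E1 : K = block_mx 1%:M 0 B 1%:M *m block_mx 1%:M (- A) 0 (1%:M + B *m A).
  rewrite mulmx_block !(mul1mx,mul0mx,mulmx0,mulmx1,addr0,add0r,mulmxN).
  by rewrite addrCA addNr addr0.
have E2 : K = block_mx (1%:M + A *m B) (- A) 0 1%:M *m block_mx 1%:M 0 B 1%:M.
  rewrite mulmx_block !(mul1mx,mul0mx,mulmx0,mulmx1,addr0,add0r,mulNmx).
  by rewrite addrK.
have := congr1 determinant E1; rewrite E2 !det_mulmx !det_lblock !det_ublock !det1 !mul1r !mulr1.
by [].
Qed.

Section adjoint.
Context (C : numClosedFieldType).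

Definition hc m n (A : 'M[C]_(m, n)) : 'M[C]_(n, m) := map_mx Num.conj_op A^T.

Lemma hcE m n (A : 'M[C]_(m, n)) i j : hc A i j = Num.conj_op (A j i).
Proof. by rewrite !mxE. Qed.

Lemma hcK m n (A : 'M[C]_(m, n)) : hc (hc A) = A.
Proof. by apply/matrixP => i j; rewrite !hcE conjCK. Qed.

Lemma hcM m n p (A : 'M[C]_(m, n)) (B : 'M[C]_(n, p)) : hc (A *m B) = hc B *m hc A.
Proof. by rewrite /hc trmx_mul map_mxM. Qed.

Lemma hcD m n (A B : 'M[C]_(m, n)) : hc (A + B) = hc A + hc B.
Proof. by apply/matrixP => i j; rewrite !(hcE, mxE) rmorphD. Qed.

Lemma hcN m n (A : 'M[C]_(m, n)) : hc (- A) = - hc A.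
Proof. by apply/matrixP => i j; rewrite !(hcE, mxE) rmorphN. Qed.

Lemma hc0 m n : hc (0 : 'M[C]_(m, n)) = 0.
Proof. by apply/matrixP => i j; rewrite !(hcE, mxE) rmorph0. Qed.

Lemma hc1 n : hc (1%:M : 'M[C]_n) = 1%:M.
Proof. by apply/matrixP => i j; rewrite !(hcE, mxE) eq_sym; case: eqP; rewrite ?rmorph1 ?rmorph0. Qed.

Lemma hc_sum m n I (r : seq I) (P : pred I) (F : I -> 'M[C]_(m, n)) :
  hc (\sum_(i <- r | P i) F i) = \sum_(i <- r | P i) hc (F i).
Proof. by apply: (big_morph (@hc m n)); [exact: hcD|exact: hc0]. Qed.

Lemma det_hc n (A : 'M[C]_n) : \det (hc A) = Num.conj_op (\det A).
Proof. by rewrite /hc det_map_mx det_tr. Qed.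

Lemma hc_inv n (A : 'M[C]_n) : A \in unitmx -> hc (invmx A) = invmx (hc A).
Proof.
move=> uA; have uA' : hc A \in unitmx.
  by rewrite unitmxE det_hc unitfE conjC_eq0 -unitfE -unitmxE.
by rewrite -[LHS](mulmxK uA') -hcM mulmxV// hc1 mul1mx.
Qed.

Definition dot n (u v : 'rV[C]_n) : C := (u *m hc v) 0 0.

Lemma dotE n (u v : 'rV[C]_n) : dot u v = \sum_j u 0 j * Num.conj_op (v 0 j).
Proof. by rewrite /dot mxE; apply: eq_bigr => j _; rewrite hcE. Qed.

Lemma dot_conj n (u v : 'rV[C]_n) : Num.conj_op (dot u v) = dot v u.
Proof. by rewrite /dot -hcE hcM hcK. Qed.

Lemma dotM n p (u : 'rV[C]_n) (A : 'M[C]_(n, p)) v : dot (u *m A) v = dot u (v *m hc A).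
Proof. by rewrite /dot hcM hcK mulmxA. Qed.

Lemma dotDl n (u v w : 'rV[C]_n) : dot (u + v) w = dot u w + dot v w.
Proof. by rewrite /dot mulmxDl mxE. Qed.

Lemma dotDr n (u v w : 'rV[C]_n) : dot u (v + w) = dot u v + dot u w.
Proof. by rewrite /dot hcD mulmxDr mxE. Qed.

Lemma dotNl n (u w : 'rV[C]_n) : dot (- u) w = - dot u w.
Proof. by rewrite /dot mulNmx mxE. Qed.

Lemma dotNr n (u w : 'rV[C]_n) : dot u (- w) = - dot u w.
Proof. by rewrite /dot hcN mulmxN mxE. Qed.

Lemma dotZl n c (u w : 'rV[C]_n) : dot (c *: u) w = c * dot u w.
Proof. by rewrite /dot -scalemxAl mxE. Qed.

Lemma dotZr n c (u w : 'rV[C]_n) : dot u (c *: w) = Num.conj_op c * dot u w.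
Proof. by rewrite -[LHS]dot_conj dotZl rmorphM /= dot_conj. Qed.

Lemma dot_ge0 n (u : 'rV[C]_n) : 0 <= dot u u.
Proof. by rewrite dotE sumr_ge0// => j _; rewrite mul_conjC_ge0. Qed.

Lemma dot_eq0 n (u : 'rV[C]_n) : (dot u u == 0) = (u == 0).
Proof.
apply/eqP/eqP => [|->]; last by rewrite /dot mul0mx mxE.
rewrite dotE => /eqP; rewrite psumr_eq0; last by move=> j _; rewrite mul_conjC_ge0.
move=> /allP h; apply/rowP => j; rewrite mxE; apply/eqP.
by have := h j (mem_index_enum j); rewrite /= mul_conjC_eq0.
Qed.

Lemma dot_CS n (u v : 'rV[C]_n) : dot u v * dot v u <= dot u u * dot v v.
Proof.
have [->|v0] := eqVneq v 0; first by rewrite /dot hc0 !mulmx0 mxE mul0r mulr0.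
have vp : 0 < dot v v by rewrite lt0r dot_eq0 v0 dot_ge0.
have := dot_ge0 (dot v v *: u - dot u v *: v).
rewrite dotDl !dotDr !dotNl !dotNr !dotZl !dotZr !dot_conj => h.
rewrite -subr_ge0 -(pmulr_rge0 _ vp); apply: le_trans h _.
by rewrite le_eqVlt; apply/orP; left; apply/eqP; ring.
Qed.

Definition dotdelta n (j : 'I_n) : 'rV[C]_n := delta_mx 0 j.

Lemma dot_delta n (j : 'I_n) : dot (dotdelta j) (dotdelta j) = 1.
Proof.
rewrite dotE (bigD1 j)//= !mxE !eqxx /= conjC1 mulr1 big1 ?addr0// => k kj.
by rewrite !mxE (negbTE kj) andbF mul0r.
Qed.

End adjoint.

Section gramS.
Context (C : numClosedFieldType) (n : nat).
Implicit Types (s : seq 'rV[C]_n) (r u : 'rV[C]_n).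

(* The regularisation parameter is 1: a smaller one is obtained by scaling the rows. *)
Definition gS s : 'M[C]_n := 1%:M + \sum_(r <- s) hc r *m r.

Definition gQ s : 'M[C]_n := invmx (gS s).

Lemma gS_herm s : hc (gS s) = gS s.
Proof.
rewrite /gS hcD hc1 hc_sum; congr (_ + _); apply: eq_bigr => r _.
by rewrite hcM hcK.
Qed.

Lemma gS_form s u : dot (u *m gS s) u = dot u u + \sum_(r <- s) dot u r * dot r u.
Proof.
rewrite /gS mulmxDr mulmx1 dotDl mulmx_sumr; congr (_ + _).
rewrite /dot mulmx_suml summxE; apply: eq_bigr => r _.
by rewrite (mulmxA u (hc r) r) -[_ *m r *m _]mulmxA [LHS]mxE big_ord1.
Qed.

Lemma dot_dotC u r : 0 <= dot u r * dot r u.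
Proof. by rewrite -[dot r u]dot_conj mul_conjC_ge0. Qed.

Lemma gS_unit s : gS s \in unitmx.
Proof.
rewrite -row_free_unit -kermx_eq0; apply/eqP/row_matrixP => i.
rewrite row0; set u := row i _.
have uS : u *m gS s = 0 by apply/sub_kermxP; rewrite row_sub.
have := gS_form s u; rewrite uS {1}/dot mul0mx mxE => /esym/eqP.
rewrite paddr_eq0 ?dot_ge0//; last by rewrite sumr_ge0// => r _; exact: dot_dotC.
by rewrite dot_eq0 => /andP[/eqP].
Qed.

Lemma gQ_herm s : hc (gQ s) = gQ s.
Proof. by rewrite /gQ hc_inv ?gS_unit// gS_herm. Qed.

Lemma det_gS_cons r s : \det (gS (r :: s)) = \det (gS s) * (1 + dot (r *m gQ s) r).
Proof.
have -> : gS (r :: s) = gS s *m (1%:M + (gQ s *m hc r) *m r).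
  rewrite mulmxDr mulmx1 !mulmxA /gQ mulmxV ?gS_unit// mul1mx /gS big_cons.
  by rewrite addrCA addrC.
rewrite det_mulmx det_1addmx; congr (_ * _).
by rewrite det_mx11 mxE [X in X + _]mxE eqxx /dot mulmxA.
Qed.

(** Since [gS s] dominates the identity, its inverse Q satisfies Q^2 <= Q <= 1 as quadratic forms.
    The first inequality comes from pairing v = uQ with u = vS, the second from it and |u - v|^2 >=
    0. *)
Lemma gQ_ge s u : 0 <= dot (u *m gQ s) u /\
  dot (u *m gQ s) (u *m gQ s) <= dot (u *m gQ s) u /\
  dot (u *m gQ s) u <= dot u u.
Proof.
set v := u *m gQ s.
have uE : u = v *m gS s by rewrite /v /gQ mulmxKV ?gS_unit.
have E1 : dot v u = dot v v + \sum_(r <- s) dot v r * dot r v.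
  by rewrite {1}uE -gS_form dotM gS_herm.
have P1 : 0 <= \sum_(r <- s) dot v r * dot r v by rewrite sumr_ge0// => r _; exact: dot_dotC.
have vv : dot v v <= dot v u by rewrite E1 lerDl.
have vu0 : 0 <= dot v u by rewrite (le_trans _ vv)// dot_ge0.
split => //; split => //.
have rvu : dot u v = dot v u.
  by rewrite -dot_conj geC0_conj.
have := dot_ge0 (u - v); rewrite dotDl !dotDr !dotNl !dotNr rvu => h.
rewrite -subr_ge0; apply: le_trans h _.
rewrite -subr_ge0 [X in 0 <= X](_ : _ = dot v u - dot v v); last by ring.
by rewrite subr_ge0.
Qed.

Lemma det_gS_gt0 s : 1 <= \det (gS s).
Proof.
elim: s => [|r s IH]; first by rewrite /gS big_nil addr0 det1.
rewrite det_gS_cons mulr_ege1// lerDl; by have [] := gQ_ge s r.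
Qed.

(** [gS s] also dominates the rank-one form of [r]; evaluated at v = rQ this reads q^2 <= q for the
    quadratic form q in question. *)
Lemma gQ_le1 s r : r \in s -> dot (r *m gQ s) r <= 1.
Proof.
move=> rs; set v := r *m gQ s.
have rE : r = v *m gS s by rewrite /v /gQ mulmxKV ?gS_unit.
have E1 : dot v r = dot v v + \sum_(r' <- s) dot v r' * dot r' v.
  by rewrite {1}rE -gS_form dotM gS_herm.
have [v0 _] := gQ_ge s r; rewrite -/v in v0.
have h : dot v r * dot r v <= dot v r.
  rewrite [X in _ <= X]E1 (big_rem r)//= addrCA lerDl addr_ge0 ?dot_ge0//.
  by rewrite sumr_ge0// => r' _; exact: dot_dotC.
rewrite -[dot r v]dot_conj geC0_conj// in h.
have [->|nz] := eqVneq (dot v r) 0; first by rewrite ler01.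
by rewrite -(ler_pM2l (x := dot v r)) ?mulr1// lt0r nz v0.
Qed.

(** From 1 - Q = Q (S - 1), the defect n - tr Q is a sum of one term per vector, each at most 1 by
    [gQ_le1]. Fewer vectors than dimensions therefore leave Q a large trace, on which the comparison
    of rows rests. *)
Lemma tr_gQ s : n%:R - (size s)%:R <= \tr (gQ s).
Proof.
have E : 1%:M - gQ s = gQ s *m (\sum_(r <- s) hc r *m r).
  have : gQ s *m gS s = 1%:M by rewrite /gQ mulVmx ?gS_unit.
  by rewrite {1}/gS mulmxDr mulmx1 => <-; rewrite addrAC subrr add0r.
have T : n%:R - \tr (gQ s) = \sum_(r <- s) dot (r *m gQ s) r.
  rewrite -mxtrace1 -raddfB E mulmx_sumr.
  rewrite raddf_sum; apply: eq_bigr => r _ /=.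
  by rewrite mulmxA mxtrace_mulC mulmxA /mxtrace big_ord1.
rewrite lerBlDl -lerBlDr T.
rewrite -[X in _ <= X]/((size s)%:R) -sum1_size natr_sum.
by rewrite big_seq [X in _ <= X]big_seq; apply: ler_sum => r; exact: gQ_le1.
Qed.

End gramS.

Section maxvol.
Context (F : fieldType) (R : realFieldType) (nu : F -> R).
Hypothesis nuM : {morph nu : x y / x * y}.
Hypothesis nu_gt0 : forall x, (0 < nu x) = (x != 0).

(* Choosing a minor of maximal size among the normal vectors makes all coordinates
   at most 1, with an identity block on the chosen columns. *)
Lemma maxvol_basis p n (H : 'M[F]_(p, n)) : exists d (f : 'I_d -> 'I_n) (U : 'M[F]_(d, n)),
  [/\ (n - p <= d)%N, injective f, (forall k l, U k (f l) = (k == l)%:R),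
      (forall k j, nu (U k j) <= 1) & H *m U^T = 0].
Proof.
pose W := kermx H^T; pose d := \rank W; pose B := row_base W.
have BH : B *m H^T = 0.
  by apply/sub_kermxP; rewrite eq_row_base.
have [g gU] : exists g : 'I_d -> 'I_n, colsub g B \in unitmx.
  have rf : row_full B^T by rewrite /row_full mxrank_tr; exact: row_base_free.
  exists (fullrankfun rf); rewrite -unitmx_tr.
  have -> : (colsub (fullrankfun rf) B)^T = rowsub (fullrankfun rf) B^T.
    by apply/matrixP => i j; rewrite !mxE.
  exact: fullrowsub_unit.
pose vol (f : {ffun 'I_d -> 'I_n}) := nu (\det (colsub f B)).
pose f := [arg max_(f > finfun g) vol f]%O.
have fmax f' : vol f' <= vol f.
  rewrite /f; case: (@Order.TotalTheory.arg_maxP _ _ _ (finfun g) xpredT vol) => // f0 _ h.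
  exact: h.
have detf : \det (colsub f B) != 0.
  rewrite -nu_gt0; apply: lt_le_trans (fmax (finfun g)); rewrite /vol nu_gt0.
  have -> : colsub (finfun g) B = colsub g B by apply/matrixP => i j; rewrite !mxE ffunE.
  by rewrite -unitfE -unitmxE.
have uf : colsub f B \in unitmx by rewrite unitmxE unitfE.
have [U UE] : exists U, U = invmx (colsub f B) *m B by eexists.
have Uf : colsub f U = 1%:M.
  rewrite UE -(mulVmx uf); apply/matrixP => i j; rewrite !mxE.
  by apply: eq_bigr => k _; rewrite !mxE.
have Ufkl k l : U k (f l) = (k == l)%:R.
  by have /matrixP/(_ k l) := Uf; rewrite !mxE.
exists d, f, U; split => //.
- by rewrite /d /W mxrank_ker leq_sub2l// mxrank_tr rank_leq_row.
- move=> l l' ff; apply/eqP; apply: contraT => ll'.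
  by have := Ufkl l l'; rewrite -ff Ufkl eqxx (negbTE ll') => /eqP; rewrite oner_eq0.
(* Exchanging the [k]-th chosen column for column [j] multiplies the minor by [U k j], so maximality
   of [f] bounds this entry. *)
- move=> k j; pose f' := [ffun l => if l == k then j else f l].
  have E : colsub f' B = colsub f B *m colsub f' U.
    apply/matrixP => i l; rewrite -[in LHS](mulKVmx uf B) -UE !mxE.
    by apply: eq_bigr => m _; rewrite !mxE.
  pose v : 'cV[F]_d := col j U - delta_mx k 0.
  have E2 : colsub f' U = 1%:M + v *m delta_mx 0 k.
    apply/matrixP => i l; rewrite !mxE ffunE big_ord1 !mxE eqxx andbT /=.
    case: (eqVneq l k) => [->|lk].
      by rewrite ?mulr1n mulr1 addrC subrK.
    by rewrite Ufkl ?mulr0n mulr0 addr0.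
  have D : \det (colsub f' U) = U k j.
    rewrite E2 det_1addmx det_mx11 !mxE eqxx (bigD1 k)//= big1 ?addr0.
      by rewrite !mxE !eqxx mul1r mulr1n addrCA subrr addr0.
    by move=> l lk; rewrite !mxE (negbTE lk) andbF mul0r.
  have := fmax f'; rewrite {1}/vol E det_mulmx nuM D -/(vol f).
  by rewrite ger_pMr// /vol nu_gt0.
- by rewrite UE -[H in H *m _]trmxK -trmx_mul -mulmxA BH mulmx0 trmx0.
Qed.

End maxvol.

Section gram.
Context (C : numClosedFieldType).

Definition gram p n (H : 'M[C]_(p, n)) : C := \det (H *m hc H).

Lemma gram_ge0 p n (H : 'M[C]_(p, n)) : 0 <= gram H.
Proof.
rewrite /gram; set G := H *m hc H.
have Gh : hc G = G by rewrite /G hcM hcK.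
have nG : G \is normalmx by apply/normalmxP; rewrite -[map_mx _ _]/(hc G) Gh.
have /orthomx_spectralP GE := nG.
set P := spectralmx G in GE; set X := spectral_diag G in GE.
have uP : P \is unitarymx by exact: spectral_unitarymx.
have PU : P \in unitmx by exact: unitarymx_unit.
have XE : diag_mx X = (P *m H) *m hc (P *m H).
  rewrite hcM (_ : hc P = invmx P); last by rewrite invmx_unitary.
  rewrite mulmxA -(mulmxA P) -/G GE.
  by rewrite !mulmxA mulmxV// mul1mx -mulmxA mulmxV// mulmx1.
have -> : \det G = \det (diag_mx X).
  rewrite GE !det_mulmx mulrAC -det_mulmx mulVmx// det1 mul1r //.
rewrite det_diag prodr_ge0// => i _.
have := congr1 (fun A : 'M[C]_p => A i i) XE; rewrite mxE eqxx mulr1n => ->.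
by rewrite mxE sumr_ge0// => j _; rewrite hcE mul_conjC_ge0.
Qed.

Lemma gram_unit_ker p n (H : 'M[C]_(p, n)) (y : 'rV[C]_p) :
  y *m (H *m hc H) = 0 -> y *m H = 0.
Proof.
move=> y0; apply/eqP; rewrite -dot_eq0 /dot hcM -mulmxA (mulmxA H) (mulmxA y) y0.
by rewrite mul0mx mxE.
Qed.

(* gram H / gram (row' i H) is the squared distance of row i to the span of the
   other rows, so it is bounded below through any vector u normal to that span. *)
Lemma gram_ge p n (H : 'M[C]_(p.+1, n)) i (u : 'rV[C]_n) :
  (forall k, k != i -> dot (row k H) u = 0) ->
  gram (row' i H) * (dot (row i H) u * dot u (row i H)) <= gram H * dot u u.
Proof.
move=> h; set s := dot (row i H) u.
have sc : dot u (row i H) = Num.conj_op s by rewrite dot_conj.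
rewrite sc.
have Hu : H *m hc u = s *: delta_mx i 0.
  apply/colP => k; rewrite !mxE eqxx andbT.
  have -> : \sum_j H k j * (hc u) j 0 = dot (row k H) u.
    by rewrite dotE; apply: eq_bigr => j _; rewrite !mxE.
  by case: (eqVneq k i) => [->|/h ->]; rewrite ?mulr1 ?mulr0.
have [s0|s0] := eqVneq s 0.
  by rewrite s0 mul0r mulr0 mulr_ge0 ?gram_ge0 ?dot_ge0.
set G := H *m hc H.
(* If G is singular, a vector of its kernel also kills H. Pairing with u, where H sends u to s times
   the i-th basis vector and s is nonzero, shows that its i-th coordinate vanishes, so the other
   rows are dependent as well. *)
have [uG|nuG] := boolP (G \in unitmx); last first.
  suff -> : gram (row' i H) = 0 by rewrite mul0r mulr_ge0 ?gram_ge0 ?dot_ge0.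
  have : kermx G != 0 by rewrite kermx_eq0 row_free_unit.
  move=> /rowV0Pn[y yk y0].
  have yG : y *m G = 0 by exact/sub_kermxP.
  have yH := gram_unit_ker yG.
  have yi : y 0 i = 0.
    have : y *m H *m hc u = 0 by rewrite yH mul0mx.
    rewrite -mulmxA Hu -scalemxAr => /matrixP/(_ 0 0); rewrite !mxE.
    rewrite (bigD1 i)//= !mxE !eqxx mulr1 big1 ?addr0.
      by move=> /eqP; rewrite mulf_eq0 (negbTE s0) => /eqP.
    by move=> k ki; rewrite !mxE (negbTE ki) mulr0.
  apply/eqP; apply: contraT; rewrite -unitfE -unitmxE -row_free_unit -kermx_eq0 => /eqP k0.
  have /sub_kermxP : col' i y *m (row' i H *m hc (row' i H)) = 0.
    rewrite mulmxA (_ : col' i y *m row' i H = 0) ?mul0mx//.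
    rewrite -yH; apply/rowP => j; rewrite !mxE [in RHS](bigD1_ord i)//= yi mul0r add0r.
    by apply: eq_bigr => k _; rewrite !mxE.
  rewrite k0 submx0 => /eqP/rowP y'0; case/negP: y0; apply/eqP/rowP => k; rewrite mxE.
  case: (unliftP i k) => [k' ->|->//].
  by have := y'0 k'; rewrite !mxE.
pose E : 'rV[C]_p.+1 := delta_mx 0 i.
pose t := (E *m invmx G *m hc E) 0 0.
(* The dual vector of row i inside the row space. Its squared norm t is [gram (row' i H) / gram H]
   by Cramer's rule and its product with u is s t, so Cauchy-Schwarz concludes. *)
pose v := E *m invmx G *m H.
have Gh : hc G = G by rewrite /G hcM hcK.
have iGh : hc (invmx G) = invmx G by rewrite hc_inv// Gh.
have vv : dot v v = t.
  rewrite /dot /v !hcM iGh !mulmxA -(mulmxA (E *m invmx G) H (hc H)) -/G.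
  by rewrite mulmxKV.
have hE : hc E = delta_mx i 0.
  by apply/matrixP => a b; rewrite hcE !mxE andbC; case: andP; rewrite ?conjC1 ?conjC0.
have vu : dot v u = s * t.
  by rewrite /dot /v -(mulmxA _ H) Hu -scalemxAr mxE /t hE.
have G0 : 0 < gram H.
  by rewrite lt0r gram_ge0 andbT -unitfE -unitmxE.
have tE : gram H * t = gram (row' i H).
  rewrite /t hE.
  have -> : (E *m invmx G *m (delta_mx i 0 : 'cV[C]_p.+1)) 0 0 = invmx G i i.
    rewrite /E -rowE mxE (bigD1 i)//= !mxE !eqxx mulr1 big1 ?addr0// => k ki.
    by rewrite !mxE (negbTE ki) mulr0.
  rewrite /invmx uG mxE mulrA /gram -/G divff -?unitfE -?unitmxE// mul1r mxE /cofactor.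
  rewrite -signr_odd oddD addbb expr0 mul1r; congr (\det _).
  apply/matrixP => a b; rewrite !mxE; apply: eq_bigr => k _; by rewrite !mxE.
have t0 : 0 <= t by rewrite -vv dot_ge0.
have := dot_CS v u; rewrite -(dot_conj v u) vu vv rmorphM /= (geC0_conj t0) => CS.
rewrite -tE.
have [->|tn0] := eqVneq t 0.
  by rewrite mulr0 mul0r mulr_ge0 ?gram_ge0 ?dot_ge0.
have tp : 0 < t by rewrite lt0r tn0.
rewrite -mulrA ler_pM2l// -(ler_pM2l tp); apply: le_trans CS.
by rewrite le_eqVlt; apply/orP; left; apply/eqP; rewrite /=; ring.
Qed.

Lemma det_gS_le n (s : seq 'rV[C]_n) : \det (gS s) <= \prod_(r <- s) (1 + dot r r).
Proof.
elim: s => [|r s IH]; first by rewrite /gS !big_nil addr0 det1.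
rewrite det_gS_cons big_cons mulrC.
have [q0 [_ q1]] := gQ_ge s r.
apply: ler_pM => //; first by rewrite addr_ge0.
- by rewrite (le_trans _ (det_gS_gt0 s)).
- by rewrite lerD2l.
Qed.

Lemma det_gS_cat_le n (s t : seq 'rV[C]_n) :
  \det (gS (s ++ t)) <= \det (gS t) * \prod_(r <- s) (1 + dot r r).
Proof.
elim: s => [|r s IH]; first by rewrite big_nil mulr1.
rewrite cat_cons det_gS_cons big_cons mulrCA mulrC.
have [q0 [_ q1]] := gQ_ge (s ++ t) r.
apply: ler_pM => //; first by rewrite addr_ge0.
- by rewrite (le_trans _ (det_gS_gt0 _)).
- by rewrite lerD2l.
Qed.

Lemma gS_mx p n (H : 'M[C]_(p, n)) (c : C) :
  gS [seq c *: row i H | i <- enum 'I_p] = 1%:M + (c * Num.conj_op c) *: (hc H *m H).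
Proof.
rewrite /gS big_map big_enum /=; congr (_ + _).
apply/matrixP => a b; rewrite summxE !mxE big_distrr; apply: eq_bigr => k _.
rewrite !mxE big_ord1 !mxE rmorphM /=; ring.
Qed.

Lemma det_gS_mx p n (H : 'M[C]_(p, n)) (c : C) : 0 < c ->
  \det (gS [seq c *: row i H | i <- enum 'I_p]) = \det (1%:M + c ^+ 2 *: (H *m hc H)).
Proof.
move=> c0; rewrite gS_mx geC0_conj ?ltW// -expr2 scalemxAl det_1addmx.
by rewrite -scalemxAr.
Qed.

(** With G the Gram matrix, det (1 + c^2 G) = c^(2p) det G det (1 + c^-2 G^-1), and the last factor
    is at least 1. It is itself the regularised determinant of the rows of G^-1 H scaled by 1 / c;
    their squared norms are the diagonal entries of G^-1 over c^2, so [det_gS_le] bounds it. *)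
Lemma gram_reg p n (H : 'M[C]_(p, n)) (c : C) K : 0 < c -> gram H != 0 ->
  (forall i, invmx (H *m hc H) i i <= K) ->
  (c ^+ 2) ^+ p * gram H <= \det (gS [seq c *: row i H | i <- enum 'I_p]) <=
    (c ^+ 2) ^+ p * gram H * (1 + c ^- 2 * K) ^+ p.
Proof.
move=> c0 G0 hK; set G := H *m hc H.
have uG : G \in unitmx by rewrite unitmxE unitfE.
have Gh : hc G = G by rewrite /G hcM hcK.
have iGh : hc (invmx G) = invmx G by rewrite hc_inv// Gh.
have c20 : 0 < c ^+ 2 by rewrite exprn_gt0.
have gE : 0 <= (c ^+ 2) ^+ p * gram H.
  by rewrite mulr_ge0 ?gram_ge0// exprn_ge0// ltW.
pose A := invmx G *m H.
have AA : A *m hc A = invmx G.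
  by rewrite /A hcM iGh -mulmxA (mulmxA H) -/G mulmxV// mulmx1.
have -> : \det (gS [seq c *: row i H | i <- enum 'I_p]) =
   (c ^+ 2) ^+ p * gram H * \det (gS [seq c^-1 *: row i A | i <- enum 'I_p]).
  rewrite det_gS_mx// det_gS_mx ?invr_gt0// AA.
  have -> : 1%:M + c ^+ 2 *: (H *m hc H) =
     (c ^+ 2 *: (H *m hc H)) *m (1%:M + c^-1 ^+ 2 *: invmx G).
    rewrite mulmxDr mulmx1 -scalemxAl -scalemxAr scalerA -/G mulmxV//.
    by rewrite -exprMn divff ?gt_eqF// expr1n scale1r addrC.
  by rewrite det_mulmx detZ.
apply/andP; split.
  by rewrite -[X in X <= _]mulr1; apply: ler_wpM2l => //; exact: det_gS_gt0.
apply: ler_wpM2l => //; apply: (le_trans (det_gS_le _)).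
rewrite big_map big_enum /=.
apply: (@le_trans _ _ (\prod_(i < p) (1 + c ^- 2 * K))); last first.
  by rewrite prodr_const card_ord.
apply: ler_prod => i _; rewrite addr_ge0 ?dot_ge0//= lerD2l.
have -> : dot (c^-1 *: row i A) (c^-1 *: row i A) = c ^- 2 * dot (row i A) (row i A).
  rewrite dotZl dotZr (@geC0_conj _ c^-1) ?invr_ge0 ?(ltW c0)//.
  by rewrite -exprVn expr2 mulrA.
apply: ler_wpM2l; first by rewrite invr_ge0 (ltW c20).
apply: le_trans (hK i); rewrite -/G -AA mxE dotE le_eqVlt; apply/orP; left.
by apply/eqP; apply: eq_bigr => j _; rewrite hcE !mxE.
Qed.

Lemma invmx_gram p n (H : 'M[C]_(p.+1, n)) i : gram H != 0 ->
  gram H * invmx (H *m hc H) i i = gram (row' i H).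
Proof.
move=> G0; set G := H *m hc H.
have uG : G \in unitmx by rewrite unitmxE unitfE.
rewrite /invmx uG mxE mulrA /gram -/G divff// mul1r mxE /cofactor.
rewrite -signr_odd oddD addbb expr0 mul1r; congr (\det _).
by apply/matrixP => a b; rewrite !mxE; apply: eq_bigr => k _; rewrite !mxE.
Qed.

Lemma gram_square n (A : 'M[C]_n) : gram A = \det A * Num.conj_op (\det A).
Proof. by rewrite /gram det_mulmx det_hc. Qed.

End gram.

(** * Littlewood-Offord bounds *)

Section cube.
Local Close Scope classical_set_scope.
Context (R : realType) (I : finType).
Implicit Types (S G : {set I}) (j : I).

(** Subsets of [I] are the vertices of the cube: a subset sum is a random sign sum up to an affine
    change, and toggling one element walks along an edge. *)
Definition toggle j S : {set I} := if j \in S then S :\ j else j |: S.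

Lemma toggleK j : involutive (toggle j).
Proof.
move=> S; rewrite /toggle; have [jS|jS] := boolP (j \in S); rewrite !inE eqxx /=.
  by rewrite finset.setD1K.
by rewrite finset.setU1K.
Qed.

Lemma in_toggle j k S : (k \in toggle j S) = (k == j) (+) (k \in S).
Proof.
rewrite /toggle; case: ifPn => jS; rewrite !inE; case: eqVneq => [->|//] /=.
  by rewrite jS.
by rewrite jS.
Qed.

Lemma sum_toggle (V : zmodType) j (F : {set I} -> V) :
  \sum_S F (toggle j S) = \sum_S F S.
Proof.
by rewrite [RHS](reindex_inj (inv_inj (toggleK j))).
Qed.

Lemma sum_set_toggle (V : zmodType) (W : I -> V) j S :
  \sum_(k in toggle j S) W k = \sum_(k in S) W k + (if j \in S then - W j else W j).
Proof.
rewrite /toggle; case: ifPn => jS; last by rewrite big_setU1//= addrC.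
by rewrite [in RHS](big_setD1 j)//= addrAC subrr add0r.
Qed.

Lemma card_sets_pred (Q : pred {set I}) :
  (#|[set S : {set I} | Q S]|)%:R = \sum_S (Q S)%:R :> R.
Proof.
rewrite -sum1_card natr_sum big_mkcond; apply: eq_bigr => S _; rewrite inE.
by case: (Q S).
Qed.

Lemma card_sets : #|{set I}| = (2 ^ #|I|)%N.
Proof. by rewrite -(cardsT {set I}) -finset.powersetT card_powerset cardsT. Qed.

Section LO.
Variables (W : I -> R) (G : {set I}) (delta s0 : R).
Hypothesis d0 : 0 < delta.
Hypothesis Wd : forall j, j \in G -> delta <= `|W j|.

Let s S := s0 + \sum_(k in S) W k.
(** Toggling [j] changes [s S] by minus [sg j S] times the modulus of [W j]. Summed over all
    subsets, the signs of distinct indices are orthogonal, which gives [sum_sg2]. *)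
Let sg j S : R := if (j \in S) == (0 < W j) then 1 else -1.
Let f (c : R) S : R := (s S <= c)%R%:R.

Lemma sg_toggle j S : sg j (toggle j S) = - sg j S.
Proof.
rewrite /sg in_toggle eqxx /=; case: (j \in S); case: (0 < W j) => //=;
  by rewrite ?opprK.
Qed.

Lemma sg_toggle_neq j k S : k != j -> sg k (toggle j S) = sg k S.
Proof. by move=> kj; rewrite /sg in_toggle (negbTE kj). Qed.

Lemma s_toggle j S : s (toggle j S) = s S - sg j S * `|W j|.
Proof.
rewrite /s sum_set_toggle -addrA; congr (_ + _); congr (_ + _); rewrite /sg.
by case: (ltrP 0 (W j)) => W0; case: (j \in S) => /=;
  rewrite ?(gtr0_norm W0) ?(ler0_norm W0) ?mul1r ?mulN1r ?opprK.
Qed.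

Lemma sum_sg2 : \sum_S (\sum_(j in G) sg j S) ^+ 2 = (#|G| * 2 ^ #|I|)%:R.
Proof.
transitivity (\sum_S \sum_(j in G) \sum_(k in G) sg j S * sg k S).
  by apply: eq_bigr => S _; rewrite expr2 big_distrlr.
transitivity (\sum_(j in G) \sum_S \sum_(k in G) sg j S * sg k S).
  exact: exchange_big.
transitivity (\sum_(j in G) (2 ^ #|I|)%:R : R).
  apply: eq_bigr => j jG.
  transitivity (\sum_(k in G) \sum_S sg j S * sg k S); first exact: exchange_big.
  rewrite (bigD1 j)//= [X in _ + X]big1 ?addr0.
    transitivity (\sum_(S : {set I}) (1 : R)); last by rewrite sumr_const card_sets.
    by apply: eq_bigr => S _; rewrite /sg; case: ifP => _; rewrite ?mulr1 ?mulrNN ?mulr1.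
  move=> k /andP[kG kj].
  have : \sum_S sg j S * sg k S = - \sum_S sg j S * sg k S.
    rewrite -[LHS](sum_toggle j (fun S => sg j S * sg k S)) -sumrN; apply: eq_bigr => S _.
    by rewrite sg_toggle sg_toggle_neq// mulNr.
  by move: (\sum_S _) => x E; lra.
by rewrite sumr_const natrM mulr_natl.
Qed.

(** Equals 1 when toggling [j] carries [s S] across the level [c] and 0 otherwise: it marks the
    edges in the boundary of a sublevel set. *)
Let cross (c : R) j S : R := - sg j S * (f c S - f c (toggle j S)).

(** Edge-boundary bound. Reindexing by toggles turns the number of crossings into -2 times the sum
    of f(S) D(S), where D is the sum of signs, and the second moment of D bounds it. Cauchy-Schwarz
    is used in arithmetic-geometric form with weight [q]. *)
Lemma sum_cross c : \sum_S \sum_(j in G) cross c j S <=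
  2 * (2 ^ #|I|)%:R * Num.sqrt #|G|%:R.
Proof.
set g := #|G|%:R : R; set q := Num.sqrt g.
have [G0|Gp] := posnP #|G|.
  have GE : G = finset.set0 by apply/eqP; rewrite -cards_eq0 G0.
  rewrite big1; last by move=> S _; rewrite GE big_set0.
  by rewrite mulr_ge0// sqrtr_ge0.
have gp : 0 < g by rewrite ltr0n.
have qp : 0 < q by rewrite sqrtr_gt0.
have qq : q * q = g by rewrite -expr2 sqr_sqrtr// ltW.
have E j : \sum_S cross c j S = 2 * \sum_S - sg j S * f c S.
  rewrite /cross mulr_sumr.
  under eq_bigr do rewrite mulrBr.
  rewrite sumrB -[X in _ - X](sum_toggle j (fun S => - sg j S * f c (toggle j S))).
  under [X in _ - X]eq_bigr do rewrite sg_toggle toggleK opprK.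
  rewrite -sumrB; apply: eq_bigr => S _; ring.
rewrite exchange_big (eq_bigr _ (fun j _ => E j)) -mulr_sumr exchange_big /=.
rewrite -mulrA ler_pM2l//.
apply: (@le_trans _ _ (\sum_S ((\sum_(j in G) sg j S) ^+ 2 / q + q) / 2)).
  apply: ler_sum => S _; rewrite -mulr_suml sumrN /f.
  set D := \sum_(j in G) sg j S.
  have h0 : 0 <= (D + q) ^+ 2 / q by rewrite divr_ge0 ?sqr_ge0 ?ltW.
  have -> : D ^+ 2 / q + q = (D + q) ^+ 2 / q - 2 * D.
    by field; rewrite gt_eqF.
  have h1 : 0 <= D ^+ 2 / q by rewrite divr_ge0 ?sqr_ge0 ?ltW.
  have h2 : (D + q) ^+ 2 / q = D ^+ 2 / q + 2 * D + q by field; rewrite gt_eqF.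
  case: (s S <= c); rewrite ?mulr1 ?mulr0; lra.
rewrite -mulr_suml big_split /= -mulr_suml sum_sg2 sumr_const card_sets.
have EE : (#|G| * 2 ^ #|I|)%:R = q * q * (2 ^ #|I|)%:R by rewrite natrM -/g qq.
rewrite EE -[q *+ _]mulr_natr; set N := (2 ^ #|I|)%:R.
have -> : (q * q * N / q + q * N) / 2 = N * q by field; rewrite gt_eqF.
by rewrite lexx.
Qed.

(** A jump of size at least [delta] must leave a half-open band of width [delta], crossing [c] or
    [c - delta]. So every subset in the band has at least [#|G|] crossings, against the totals of
    [sum_cross] at both levels. *)
Lemma LO_band c : (#|[set S : {set I} | ((c - delta < s S) && (s S <= c))%R]|)%:R * Num.sqrt #|G|%:R
  <= 4 * (2 ^ #|I|)%:R :> R.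
Proof.
set g := #|G|%:R : R; set q := Num.sqrt g.
have [G0|Gp] := posnP #|G|.
  by rewrite /q /g G0 sqrtr0 mulr0 mulr_ge0.
have gp : 0 < g by rewrite ltr0n.
have qp : 0 < q by rewrite sqrtr_gt0.
have qq : q * q = g by rewrite -expr2 sqr_sqrtr// ltW.
have cross0 c' j S : 0 <= cross c' j S.
  rewrite /cross /f s_toggle; have W0 : 0 <= `|W j| by [].
  rewrite /sg; case: ifP => _; rewrite ?mul1r ?mulN1r ?opprK;
  case: (leP (s S) c') => h1; case: (leP _ c') => h2 /=; lra.
rewrite -(ler_pM2r qp) -mulrA qq.
apply: (@le_trans _ _ (\sum_S \sum_(j in G) cross c j S +
   \sum_S \sum_(j in G) cross (c - delta) j S)); last first.
  apply: (le_trans (lerD (sum_cross c) (sum_cross _))).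
  rewrite -/g -/q le_eqVlt; apply/orP; left; apply/eqP; ring.
rewrite card_sets_pred mulr_suml -big_split /=; apply: ler_sum => S _.
have [/andP[h1 h2]|_] := boolP (_ && _); last first.
  by rewrite mul0r addr_ge0// sumr_ge0.
rewrite mul1r /g -sumr_const -big_split /=; apply: ler_sum => j /Wd Wj.
rewrite /cross /f s_toggle h2.
rewrite /sg; case: ifP => _; rewrite ?mul1r ?mulN1r ?opprK;
  case: (leP (s S) (c - delta)) => h3; case: (leP _ c) => h4;
  case: (leP _ (c - delta)) => h5 /=; lra.
Qed.

End LO.

Lemma LO_interval (W : I -> R) G (delta s0 : R) (a r : R) (k : nat) :
  0 < delta -> (forall j, j \in G -> delta <= `|W j|) ->
  2 * r < k%:R * delta ->
  (#|[set S : {set I} | (`|s0 + \sum_(j in S) W j - a| <= r)%R]|)%:R * Num.sqrt #|G|%:R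
  <= 4 * k%:R * (2 ^ #|I|)%:R :> R.
Proof.
move=> d0 Wd rk.
set q := Num.sqrt _; have q0 : 0 <= q by exact: sqrtr_ge0.
set s := fun S => s0 + \sum_(j in S) W j.
apply: (@le_trans _ _ (\sum_(l < k) (#|[set S : {set I} |
   ((a + r - l%:R * delta - delta < s S) && (s S <= a + r - l%:R * delta))%R]|)%:R * q)); last first.
  apply: (@le_trans _ _ (\sum_(l < k) 4 * (2 ^ #|I|)%:R)).
    by apply: ler_sum => l _; exact: LO_band.
  by rewrite sumr_const card_ord -[4 * _ *+ k]mulr_natr mulrAC lexx.
rewrite -mulr_suml; apply: ler_wpM2r => //.
rewrite card_sets_pred; under [X in _ <= X]eq_bigr do rewrite card_sets_pred.
rewrite exchange_big; apply: ler_sum => S _.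
have [h|_] := boolP (`|_| <= r); last by rewrite sumr_ge0.
rewrite -/(s S) ler_norml in h; case/andP: h => h1 h2.
have [l lE] : exists l : 'I_k, (a + r - l%:R * delta - delta < s S) && (s S <= a + r - l%:R * delta).
  pose x := (a + r - s S) / delta.
  have x0 : 0 <= x by rewrite divr_ge0//; lra.
  have xd : x * delta = a + r - s S by rewrite /x divfK// gt_eqF.
  have xk : (Num.truncn x < k)%N.
    by rewrite truncn_lt_nat// -(ltr_pM2r d0) xd; lra.
  exists (Ordinal xk) => /=.
  have t1 : (Num.truncn x)%:R * delta <= a + r - s S.
    by rewrite -xd ler_pM2r// truncn_le.
  have t2 : a + r - s S < (Num.truncn x)%:R * delta + delta.
    rewrite -xd -[X in _ + X]mul1r -mulrDl ltr_pM2r// natr1.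
    exact: truncnS_gt.
  by apply/andP; split; lra.
rewrite (bigD1 l)//= lE lerDl sumr_ge0// => l' _.
Qed.

(** For at least half of [G] the real parts, or for at least half the imaginary parts, have size
    [delta / 2]; the real bound applied to that coordinate loses only constant factors. *)
Lemma LO_complex (W : I -> R[i]) G (delta : R) (s0 a : R[i]) (r : R) (k : nat) :
  0 < delta -> (forall j, j \in G -> delta <= cabs (W j)) ->
  4 * r < k%:R * delta ->
  (#|[set S : {set I} | (cabs (s0 + \sum_(j in S) W j - a) <= r)%R]|)%:R * Num.sqrt #|G|%:R
  <= 8 * k%:R * (2 ^ #|I|)%:R :> R.
Proof.
move=> d0 Wd rk.
pose G1 := [set j in G | delta / 2 <= `|complex.Re (W j)|].
pose G2 := [set j in G | delta / 2 <= `|complex.Im (W j)|].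
have GU : (#|G| <= #|G1| + #|G2|)%N.
  apply: leq_trans (leq_card_setU G1 G2).
  apply: subset_leq_card; apply/fintype.subsetP => j jG; rewrite !inE jG /=.
  have := Wd j jG; have := cabs_le_ReIm (W j).
  case: (leP (delta / 2) `|complex.Re (W j)|) => //= h1.
  case: (leP (delta / 2) `|complex.Im (W j)|) => //= h2.
  by move: h1 h2; lra.
have key (G' : {set I}) : (#|G| <= 2 * #|G'|)%N -> Num.sqrt #|G|%:R <= 2 * Num.sqrt #|G'|%:R :> R.
  move=> GG'; rewrite -(ler_pXn2r (n := 2))// ?nnegrE ?mulr_ge0 ?sqrtr_ge0//.
  rewrite exprMn !sqr_sqrtr// -natrX -natrM ler_nat (leq_trans GG')//.
  by rewrite leq_mul2r orbT.
have d2 : 0 < delta / 2 by rewrite divr_gt0.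
have rk2 : 2 * r < k%:R * (delta / 2) by lra.
set N := (#|_|)%:R; have N0 : 0 <= N by [].
have fin (G' : {set I}) (b : R) : (#|G| <= 2 * #|G'|)%N ->
   N * Num.sqrt #|G'|%:R <= 4 * k%:R * (2 ^ #|I|)%:R ->
   N * Num.sqrt #|G|%:R <= 8 * k%:R * (2 ^ #|I|)%:R.
  move=> GG' h; apply: (le_trans (ler_wpM2l N0 (key _ GG'))).
  rewrite mulrCA; apply: (le_trans (ler_wpM2l _ h)) => //.
  by rewrite le_eqVlt; apply/orP; left; apply/eqP; ring.
have [h|h] := leqP #|G| (2 * #|G1|).
  apply: (fin G1) => //.
  apply: le_trans (@LO_interval (fun j => complex.Re (W j)) G1 _ (complex.Re s0) (complex.Re a) r k d2 _ rk2); last first.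
    by move=> j; rewrite inE => /andP[].
  apply: ler_wpM2r; first exact: sqrtr_ge0.
  rewrite ler_nat; apply: subset_leq_card; apply/fintype.subsetP => S; rewrite !inE.
  by apply: le_trans; rewrite -Re_sum -ReN -!ReD Re_le_cabs.
have h2 : (#|G| <= 2 * #|G2|)%N by lia.
apply: (fin G2) => //.
apply: le_trans (@LO_interval (fun j => complex.Im (W j)) G2 _ (complex.Im s0) (complex.Im a) r k d2 _ rk2); last first.
  by move=> j; rewrite inE => /andP[].
apply: ler_wpM2r; first exact: sqrtr_ge0.
rewrite ler_nat; apply: subset_leq_card; apply/fintype.subsetP => S; rewrite !inE.
by apply: le_trans; rewrite -Im_sum -ImN -!ImD Im_le_cabs.
Qed.

(* Toggling one index of a subset counted on the left lands in the larger ball;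
   for a given image the toggled index is one of the few W j near a prescribed point. *)
Lemma flip_count (W : I -> R[i]) G (B rho : R) (s0 a : R[i]) (m : nat) :
  (forall j, j \in G -> cabs (W j) <= B) ->
  (forall v, (#|[set j in G | (cabs (W j - v) <= rho)%R]| <= m)%N) ->
  (#|[set S : {set I} | (cabs (s0 + \sum_(j in S) W j - a) <= rho)%R]| * #|G| <=
   2 * m * #|[set S : {set I} | (cabs (s0 + \sum_(j in S) W j - a) <= rho + B)%R]|)%N.
Proof.
move=> WB Wm; set s := fun S => s0 + \sum_(j in S) W j.
rewrite -(ler_nat R) !natrM !card_sets_pred.
have -> : #|G|%:R = \sum_(j in G) 1 :> R by rewrite sumr_const.
rewrite mulr_suml.
have -> : \sum_S (cabs (s S - a) <= rho)%R%:R * \sum_(j in G) 1 =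
   \sum_S \sum_(j in G) (cabs (s (toggle j S) - a) <= rho)%R%:R :> R.
  rewrite exchange_big /=; under eq_bigr do rewrite mulr_sumr.
  rewrite exchange_big /=; apply: eq_bigr => j _.
  by rewrite (sum_toggle j (fun S => (cabs (s S - a) <= rho)%R%:R)); apply: eq_bigr => S _; rewrite mulr1.
rewrite mulr_sumr; apply: ler_sum => S _.
rewrite -/(s S).
have sT j : s (toggle j S) = s S + (if j \in S then - W j else W j).
  by rewrite /s sum_set_toggle addrA.
have [h|h] := boolP (cabs (s S - a) <= rho + B); last first.
  rewrite mulr0 big1// => j jG; rewrite sT.
  case: leP => // h2; case/negP: h.
  apply: (le_trans (cabs_tri3 _ _ (s S + (if j \in S then - W j else W j)))).
  rewrite addrC; apply: lerD => //.
  rewrite opprD addNKr.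
  by rewrite cabsN; case: ifP => _; rewrite ?cabsN WB.
rewrite mulr1 (bigID (fun j => j \in S)) /=.
have -> : 2 * m%:R = m%:R + m%:R :> R by ring.
apply: lerD.
  apply: (@le_trans _ _ (#|[set j in G | (cabs (W j - (s S - a)) <= rho)%R]|)%:R); last by rewrite ler_nat.
  rewrite -sum1_card natr_sum big_mkcond [X in _ <= X]big_mkcond.
  apply: ler_sum => j _; rewrite inE.
  case: (boolP (j \in G)) => jG /=; last by [].
  rewrite sT; case: (boolP (j \in S)) => jS; last by case: ifP.
  by rewrite addrAC cabsB; case: (_ <= rho).
apply: (@le_trans _ _ (#|[set j in G | (cabs (W j - (a - s S)) <= rho)%R]|)%:R); last by rewrite ler_nat.
rewrite -sum1_card natr_sum big_mkcond [X in _ <= X]big_mkcond.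
apply: ler_sum => j _; rewrite inE.
case: (boolP (j \in G)) => jG /=; last by [].
rewrite sT; case: (boolP (j \in S)) => jS /=; first by case: ifP.
by rewrite opprB [s S + W j]addrC -addrA; case: (_ <= rho).
Qed.

(** Chaining the two bounds gains a factor m / #|G| over Littlewood-Offord alone, that is an
    exponent 3/2 of [#|G|] when the steps rarely coincide. The exponent 1/2 is too weak for a union
    over the last rows. *)
Lemma flip_LO (W : I -> R[i]) G (delta B rho : R) (s0 a : R[i]) (m k : nat) :
  0 < delta ->
  (forall j, j \in G -> delta <= cabs (W j) <= B) ->
  (forall v, (#|[set j in G | (cabs (W j - v) <= rho)%R]| <= m)%N) ->
  4 * (rho + B) < k%:R * delta ->
  (#|[set S : {set I} | (cabs (s0 + \sum_(j in S) W j - a) <= rho)%R]|)%:R *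
     (#|G|%:R * Num.sqrt #|G|%:R) <= 16 * m%:R * k%:R * (2 ^ #|I|)%:R :> R.
Proof.
move=> d0 Wd Wm rk.
have q0 : 0 <= Num.sqrt #|G|%:R :> R by exact: sqrtr_ge0.
have WB j : j \in G -> cabs (W j) <= B by case/Wd/andP.
have := @flip_count W G B rho s0 a m WB Wm.
rewrite -(ler_nat R) !natrM => h1.
have h2 := @LO_complex W G delta s0 a (rho + B) k d0 (fun j jG => proj1 (andP (Wd j jG))) rk.
rewrite mulrA; apply: (le_trans (ler_wpM2r q0 h1)); rewrite -mulrA.
have m0 : 0 <= 2 * m%:R :> R by rewrite mulr_ge0.
apply: (le_trans (ler_wpM2l m0 h2)).
by rewrite le_eqVlt; apply/orP; left; apply/eqP; ring.
Qed.

End cube.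

Section grid.
Context (R : realType).

Definition gridpt (rho : R) (M : nat) (p : 'I_(2 * M).+1 * 'I_(2 * M).+1) : R[i] :=
  ((((p.1 : nat)%:R - M%:R) * rho) +i* (((p.2 : nat)%:R - M%:R) * rho))%C.

Lemma grid_round1 (rho x : R) (M : nat) : 0 < rho -> `|x| <= M%:R * rho ->
  exists p : 'I_(2 * M).+1, `|x - ((p : nat)%:R - M%:R) * rho| <= rho.
Proof.
move=> r0; rewrite ler_norml => /andP[x1 x2].
pose y := x / rho + M%:R.
have xr : x / rho * rho = x by rewrite divfK// gt_eqF.
have y0 : 0 <= y by rewrite -(pmulr_lge0 _ r0) mulrDl xr; lra.
have yM : (Num.truncn y < (2 * M).+1)%N.
  rewrite truncn_lt_nat// -(ltr_pM2r r0) mulrDl xr -natr1 natrM.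
  by rewrite -subr_gt0 mulrDl; lra.
exists (Ordinal yM) => /=.
have /andP[t1 t2] := truncn_itv y0.
have yr : y * rho = x + M%:R * rho by rewrite mulrDl xr.
have e1 : (Num.truncn y)%:R * rho <= x + M%:R * rho by rewrite -yr ler_pM2r.
have e2 : x + M%:R * rho < ((Num.truncn y)%:R + 1) * rho by rewrite -yr ltr_pM2r// natr1.
by rewrite ler_norml mulrBl; apply/andP; split; lra.
Qed.

Lemma grid_round (rho : R) (v : R[i]) (M : nat) : 0 < rho -> cabs v <= M%:R * rho ->
  exists p, cabs (v - gridpt rho (M := M) p) <= 2 * rho.
Proof.
move=> r0 vM.
have [p1 h1] := grid_round1 r0 (le_trans (Re_le_cabs v) vM).
have [p2 h2] := grid_round1 r0 (le_trans (Im_le_cabs v) vM).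
exists (p1, p2); apply: (le_trans (cabs_le_ReIm _)).
by rewrite ReD ImD ReN ImN /=; lra.
Qed.

End grid.

(** * Small-ball bounds for one random row *)

Section row_anticonc.
Context (R : realType) (mu : probability (borelC R) R) (Q : probability (Arr R) R).
Hypothesis iidQ : iid_law mu Q.
Let Qi : indep_law Q := iidQ.1.

Definition ent (a : Arr R) i j : R[i] := a i j.

Lemma cmeas_ent i j : cmeas (fun a : Arr R => ent a i j).
Proof. exact: (cmeas_comp (@measurable_coord R i j)). Qed.

Definition rsum n (w : 'I_n -> R[i]) i (a : Arr R) : R[i] := \sum_(j < n) ent a i j * w j.

Lemma cmeas_rsum n (w : 'I_n -> R[i]) i : cmeas (rsum w i).
Proof.
by apply: cmeas_sum => j; apply: cmeasM; [exact: cmeas_ent|exact: cmeas_cst].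
Qed.

Definition rball n (w : 'I_n -> R[i]) i c (rho : R) : set (Arr R) :=
  [set a | cabs (rsum w i a - c) <= rho].

Lemma measurable_rball n (w : 'I_n -> R[i]) i c rho : measurable (rball w i c rho).
Proof.
apply: measurable_leRR; last exact: measurable_cst.
by apply: measurable_cabs; apply: cmeasB; [exact: cmeas_rsum|exact: cmeas_cst].
Qed.

Context (alpha beta kappa : R).
Hypothesis alpha0 : 0 < alpha.
Hypothesis beta0 : 0 < beta.
Hypothesis beta1 : beta <= 1.
Hypothesis kappa0 : 0 < kappa.
Hypothesis NDG : forall c : R[i], Pr mu [set x : borelC R | cabs ((x : R[i]) - c) <= alpha] <= 1 - beta.
Definition pairset : set (borelC R * borelC R) :=
  [set p | alpha <= cabs ((p.1 : R[i]) - p.2) /\ cabs ((p.1 : R[i]) - p.2) <= kappa].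
Hypothesis PAIR : beta <= Pr (mu \x mu)%E pairset.

Lemma cmeas_fst : @cmeas R _ (borelC R * borelC R)%type (fun p => (p.1 : R[i])).
Proof. exact: (cmeas_compl (@cmeas_borelC R) measurable_fst). Qed.
Lemma cmeas_snd : @cmeas R _ (borelC R * borelC R)%type (fun p => (p.2 : R[i])).
Proof. exact: (cmeas_compl (@cmeas_borelC R) measurable_snd). Qed.

Lemma measurable_pairset : measurable pairset.
Proof.
have mc : measurable_fun setT (fun p : borelC R * borelC R => cabs ((p.1 : R[i]) - p.2)).
  by apply: measurable_cabs; apply: cmeasB; [exact: cmeas_fst|exact: cmeas_snd].
by apply: measurableI; apply: measurable_leRR => //; exact: measurable_cst.
Qed.

Lemma ent_amerge S (a b : Arr R) i j :
  ent (amerge S (a, b)) i j = if S (i, j) then ent a i j else ent b i j.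
Proof. by rewrite /ent /amerge. Qed.

(** All entries but the one at (i, j0) are frozen; the event then confines that entry to a ball of
    radius [alpha]. *)
Lemma sparse_bound n (w : 'I_n -> R[i]) i c rho j0 :
  rho <= alpha * cabs (w j0) -> w j0 != 0 ->
  Pr Q (rball w i c rho) <= 1 - beta.
Proof.
move=> rw w0; have wp : 0 < cabs (w j0) by rewrite cabs_gt0.
rewrite -[X in _ <= X]add0r -(_ : Pr Q set0 = 0); last by rewrite /Pr measure0.
apply: (@Pr_merge_le _ _ Qi (predC1 (i, (j0 : nat)))) => //.
- exact: measurable_rball.
- by rewrite subr_ge0.
move=> a _.
pose c' := (c - \sum_(j < n | j != j0) ent a i j * w j) / w j0.
have mB : measurable [set x : borelC R | cabs ((x : R[i]) - c') <= alpha].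
  apply: measurable_leRR; last exact: measurable_cst.
  apply: measurable_cabs; apply: cmeasB; [exact: cmeas_borelC|exact: cmeas_cst].
apply: le_trans (NDG c').
have -> : Pr mu [set x : borelC R | cabs ((x : R[i]) - c') <= alpha] =
   Pr Q [set b | [set x : borelC R | cabs ((x : R[i]) - c') <= alpha] (b i j0)].
  by rewrite /Pr iidQ.2.
apply: le_Pr.
- rewrite -[X in measurable X]setTI.
  exact: (measurable_merge_snd _ a measurableT (measurable_rball w i c rho)).
- exact: (@measurable_coord_set R (i, (j0 : nat)) _ mB).
move=> b; rewrite /rball /= /rsum (bigD1 j0)//= ent_amerge /= eqxx /=.
have -> : \sum_(j < n | j != j0) ent (amerge (predC1 (i, (j0 : nat))) (a, b)) i j * w j =
   \sum_(j < n | j != j0) ent a i j * w j.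
  apply: eq_bigr => j jj0; rewrite ent_amerge /=.
  by case: eqP => // -[/val_inj E]; rewrite E eqxx in jj0.
move=> h; rewrite -(ler_pM2r wp) -cabsM.
apply: le_trans rw; apply: le_trans h.
by rewrite mulrBl /c' divfK// opprB addrA.
Qed.

(** With the other columns frozen, the identity block leaves in the [k]-th condition the single
    entry at column [f k]. The d conditions thus confine d independent entries to balls of radius
    [alpha]; approximate orthogonality is enough for this form of Odlyzko's argument. *)
Lemma odlyzko_bound n d (f : 'I_d -> 'I_n) (U : 'I_d -> 'I_n -> R[i]) (i : nat) (c : 'I_d -> R[i]) :
  injective f -> (forall k l, U k (f l) = (k == l)%:R) ->
  Pr Q [set a | forall k, cabs (rsum (U k) i a - c k) <= alpha] <= (1 - beta) ^+ d.
Proof.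
move=> fi Uf.
have b01 : 0 <= 1 - beta by rewrite subr_ge0.
rewrite -[X in _ <= X]add0r -(_ : Pr Q set0 = 0); last by rewrite /Pr measure0.
have mE : measurable [set a | forall k, cabs (rsum (U k) i a - c k) <= alpha].
  rewrite (_ : [set a | _] = \bigcap_(k in [set: 'I_d]) rball (U k) i (c k) alpha).
    by apply: fin_bigcap_measurable => // k _; exact: measurable_rball.
  by apply/seteqP; split => a h k //; [move=> _; exact: h|exact: h].
pose S : pred (nat * nat) := fun p => ~~ [exists k, p == (i, (f k : nat))].
apply: (@Pr_merge_le _ _ Qi S) => //.
  by rewrite exprn_ge0.
move=> a _.
pose c' k := c k - \sum_(j < n | ~~ [exists l, j == f l]) ent a i j * U k j.
pose B k : set (borelC R) := [set x : borelC R | cabs ((x : R[i]) - c' k) <= alpha].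
have mB k : measurable (B k).
  apply: measurable_leRR; last exact: measurable_cst.
  apply: measurable_cabs; apply: cmeasB; [exact: cmeas_borelC|exact: cmeas_cst].
pose s := [seq (i, (f k : nat)) | k <- enum 'I_d].
have us : uniq s.
  by rewrite map_inj_uniq ?enum_uniq// => k l [/val_inj/fi].
pose Bp (p : nat * nat) : set (borelC R) :=
  if [pick k | p == (i, (f k : nat))] is Some k then B k else setT.
have BpE k : Bp (i, (f k : nat)) = B k.
  rewrite /Bp; case: pickP => [l /eqP[/val_inj/fi ->]//|/(_ k)].
  by rewrite eqxx.
have mBp p : measurable (Bp p) by rewrite /Bp; case: pickP.
have bI p (x : borelC R) : `|\1_(Bp p) x : R| <= 1.
  by rewrite indicE; case: (_ \in _); rewrite /= ?normr1 ?normr0.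
have E := @Ex_indep_prod _ _ _ iidQ s (fun p => \1_(Bp p)) 1 us ler01
  (fun p => measurable_indic (mBp p)) bI.
have P1 : \prod_(p <- s) Ex mu \1_(Bp p) <= (1 - beta) ^+ d.
  rewrite big_map big_enum /=.
  apply: (@le_trans _ _ (\prod_(k < d) (1 - beta))); last by rewrite prodr_const card_ord.
  apply: ler_prod => k _; rewrite BpE -Pr_Ex// Pr_ge0 /=; exact: NDG.
apply: le_trans P1; rewrite -E.
rewrite Pr_Ex; last first.
  by rewrite -[X in measurable X]setTI; exact: (measurable_merge_snd S a measurableT mE).
have mprod : measurable_fun setT (fun b : Arr R => \prod_(p <- s) (\1_(Bp p) (b p.1 p.2) : R)).
  apply: measurable_fun_prodR => p.
  apply: (measurableT_comp (f := \1_(Bp p) : _ -> R)); first exact: measurable_indic.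
  exact: measurable_coord.
apply: le_Ex.
- apply: itg_indic.
  by rewrite -[X in measurable X]setTI; exact: (measurable_merge_snd S a measurableT mE).
- apply: (@itg_bounded _ _ _ _ _ 1) => // b.
  rewrite ger0_norm; last by apply: prodr_ge0 => p _; rewrite indicE.
  apply: (@le_trans _ _ (\prod_(p <- s) 1)); last by rewrite big1.
  by apply: ler_prod => p _; rewrite indicE; case: (_ \in _); rewrite /= ?ler01 ?lexx.
move=> b; rewrite [X in X <= _]indicE.
case: (boolP (b \in _)); last by move=> _; apply: prodr_ge0 => p _; rewrite indicE.
rewrite inE /= => h.
rewrite big_map big_enum /= big1// => k _; rewrite BpE indicE mem_set// /B /=.
have := h k; rewrite /rsum (bigID (fun j => [exists l, j == f l])) /=.
have -> : \sum_(j < n | ~~ [exists l, j == f l]) ent (amerge S (a, b)) i j * U k j =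
   \sum_(j < n | ~~ [exists l, j == f l]) ent a i j * U k j.
  apply: eq_bigr => j /existsPn jl; rewrite ent_amerge /S ifT//.
  by apply/existsPn => l; apply/negP => /eqP[/val_inj E']; have := jl l; rewrite E' eqxx.
rewrite (bigD1 (f k)) /=; last by apply/existsP; exists k.
rewrite Uf eqxx mulr1 big1 ?addr0.
  rewrite ent_amerge /S ifF; last by apply/negbTE; rewrite negbK; apply/existsP; exists k.
  by rewrite /c' opprB addrA addrAC.
move=> j /andP[/existsP[l /eqP ->] lk]; rewrite Uf.
by case: eqP => [E'|_]; [rewrite E' eqxx in lk|rewrite mulr0].
Qed.

Section sym.
Variables (n : nat) (w : 'I_n -> R[i]) (i : nat).

(** Every merge of two independent copies along a set of columns has the law of one copy, so the
    probability is an average over all subsets. For fixed (a, b) the merged row sums are subset sums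
    with steps [(ent a i j - ent b i j) * w j], open to the bounds on the cube. *)
Lemma symmetrize (c : R[i]) rho (Bad : set (Arr R * Arr R)) p :
  measurable Bad -> 0 <= p ->
  (forall a b, ~ Bad (a, b) ->
    \sum_(S : {set 'I_n}) ((cabs (rsum w i b + \sum_(j in S) ((ent a i j - ent b i j) * w j) - c) <= rho)%R : nat)%:R <= p * (2 ^ n)%:R :> R) ->
  Pr Q (rball w i c rho) <= p + Pr (Q \x Q)%E Bad.
Proof.
move=> mBad p0 h.
have N0 : 0 < (2 ^ n)%:R :> R by rewrite ltr0n expn_gt0.
pose SS (S : {set 'I_n}) : pred (nat * nat) := fun x => [exists j in S, val j == x.2].
have SSE (S : {set 'I_n}) (j : 'I_n) : SS S (i, val j) = (j \in S).
  apply/existsP/idP => [[k /andP[kS /eqP/val_inj <-]]//|jS].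
  by exists j; rewrite jS /=.
have rE S (ab : Arr R * Arr R) : rsum w i (amerge (SS S) ab) =
    rsum w i ab.2 + \sum_(j in S) ((ent ab.1 i j - ent ab.2 i j) * w j).
  case: ab => a b; rewrite /rsum [X in _ + X]big_mkcond -big_split; apply: eq_bigr => j _ /=.
  rewrite ent_amerge SSE; case: ifP => _; last by rewrite addr0.
  by rewrite mulrBl addrC subrK.
have mE S : measurable (amerge (SS S) @^-1` rball w i c rho).
  rewrite -[X in measurable X]setTI.
  exact: (measurable_merge (SS S) measurableT (measurable_rball w i c rho)).
have PE S : Pr Q (rball w i c rho) = Ex (Q \x Q)%E (\1_(amerge (SS S) @^-1` rball w i c rho)).
  rewrite -Pr_Ex//; rewrite /Pr; congr fine; apply: merge_law => //.
  exact: measurable_rball.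
have E1 : (2 ^ n)%:R * Pr Q (rball w i c rho) =
    Ex (Q \x Q)%E (fun ab => \sum_(S : {set 'I_n}) \1_(amerge (SS S) @^-1` rball w i c rho) ab).
  rewrite Ex_sum; last by move=> S; exact: itg_indic.
  rewrite (eq_bigr (fun=> Pr Q (rball w i c rho))); last by move=> S _; rewrite -PE.
  by rewrite sumr_const card_sets card_ord mulr_natl.
rewrite -(ler_pM2l N0) E1 mulrDr [X in _ <= X + _]mulrC.
rewrite (Pr_Ex (Q \x Q)%E mBad) -ExZ; last exact: itg_indic.
rewrite -[X in _ <= X + _](Ex_cst (Q \x Q)%E) -ExD; last 2 first.
- exact: itg_cst.
- by apply: itgZ; exact: itg_indic.
apply: le_Ex.
- by apply: itg_sum => S; exact: itg_indic.
- by apply: itgD; [exact: itg_cst|apply: itgZ; exact: itg_indic].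
move=> [a b]; rewrite [X in _ + _ * X]indicE.
case: (boolP ((a, b) \in Bad)) => hB /=.
  rewrite mulr1 (@le_trans _ _ (2 ^ n)%:R)//; last by rewrite lerDr mulr_ge0// ltW.
  apply: (@le_trans _ _ (\sum_(S : {set 'I_n}) 1)).
    by apply: ler_sum => S _; rewrite indicE; case: (_ \in _).
  by rewrite sumr_const card_sets card_ord.
rewrite mulr0 addr0; apply: le_trans (h a b _); last by move/negP: hB => + /mem_set.
rewrite le_eqVlt; apply/orP; left; apply/eqP; apply: eq_bigr => S _.
rewrite indicE; congr (_%:R); congr nat_of_bool.
apply/idP/idP; rewrite inE /rball /= rE; exact.
Qed.

End sym.

End row_anticonc.

Section SS.
Context (R : realType) (mu : probability (borelC R) R) (Q : probability (Arr R) R).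
Hypothesis iidQ : iid_law mu Q.
Context (alpha beta kappa : R).
Hypothesis alpha0 : 0 < alpha.
Hypothesis beta0 : 0 < beta.
Hypothesis kappa0 : 0 < kappa.
Hypothesis PAIR : beta <= Pr (mu \x mu)%E (pairset alpha kappa).

Section fixed.
Variables (n : nat) (w : 'I_n -> R[i]) (i : nat) (I : {set 'I_n}).

Let s := [seq (i, val j) | j <- enum I].

Let us : uniq s.
Proof. by rewrite map_inj_uniq ?enum_uniq// => j j' [/val_inj]. Qed.

Let size_s : size s = #|I|.
Proof. by rewrite size_map cardE. Qed.

Let wn (k : nat) : R[i] := oapp w 0 (insub k).

Let wnE (j : 'I_n) : wn j = w j.
Proof. by rewrite /wn valK. Qed.

Lemma count_row (P : nat * nat -> bool) :
  count P s = #|[pred j in I | P (i, val j)]|.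
Proof.
by rewrite count_map -sum1_count -sum1_card big_enum_cond; apply: eq_bigl => j; rewrite !inE.
Qed.

Definition fewpairs (N1 : nat) : set (Arr R * Arr R) :=
  [set ab | (count (fun p => ab \in prB (fun=> pairset alpha kappa) p) s < N1)%N].

Lemma measurable_fewpairs N1 : measurable (fewpairs N1).
Proof.
apply: (@measurable_count_lt R) => p; apply: measurable_prB => _; exact: measurable_pairset.
Qed.

(** The lower-tail Chernoff bound is 2^N1 exp(- beta #|I| / 2), and the hypothesis on [N1] lets half
    of the exponent pay for the first factor. *)
Lemma fewpairs_le (N1 : nat) : N1%:R <= beta * #|I|%:R / 4 ->
  Pr (Q \x Q)%E (fewpairs N1) <= expR (- (beta * #|I|%:R / 4)).
Proof.
move=> hN1.
have := @chernoff_low _ _ _ iidQ s (fun=> pairset alpha kappa) beta N1 us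
  (fun=> measurable_pairset alpha kappa) (fun=> PAIR).
move/le_trans; apply; rewrite size_s.
have h2 : 2 ^+ N1 <= expR N1%:R :> R.
  have -> : N1%:R = \sum_(k < N1) (1 : R) by rewrite sumr_const card_ord.
  rewrite expR_sum -[X in 2 ^+ X]card_ord -prodr_const; apply: ler_prod => k _.
  rewrite ler0n /=; exact: expR_ge1Dx.
apply: (le_trans (ler_wpM2r (expR_ge0 _) h2)).
by rewrite -expRD ler_expR; move: hN1; lra.
Qed.

Let G (ab : Arr R * Arr R) : {set 'I_n} :=
  [set j in I | ab \in prB (fun=> pairset alpha kappa) (i, val j)]%SET.

Let GE ab j : (j \in G ab) = (j \in I) &&
   (alpha <= cabs (ent ab.1 i j - ent ab.2 i j) <= kappa).
Proof.
rewrite inE; congr andb; apply/idP/idP.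
  by rewrite inE /prB /pairset /= => -[-> ->].
by move=> /andP[h1 h2]; rewrite inE.
Qed.

Let cardG ab N1 : ~ fewpairs N1 ab -> (N1 <= #|G ab|)%N.
Proof.
rewrite /fewpairs /= count_row => /negP; rewrite -leqNgt => /leq_trans; apply.
by apply: subset_leq_card; apply/fintype.subsetP => j; rewrite !inE.
Qed.

Let Wab (ab : Arr R * Arr R) (j : 'I_n) := (ent ab.1 i j - ent ab.2 i j) * w j.

Lemma LO_bound (c : R[i]) (rho K : R) (N1 : nat) :
  0 < K -> (forall j, j \in I -> K <= cabs (w j)) ->
  4 * rho < alpha * K -> (0 < N1)%N -> N1%:R <= beta * #|I|%:R / 4 ->
  Pr Q (rball w i c rho) <= 8 / Num.sqrt N1%:R + expR (- (beta * #|I|%:R / 4)).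
Proof.
move=> K0 wK rK N10 hN1.
have sq0 : 0 < Num.sqrt N1%:R :> R by rewrite sqrtr_gt0 ltr0n.
apply: le_trans (lerD (lexx _) (fewpairs_le hN1)).
apply: (symmetrize iidQ); [exact: measurable_fewpairs|by rewrite divr_ge0// ltW|].
move=> a b /cardG hG.
have aK : 0 < alpha * K by rewrite mulr_gt0.
have hW j : j \in G (a, b) -> alpha * K <= cabs (Wab (a, b) j).
  rewrite GE => /andP[jI /andP[h1 _]].
  rewrite /Wab /= cabsM; apply: (ler_pM (ltW alpha0) (ltW K0) h1); exact: wK.
have rK1 : 4 * rho < 1%:R * (alpha * K) by rewrite mul1r.
have := LO_complex (rsum w i b) c aK hW rK1.
rewrite card_sets_pred card_ord mulr1 => H.
set T := \sum_S _ in H *.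
have T0 : 0 <= T by rewrite sumr_ge0.
rewrite mulrAC ler_pdivlMr//; apply: le_trans H.
by rewrite ler_wpM2l// ler_wsqrtr// ler_nat.
Qed.

(** [flip_LO] needs steps that do not clump. For a fixed value xi of the pair difference, at most
    [q] indices have [xi * w j] near a given point, so clump counts have mean at most [q]; Chernoff
    and a union over a grid of centres exclude clumps larger than [2 * q + h]. *)
Lemma SS_bound (c : R[i]) (rho K : R) (q h N1 k M : nat) :
  0 < K -> 0 < rho -> (forall j, j \in I -> K <= cabs (w j) <= 2 * K) ->
  (forall v, (#|[pred j in I | (cabs (w j - v) <= 3 * rho / alpha)%R]| <= q)%N) ->
  4 * (rho + 2 * kappa * K) < k%:R * (alpha * K) ->
  2 * kappa * K + rho <= M%:R * rho ->
  (0 < N1)%N -> N1%:R <= beta * #|I|%:R / 4 ->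
  Pr Q (rball w i c rho) <= 16 * (2 * q + h)%:R * k%:R / (N1%:R * Num.sqrt N1%:R) +
   (((2 * M).+1 ^ 2)%:R / 2 ^+ h + expR (- (beta * #|I|%:R / 4))).
Proof.
move=> K0 r0 wK wq hk hM N10 hN1.
have sq0 : 0 < Num.sqrt N1%:R :> R by rewrite sqrtr_gt0 ltr0n.
have N1p : 0 < N1%:R :> R by rewrite ltr0n.
pose Bv (v : R[i]) (p : nat * nat) : set (borelC R * borelC R) :=
  pairset alpha kappa `&` [set x | cabs (((x.1 : R[i]) - x.2) * wn p.2 - v) <= 3 * rho].
have mBv v p : measurable (Bv v p).
  apply: measurableI; first exact: measurable_pairset.
  apply: measurable_leRR; last exact: measurable_cst.
  apply: measurable_cabs; apply: cmeasB; last exact: cmeas_cst.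
  apply: cmeasM; last exact: cmeas_cst.
  by apply: cmeasB; [exact: cmeas_fst|exact: cmeas_snd].
have sumBv v : \sum_(p <- s) Pr (mu \x mu)%E (Bv v p) <= q%:R.
  rewrite (eq_bigr (fun p => Ex (mu \x mu)%E (\1_(Bv v p)))); last by move=> p _; rewrite -Pr_Ex.
  rewrite -Ex_sum; last by move=> p; exact: itg_indic.
  rewrite -[X in _ <= X](Ex_cst (mu \x mu)%E); apply: le_Ex; last 1 first.
  - move=> x; rewrite big_map big_enum /=.
    have [xp|xp] := boolP (x \in pairset alpha kappa); last first.
      rewrite big1// => j _; rewrite indicE memNset// => -[xp' _].
      by case/negP: xp; rewrite inE.
    move: xp; rewrite inE => -[x1 x2].
    set xi := (x.1 : R[i]) - x.2 in x1 x2.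
    have xip : 0 < cabs xi by rewrite (lt_le_trans alpha0).
    have xi0 : xi != 0 by rewrite -cabs_gt0.
    apply: (@le_trans _ _ (#|[pred j in I | (cabs (w j - v / xi) <= 3 * rho / alpha)%R]|%:R)); last by rewrite ler_nat.
    rewrite -sum1_card natr_sum big_mkcond [X in _ <= X]big_mkcond; apply: ler_sum => j _.
    rewrite !inE; case: (j \in I) => //=.
    rewrite indicE; case: (boolP (x \in _)); last by case: ifP.
    rewrite inE => -[_]; rewrite /= wnE -/xi => hj; rewrite ifT//.
    rewrite ler_pdivlMr// (@le_trans _ _ (cabs (w j - v / xi) * cabs xi))//.
      by rewrite ler_wpM2l ?cabs_ge0.
    by rewrite -cabsM mulrBl divfK// mulrC.
  - by apply: itg_sum => p; exact: itg_indic.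
  - exact: itg_cst.
(* The part [2 * q] absorbs exp(q) <= 4^q in the Chernoff bound and leaves 2^-h. *)
pose m := (2 * q + h)%N.
pose many v : set (Arr R * Arr R) := [set ab | (m <= count (fun p => ab \in prB (Bv v) p) s)%N].
have mmany v : measurable (many v).
  by apply: (@measurable_count_ge R) => p; apply: measurable_prB.
have Pmany v : Pr (Q \x Q)%E (many v) <= (2 ^+ h)^-1.
  apply: (le_trans (chernoff_up iidQ m us (mBv v) (sumBv v))).
  have e4 : expR 1 <= 4 :> R.
    have -> : 1 = 2^-1 + 2^-1 :> R by field.
    rewrite expRD; have e2 : expR (2^-1) <= 2 :> R.
      rewrite -[X in expR X]opprK expRN -[X in _ <= X]invrK lef_pV2 ?posrE ?expR_gt0 ?invr_gt0//.
      by apply: le_trans (expR_ge1Dx _); lra.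
    by have := ler_pM (expR_ge0 _) (expR_ge0 _) e2 e2; lra.
  have eq4 : expR q%:R <= 4 ^+ q :> R.
    have -> : q%:R = \sum_(k < q) (1 : R) by rewrite sumr_const card_ord.
    rewrite expR_sum -[X in 4 ^+ X]card_ord -prodr_const; apply: ler_prod => l _.
    by rewrite expR_ge0.
  rewrite ler_pdivrMr ?exprn_gt0// /m exprD mulrCA mulVf ?gt_eqF ?exprn_gt0// mulr1 exprM.
  by have -> : 2 ^+ 2 = 4 :> R by ring.
pose Bad := fewpairs N1 `|` [set ab | exists p : 'I_(2 * M).+1 * 'I_(2 * M).+1, many (gridpt rho p) ab].
have mgrid : measurable [set ab | exists p : 'I_(2 * M).+1 * 'I_(2 * M).+1, many (gridpt rho p) ab].
  rewrite (_ : [set ab | _] = \bigcup_(p in [set: 'I_(2 * M).+1 * 'I_(2 * M).+1]) many (gridpt rho p)).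
    by apply: fin_bigcup_measurable => // p _; exact: mmany.
  by apply/seteqP; split => ab /= [p]; [exists p|exists p].
have mBad : measurable Bad by apply: measurableU => //; exact: measurable_fewpairs.
have PBad : Pr (Q \x Q)%E Bad <= ((2 * M).+1 ^ 2)%:R / 2 ^+ h + expR (- (beta * #|I|%:R / 4)).
  apply: (le_trans (Pr_setU _ _ _)) => //; first exact: measurable_fewpairs.
  rewrite addrC; apply: lerD; last exact: fewpairs_le.
  apply: (le_trans (Pr_bigcup _ _)); first by move=> p; exact: mmany.
  apply: (@le_trans _ _ (\sum_(p : 'I_(2 * M).+1 * 'I_(2 * M).+1) (2 ^+ h)^-1)).
    by apply: ler_sum => p _; exact: Pmany.
  by rewrite sumr_const card_prod !card_ord mulnn mulr_natl lexx.
apply: le_trans (lerD (lexx _) PBad).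
apply: (symmetrize iidQ); [exact: mBad|by rewrite divr_ge0 ?mulr_ge0// ltW// mulr_gt0|].
move=> a b nBad.
have hG : (N1 <= #|G (a, b)|)%N by apply: cardG => h1; apply: nBad; left.
have hm (p : 'I_(2 * M).+1 * 'I_(2 * M).+1) : (count (fun x => (a, b) \in prB (Bv (gridpt rho p)) x) s < m)%N.
  by rewrite ltnNge; apply/negP => h1; apply: nBad; right; exists p.
have aK : 0 < alpha * K by rewrite mulr_gt0.
have hW j : j \in G (a, b) -> alpha * K <= cabs (Wab (a, b) j) <= 2 * kappa * K.
  rewrite GE => /andP[jI /andP[h1 h2]]; have /andP[h3 h4] := wK j jI.
  rewrite /Wab /= cabsM; apply/andP; split; first exact: (ler_pM (ltW alpha0) (ltW K0) h1 h3).
  rewrite (_ : 2 * kappa * K = kappa * (2 * K)); last by ring.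
  exact: (ler_pM (cabs_ge0 _) (cabs_ge0 _) h2 h4).
have hclump (v : R[i]) : (#|[set j in G (a, b) | (cabs (Wab (a, b) j - v) <= rho)%R]%SET| <= m)%N.
  (* Beyond the grid there are no steps, since these have modulus at most [2 * kappa * K]. Inside,
     rounding [v] to the grid costs [2 * rho], whence the radius [3 * rho] in [Bv]. *)
  have [vM|vM] := leP (cabs v) (M%:R * rho); last first.
    rewrite (_ : [set j in _ | _]%SET = finset.set0) ?cards0//.
    apply/setP => j; rewrite inE finset.in_set0; apply/negbTE/negP => /andP[jG hv].
    have /andP[_ h4] := hW j jG.
    have hvv : cabs v <= cabs (Wab (a, b) j - v) + cabs (Wab (a, b) j).
      by have := cabs_triB (Wab (a, b) j) (Wab (a, b) j - v); rewrite subKr addrC.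
    have h5 := le_trans hvv (lerD hv h4); rewrite addrC in h5.
    by have := lt_le_trans vM (le_trans h5 hM); rewrite ltxx.
  have [p hp] := grid_round r0 vM.
  apply: leq_trans (ltnW (hm p)); rewrite count_row.
  apply: subset_leq_card; apply/fintype.subsetP => j; rewrite inE => /andP[].
  rewrite GE => /andP[jI /andP[h1 h2]] hv; rewrite inE; apply/andP; split=> //.
  rewrite inE /prB /Bv; split => /=; first by split.
  rewrite wnE; apply: (le_trans (cabs_tri3 _ _ v)); move: hv hp; rewrite /Wab /ent /=; lra.
have := flip_LO (rsum w i b) c aK hW hclump hk.
rewrite card_sets_pred card_ord => H.
set T := \sum_S _ in H *.
have NN : N1%:R * Num.sqrt N1%:R <= #|G (a, b)|%:R * Num.sqrt #|G (a, b)|%:R :> R.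
  by rewrite ler_pM ?sqrtr_ge0 ?ler_nat ?ler_wsqrtr ?ler_nat.
have NNp : 0 < N1%:R * Num.sqrt N1%:R :> R by rewrite mulr_gt0.
have T0 : 0 <= T by rewrite sumr_ge0.
rewrite mulrAC ler_pdivlMr//.
apply: le_trans H; exact: ler_wpM2l.
Qed.

End fixed.
End SS.

(** * Nets of normal vectors and the last rows *)

Section clumps.
Context (R : realType) (n : nat) (w : 'I_n -> R[i]).

Definition nonclumpy (I : {set 'I_n}) (s : R) (q : nat) :=
  forall v, (#|[set j in I | (cabs (w j - v) <= s)%R]%SET| <= q)%N.

(** Clumps of more than [q] indices are removed until none is left. They are disjoint, hence the
    bound on the number of centres; keeping each centre near some [w j] bounds the centres whenever
    [w] is bounded. *)
Lemma greedy_clumps (s : R) (q : nat) (I : {set 'I_n}) : exists (J : {set 'I_n}) (vs : seq R[i]),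
  [/\ (size vs * q <= #|I|)%N, nonclumpy J s q,
   forall v, v \in vs -> exists j, cabs (w j - v) <= s &
   forall j, j \in I -> j \notin J -> exists2 v, v \in vs & cabs (w j - v) <= s].
Proof.
have [N] := ubnP #|I|; elim: N I => // N IH I IN.
have [nc|] := pselect (nonclumpy I s q).
  by exists I, [::]; split => // j jI; rewrite jI.
move=> /existsNP[v /negP]; rewrite -ltnNge => hv.
set K := [set j in I | _]%SET in hv.
have KI : K \subset I by apply/fintype.subsetP => j; rewrite inE => /andP[].
have cK : #|I| = (#|K| + #|I :\: K|)%N by rewrite -(cardsID K I) (finset.setIidPr KI).
have [j1 j1K] : exists j, j \in K by apply/card_gt0P; apply: leq_ltn_trans hv.
have [|J [vs [h1 h2 h3 h4]]] := IH (I :\: K)%SET; first by move: hv IN; rewrite cK; lia.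
exists J, (v :: vs); split => //.
- by rewrite /= mulSn; move: h1 hv; rewrite cK; lia.
- move=> v'; rewrite inE => /orP[/eqP ->|/h3//].
  by exists j1; move: j1K; rewrite inE => /andP[].
- move=> j jI jJ; case: (boolP (j \in K)) => jK.
    by exists v; [rewrite inE eqxx|move: jK; rewrite inE => /andP[]].
  have [|v' v'vs hv'] := h4 j _ jJ; first by rewrite inE jK.
  by exists v' => //; rewrite inE v'vs orbT.
Qed.

(** At most [q] indices have modulus at most [s], because the ball at 0 is no clump. The others fall
    into [Lev] dyadic shells, and one of these receives [m] of them by pigeonhole. *)
Lemma dyadic_shell (s : R) (q Lev m e : nat) (I : {set 'I_n}) :
  0 < s -> (forall j, cabs (w j) <= 2) -> 2 <= s * 2 ^+ Lev -> (0 < Lev)%N -> (0 < m)%N ->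
  nonclumpy I s q -> (q + Lev * m <= e)%N -> (e <= #|I|)%N ->
  exists (K : R) (J : {set 'I_n}), [/\ s <= K, J \subset I, (m <= #|J|)%N &
    forall j, j \in J -> K <= cabs (w j) <= 2 * K].
Proof.
move=> s0 w2 sL Lev0 m0 nc he eI.
pose sh (l : 'I_Lev) := [set j in I | (s * 2 ^+ l <= cabs (w j) <= 2 * (s * 2 ^+ l))%R]%SET.
have [[l hl]|/forallNP hno] := pselect (exists l, (m <= #|sh l|)%N).
  exists (s * 2 ^+ l), (sh l); split => //.
  - rewrite -[X in X <= _]mulr1 ler_pM2l//; apply: exprn_ege1; exact: ler1n.
  - by apply/fintype.subsetP => j; rewrite inE => /andP[].
  - by move=> j; rewrite inE => /andP[].
exfalso; have lt l : (#|sh l| <= m.-1)%N by have /negP := hno l; rewrite -ltnNge; lia.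
have cov : I \subset [set j in I | (cabs (w j - 0) <= s)%R]%SET :|: (\bigcup_l sh l)%SET.
  apply/fintype.subsetP => j jI; rewrite !inE jI subr0 /=.
  have [//|sj] := leP; apply/finset.bigcupP.
  suff [l hl] : exists l : nat, (l < Lev)%N /\ s * 2 ^+ l <= cabs (w j) <= 2 * (s * 2 ^+ l).
    by case: hl => hl1 hl2; exists (Ordinal hl1); rewrite // inE jI.
  have : cabs (w j) <= s * 2 ^+ Lev by exact: le_trans (w2 j) sL.
  elim: Lev Lev0 {sL he sh hno lt} => // L IH _ hL.
  have [wL|wL] := leP (cabs (w j)) (s * 2 ^+ L).
    case: L IH wL {hL} => [|L] IH wL; first by rewrite expr0 mulr1 leNgt sj in wL.
    by have [//|l [l1 l2]] := IH _ wL; exists l; split => //; exact: ltnW.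
  exists L; split => //; rewrite ltW//=; apply: le_trans hL _.
  by rewrite exprS mulrCA.
have := subset_leq_card cov; apply/negP; rewrite -ltnNge.
apply: leq_ltn_trans (leq_card_setU _ _) _.
have h1 := nc 0.
have h2 : (#|(\bigcup_l sh l)%SET| <= Lev * m.-1)%N.
  apply: (@leq_trans (\sum_(l < Lev) m.-1)); last by rewrite sum_nat_const card_ord.
  apply: (big_ind2 (fun (A : {set 'I_n}) k => (#|A| <= k)%N)); first by rewrite cards0.
    by move=> A a B b hA hB; apply: (leq_trans (leq_card_setU _ _)); exact: leq_add.
  by move=> l _; exact: lt.
apply: leq_ltn_trans (leq_add h1 h2) _.
apply: leq_trans eI; apply: leq_trans he.
by rewrite -addnS leq_add2l ltn_pmul2l// prednK.
Qed.

End clumps.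

Section nets.
Context (R : realType) (n V e M : nat) (s : R).

Definition gridT := ('I_(2 * M).+1 * 'I_(2 * M).+1)%type.
(** The factors are, in order, a class for each index, a grid point for each class, the positions of
    the exceptional indices, and a grid point for each of these. *)
Definition netT := ({ffun 'I_n -> 'I_V} * {ffun 'I_V -> gridT} *
  {ffun 'I_e -> 'I_n} * {ffun 'I_e -> gridT})%type.

Lemma card_netT : #|{: netT}| =
  (V ^ n * ((2 * M).+1 * (2 * M).+1) ^ V * n ^ e * ((2 * M).+1 * (2 * M).+1) ^ e)%N.
Proof. by rewrite !card_prod !card_ffun !card_prod !card_ord. Qed.

Definition netpt (t : netT) (j : 'I_n) : R[i] :=
  if [pick k | t.1.2 k == j] is Some k then gridpt s (t.2 k)
  else gridpt s (t.1.1.2 (t.1.1.1 j)).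

Lemma net_approx (w : 'I_n -> R[i]) (E : {set 'I_n}) (h : 'I_n -> 'I_V) (v : 'I_V -> R[i]) (j0 : 'I_n) :
  0 < s -> (#|E| <= e)%N -> (forall j, j \notin E -> cabs (w j - v (h j)) <= s) ->
  (forall j, cabs (w j) <= M%:R * s) -> (forall j, cabs (v j) <= M%:R * s) ->
  exists t, forall j, cabs (w j - netpt t j) <= 3 * s.
Proof.
move=> s0 Ee hE wM vM.
have [gw hgw] := choice (fun j => grid_round s0 (wM j)).
have [gv hgv] := choice (fun l => grid_round s0 (vM l)).
pose f (k : 'I_e) := nth j0 (enum E) k.
exists ([ffun j => h j], [ffun l => gv l], [ffun k => f k], [ffun k => gw (f k)]) => j.
rewrite /netpt /=; case: pickP => [k|hno]; rewrite ffunE.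
  by rewrite ffunE => /eqP <-; apply: (le_trans (hgw _)); move: s0; lra.
rewrite ffunE; have jE : j \notin E.
  apply/negP => jE; have je : (index j (enum E) < e)%N.
    by apply: leq_trans Ee; rewrite cardE index_mem mem_enum.
  by have := hno (Ordinal je); rewrite ffunE /f /= nth_index ?mem_enum// eqxx.
apply: (le_trans (cabs_tri3 _ _ (v (h j)))).
by have := hE j jE; have := hgv (h j); lra.
Qed.

End nets.

(** Off the remainder of the greedy procedure, [w] takes at most n / q values up to [s]. The
    remainder either has [e] indices or serves as the exceptional set of a net point. The additional
    class in [(n %/ q).+1] keeps the index type inhabited. *)
Lemma clump_net (R : realType) n q e M (s : R) (w : 'I_n -> R[i]) : (0 < n)%N -> (0 < q)%N -> 0 < s ->
  (forall j, cabs (w j) <= 2) -> 2 + s <= M%:R * s ->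
  (exists2 I : {set 'I_n}, (e <= #|I|)%N & nonclumpy w I s q) \/
  exists t : netT n (n %/ q).+1 e M, forall j, cabs (w j - netpt s t j) <= 3 * s.
Proof.
move=> n0 q0 s0 w2 hM.
have [J [vs [h1 h2 h3 h4]]] := greedy_clumps w s q finset.setT.
have [eJ|Je] := leqP e #|J|; [by left; exists J|right].
have szv : (size vs <= n %/ q)%N by rewrite leq_divRL// (leq_trans h1)// cardsT card_ord.
pose v (l : 'I_(n %/ q).+1) := nth 0 vs l.
have /choice[h hh] (j : 'I_n) : exists l : 'I_(n %/ q).+1, j \notin J -> cabs (w j - v l) <= s.
  have [jJ|jJ] := boolP (j \in J); first by exists ord0.
  have [|u uv hu] := h4 j _ jJ; first by rewrite inE.
  have il : (index u vs < (n %/ q).+1)%N.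
    by rewrite ltnS (leq_trans _ szv)// index_size.
  by exists (Ordinal il) => _; rewrite /v /= nth_index.
apply: (net_approx (E := J) (h := h) (v := v)) => //.
- exact: (Ordinal n0).
- exact: ltnW.
- by move=> j; have := w2 j; lra.
- move=> l; have [lt|ge] := ltnP l (size vs); last by rewrite /v nth_default// cabs0; move: hM s0; lra.
  have [j hj] := h3 (v l) (mem_nth _ lt).
  have := cabs_triB (w j) (w j - v l); rewrite subKr; have := w2 j; move: hM hj; lra.
Qed.

Lemma sparse_net (R : realType) n e M (s : R) (w : 'I_n -> R[i]) : (0 < n)%N -> 0 < s ->
  (forall j, cabs (w j) <= 2) -> 2 + s <= M%:R * s ->
  (e <= #|[set j | (s <= cabs (w j))%R]%SET|)%N \/
  exists t : netT n 1 e M, forall j, cabs (w j - netpt s t j) <= 3 * s.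
Proof.
move=> n0 s0 w2 hM; set E := finset _.
have [|Ee] := leqP e #|E|; [by left|right].
apply: (net_approx (E := E) (h := fun=> ord0) (v := fun=> 0)) => //.
- exact: (Ordinal n0).
- exact: ltnW.
- by move=> j; rewrite inE -ltNge subr0 => /ltW.
- by move=> j; have := w2 j; lra.
- by move=> j; rewrite cabs0; move: hM s0; lra.
Qed.

Section levels.
Context (R : realType) (mu : probability (borelC R) R) (Q : probability (Arr R) R).
Hypothesis iidQ : iid_law mu Q.
Let Qi : indep_law Q := iidQ.1.
Context (alpha beta kappa : R).
Hypothesis alpha0 : 0 < alpha.
Hypothesis beta0 : 0 < beta.
Hypothesis beta1 : beta <= 1.
Hypothesis kappa0 : 0 < kappa.
Hypothesis NDG : forall c : R[i], Pr mu [set x : borelC R | cabs ((x : R[i]) - c) <= alpha] <= 1 - beta.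
Hypothesis PAIR : beta <= Pr (mu \x mu)%E (pairset alpha kappa).

Definition anticonc n (w : 'I_n -> R[i]) (rho p : R) := forall i c, Pr Q (rball w i c rho) <= p.

(** [SS_bound] on the indices found by [dyadic_shell], whose moduli agree up to a factor 2. The
    bounds rho <= s <= K <= 2 make [k] and [M] independent of the shell. *)
Lemma anticonc_nonclumpy n (w : 'I_n -> R[i]) (I : {set 'I_n}) (s rho : R) (q Lev m e h N1 k M : nat) :
  0 < rho -> rho <= s -> 3 * rho / alpha <= s -> (forall j, cabs (w j) <= 2) -> 2 <= s * 2 ^+ Lev ->
  (0 < Lev)%N -> (0 < N1)%N -> nonclumpy w I s q -> (q + Lev * m <= e)%N -> (e <= #|I|)%N ->
  4 * (1 + 2 * kappa) < k%:R * alpha -> 4 * kappa + rho <= M%:R * rho -> 4 * N1%:R <= beta * m%:R ->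
  anticonc w rho (16 * (2 * q + h)%:R * k%:R / (N1%:R * Num.sqrt N1%:R) +
    (((2 * M).+1 ^ 2)%:R / 2 ^+ h + expR (- N1%:R))).
Proof.
move=> r0 rs rs3 w2 sL Lev0 N10 nc he eI hk hM hN1 i c.
have s0 : 0 < s by exact: lt_le_trans rs.
have m0 : (0 < m)%N.
  rewrite -(ltr0n R); have : 0 < N1%:R :> R by rewrite ltr0n.
  by move: hN1; have [m0|] := leP m%:R (0 : R) => // h1 h2; have := mulr_ge0_le0 (ltW beta0) m0; lra.
have [K [J [sK JI mJ wK]]] := dyadic_shell s0 w2 sL Lev0 m0 nc he eI.
have K0 : 0 < K by exact: lt_le_trans sK.
have K2 : K <= 2.
  have /card_gt0P[j jJ] : (0 < #|J|)%N by exact: leq_trans mJ.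
  by have /andP[] := wK j jJ; have := w2 j; lra.
have mJR : beta * m%:R <= beta * #|J|%:R by rewrite ler_pM2l// ler_nat.
have hN2 : N1%:R <= beta * #|J|%:R / 4 by move: hN1 mJR; lra.
have := SS_bound iidQ alpha0 PAIR i (n:=n) (w:=w) (I:=J) c (rho:=rho) (K:=K) (q:=q) h (N1:=N1) (k:=k) (M:=M) K0 r0 wK.
move=> /(_ _ _ _ N10 hN2) H.
apply: le_trans (H _ _ _) _.
- move=> v; apply: leq_trans (nc v); apply: subset_leq_card; apply/fintype.subsetP => j; rewrite !inE.
  by move=> /andP[/(fintype.subsetP JI) ->] hv /=; exact: le_trans hv rs3.
- have h1 := ler_wpM2r (ltW K0) (ltW hk).
  apply: (@le_lt_trans _ _ (4 * (1 + 2 * kappa) * K)); last by rewrite mulrA ltr_pM2r.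
  by have := le_trans rs sK; rewrite (_ : 4 * (1 + 2 * kappa) * K = 4 * K + 8 * (kappa * K)); [lra|ring].
- have := ler_pM2l kappa0 K 2; rewrite K2 => h1; move: hM h1; lra.
- by rewrite !lerD2l ler_expR lerN2.
Qed.

Lemma anticonc_spread n (w : 'I_n -> R[i]) (s rho : R) (e N1 : nat) :
  0 < s -> 4 * rho < alpha * s -> (0 < N1)%N -> (e <= #|[set j | (s <= cabs (w j))%R]%SET|)%N ->
  4 * N1%:R <= beta * e%:R ->
  anticonc w rho (8 / Num.sqrt N1%:R + expR (- N1%:R)).
Proof.
move=> s0 rs N10 eI hN1 i c; set J := finset _ in eI.
have mJR : beta * e%:R <= beta * #|J|%:R by rewrite ler_pM2l// ler_nat.
have hN2 : N1%:R <= beta * #|J|%:R / 4 by move: hN1 mJR; lra.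
have wJ j : j \in J -> s <= cabs (w j) by rewrite inE.
have H := LO_bound iidQ alpha0 PAIR i c s0 wJ rs N10 hN2.
apply: (le_trans H).
by rewrite lerD2l ler_expR lerN2.
Qed.

Lemma anticonc_nonzero n (w : 'I_n -> R[i]) (rho : R) j0 :
  1 <= 2 * cabs (w j0) -> 2 * rho <= alpha -> anticonc w rho (1 - beta).
Proof.
move=> wj hr i c; apply: (@sparse_bound _ _ _ iidQ alpha beta beta1 NDG n w i c rho j0).
  have := ler_pM2l alpha0 1 (2 * cabs (w j0)); rewrite wj mulr1 => h; move: h hr; lra.
by rewrite -cabs_gt0; move: wj; lra.
Qed.

End levels.

(** * Gram ratios of successive rows and their normal vectors *)

Section rows.
Context (R : realType).

Definition gramR p n (H : 'M[R[i]]_(p, n)) : R := complex.Re (gram H).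

Lemma gramRE p n (H : 'M[R[i]]_(p, n)) : gram H = (gramR H)%:C%C.
Proof. by have := gram_ge0 H; rewrite /gramR; case: (gram H) => a b; rewrite lecE /= => /andP[/eqP ->]. Qed.

Lemma gramR_ge0 p n (H : 'M[R[i]]_(p, n)) : 0 <= gramR H.
Proof. by rewrite -lecR -gramRE gram_ge0. Qed.

(** By [gram_ge] the Gram ratio controls the squared product of row i with u over |u|^2, and |u|^2
    <= n as coordinates are at most 1. The sums here are bilinear, hence the conjugation in [v]. *)
Lemma gramR_small p n (H : 'M[R[i]]_(p.+1, n)) i (u : 'I_n -> R[i]) (tau rho : R) :
  (forall k, k != i -> \sum_j H k j * u j = 0) -> (forall j, cabs (u j) <= 1) ->
  tau * n%:R <= rho ^+ 2 -> 0 <= rho ->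
  gramR H < tau * gramR (row' i H) -> cabs (\sum_j H i j * u j) <= rho.
Proof.
move=> Hu u1 tr r0 hG.
pose v : 'rV[R[i]]_n := \row_j Num.conj_op (u j).
have dv k : dot (row k H) v = \sum_j H k j * u j.
  by rewrite dotE; apply: eq_bigr => j _; rewrite !mxE conjCK.
have := @gram_ge _ _ _ H i v; rewrite dv => /(_ _)/wrap[].
  by move=> k ki; rewrite dv Hu.
rewrite -(dot_conj _ v) dv mulJ_cabs.
have vv : dot v v = (\sum_j cabs (u j) ^+ 2)%:C%C.
  rewrite dotE rmorph_sum /=; apply: eq_bigr => j _.
  by rewrite mxE conjCK mulrC mulJ_cabs.
rewrite vv !gramRE -!rmorphM /= lecR => h.
have sn : \sum_j cabs (u j) ^+ 2 <= n%:R.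
  rewrite -[X in X%:R]card_ord -sumr_const; apply: ler_sum => j _.
  by rewrite expr_le1// cabs_ge0.
set g := gramR H in h hG; set g' := gramR (row' i H) in h hG.
have g0 : 0 <= g by exact: gramR_ge0.
have g'0 : 0 < g'.
  rewrite lt0r gramR_ge0 andbT; apply/eqP => g'0; move: hG; rewrite g'0 mulr0 => hG.
  by have := le_lt_trans g0 hG; rewrite ltxx.
rewrite -(@ler_pXn2r _ 2) ?nnegrE ?cabs_ge0// -(ler_pM2l g'0).
apply: (le_trans h); apply: (@le_trans _ _ (g * n%:R)); first exact: ler_wpM2l.
apply: (@le_trans _ _ (tau * g' * n%:R)); first by rewrite ler_wpM2r// ltW.
by rewrite (mulrC tau) -mulrA ler_pM2l.
Qed.

Definition rowsm (m : nat -> nat -> R[i]) p n (a : Arr R) : 'M[R[i]]_(p, n) :=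
  \matrix_(i < p, j < n) (m i j + ent a i j).

Lemma cmeas_rowsm m p n i j : cmeas (fun a => rowsm m p n a i j).
Proof.
rewrite (_ : (fun a => _) = fun a => m i j + ent a i j); last by apply/funext => a; rewrite mxE.
by apply: cmeasD; [exact: cmeas_cst|exact: cmeas_ent].
Qed.

Lemma measurable_gramR p n (H : Arr R -> 'M[R[i]]_(p, n)) :
  (forall i j, cmeas (fun a => H a i j)) -> measurable_fun setT (fun a => gramR (H a)).
Proof.
move=> h; suff [] : cmeas (fun a => gram (H a)) by [].
apply: cmeas_det => i j; apply: cmeas_mulmx => // k l.
rewrite (_ : (fun a => _) = fun a => Num.conj_op (H a l k)); last first.
  by apply/funext => a; rewrite hcE.
exact: cmeas_conj.
Qed.

End rows.

Section level_sets.
Context (R : realType) (mu : probability (borelC R) R) (Q : probability (Arr R) R).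
Hypothesis iidQ : iid_law mu Q.
Let Qi : indep_law Q := iidQ.1.

Lemma Pr_merge_mul S (E F : set (Arr R)) (r : R) : measurable E -> measurable F ->
  (forall a b, F (amerge S (a, b)) <-> F a) ->
  (forall a, F a -> Pr Q [set b | E (amerge S (a, b))] <= r) ->
  Pr Q (F `&` E) <= r * Pr Q F.
Proof.
move=> mE mF hF h; have mFE := measurableI _ _ mF mE.
rewrite Pr_Ex// (Ex_merge Qi (S := S)); last 2 first.
- exact: itg_indic.
- move=> a; apply: (@itg_bounded_merge _ _ _ _ 1); first exact: measurable_indic.
  by move=> x; rewrite indicE; case: (_ \in _); rewrite /= ?normr1 ?normr0.
have mEa a : measurable [set b | E (amerge S (a, b))].
  by rewrite -[X in measurable X]setTI; exact: (measurable_merge_snd S a).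
rewrite Pr_Ex// -ExZ; last exact: itg_indic.
apply: le_Ex.
- apply: (Ex_merge_itg Qi); first exact: itg_indic.
  move=> a; apply: (@itg_bounded_merge _ _ _ _ 1); first exact: measurable_indic.
  by move=> x; rewrite indicE; case: (_ \in _); rewrite /= ?normr1 ?normr0.
- by apply: itgZ; exact: itg_indic.
- move=> a; rewrite [X in _ <= _ * X]indicE; case: (boolP (a \in F)) => aF.
    rewrite mulr1; apply: le_trans (h a _); last by move: aF; rewrite inE.
    rewrite Pr_Ex// le_eqVlt; apply/orP; left; apply/eqP; apply: eq_Ex => b.
    rewrite !indicE; congr (_%:R); congr nat_of_bool; apply/idP/idP; rewrite !inE /=; first by case.
    by move=> ?; split => //; apply/hF; move: aF; rewrite inE.
  rewrite mulr0 (eq_Ex _ (g := fun=> 0)) ?Ex_cst// => b.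
  rewrite indicE memNset// => -[/hF Fa _].
  by move/negP : aF; apply; rewrite inE.
Qed.

Lemma Pr_rballs n (w : 'I_n -> R[i]) rho p k (c : nat -> R[i]) : 0 <= p -> anticonc Q w rho p ->
  Pr Q [set a | forall i, (i < k)%N -> rball w i (c i) rho a] <= p ^+ k.
Proof.
move=> p0 ac; pose F k := [set a | forall i, (i < k)%N -> rball w i (c i) rho a].
have FS k' : F k'.+1 = F k' `&` rball w k' (c k') rho.
  apply/seteqP; split => a /=; first by move=> h; split; [move=> i ik; apply: h; rewrite ltnS ltnW|exact: h].
  move=> [h1 h2] i; rewrite ltnS leq_eqVlt => /orP[/eqP -> //|]; exact: h1.
have mF k' : measurable (F k').
  elim: k' => [|k' IH]; last by rewrite FS; apply: measurableI => //; exact: measurable_rball.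
  by rewrite (_ : F 0%N = setT)//; apply/seteqP; split.
rewrite -/(F k); elim: k => [|k IH]; first by rewrite expr0; apply: Pr_le1.
rewrite FS exprS; apply: (@le_trans _ _ (p * Pr Q (F k))); last exact: ler_wpM2l.
pose S : pred (nat * nat) := fun x => (x.1 < k)%N.
have rs a b i : rsum w i (amerge S (a, b)) = if (i < k)%N then rsum w i a else rsum w i b.
  by rewrite /rsum; case: ifP => ik; apply: eq_bigr => j _; rewrite ent_amerge /S /= ik.
apply: (Pr_merge_mul (S := S)) => //.
- exact: measurable_rball.
- by move=> a b; split => h i ik; have := h i ik; rewrite /rball /= rs ik.
- move=> a _; apply: le_trans (ac k (c k)); rewrite le_eqVlt; apply/orP; left; apply/eqP.
  by congr Pr; apply/seteqP; split => b; rewrite /rball /= rs ltnn.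
Qed.

(** The centre of the ball moves the deterministic part of the row to the other side: up to [rho],
    the first [k] rows annihilate a net point. Only net points with small-ball probability [p]
    enter, which makes the union bound of [Pr_levelset] possible. *)
Definition levelset n k (m : nat -> nat -> R[i]) (D : finType) (pt : D -> 'I_n -> R[i]) (rho p : R) :
  set (Arr R) :=
  [set a | exists t, anticonc Q (pt t) rho p /\
     forall i, (i < k)%N -> rball (pt t) i (- \sum_(j < n) m i j * pt t j) rho a].

Lemma levelsetE n k m (D : finType) (pt : D -> 'I_n -> R[i]) rho p :
  levelset k m pt rho p = \bigcup_(t in [set: D]) (if `[< anticonc Q (pt t) rho p >] then
    [set a | forall i, (i < k)%N -> rball (pt t) i (- \sum_(j < n) m i j * pt t j) rho a] else set0).
Proof.
apply/seteqP; split => a /=.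
  by move=> [t [h1 h2]]; exists t => //; case: asboolP.
by move=> [t _]; case: asboolP => // h1 h2; exists t.
Qed.

Lemma measurable_rballs n (w : 'I_n -> R[i]) k (c : nat -> R[i]) rho :
  measurable [set a | forall i, (i < k)%N -> rball w i (c i) rho a].
Proof.
rewrite (_ : [set a | _] = \bigcap_(i in `I_k) rball w i (c i) rho).
  by apply: fin_bigcap_measurable; [exact: finite_II|move=> i _; exact: measurable_rball].
by apply/seteqP; split.
Qed.

Lemma measurable_levelset n k m (D : finType) (pt : D -> 'I_n -> R[i]) rho p :
  measurable (levelset k m pt rho p).
Proof.
rewrite levelsetE; apply: fin_bigcup_measurable => // t _.
by case: ifP => _ //; exact: measurable_rballs.
Qed.

Lemma Pr_levelset n k m (D : finType) (pt : D -> 'I_n -> R[i]) rho p : 0 <= p ->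
  Pr Q (levelset k m pt rho p) <= #|D|%:R * p ^+ k.
Proof.
move=> p0; rewrite levelsetE; set F := fun t : D => _; 
rewrite (_ : bigcup _ _ = [set a | exists t, F t a]); last first.
  by apply/seteqP; split => a [t]; exists t.
apply: (le_trans (Pr_bigcup Q (F := F) _)).
  by move=> t; rewrite /F; case: ifP => _ //; exact: measurable_rballs.
apply: (@le_trans _ _ (\sum_(t : D) p ^+ k)); last by rewrite sumr_const mulr_natl.
apply: ler_sum => t _; rewrite /F; case: asboolP => [ac|_]; last by rewrite /Pr measure0 exprn_ge0.
exact: Pr_rballs.
Qed.

Definition okset n (m : nat -> nat -> R[i]) (B : R) : set (Arr R) :=
  [set a | forall i j, (i < n)%N -> (j < n)%N -> cabs (m i j + ent a i j) <= B].

Lemma measurable_okset n m B : measurable (okset n m B).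
Proof.
rewrite (_ : okset n m B = \bigcap_(i in `I_n) \bigcap_(j in `I_n) [set a | cabs (m i j + ent a i j) <= B]).
  apply: fin_bigcap_measurable; first exact: finite_II.
  move=> i _; apply: fin_bigcap_measurable; first exact: finite_II.
  move=> j _; apply: measurable_leRR; last exact: measurable_cst.
  by apply: measurable_cabs; apply: cmeasD; [exact: cmeas_cst|exact: cmeas_ent].
apply/seteqP; split => a h.
  by move=> i ik j jk; exact: h.
by move=> i j ik jk; exact: (h i ik j jk).
Qed.

Lemma mem_levelset n k m (D : finType) (pt : D -> 'I_n -> R[i]) rho p B delta (w : 'I_n -> R[i]) t a :
  (k <= n)%N -> (forall i j, (i < k)%N -> (j < n)%N -> cabs (m i j + ent a i j) <= B) ->
  (forall i, (i < k)%N -> \sum_(j < n) (m i j + ent a i j) * w j = 0) ->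
  (forall j, cabs (w j - pt t j) <= delta) -> 0 <= B -> n%:R * (B * delta) <= rho ->
  anticonc Q (pt t) rho p -> levelset k m pt rho p a.
Proof.
move=> kn ok hw wd B0 hr ac; exists t; split => // i ik.
rewrite /rball /= opprK /rsum addrC -big_split /=.
have -> : \sum_(j < n) (m i j * pt t j + ent a i j * pt t j) =
    - \sum_(j < n) (m i j + ent a i j) * (w j - pt t j).
  apply/eqP; rewrite -subr_eq0 opprK -big_split /= -[X in _ == X](hw i ik).
  by apply/eqP/eq_bigr => j _ /=; ring.
rewrite cabsN; apply: le_trans hr; apply: (le_trans (cabs_sum _ _ _)).
apply: (@le_trans _ _ (\sum_(j < n) B * delta)); last by rewrite sumr_const card_ord mulr_natl.
by apply: ler_sum => j _; rewrite cabsM ler_pM ?cabs_ge0// ok.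
Qed.

Lemma cabs_basis p n (H : 'M[R[i]]_(p, n)) : exists d (f : 'I_d -> 'I_n) (U : 'M[R[i]]_(d, n)),
  [/\ (n - p <= d)%N, injective f, (forall k l, U k (f l) = (k == l)%:R),
      (forall k j, cabs (U k j) <= 1) & (forall i k, \sum_j H i j * U k j = 0)].
Proof.
have [|x|d [f [U [h1 h2 h3 h4 h5]]]] := @maxvol_basis _ R (@cabs R) _ _ p n H.
- by move=> x y; rewrite cabsM.
- by rewrite cabs_gt0.
exists d, f, U; split => // i k.
have := congr1 (fun A : 'M[R[i]]_(p, d) => A i k) h5; rewrite !mxE => h.
by rewrite -[RHS]h; apply: eq_bigr => j _; rewrite ?mxE.
Qed.

Lemma row'_rowsm m p n (a : Arr R) : row' ord_max (rowsm m p.+1 n a) = rowsm m p n a.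
Proof.
by apply/matrixP => i j; rewrite !mxE; congr (m _ j + ent a _ j); rewrite /= /bump leqNgt ltn_ord.
Qed.

Section last_row.
Variables (n k : nat) (m : nat -> nat -> R[i]) (B tau : R).
Variables (D1 D2 D3 : finType) (pt1 : D1 -> 'I_n -> R[i]) (pt2 : D2 -> 'I_n -> R[i]) (pt3 : D3 -> 'I_n -> R[i]).
Variables (r1 r2 r3 r4 q1 q2 q3 q4 d1 d2 d3 : R).
Hypothesis kn : (k < n)%N.
Hypothesis B0 : 0 <= B.
Hypothesis L1 : forall w, (forall j, cabs (w j) <= 2) ->
  anticonc Q w r1 q1 \/ exists t, forall j, cabs (w j - pt1 t j) <= d1.
Hypothesis L2 : forall w, (forall j, cabs (w j) <= 2) ->
  anticonc Q w r2 q2 \/ exists t, forall j, cabs (w j - pt2 t j) <= d2.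
Hypothesis L3 : forall w, (forall j, cabs (w j) <= 2) ->
  anticonc Q w r3 q3 \/ exists t, forall j, cabs (w j - pt3 t j) <= d3.
Hypothesis L4 : forall (w : 'I_n -> R[i]) j, 1 <= 2 * cabs (w j) -> anticonc Q w r4 q4.
Hypotheses (q10 : 0 <= q1) (q20 : 0 <= q2) (q30 : 0 <= q3) (q40 : 0 <= q4).
Hypotheses (d10 : 0 <= d1) (d20 : 0 <= d2) (d30 : 0 <= d3) (ds : d1 + d2 + d3 <= 2^-1).
Hypotheses (hr2 : n%:R * (B * d1) <= r2) (hr3 : n%:R * (B * (d1 + d2)) <= r3)
  (hr4 : n%:R * (B * (d1 + d2 + d3)) <= r4) (r10 : 0 <= r1) (hr1 : tau * n%:R <= r1 ^+ 2).

(** Given the first [k] rows, let w be normal to them. If [L1] yields anticoncentration of w, the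
    new row is rarely nearly normal to w, at cost [q1]. Otherwise w has a net approximation; once an
    approximation anticoncentrates, the first [k] rows are in a level set, because they nearly
    annihilate it. The fourth level always succeeds, through the coordinate where w is 1. *)
Lemma last_row :
  Pr Q (okset n m B `&` [set a | gramR (rowsm m k.+1 n a) < tau * gramR (rowsm m k n a)]) <=
    #|D1|%:R * q2 ^+ k + (#|D2|%:R * q3 ^+ k + #|D3|%:R * q4 ^+ k) + q1.
Proof.
set E := _ `&` _.
have mE : measurable E.
  apply: measurableI; first exact: measurable_okset.
  apply: measurable_ltRR; first by apply: measurable_gramR => *; exact: cmeas_rowsm.
  apply: measurable_funM; first exact: measurable_cst.
  by apply: measurable_gramR => *; exact: cmeas_rowsm.
pose Bad := levelset k m pt1 r2 q2 `|` (levelset k m pt2 r3 q3 `|` levelset k m pt3 r4 q4).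
have mB2 : measurable (levelset k m pt2 r3 q3 `|` levelset k m pt3 r4 q4).
  by apply: measurableU; exact: measurable_levelset.
have mBad : measurable Bad by apply: measurableU => //; exact: measurable_levelset.
apply: (@le_trans _ _ (Pr Q Bad + q1)); last first.
  rewrite lerD2r; apply: le_trans (Pr_setU _ _ mB2) _; first exact: measurable_levelset.
  apply: lerD; first exact: Pr_levelset.
  apply: le_trans (Pr_setU _ _ _) _; try exact: measurable_levelset.
  by apply: lerD; exact: Pr_levelset.
pose S : pred (nat * nat) := fun x => (x.1 < k)%N.
apply: (Pr_merge_le Qi (S := S)) => // a nB.
have entS b (i j : nat) : (i < k)%N -> ent (amerge S (a, b)) i j = ent a i j.
  by move=> ik; rewrite ent_amerge /S /= ik.
have entk b (j : nat) : ent (amerge S (a, b)) k j = ent b k j by rewrite ent_amerge /S /= ltnn.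
have mEa : measurable [set b | E (amerge S (a, b))].
  by rewrite -[X in measurable X]setTI; exact: (measurable_merge_snd S a).
have [ok|nok] := pselect (forall i j, (i < k)%N -> (j < n)%N -> cabs (m i j + ent a i j) <= B); last first.
  rewrite (_ : [set b | _] = set0) ?/Pr ?measure0//; apply/seteqP; split => b //= -[okb _].
  apply: nok => i j ik jn; rewrite -(entS b)//; apply: okb => //.
  exact: ltn_trans ik kn.
have [d [f [U [hd _ Uf U1 UH]]]] := cabs_basis (rowsm m k n a).
have d0 : (0 < d)%N by apply: leq_trans hd; rewrite subn_gt0.
pose k0 := Ordinal d0; pose w j := U k0 j.
have w1 j : cabs (w j) <= 1 by exact: U1.
have w2 j : cabs (w j) <= 2 by have := w1 j; lra.
have hw i : (i < k)%N -> \sum_(j < n) (m i j + ent a i j) * w j = 0.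
  move=> ik; have := UH (Ordinal ik) k0.
  by under eq_bigr do rewrite mxE.
have kn' := ltnW kn.
have dd1 : d1 <= 2^-1 by move: ds d20 d30; lra.
have dd2 : d1 + d2 <= 2^-1 by move: ds d30; lra.
(* Total errors of at most 1/2 keep the approximations within modulus 2, where the next dichotomy
   applies. *)
have near2 (v : 'I_n -> R[i]) e : (forall j, cabs (w j - v j) <= e) -> e <= 2^-1 -> forall j, cabs (v j) <= 2.
  move=> h e2 j; have := h j; have := w1 j; have := cabs_triB (w j) (w j - v j); rewrite subKr; move: e2; lra.
have [acw|[t1 ht1]] := L1 w2.
  apply: le_trans (acw k (- \sum_(j < n) m k j * w j)).
  apply: le_Pr => //; first exact: measurable_rball.
  move=> b /= [okb hG0]; rewrite /rball /= opprK.
  have hG : gramR (rowsm m k.+1 n (amerge S (a, b))) <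
     tau * gramR (row' ord_max (rowsm m k.+1 n (amerge S (a, b)))) by rewrite row'_rowsm.
  have := gramR_small (u := w) _ w1 hr1 r10 hG.
  have -> : \sum_j rowsm m k.+1 n (amerge S (a, b)) ord_max j * w j = rsum w k b + \sum_(j < n) m k j * w j.
    by rewrite /rsum -big_split; apply: eq_bigr => j _; rewrite mxE /= entk addrC mulrDl.
  apply=> i im; have ik : (i < k)%N.
    by have := ltn_ord i; rewrite ltnS leq_eqVlt => /orP[/eqP ik|//]; case/eqP: im; exact: val_inj.
  by rewrite -[RHS](hw i ik); apply: eq_bigr => j _; rewrite mxE entS.
have [acw|[t2 ht2]] := L2 (near2 _ _ ht1 dd1).
  by case: nB; left; exact: (mem_levelset kn' ok hw ht1 B0 hr2 acw).
have ht2' j : cabs (w j - pt2 t2 j) <= d1 + d2.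
  by apply: (le_trans (cabs_tri3 _ _ (pt1 t1 j))); exact: lerD.
have [acw|[t3 ht3]] := L3 (near2 _ _ ht2' dd2).
  by case: nB; right; left; exact: (mem_levelset kn' ok hw ht2' B0 hr3 acw).
have ht3' j : cabs (w j - pt3 t3 j) <= d1 + d2 + d3.
  by apply: (le_trans (cabs_tri3 _ _ (pt2 t2 j))); exact: lerD.
case: nB; right; right; apply: (mem_levelset kn' ok hw ht3' B0 hr4).
apply: (@L4 _ (f k0)); have wf : w (f k0) = 1 by rewrite /w Uf eqxx.
have := ht3' (f k0); have := cabs_tri3 (w (f k0)) 0 (pt3 t3 (f k0)).
by rewrite !subr0 wf cabs1; move: ds; lra.
Qed.

End last_row.

Section odlyzko.
Context (alpha beta : R).
Hypothesis alpha0 : 0 < alpha.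
Hypothesis beta0 : 0 < beta.
Hypothesis beta1 : beta <= 1.
Hypothesis NDG : forall c : R[i], Pr mu [set x : borelC R | cabs ((x : R[i]) - c) <= alpha] <= 1 - beta.

Definition smallrow (m : nat -> nat -> R[i]) p n (tau : R) (i : 'I_p.+1) : set (Arr R) :=
  [set a | gramR (rowsm m p.+1 n a) < tau * gramR (row' i (rowsm m p.+1 n a))].

Lemma measurable_smallrow m p n tau (i : 'I_p.+1) : measurable (smallrow m n tau i).
Proof.
apply: measurable_ltRR; first by apply: measurable_gramR => *; exact: cmeas_rowsm.
apply: measurable_funM; first exact: measurable_cst.
apply: measurable_gramR => i' j.
rewrite (_ : (fun a => _) = fun a => rowsm m p.+1 n a (lift i i') j); first exact: cmeas_rowsm.
by apply/funext => a; rewrite !mxE.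
Qed.

(** The other p rows have at least n - p normal vectors with an identity block, by [cabs_basis]; a
    small Gram ratio makes row i nearly normal to all of them at once. *)
Lemma Pr_smallrow m p n tau (i : 'I_p.+1) : (p < n)%N -> tau * n%:R <= alpha ^+ 2 ->
  Pr Q (smallrow m n tau i) <= (1 - beta) ^+ (n - p).
Proof.
move=> pn ht; have b01 : 0 <= 1 - beta by rewrite subr_ge0.
rewrite -[X in _ <= X]add0r -(_ : Pr Q set0 = 0); last by rewrite /Pr measure0.
pose S : pred (nat * nat) := fun x => x.1 != i.
have mE := @measurable_smallrow m p n tau i.
apply: (Pr_merge_le Qi (S := S)) => //; first by rewrite exprn_ge0.
move=> a _.
have [d [f [U [hd fi Uf U1 UH]]]] := cabs_basis (row' i (rowsm m p.+1 n a)).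
have mEa : measurable [set b | smallrow m n tau i (amerge S (a, b))].
  by rewrite -[X in measurable X]setTI; exact: (measurable_merge_snd S a).
pose c (k : 'I_d) : R[i] := - \sum_(j < n) m i j * U k j.
apply: (@le_trans _ _ ((1 - beta) ^+ d)); last by apply: ler_wiXn2l; rewrite // gerBl ltW.
apply: le_trans (odlyzko_bound iidQ beta1 NDG (f := f) (U := U) i c fi Uf).
apply: le_Pr => //.
  rewrite (_ : [set a | _] = \bigcap_(k in [set: 'I_d]) rball (U k) i (c k) alpha).
    by apply: fin_bigcap_measurable => // k _; exact: measurable_rball.
  by apply/seteqP; split => b h k //; [move=> _; exact: h|exact: h].
move=> b /= hG k; have := gramR_small (u := U k) _ (U1 k) ht (ltW alpha0) hG.
have -> : \sum_j rowsm m p.+1 n (amerge S (a, b)) i j * U k j = rsum (U k) i b - c k.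
  rewrite /c opprK /rsum -big_split; apply: eq_bigr => j _.
  by rewrite mxE ent_amerge /S /= eqxx /= addrC mulrDl.
apply=> i'; case: (unliftP i i') => [i'' ->|-> /eqP//] _.
rewrite -[RHS](UH i'' k); apply: eq_bigr => j _.
by rewrite !mxE ent_amerge /S /= eq_sym neq_bump.
Qed.

End odlyzko.
End level_sets.

(** * Choice of exponents and scales *)

Section asymptotics.
Context (R : realType).

(** With b = a + 1 one has exp(cL) >= (cL / b)^b = (2L)^b / u, and the surplus factor 2L dominates
    the constant [u]. *)
Lemma pow_le_expR (a : nat) (c : R) : 0 < c ->
  exists L0 : nat, forall L : nat, (L0 <= L)%N -> (2 * L%:R) ^+ a <= expR (c * L%:R).
Proof.
move=> c0; set b := a.+1; have b0 : 0 < b%:R :> R by rewrite ltr0n.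
pose u := (2 * b%:R / c) ^+ b.
have u0 : 0 < u by rewrite exprn_gt0// divr_gt0// mulr_gt0.
exists (Num.truncn u).+1 => L hL.
have uL : u <= 2 * L%:R.
  have := truncnS_gt u; have : (Num.truncn u).+1%:R <= L%:R :> R by rewrite ler_nat.
  move: u0; lra.
have L0 : 0 < L%:R :> R by rewrite ltr0n; exact: leq_trans hL.
have -> : c * L%:R = b%:R * (c * L%:R / b%:R) by field; rewrite gt_eqF.
rewrite expRM_natl.
apply: (@le_trans _ _ ((c * L%:R / b%:R) ^+ b)); last first.
  rewrite ler_pXn2r ?nnegrE ?expR_ge0 ?divr_ge0 ?mulr_ge0 ?(ltW c0)//.
  by apply: le_trans (expR_ge1Dx _); rewrite lerDr.
have -> : c * L%:R / b%:R = 2 * L%:R * (2 * b%:R / c)^-1 by field; rewrite !gt_eqF.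
rewrite [X in _ <= X]exprMn exprVn -/u ler_pdivlMr//.
have -> : (2 * L%:R) ^+ b = 2 * L%:R * (2 * L%:R) ^+ a :> R by exact: exprS.
by rewrite mulrC ler_wpM2r// exprn_ge0// mulr_ge0.
Qed.

Lemma two_mul_lt (n M : nat) : (3 <= n)%N -> (0 < M)%N -> ((2 * M).+1 <= n * M)%N.
Proof. by nia. Qed.

(** Exponents of n in a net count, with l for L^39: L from the rows missing among n, 46 for each
    grid point (23 per coordinate) of the [V] values and of the 2 l exceptions, and 2 l for the
    positions of these. *)
Lemma sum_exponents (L V l : nat) : (V <= l)%N -> (L <= l)%N ->
  (L + (46 * V + (2 * l + 46 * (2 * l))) <= 142 * l)%N.
Proof. by lia. Qed.

Lemma succ_le_double (L : nat) : (3 <= L)%N -> (L.+1 <= 2 * L)%N.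
Proof. by lia. Qed.

Lemma n_le_pow (L n : nat) : (3 <= L)%N -> (n < L.+1 ^ 40)%N -> n%:R <= (2 * L%:R) ^+ 40 :> R.
Proof.
move=> L3 nL; apply: (@le_trans _ _ ((L.+1)%:R ^+ 40)); first by rewrite -natrX ler_nat ltnW.
by apply: lerXn2r; rewrite ?nnegrE ?mulr_ge0// -natrM ler_nat; exact: succ_le_double.
Qed.

Section netterm.
Variables (beta : R) (L n k A : nat).
Hypothesis AE : A = (40 * 142)%N.
Hypotheses (beta0 : 0 < beta) (beta2 : beta <= 2^-1).
Hypothesis (L3 : (3 <= L)%N) (Ln : (L ^ 40 <= n)%N) (nL : (n < L.+1 ^ 40)%N) (kn : (k < n)%N) (nk : (n <= k + L)%N).
Hypothesis hE : (2 * L%:R) ^+ A <= expR (beta / 4 * L%:R).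

Let L1 : 1 <= L%:R :> R. Proof. by rewrite ler1n; exact: leq_trans L3. Qed.
Let L0 : 0 < L%:R :> R. Proof. exact: lt_le_trans L1. Qed.

Lemma Lpow_le (a : nat) : (a <= A)%N -> L%:R ^+ a <= expR (beta / 4 * L%:R).
Proof.
move=> ha; apply: le_trans hE; apply: (@le_trans _ _ (L%:R ^+ A)).
  exact: ler_weXn2l.
by apply: lerXn2r; rewrite ?nnegrE ?mulr_ge0//; move: L0; lra.
Qed.

Lemma expRN_le (a : nat) (t : R) : (a <= A)%N -> beta / 4 * L%:R <= t -> expR (- t) <= L%:R ^- a.
Proof.
move=> ha ht; rewrite expRN lef_pV2 ?posrE ?expR_gt0 ?exprn_gt0//.
by apply: le_trans (Lpow_le ha) _; rewrite ler_expR.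
Qed.

(** Pairing one class choice with one row gives [V%:R * p <= 1 - beta] per row, hence exp(- beta k)
    with k of order L^40. All else is at most n^(142 L^39), of lower order: [hE] compares n^142 with
    exp(beta L / 4), which explains the value of [A]. *)
Lemma card_net_pow V (e := (2 * L ^ 39)%N) (M := (n ^ 22)%N) (p : R) : 0 <= p -> (V <= L ^ 39)%N ->
  V%:R * p <= 1 - beta ->
  #|{: netT n V e M}|%:R * p ^+ k <= L%:R ^- 43.
Proof.
move=> p0 VL Vp.
have L39 : 1 <= L%:R ^+ 39 :> R by exact: exprn_ege1.
have n3 : (3 <= n)%N.
  by apply: leq_trans Ln; apply: leq_trans L3 _; rewrite -[X in (X <= _)%N]expn1 leq_pexp2l//; exact: leq_trans L3.
have n1 : 1 <= n%:R :> R by rewrite ler1n; exact: leq_trans n3.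
have G1 : ((2 * M).+1)%:R <= n%:R ^+ 23 :> R.
  rewrite -natrX ler_nat expnS -/M.
  by apply: two_mul_lt => //; rewrite expn_gt0 (leq_trans _ n3).
rewrite card_netT !(natrM, natrX).
set g := ((2 * M).+1)%:R in G1 *.
have g0 : 0 <= g by rewrite ler0n.
have gg : g * g <= n%:R ^+ 46 by rewrite (exprD _ 23 23) ler_pM.
have gV a : (g * g) ^+ a <= n%:R ^+ (46 * a).
  by rewrite exprM; apply: lerXn2r; rewrite ?nnegrE ?mulr_ge0 ?exprn_ge0.
have VV : V%:R ^+ n * p ^+ k <= expR (- (beta * k%:R)) * n%:R ^+ L.
  have -> : V%:R ^+ n * p ^+ k = (V%:R * p) ^+ k * V%:R ^+ (n - k).
    by rewrite exprMn -[in LHS](subnKC (ltnW kn)) exprD; ring.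
  apply: ler_pM; [by rewrite exprn_ge0// mulr_ge0|by rewrite exprn_ge0| |].
    apply: (@le_trans _ _ (expR (- beta) ^+ k)).
      apply: lerXn2r; rewrite ?nnegrE ?expR_ge0 ?mulr_ge0//; apply: (le_trans Vp).
      exact: expR_ge1Dx.
    by rewrite -expRM_natr mulNr.
  apply: (@le_trans _ _ (n%:R ^+ (n - k))); last by apply: ler_weXn2l => //; rewrite leq_subLR.
  apply: lerXn2r; rewrite ?nnegrE// ler_nat; apply: (leq_trans VL).
  by apply: leq_trans Ln; rewrite leq_pexp2l//; exact: leq_trans L3.
apply: (@le_trans _ _ (expR (- (beta * k%:R)) * n%:R ^+ (142 * L ^ 39))).
  rewrite [X in X <= _](_ : _ = V%:R ^+ n * p ^+ k * ((g * g) ^+ V * (n%:R ^+ e * (g * g) ^+ e))); last by ring.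
  apply: (@le_trans _ _ (expR (- (beta * k%:R)) * n%:R ^+ L * (n%:R ^+ (46 * V) * (n%:R ^+ e * n%:R ^+ (46 * e))))).
    apply: ler_pM => //; first by rewrite mulr_ge0 ?exprn_ge0.
      by rewrite !mulr_ge0 ?exprn_ge0 ?mulr_ge0.
    by rewrite ler_pM ?mulr_ge0 ?exprn_ge0 ?mulr_ge0// ler_wpM2l ?exprn_ge0.
  rewrite -mulrA -!exprD ler_wpM2l ?expR_ge0//; apply: ler_weXn2l => //.
  have : (L <= L ^ 39)%N by rewrite -[X in (X <= _)%N]expn1 leq_pexp2l//; exact: leq_trans L3.
  by move=> LL; exact: sum_exponents.
have kL : L%:R ^+ 40 / 2 <= k%:R :> R.
  have h1 : L%:R ^+ 40 <= k%:R + L%:R :> R by rewrite -natrD -natrX ler_nat (leq_trans Ln).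
  have h2 : 2 * L%:R <= L%:R ^+ 40 :> R.
    rewrite exprS mulrC ler_pM2l// exprS; have : 3 <= L%:R :> R by rewrite ler_nat.
    by have := exprn_ege1 38 L1; move=> h3 h4; have := ler_pM (ltW ltr01) (ltW ltr01) L1 h3; nra.
  by move: h1 h2; lra.
have nE : n%:R ^+ (142 * L ^ 39) <= expR (beta / 4 * L%:R ^+ 40).
  have -> : beta / 4 * L%:R ^+ 40 = beta / 4 * L%:R * (L ^ 39)%:R by rewrite natrX exprS mulrA.
  rewrite exprM expRM_natr.
  apply: lerXn2r; rewrite ?nnegrE ?exprn_ge0 ?expR_ge0//.
  apply: le_trans hE; rewrite AE exprM; apply: lerXn2r; rewrite ?nnegrE ?exprn_ge0 ?mulr_ge0//.
  exact: n_le_pow L3 nL.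
apply: (@le_trans _ _ (expR (- (beta / 4 * L%:R ^+ 40)))).
  apply: (le_trans (ler_wpM2l (expR_ge0 _) nE)); rewrite -expRD ler_expR.
  by have := ler_pM2l beta0 (L%:R ^+ 40 / 2) k%:R; rewrite kL => h; move: h; lra.
apply: expRN_le; first by rewrite AE.
rewrite ler_pM2l ?divr_gt0//.
by rewrite -[X in X <= _]expr1 ler_weXn2l.
Qed.

End netterm.
End asymptotics.

Section last_row_asymptotics.
Context (R : realType) (mu : probability (borelC R) R) (Q : probability (Arr R) R).
Hypothesis iidQ : iid_law mu Q.
Context (alpha beta kappa : R).
Hypothesis alpha0 : 0 < alpha.
Hypothesis beta0 : 0 < beta.
Hypothesis beta2 : beta <= 2^-1.
Hypothesis kappa0 : 0 < kappa.
Hypothesis NDG : forall c : R[i], Pr mu [set x : borelC R | cabs ((x : R[i]) - c) <= alpha] <= 1 - beta.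
Hypothesis PAIR : beta <= Pr (mu \x mu)%E (pairset alpha kappa).

Section fixed_scale.
Variables (L n k0 A : nat).
Hypothesis AE : A = (40 * 142)%N.
Hypothesis (Ln : (L ^ 40 <= n)%N) (nL : (n < L.+1 ^ 40)%N).
Hypothesis hE : (2 * L%:R) ^+ A <= expR (beta / 4 * L%:R).
Hypothesis hk : 4 * (1 + 2 * kappa) < k0%:R * alpha.
Hypotheses (hL1 : 2 ^+ 41 <= L%:R :> R) (hL2 : 96 * k0%:R <= L%:R :> R) (hL3 : 4 <= beta * L%:R)
  (hL4 : 5 <= alpha * L%:R) (hL5 : 4 * kappa + 1 <= L%:R).

Let L12 : 12 <= L%:R :> R.
Proof. by apply: le_trans hL1; rewrite -natrX ler_nat. Qed.
Let L3 : (3 <= L)%N.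
Proof. by rewrite -(ler_nat R); have := L12; lra. Qed.
Let L0n : (0 < L)%N. Proof. exact: leq_trans L3. Qed.
Let L1 : 1 <= L%:R :> R. Proof. by rewrite ler1n. Qed.
Let L0 : 0 < L%:R :> R. Proof. exact: lt_le_trans L1. Qed.
Let Lle : L%:R <= n%:R :> R.
Proof.
by rewrite ler_nat; apply: leq_trans Ln; rewrite -[X in (X <= _)%N]expn1 leq_pexp2l.
Qed.
Let n0 : 0 < n%:R :> R. Proof. exact: lt_le_trans Lle. Qed.
Let n1 : 1 <= n%:R :> R. Proof. exact: le_trans Lle. Qed.
Let n0n : (0 < n)%N. Proof. by rewrite -(ltr0n R). Qed.
Let x : R := n%:R^-1.
Let nx : n%:R * x = 1. Proof. by rewrite /x divff// gt_eqF. Qed.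
Let x0 : 0 < x. Proof. by rewrite invr_gt0. Qed.
Let x1 : x <= 1. Proof. by rewrite invf_le1. Qed.
Let xL : x * L%:R <= 1. Proof. by rewrite /x mulrC ler_pdivrMr// mul1r. Qed.
Let xa : 5 * x <= alpha.
Proof.
have := ler_pM2r x0 5 (alpha * L%:R); rewrite hL4 => h.
have := ler_pM2l alpha0 (x * L%:R) 1; rewrite xL => h2.
by move: h h2; rewrite mulr1 -mulrA (mulrC L%:R); exact: le_trans.
Qed.
Let xp b : 0 < x ^+ b. Proof. exact: exprn_gt0. Qed.
Let x_12 : 12 * x <= 1.
Proof. by apply: le_trans xL; rewrite mulrC ler_pM2l. Qed.

Let e := (2 * L ^ 39)%N.
Let M := (n ^ 22)%N.

Let beta4 (t : R) : L%:R <= t -> beta / 4 * L%:R <= t.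
Proof.
move=> h; apply: le_trans h; rewrite ler_piMl// ?(ltW L0)//.
by move: beta2; lra.
Qed.

Let expRL (a : nat) : (1 <= a)%N -> expR (- (L ^ a)%:R) <= L%:R ^- 43 :> R.
Proof.
move=> a1; apply: (expRN_le L3 hE); first by rewrite AE.
by apply: beta4; rewrite ler_nat -[X in (X <= _)%N]expn1 leq_pexp2l.
Qed.

Let expR_le2L : expR (beta / 4 * L%:R) * expR (beta / 4 * L%:R) <= 2 ^+ L :> R.
Proof.
have h2 : expR (2^-1) <= 2 :> R.
  rewrite -[X in expR X]opprK expRN -[X in _ <= X]invrK lef_pV2 ?posrE ?expR_gt0 ?invr_gt0//.
  by apply: le_trans (expR_ge1Dx _); lra.
rewrite -expRD; apply: (@le_trans _ _ (expR (2^-1 * L%:R))).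
  by rewrite ler_expR -mulrDl ler_pM2r//; move: beta2; lra.
by rewrite expRM_natr; apply: lerXn2r; rewrite ?nnegrE ?expR_ge0.
Qed.

Let npow_le (a : nat) : (40 * a <= A)%N -> n%:R ^+ a <= expR (beta / 4 * L%:R).
Proof.
move=> ha; apply: le_trans hE; apply: (@le_trans _ _ ((2 * L%:R) ^+ (40 * a))).
  rewrite exprM; apply: lerXn2r; rewrite ?nnegrE ?exprn_ge0 ?mulr_ge0//.
  exact: (n_le_pow R L3 nL).
by apply: ler_weXn2l => //; have := L12; lra.
Qed.

Let pow2L (a : nat) (c : R) : (40 * a <= A)%N -> c <= L%:R ^+ 43 -> c * n%:R ^+ a <= 2 ^+ L.
Proof.
move=> ha hc; apply: le_trans expR_le2L.
apply: (@le_trans _ _ (L%:R ^+ 43 * n%:R ^+ a)); first by rewrite ler_wpM2r// exprn_ge0.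
apply: ler_pM; rewrite ?exprn_ge0//; last exact: npow_le.
by apply: (Lpow_le L3 hE); rewrite AE.
Qed.

(** With N1 = L^37 the denominator N1^(3/2) is at least L^55; one power of L absorbs 96 [k0], and
    half of the bound is left to the grid and Chernoff terms, which are below L^-43. *)
Lemma small_anticonc (a : nat) : (12 <= a)%N ->
  16 * (2 * L ^ a + L)%:R * k0%:R / ((L ^ 37)%:R * Num.sqrt (L ^ 37)%:R) +
    (((2 * M).+1 ^ 2)%:R / 2 ^+ L + expR (- (L ^ 37)%:R)) <= L%:R ^+ a / L%:R ^+ 54 :> R.
Proof.
move=> a12.
have La : L%:R <= L%:R ^+ a :> R.
  by rewrite -[X in X <= _]expr1 ler_weXn2l//; exact: leq_trans a12.
have Lp b : 0 < L%:R ^+ b :> R by rewrite exprn_gt0.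
have sq : L%:R ^+ 18 <= Num.sqrt (L%:R ^+ 37) :> R.
  rewrite -(ger0_norm (ltW (Lp 18))) -sqrtr_sqr ler_wsqrtr// -exprM.
  exact: ler_weXn2l.
have t1 : 16 * (2 * L ^ a + L)%:R * k0%:R / ((L ^ 37)%:R * Num.sqrt (L ^ 37)%:R) <=
    L%:R ^+ a / L%:R ^+ 54 / 2 :> R.
  rewrite (natrX _ L 37); apply: (@le_trans _ _ (16 * (3 * L%:R ^+ a) * k0%:R / (L%:R ^+ 37 * L%:R ^+ 18))).
    apply: ler_pM; rewrite ?mulr_ge0 ?invr_ge0 ?mulr_ge0 ?sqrtr_ge0//.
      by rewrite ler_wpM2r// ler_wpM2l// natrD natrM natrX; move: La; lra.
    rewrite lef_pV2 ?posrE ?mulr_gt0 ?(lt_le_trans (Lp 18) sq)//.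
    by rewrite ler_pM2l.
  rewrite -exprD ler_pdivrMr// (_ : L%:R ^+ (37 + 18) = L%:R ^+ 54 * L%:R); last by rewrite -exprSr.
  rewrite [X in _ <= X](_ : _ = L%:R ^+ a * (L%:R / 2)); last by field; rewrite gt_eqF.
  rewrite [X in X <= _](_ : _ = L%:R ^+ a * (48 * k0%:R)); last by ring.
  by rewrite ler_pM2l//; move: hL2; lra.
have t2 : ((2 * M).+1 ^ 2)%:R / 2 ^+ L <= L%:R ^- 43 :> R.
  rewrite ler_pdivrMr ?exprn_gt0// mulrC -ler_pdivrMr ?invr_gt0// invrK.
  rewrite mulrC; apply: (@le_trans _ _ (L%:R ^+ 43 * n%:R ^+ 46)); last by apply: pow2L; rewrite ?AE.
  rewrite ler_pM2l// (exprM _ 23 2) natrX; apply: lerXn2r; rewrite ?nnegrE ?exprn_ge0//.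
  rewrite -natrX ler_nat expnS; apply: two_mul_lt; last by rewrite expn_gt0 n0n.
  by rewrite -(ler_nat R); apply: le_trans Lle; rewrite ler_nat.
have t3 := expRL (isT : (1 <= 37)%N).
have t4 : 2 * L%:R ^- 43 <= L%:R ^+ a / L%:R ^+ 54 / 2 :> R.
  apply: (@le_trans _ _ (L%:R ^+ 12 / L%:R ^+ 54 / 2)); last first.
    by rewrite ler_pM2r// ler_pM2r ?invr_gt0//; exact: ler_weXn2l.
  rewrite [X in _ <= X](_ : _ = L%:R / 2 * L%:R ^- 43); last by field; rewrite gt_eqF.
  by rewrite ler_pM2r ?invr_gt0//; have := L12; lra.
by move: t1 t2 t3 t4; lra.
Qed.

(** Clumps have size L^a at scale n^-b. A dyadic shell receives L^38 indices, of which L^37 give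
    usable pairs; L shells and one clump fit into e = 2 L^39. *)
Lemma level_dichotomy (a b : nat) (w : 'I_n -> R[i]) : (12 <= a)%N -> (a <= 38)%N -> (1 <= b)%N -> (b <= 20)%N ->
  (forall j, cabs (w j) <= 2) ->
  anticonc Q w (x ^+ b.+1) (L%:R ^+ a / L%:R ^+ 54) \/
  exists t : netT n (n %/ L ^ a).+1 e M, forall j, cabs (w j - netpt (x ^+ b) t j) <= 3 * x ^+ b.
Proof.
move=> a12 a38 b1 b20 w2.
have Mx : n%:R <= M%:R * x ^+ b.+1.
  rewrite /M natrX; apply: (@le_trans _ _ (n%:R ^+ 22 * x ^+ 21)).
    by rewrite exprSr (mulrC (_ ^+ 21)) -mulrA -exprMn nx expr1n mulr1.
  rewrite ler_pM2l ?exprn_gt0//; apply: ler_wiXn2l => //; exact: ltW.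
have xb1 : x ^+ b <= 1 by apply: exprn_ile1 => //; exact: ltW.
have xbb : x ^+ b.+1 <= x ^+ b by rewrite exprS ler_piMl// ltW.
have hM : 2 + x ^+ b <= M%:R * x ^+ b.
  apply: (@le_trans _ _ n%:R); last by apply: (le_trans Mx); rewrite ler_wpM2l.
  by move: xb1 Lle L12; lra.
have La0 : (0 < L ^ a)%N by rewrite expn_gt0 L0n.
have [[I eI nc]|] := clump_net e n0n La0 (xp b) w2 hM; last by right.
left => i c; apply: le_trans (small_anticonc a12).
apply: (anticonc_nonclumpy iidQ alpha0 beta0 kappa0 PAIR (I := I) (s := x ^+ b) (Lev := L) (m := L ^ 38) (e := e)) => //.
- rewrite ler_pdivrMr// exprS mulrA [X in _ <= X]mulrC ler_pM2r//.
  by move: xa x0; lra.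
- have h : 2 * n%:R ^+ 20 <= 2 ^+ L :> R.
    apply: pow2L; first by rewrite AE.
    by apply: (@le_trans _ _ L%:R); [have := L12; lra|rewrite -[X in X <= _]expr1 ler_weXn2l].
  apply: (@le_trans _ _ (x ^+ 20 * (2 * n%:R ^+ 20))).
    by rewrite mulrCA -exprMn mulrC (mulrC x) nx expr1n mul1r.
  by apply: ler_pM; rewrite ?mulr_ge0 ?exprn_ge0 ?(ltW x0)//; apply: ler_wiXn2l => //; exact: ltW.
- by rewrite expn_gt0 L0n.
- rewrite /e -expnS mul2n -addnn leq_add2r leq_pexp2l//; exact: leq_trans a38 _.
- apply: le_trans Mx; apply: le_trans Lle; apply: le_trans hL5; rewrite lerD2l; exact: le_trans xbb xb1.
- rewrite (expnS _ 37) natrM mulrA; apply: ler_wpM2r => //.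
Qed.

Lemma sparse_dichotomy (w : 'I_n -> R[i]) : (forall j, cabs (w j) <= 2) ->
  anticonc Q w (x ^+ 11) (L%:R ^- 18) \/
  exists t : netT n 1 e M, forall j, cabs (w j - netpt (x ^+ 10) t j) <= 3 * x ^+ 10.
Proof.
move=> w2.
have Mx : n%:R <= M%:R * x ^+ 10.
  rewrite /M natrX; apply: (@le_trans _ _ (n%:R ^+ 22 * x ^+ 21)).
    by rewrite exprSr (mulrC (_ ^+ 21)) -mulrA -exprMn nx expr1n mulr1.
  rewrite ler_pM2l ?exprn_gt0//; apply: ler_wiXn2l => //; exact: ltW.
have xb1 : x ^+ 10 <= 1 by apply: exprn_ile1 => //; exact: ltW.
have hM : 2 + x ^+ 10 <= M%:R * x ^+ 10.
  by apply: le_trans Mx; move: xb1 Lle L12; lra.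
have [eI|] := sparse_net e n0n (xp 10) w2 hM; [left|by right].
have N10 : (0 < L ^ 38)%N by rewrite expn_gt0 L0n.
move=> i c.
have H := @anticonc_spread _ _ _ iidQ alpha beta kappa alpha0 beta0 PAIR n w (x ^+ 10) (x ^+ 11) e (L ^ 38) (xp 10) _ N10 eI _ i c.
apply: (le_trans (H _ _)).
- rewrite exprS mulrA ltr_pM2r//; move: xa x0; lra.
- rewrite /e (expnS _ 38) !natrM; have : 0 < (L ^ 38)%:R :> R by rewrite ltr0n.
  move=> h; have h2 := ler_wpM2r (ltW h) hL3.
  rewrite (_ : beta * _ = 2 * (beta * L%:R * (L ^ 38)%:R)); last by ring.
  by move: h h2; lra.
have -> : Num.sqrt (L ^ 38)%:R = L%:R ^+ 19 :> R.
  by rewrite natrX (exprM _ 19 2) sqrtr_sqr ger0_norm// exprn_ge0// ltW.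
have h43 := expRL (isT : (1 <= 38)%N).
have h1 : L%:R ^- 43 <= L%:R ^- 19 :> R by rewrite lef_pV2 ?posrE ?exprn_gt0//; exact: ler_weXn2l.
apply: (@le_trans _ _ (L%:R * L%:R ^- 19)); last first.
  by rewrite exprS invfM mulrA divff ?mul1r// gt_eqF.
have p19 : 0 < L%:R ^- 19 :> R by rewrite invr_gt0 exprn_gt0.
have h3 := ler_wpM2r (ltW p19) L12.
by move: h43 h1 h3 p19; lra.
Qed.

Lemma card_clumps (a : nat) : (a <= 40)%N -> ((n %/ L ^ a).+1)%:R * L%:R ^+ a <= L%:R ^+ 41 :> R.
Proof.
move=> a40; have h1 : L%:R ^+ a <= n%:R :> R.
  by rewrite -natrX ler_nat (leq_trans _ Ln)// leq_pexp2l.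
have h2 : (n %/ L ^ a)%:R * L%:R ^+ a <= n%:R :> R.
  by rewrite -natrX -natrM ler_nat leq_trunc_div.
rewrite -natr1 mulrDl mul1r.
apply: (@le_trans _ _ (2 * (2 * L%:R) ^+ 40)).
  by have := n_le_pow R L3 nL; move: h1 h2; lra.
by rewrite exprMn mulrA -exprS (exprS _ 40); apply: ler_wpM2r => //; rewrite exprn_ge0// ltW.
Qed.

(** The net errors are 3 n^-20, 3 n^-15 and 3 n^-10, the radii n^-21, n^-16, n^-11 and n^-6.
    Replacing w by a net point changes a row product by at most n^3 times the error, as entries are
    at most n^2, and the next radius leaves room for this. The ratio n^-43 is the square of the
    first radius divided by n. *)
Lemma last_row_bound (m : nat -> nat -> R[i]) k : (k < n)%N -> (n <= k + L)%N ->
  Pr Q (okset n m (n%:R ^+ 2) `&` [set a | gramR (rowsm m k.+1 n a) < x ^+ 43 * gramR (rowsm m k n a)]) <=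
  2 / L%:R ^+ 42.
Proof.
move=> kn nk.
have Lp b : 0 < L%:R ^+ b :> R by rewrite exprn_gt0.
have V39 a : (12 <= a)%N -> ((n %/ L ^ a).+1 <= L ^ 39)%N.
  move=> a12; apply: (@leq_trans (n %/ L ^ 12).+1).
    by rewrite ltnS leq_div2l ?expn_gt0 ?L0n// leq_pexp2l.
  rewrite -(ler_nat R) natrX -(ler_pM2r (Lp 12)); apply: (le_trans (card_clumps _)) => //.
  by rewrite -exprD; exact: ler_weXn2l.
have Vp a (p : R) : (12 <= a)%N -> (a <= 40)%N -> 0 <= p -> p * L%:R ^+ 42 <= L%:R ^+ a ->
    (n %/ L ^ a).+1%:R * p <= 1 - beta.
  move=> a12 a40 p0 hp; have := card_clumps a40 => hV.
  have hh : (n %/ L ^ a).+1%:R * p * L%:R ^+ 42 <= L%:R ^+ 41.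
    by rewrite -mulrA; apply: le_trans hV; rewrite ler_wpM2l.
  have : (n %/ L ^ a).+1%:R * p * L%:R <= 1.
    by rewrite -(ler_pM2r (Lp 41)) mul1r; apply: le_trans hh; rewrite -[X in X <= _]mulrA -exprS.
  have : 0 <= (n %/ L ^ a).+1%:R * p by rewrite mulr_ge0.
  move: L12 beta2; generalize ((n %/ L ^ a).+1%:R * p) => y h1 h2 h3 h4.
  have := ler_wpM2l h3 h1; lra.
have q10 : 0 <= L%:R ^+ 12 / L%:R ^+ 54 :> R by rewrite divr_ge0 ?exprn_ge0// ltW.
have q20 : 0 <= L%:R ^+ 24 / L%:R ^+ 54 :> R by rewrite divr_ge0 ?exprn_ge0// ltW.
have q30 : 0 <= L%:R ^- 18 :> R by rewrite invr_ge0 exprn_ge0// ltW.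
have q40 : 0 <= 1 - beta by move: beta2; lra.
have xn b : n%:R * (n%:R ^+ 2 * x ^+ b.+3) = x ^+ b.
  by rewrite [LHS](_ : _ = (n%:R * x) ^+ 3 * x ^+ b); [rewrite nx expr1n mul1r|rewrite -(addn3 b) exprD; ring].
have xle a b : (a <= b)%N -> x ^+ b <= x ^+ a by move=> ab; apply: ler_wiXn2l => //; exact: ltW.
have x12 b : 12 * x ^+ b.+1 <= x ^+ b by rewrite exprS mulrA ler_piMl// ltW.
have A1 w := @level_dichotomy 12 20 w isT isT isT isT.
have A2 w := @level_dichotomy 24 15 w isT isT isT isT.
have A4 (w : 'I_n -> R[i]) j : 1 <= 2 * cabs (w j) -> anticonc Q w (x ^+ 6) (1 - beta).
  move=> wj; apply: (anticonc_nonzero iidQ alpha0 _ NDG wj); first by move: beta2; lra.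
  by have := x12 5; have := xle 1 5 isT; move: xa; rewrite expr1 => h1 h2 h3; have := xp 6; lra.
have d0 b : 0 <= 3 * x ^+ b by rewrite mulr_ge0// ltW.
have ds : 3 * x ^+ 20 + 3 * x ^+ 15 + 3 * x ^+ 10 <= 2^-1.
  have := xle 10 20 isT; have := xle 10 15 isT; have := x12 9; have := xle 1 9 isT; rewrite expr1; move: x_12; lra.
have h2 : n%:R * (n%:R ^+ 2 * (3 * x ^+ 20)) <= x ^+ 16.
  rewrite (_ : _ * _ = 3 * x ^+ 17); last by rewrite -(xn 17); ring.
  by have := x12 16; have := xp 17; lra.
have h3 : n%:R * (n%:R ^+ 2 * (3 * x ^+ 20 + 3 * x ^+ 15)) <= x ^+ 11.
  rewrite (_ : _ * _ = 3 * x ^+ 17 + 3 * x ^+ 12); last by rewrite -(xn 17) -(xn 12); ring.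
  by have := x12 11; have := xle 12 17 isT; have := xp 12; lra.
have h4 : n%:R * (n%:R ^+ 2 * (3 * x ^+ 20 + 3 * x ^+ 15 + 3 * x ^+ 10)) <= x ^+ 6.
  rewrite (_ : _ * _ = 3 * x ^+ 17 + 3 * x ^+ 12 + 3 * x ^+ 7); last by rewrite -(xn 17) -(xn 12) -(xn 7); ring.
  by have := x12 6; have := xle 7 12 isT; have := xle 7 17 isT; have := xp 7; lra.
have h1 : x ^+ 43 * n%:R <= (x ^+ 21) ^+ 2.
  by rewrite -exprM (exprSr _ 42) -mulrA (mulrC x) nx mulr1.
have B0 : 0 <= n%:R ^+ 2 :> R by rewrite exprn_ge0.
have H := last_row iidQ m kn B0 A1 A2 sparse_dichotomy A4 q10 q20 q30 q40 (d0 15) (d0 10) ds h2 h3 h4 (ltW (xp 21)) h1.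
apply: (le_trans H).
have c1 := card_net_pow (V := (n %/ L ^ 12).+1) AE beta0 L3 Ln nL kn nk hE q20 (V39 12 isT).
have c2 := card_net_pow (V := (n %/ L ^ 24).+1) AE beta0 L3 Ln nL kn nk hE q30 (V39 24 isT).
have c3 := card_net_pow (V := 1) AE beta0 L3 Ln nL kn nk hE q40.
have h12 : L%:R ^+ 12 / L%:R ^+ 54 = L%:R ^- 42 :> R by field; rewrite gt_eqF.
have h43 : L%:R ^- 42 = L%:R * L%:R ^- 43 :> R by field; rewrite gt_eqF.
have p43 : 0 < L%:R ^- 43 :> R by rewrite invr_gt0.
have p12 : 12 * L%:R ^- 43 <= L%:R ^- 42 :> R by rewrite h43 ler_pM2r.
rewrite h12; apply: (@le_trans _ _ (L%:R ^- 43 + (L%:R ^- 43 + L%:R ^- 43) + L%:R ^- 42)); last first.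
  by move: p12 p43; lra.
rewrite lerD2r; apply: lerD; last apply: lerD.
- apply: c1; apply: Vp => //; rewrite [X in X <= _](_ : _ = L%:R ^+ 12); last by field; rewrite gt_eqF.
  exact: lexx.
- apply: c2; apply: Vp => //; rewrite [X in X <= _](_ : _ = L%:R ^+ 24)//; by field; rewrite gt_eqF.
- by apply: c3; [rewrite expn_gt0 L0n|rewrite mul1r].
Qed.

End fixed_scale.

Lemma last_row_eventually : exists L0 : nat, forall L n k m, (L0 <= L)%N ->
  (L ^ 40 <= n)%N -> (n < L.+1 ^ 40)%N -> (k < n)%N -> (n <= k + L)%N ->
  Pr Q (okset n m (n%:R ^+ 2) `&`
    [set a | gramR (rowsm m k.+1 n a) < n%:R^-1 ^+ 43 * gramR (rowsm m k n a)]) <= 2 / L%:R ^+ 42.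
Proof.
pose A := (40 * 142)%N; have AE : A = (40 * 142)%N by [].
move: A AE => A AE.
have [L1 hL1] := pow_le_expR A (divr_gt0 beta0 (ltr0n _ 4)).
pose k0 := (Num.truncn (4 * (1 + 2 * kappa) / alpha)).+1.
have hk : 4 * (1 + 2 * kappa) < k0%:R * alpha by rewrite -ltr_pdivrMr//; exact: truncnS_gt.
pose C : R := 2 ^+ 41 + 96 * k0%:R + 4 / beta + 5 / alpha + (4 * kappa + 1).
exists (maxn L1 (Num.truncn C).+1) => L n k m; rewrite geq_max => /andP[LL1 LC] Ln nL kn nk.
have CL : C <= L%:R.
  by apply: (le_trans (ltW (truncnS_gt C))); rewrite ler_nat.
have b4 : 0 < 4 / beta by rewrite divr_gt0.
have a5 : 0 < 5 / alpha by rewrite divr_gt0.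
have h0 : 0 <= k0%:R :> R by [].
have h41 : 0 < 2 ^+ 41 :> R by rewrite exprn_gt0.
have [c41 Ec41] : exists c, c = 2 ^+ 41 :> R by eexists.
move: CL b4 a5 h0 h41 kappa0; rewrite /C -Ec41 => CL b4 a5 h0 h41 kp.
apply: (last_row_bound (k0 := k0) AE Ln nL (hL1 L LL1) hk) => //.
- by rewrite -Ec41; lra.
- lra.
- rewrite mulrC -ler_pdivrMr//; lra.
- rewrite mulrC -ler_pdivrMr//; lra.
- lra.
Qed.

End last_row_asymptotics.

(** * The regularised log-determinant *)

Section realdet.
Context (R : realType) (n : nat).
Implicit Types (s t : seq 'rV[R[i]]_n) (r : 'rV[R[i]]_n).

Definition rdet s : R := complex.Re (\det (gS s)).
Definition rnorm r : R := complex.Re (dot r r).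
Definition rq s r : R := complex.Re (dot (r *m gQ s) r).

Lemma complex_ge0E (z : R[i]) : 0 <= z -> z = (complex.Re z)%:C%C.
Proof. by case: z => a b; rewrite lecE /= => /andP[/eqP ->]. Qed.

Lemma rdetE s : \det (gS s) = (rdet s)%:C%C.
Proof. by apply: complex_ge0E; apply: le_trans (det_gS_gt0 s). Qed.

Lemma rdet_ge1 s : 1 <= rdet s.
Proof. by have := det_gS_gt0 s; rewrite rdetE lecR. Qed.

Lemma rdet_gt0 s : 0 < rdet s.
Proof. exact: lt_le_trans (rdet_ge1 s). Qed.

Lemma rnormE r : dot r r = (rnorm r)%:C%C.
Proof. by apply: complex_ge0E; exact: dot_ge0. Qed.

Lemma rnorm_sum r : rnorm r = \sum_j cabs (r 0 j) ^+ 2.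
Proof.
by rewrite /rnorm dotE Re_sum; apply: eq_bigr => j _; rewrite mulJ_cabs.
Qed.

Lemma rnorm_ge0 r : 0 <= rnorm r.
Proof. by rewrite rnorm_sum sumr_ge0// => j _; rewrite sqr_ge0. Qed.

Lemma rqE s r : dot (r *m gQ s) r = (rq s r)%:C%C.
Proof. by apply: complex_ge0E; have [] := gQ_ge s r. Qed.

Lemma rq_ge0 s r : 0 <= rq s r.
Proof. by rewrite -lecR -rqE; have [] := gQ_ge s r. Qed.

Lemma rq_le s r : rq s r <= rnorm r.
Proof. by rewrite -lecR -rqE -rnormE; have [_ []] := gQ_ge s r. Qed.

Lemma rdet_cons r s : rdet (r :: s) = rdet s * (1 + rq s r).
Proof. by rewrite /rdet det_gS_cons rdetE rqE -[1]/(1%:C%C) -!rmorphD -rmorphM. Qed.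

Lemma gS_perm s t : perm_eq s t -> gS s = gS t.
Proof. by move=> st; rewrite /gS (perm_big _ st). Qed.

Lemma rdet_cat_le s t : rdet (s ++ t) <= rdet s * \prod_(r <- t) (1 + rnorm r).
Proof.
have := det_gS_cat_le t s; rewrite (gS_perm (permEl (perm_catC t s))) !rdetE.
have -> : \prod_(r <- t) (1 + dot r r) = (\prod_(r <- t) (1 + rnorm r))%:C%C.
  rewrite rmorph_prod; apply: eq_bigr => r _.
  by rewrite rnormE rmorphD rmorph1.
by rewrite -rmorphM lecR.
Qed.

End realdet.

Section chain.
Context (R : realType).
Variables (n : nat) (m : nat -> nat -> R[i]) (a : Arr R).
Hypothesis n0 : (0 < n)%N.

Definition rowok i : Prop := forall j, (j < n)%N -> cabs (m i j + ent a i j) <= n%:R ^+ 2.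

(* A row with a large entry is replaced by 0, which gives the log-determinant
   bounded differences. *)
Definition crow i : 'rV[R[i]]_n :=
  if `[< rowok i >] then \row_(j < n) (m i j + ent a i j) else 0.

(** Scaling the rows by n amounts to the regularisation parameter n^-2 for the unscaled ones. *)
Definition crows (l : seq nat) : seq 'rV[R[i]]_n := [seq (n%:R : R)%:C%C *: crow i | i <- l].

Definition lndet (p : nat) : R := ln (rdet (crows (iota 0 p))).

Lemma rnorm_crow i : rnorm ((n%:R : R)%:C%C *: crow i) <= n%:R ^+ 7.
Proof.
rewrite rnorm_sum; apply: (@le_trans _ _ (\sum_(j < n) n%:R ^+ 6)); last first.
  by rewrite sumr_const card_ord -(mulr_natl (n%:R ^+ 6)) -exprS.
apply: ler_sum => j _; rewrite mxE cabsM cabs_real ger0_norm//.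
have h : cabs (crow i 0 j) <= n%:R ^+ 2.
  by rewrite /crow; case: asboolP => [ok|_]; rewrite mxE ?cabs0 ?exprn_ge0// ok.
rewrite (exprM _ 3 2); apply: lerXn2r; rewrite ?nnegrE ?mulr_ge0 ?cabs_ge0 ?exprn_ge0//.
by rewrite exprS ler_wpM2l.
Qed.

Hypothesis ok : okset n m (n%:R ^+ 2) a.

Lemma crowsE p : (p <= n)%N ->
  crows (iota 0 p) = [seq (n%:R : R)%:C%C *: row i (rowsm m p n a) | i <- enum 'I_p].
Proof.
move=> pn; rewrite /crows -val_enum_ord -map_comp; apply: eq_map => i /=.
have ipn : (i < n)%N by exact: leq_trans pn.
rewrite /crow asboolT; last by move=> j jn; exact: ok.
by congr (_ *: _); apply/rowP => j; rewrite !mxE.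
Qed.

Let nR0 : 0 < n%:R :> R. Proof. by rewrite ltr0n. Qed.
Let nC0 : 0 < (n%:R : R)%:C%C :> R[i]. Proof. by rewrite ltcR. Qed.

Lemma gram_reg_real p (H : 'M[R[i]]_(p.+1, n)) (K : R) : 0 < gramR H -> 0 <= K ->
  (forall i, gramR (row' i H) <= K * gramR H) ->
  (n%:R ^+ 2) ^+ p.+1 * gramR H <= rdet [seq (n%:R : R)%:C%C *: row i H | i <- enum 'I_p.+1] <=
    (n%:R ^+ 2) ^+ p.+1 * gramR H * (1 + n%:R ^- 2 * K) ^+ p.+1.
Proof.
move=> G0 K0 hK.
have gH : gram H != 0 by rewrite gramRE -[0]/((0 : R)%:C%C) (inj_eq (@complexI R)) gt_eqF.
have hi i : invmx (H *m hc H) i i <= K%:C%C.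
  have gH0 : 0 < gram H by rewrite lt0r gH gram_ge0.
  rewrite -(ler_pM2l gH0) invmx_gram// !gramRE -rmorphM lecR mulrC; exact: hK.
have := gram_reg nC0 gH hi; rewrite rdetE gramRE => /andP[h1 h2]; apply/andP; split.
  by rewrite -lecR !rmorphM !rmorphXn.
by rewrite -lecR !rmorphM !rmorphXn rmorphD rmorph1 rmorphM fmorphV rmorphXn.
Qed.

(** Up to the scaling factor, regularisation only increases the determinant, and each row beyond the
    first [p] multiplies the regularised one by at most 1 + n^7. *)
Lemma gramR_upper p : (p <= n)%N ->
  (n%:R ^+ 2) ^+ n * gramR (rowsm m n n a) <= rdet (crows (iota 0 p)) * (1 + n%:R ^+ 7) ^+ (n - p).
Proof.
move=> pn.
have h1 : rdet (crows (iota 0 n)) <= rdet (crows (iota 0 p)) * (1 + n%:R ^+ 7) ^+ (n - p).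
  have -> : crows (iota 0 n) = crows (iota 0 p) ++ crows (iota p (n - p)).
    by rewrite /crows -map_cat -iotaD subnKC.
  apply: (le_trans (rdet_cat_le _ _)); rewrite ler_pM2l ?rdet_gt0//.
  rewrite /crows big_map -[X in _ ^+ X](size_iota p).
  elim: (iota _ _) => [|i l IH]; first by rewrite big_nil.
  rewrite big_cons /= exprS; apply: ler_pM => //; first by rewrite addr_ge0 ?rnorm_ge0.
    by rewrite prodr_ge0// => j _; rewrite addr_ge0 ?rnorm_ge0.
  by rewrite lerD2l rnorm_crow.
apply: le_trans h1; rewrite (crowsE (leqnn n)).
have : forall (q : nat) (H : 'M[R[i]]_(q, n)), (0 < q)%N ->
  (n%:R ^+ 2) ^+ q * gramR H <= rdet [seq (n%:R : R)%:C%C *: row i H | i <- enum 'I_q].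
  move=> [//|q] H _; have := gramR_ge0 H; rewrite le_eqVlt => /orP[/eqP <-|G0].
    by rewrite mulr0 ltW// rdet_gt0.
  (* Only the lower half of [gram_reg_real] is used, so any valid [K] serves. *)
  set K := \sum_i gramR (row' i H) / gramR H.
  have K0 : 0 <= K by rewrite sumr_ge0// => i _; rewrite divr_ge0 ?gramR_ge0.
  have hK i : gramR (row' i H) <= K * gramR H.
    rewrite -ler_pdivrMr// /K (bigD1 i)//= lerDl sumr_ge0// => j _; by rewrite divr_ge0 ?gramR_ge0.
  by have /andP[] := gram_reg_real G0 K0 hK.
by apply.
Qed.

Section lower.
Variables (L p : nat) (beta1 tau : R).
Hypotheses (b10 : 0 < beta1) (t0 : 0 < tau) (pL : (p.+1 + L <= n)%N).
Hypothesis C1 : forall k, (k + L < n)%N -> beta1 * gramR (rowsm m k n a) <= gramR (rowsm m k.+1 n a).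
Hypothesis C2 : forall k, (k < n)%N -> (n <= k + L)%N -> tau * gramR (rowsm m k n a) <= gramR (rowsm m k.+1 n a).
Hypothesis C3 : forall i, beta1 * gramR (row' i (rowsm m p.+1 n a)) <= gramR (rowsm m p.+1 n a).

Lemma gramR_pos k : (k <= n)%N -> 0 < gramR (rowsm m k n a).
Proof.
elim: k => [_|k IH kn]; first by rewrite /gramR /gram det_mx00.
have h := IH (ltnW kn).
have [kL|kL] := ltnP (k + L) n.
  by apply: lt_le_trans (C1 kL); rewrite mulr_gt0.
by apply: lt_le_trans (C2 kn kL); rewrite mulr_gt0.
Qed.

Lemma gramR_chain1 j : (p.+1 + j + L <= n)%N ->
  beta1 ^+ j * gramR (rowsm m p.+1 n a) <= gramR (rowsm m (p.+1 + j) n a).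
Proof.
elim: j => [_|j IH hj]; first by rewrite expr0 mul1r addn0.
rewrite addnS; rewrite addnS in hj; apply: le_trans (C1 _) => //; rewrite exprS -mulrA ler_pM2l//.
by apply: IH; apply: leq_trans hj; rewrite leq_add2r.
Qed.

Lemma gramR_chain2 j : (j <= L)%N ->
  tau ^+ j * gramR (rowsm m (n - L) n a) <= gramR (rowsm m (n - L + j) n a).
Proof.
have Ln : (L <= n)%N by apply: leq_trans pL; rewrite leq_addl.
elim: j => [_|j IH hj]; first by rewrite expr0 mul1r addn0.
rewrite addnS; apply: le_trans (C2 _ _) => //.
- by rewrite exprS -mulrA ler_pM2l//; apply: IH; exact: ltnW.
- by rewrite -[X in (_ < X)%N](subnK Ln) ltn_add2l.
- by rewrite addnAC subnK// leq_addr.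
Qed.

(** [C1] and [C2] chain the Gram determinants from p + 1 rows up to n. [C3] bounds the diagonal of
    the inverse Gram matrix of the first p + 1 rows, which limits what their regularisation adds. *)
Lemma gramR_lower :
  rdet (crows (iota 0 p.+1)) * (tau ^+ L * beta1 ^+ (n - L - p.+1)) <=
  (n%:R ^+ 2) ^+ p.+1 * (1 + n%:R ^- 2 / beta1) ^+ p.+1 * gramR (rowsm m n n a).
Proof.
have Ln : (L <= n)%N by apply: leq_trans pL; rewrite leq_addl.
have pn : (p < n)%N by apply: leq_trans pL; rewrite leq_addr.
have pnL : (p.+1 <= n - L)%N by rewrite leq_subRL// addnC.
have G0 := gramR_pos pn.
have b1V : 0 <= beta1^-1 by rewrite invr_ge0 ltW.
have hK i : gramR (row' i (rowsm m p.+1 n a)) <= beta1^-1 * gramR (rowsm m p.+1 n a).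
  by rewrite mulrC ler_pdivlMr// mulrC; exact: C3.
have /andP[_ h1] := gram_reg_real G0 b1V hK.
rewrite (crowsE pn); set D := rdet _ in h1 *.
have h2 := @gramR_chain1 (n - L - p.+1)%N; rewrite subnKC// in h2.
have h3 := gramR_chain2 (leqnn L); rewrite subnK// in h3.
set Gp := gramR (rowsm m p.+1 n a) in h1 h2 *.
have h4 : tau ^+ L * beta1 ^+ (n - L - p.+1) * Gp <= gramR (rowsm m n n a).
  apply: le_trans h3; rewrite -mulrA; apply: ler_wpM2l; first by rewrite exprn_ge0// ltW.
  by apply: h2; rewrite subnK.
set c := (n%:R ^+ 2) ^+ p.+1 in h1 *; set q := (1 + _) ^+ p.+1 in h1 *.
have c0 : 0 <= c by rewrite !exprn_ge0.
have q0 : 0 <= q by rewrite exprn_ge0// addr_ge0// divr_ge0 ?invr_ge0 ?exprn_ge0// ltW.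
set y := tau ^+ L * _ in h4 *.
have y0 : 0 <= y by rewrite mulr_ge0// exprn_ge0// ltW.
apply: (le_trans (ler_wpM2r y0 h1)).
rewrite [X in X <= _](_ : _ = c * q * (y * Gp)); last by ring.
by apply: ler_wpM2l => //; rewrite mulr_ge0.
Qed.

End lower.
End chain.

Lemma lnX_nat (R : realType) (x : R) k : 0 < x -> ln (x ^+ k) = k%:R * ln x.
Proof. by move=> x0; rewrite lnXn// mulr_natl. Qed.

Lemma ln_upper (R : realType) (G D N E : R) (n d : nat) : 0 < G -> 0 < D -> 0 < N -> 0 < E ->
  (N ^+ 2) ^+ n * G <= D * E ^+ d -> 2 * n%:R * ln N + ln G <= ln D + d%:R * ln E.
Proof.
move=> G0 D0 N0 E0; rewrite -exprM => h.
have p1 : 0 < N ^+ (2 * n) by rewrite exprn_gt0.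
have p2 : 0 < E ^+ d by rewrite exprn_gt0.
rewrite -natrM -!lnX_nat// -!lnM ?posrE// ler_ln ?posrE ?mulr_gt0//.
Qed.

Lemma ln_lower (R : realType) (G D N E t b : R) (p L j : nat) : 0 < G -> 0 < D -> 0 < N -> 0 < E -> 0 < t -> 0 < b ->
  D * (t ^+ L * b ^+ j) <= (N ^+ 2) ^+ p * E ^+ p * G ->
  ln D + (L%:R * ln t + j%:R * ln b) <= 2 * p%:R * ln N + p%:R * ln E + ln G.
Proof.
move=> G0 D0 N0 E0 t0 b0; rewrite -exprM => h.
have p1 : 0 < N ^+ (2 * p) by rewrite exprn_gt0.
have p2 : 0 < E ^+ p by rewrite exprn_gt0.
have p3 : 0 < t ^+ L by rewrite exprn_gt0.
have p4 : 0 < b ^+ j by rewrite exprn_gt0.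
by rewrite -natrM -!lnX_nat// -!lnM ?posrE ?mulr_gt0// ler_ln ?posrE ?mulr_gt0.
Qed.

Lemma ln_lower_arith (R : realFieldType) (D G P pE x y z ai d L : R) :
  0 <= (d - L) * x -> 0 <= L * x -> 0 <= (d - L) * (z + y) -> 0 <= L * z -> pE <= ai ->
  D + (L * (43 * - x) + (d - L) * (y - x)) <= P + pE + G -> D - P - d * (44 * x + z) - ai <= G.
Proof. lra. Qed.

Lemma ln_upper_arith (R : realFieldType) (D G p d x E : R) :
  E <= 8 * x -> 0 <= d -> 0 <= x -> 2 * (d + p) * x + G <= D + d * E ->
  G <= D - 2 * p * x + d * (44 * x).
Proof. by move=> h1 d0 x0; have := ler_wpM2l d0 h1; have := mulr_ge0 d0 x0; lra. Qed.

Lemma norm_arith (R : realFieldType) (D G P d x z ai : R) : 0 <= d * (z + ai) -> ai <= d * ai ->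
  G <= D - P + d * (44 * x) -> D - P - d * (44 * x + z) - ai <= G ->
  `|G - (D - P)| <= d * (44 * x + z + ai).
Proof. by move=> h1 h2 h3 h4; rewrite ler_norml; apply/andP; split; lra. Qed.

(** Beyond row p + 1, the last L rows lose at most 43 ln n each and the others ln n + |ln alpha|,
    whence the coefficient 44; it also covers the upper bound of 8 ln n per row. Regularising costs
    (p + 1) ln (1 + 1 / (n alpha)) <= 1 / alpha. *)
Lemma ln_gram_bound (R : realType) (n L p : nat) (m : nat -> nat -> R[i]) (a : Arr R) (alpha : R) :
  (2 <= n)%N -> (0 < L)%N -> okset n m (n%:R ^+ 2) a -> 0 < alpha -> (p.+1 + L <= n)%N ->
  (forall k, (k + L < n)%N -> alpha / n%:R * gramR (rowsm m k n a) <= gramR (rowsm m k.+1 n a)) ->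
  (forall k, (k < n)%N -> (n <= k + L)%N -> n%:R^-1 ^+ 43 * gramR (rowsm m k n a) <= gramR (rowsm m k.+1 n a)) ->
  (forall i, alpha / n%:R * gramR (row' i (rowsm m p.+1 n a)) <= gramR (rowsm m p.+1 n a)) ->
  0 < gramR (rowsm m n n a) /\
  `|ln (gramR (rowsm m n n a)) - (lndet n m a p.+1 - 2 * p.+1%:R * ln n%:R)| <=
    (n - p.+1)%:R * (44 * ln n%:R + `|ln alpha| + alpha^-1).
Proof.
move=> n2 L0 ok a0 pL C1 C2 C3.
have n0 : (0 < n)%N by exact: leq_trans n2.
have nR : 0 < n%:R :> R by rewrite ltr0n.
have n1 : 1 <= n%:R :> R by rewrite ler1n.
have ln0 : 0 <= ln n%:R :> R by rewrite ln_ge0.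
have b10 : 0 < alpha / n%:R by rewrite divr_gt0.
have t0 : 0 < n%:R^-1 ^+ 43 :> R by rewrite exprn_gt0// invr_gt0.
have G0 := gramR_pos b10 t0 C1 C2 (leqnn n).
split => //.
have pn : (p.+1 <= n)%N by apply: leq_trans pL; rewrite leq_addr.
have Ln : (L <= n - p.+1)%N by rewrite leq_subRL.
have hl := gramR_lower n0 ok b10 t0 pL C1 C2 C3.
have hu := gramR_upper n0 ok pn.
rewrite /lndet; set D := rdet _ in hl hu *.
have D0 : 0 < D by exact: rdet_gt0.
set G := gramR _ in hl hu G0 *.
set d := (n - p.+1)%N in hu Ln *.
have np : n%:R = d%:R + p.+1%:R :> R by rewrite -natrD subnK.
have ul : ln G <= ln D - 2 * p.+1%:R * ln n%:R + d%:R * (44 * ln n%:R).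
  have h8 : 1 + n%:R ^+ 7 <= n%:R ^+ 8 :> R.
    have := exprn_ege1 7 n1; have : 2 <= n%:R :> R by rewrite ler_nat.
    move=> h1 h2; rewrite exprS; apply: (@le_trans _ _ (2 * n%:R ^+ 7)); first by lra.
    by rewrite ler_pM2r// exprn_gt0.
  have := ln_upper G0 D0 nR _ hu; have p7 : 0 < 1 + n%:R ^+ 7 :> R by rewrite ltr_wpDr ?exprn_ge0.
  move=> /(_ p7) h.
  have h9 : ln (1 + n%:R ^+ 7) <= 8 * ln n%:R :> R.
    by rewrite -lnX_nat// ler_ln ?posrE ?exprn_gt0.
  by apply: ln_upper_arith h9 _ ln0 _; rewrite // -np.
have ll : ln D - 2 * p.+1%:R * ln n%:R - d%:R * (44 * ln n%:R + `|ln alpha|) - alpha^-1 <= ln G.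
  set E := 1 + _ in hl.
  have E1 : E = 1 + (n%:R * alpha)^-1.
    by rewrite /E; congr (_ + _); field; rewrite !gt_eqF.
  have E0 : 0 < E by rewrite E1 ltr_wpDr// invr_ge0 mulr_ge0// ltW.
  have lnE : p.+1%:R * ln E <= alpha^-1.
    apply: (@le_trans _ _ (p.+1%:R * (n%:R * alpha)^-1)).
      rewrite ler_wpM2l//; have := le_ln1Dx (x := (n%:R * alpha)^-1); rewrite -E1; apply.
      by rewrite (@lt_le_trans _ _ 0)// invr_ge0 mulr_ge0// ltW.
    by rewrite invfM mulrA -[X in _ <= X]mul1r ler_pM2r ?invr_gt0// ler_pdivrMr// mul1r ler_nat.
  have := ln_lower G0 D0 nR E0 t0 b10 hl.
  have -> : (n - L - p.+1 = d - L)%N by rewrite /d -!subnDA addnC.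
  rewrite natrB// lnX_nat ?invr_gt0// !lnV ?posrE// lnM ?posrE ?invr_gt0// lnV ?posrE//.
  move=> h; have a1 : 0 <= `|ln alpha| + ln alpha.
    by rewrite -[X in _ + X]opprK subr_ge0 -normrN ler_norm.
  have dL : 0 <= d%:R - L%:R :> R by rewrite subr_ge0 ler_nat.
  by apply: ln_lower_arith lnE h; rewrite mulr_ge0.
apply: norm_arith ul ll.
  by rewrite mulr_ge0// addr_ge0// invr_ge0 ltW.
by rewrite ler_peMl ?invr_ge0 ?(ltW a0)// ler1n (leq_trans L0).
Qed.

Section measurable_lndet.
Context (R : realType).

Lemma cmeas_real d (T : measurableType d) (g : T -> R) : measurable_fun setT g -> cmeas (fun x => (g x)%:C%C).
Proof. by move=> mg; split => //=; exact: measurable_cst. Qed.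

Lemma measurable_rowok n (m : nat -> nat -> R[i]) i : measurable [set a : Arr R | rowok n m a i].
Proof.
rewrite (_ : [set a | _] = \bigcap_(j in `I_n) [set a : Arr R | cabs (m i j + ent a i j) <= n%:R ^+ 2]).
  apply: fin_bigcap_measurable; first exact: finite_II.
  move=> j _; apply: measurable_leRR; last exact: measurable_cst.
  by apply: measurable_cabs; apply: cmeasD; [exact: cmeas_cst|exact: cmeas_ent].
by apply/seteqP; split.
Qed.

Lemma cmeas_crow n (m : nat -> nat -> R[i]) i j : cmeas (fun a : Arr R => crow n m a i 0 j).
Proof.
rewrite (_ : (fun a => _) = fun a => ((\1_[set a : Arr R | rowok n m a i] a : R)%:C%C * (m i j + ent a i j))).
  apply: cmeasM; first by apply: cmeas_real; apply: measurable_indic; exact: measurable_rowok.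
  by apply: cmeasD; [exact: cmeas_cst|exact: cmeas_ent].
apply/funext => a; rewrite /crow indicE; case: asboolP => h.
  by rewrite mem_set// mul1r mxE.
by rewrite memNset// mul0r mxE.
Qed.

Lemma cmeas_gS n (m : nat -> nat -> R[i]) l k k' : cmeas (fun a : Arr R => gS (crows n m a l) k k').
Proof.
rewrite (_ : (fun a => _) = fun a => (k == k')%:R + \sum_(i <- l)
    (Num.conj_op ((n%:R : R)%:C%C * crow n m a i 0 k) * ((n%:R : R)%:C%C * crow n m a i 0 k'))).
  apply: cmeasD; first exact: cmeas_cst.
  apply: cmeas_sum => i; apply: cmeasM.
    by apply: cmeas_conj; apply: cmeasM; [exact: cmeas_cst|exact: cmeas_crow].
  by apply: cmeasM; [exact: cmeas_cst|exact: cmeas_crow].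
apply/funext => a; rewrite /gS !mxE; congr (_ + _).
rewrite /crows big_map summxE; apply: eq_bigr => i _.
by rewrite mxE big_ord1 hcE !mxE.
Qed.

Lemma measurable_rdet_crows n (m : nat -> nat -> R[i]) l : measurable_fun setT (fun a : Arr R => rdet (crows n m a l)).
Proof.
suff [] : cmeas (fun a : Arr R => \det (gS (crows n m a l))) by [].
by apply: cmeas_det => k k'; exact: cmeas_gS.
Qed.

Lemma measurable_lndet n (m : nat -> nat -> R[i]) p : measurable_fun setT (fun a : Arr R => lndet n m a p).
Proof.
apply: (measurableT_comp (f := @ln R)); first exact: measurable_ln.
exact: measurable_rdet_crows.
Qed.

End measurable_lndet.

Section det_event.
Context (R : realType) (mu : probability (borelC R) R) (Q : probability (Arr R) R).
Hypothesis iidQ : iid_law mu Q.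
Context (alpha beta kappa : R).
Hypothesis alpha0 : 0 < alpha.
Hypothesis beta0 : 0 < beta.
Hypothesis beta2 : beta <= 2^-1.
Hypothesis kappa0 : 0 < kappa.
Hypothesis NDG : forall c : R[i], Pr mu [set x : borelC R | cabs ((x : R[i]) - c) <= alpha] <= 1 - beta.
Hypothesis PAIR : beta <= Pr (mu \x mu)%E (pairset alpha kappa).

Let C0 := `|ln (alpha ^+ 2)| + (alpha ^+ 2)^-1.

Definition detgood n (m : nat -> nat -> R[i]) p (c : R) : set (Arr R) :=
  [set a | 0 < gramR (rowsm m n n a) /\
    `|ln (gramR (rowsm m n n a)) - (lndet n m a p - 2 * p%:R * ln n%:R)| <= c].

Lemma measurable_detgood n m p c : measurable (detgood n m p c).
Proof.
have mg : measurable_fun setT (fun a : Arr R => gramR (rowsm m n n a)).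
  by apply: measurable_gramR => *; exact: cmeas_rowsm.
apply: measurableI; first by apply: measurable_ltRR => //; exact: measurable_cst.
apply: measurable_leRR; last exact: measurable_cst.
apply: measurableT_comp; first exact: normr_measurable.
apply: measurable_funB.
  by apply: (measurableT_comp (f := @ln R)) => //; exact: measurable_ln.
by apply: measurable_funB; [exact: measurable_lndet|exact: measurable_cst].
Qed.

Lemma sum_small (L n : nat) : (n < L.+1 ^ 40)%N -> 2 ^+ 41 <= L%:R :> R -> (3 <= L)%N ->
  (2 * L%:R) ^+ (40 * 142) <= expR (beta / 4 * L%:R) :> R ->
  n%:R * (1 - beta) ^+ L + n%:R * (1 - beta) ^+ L <= L%:R ^- 41 :> R.
Proof.
move=> nL hL1 L3 hE.
have L1 : 1 <= L%:R :> R by rewrite ler1n; exact: leq_trans L3.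
have L0 : 0 < L%:R :> R by exact: lt_le_trans L1.
have Lp k : 0 < L%:R ^+ k :> R by exact: exprn_gt0.
have h1 : (1 - beta) ^+ L <= L%:R ^- 82 :> R.
  apply: (@le_trans _ _ (expR (- beta) ^+ L)).
    by apply: lerXn2r; rewrite ?nnegrE ?expR_ge0 ?expR_ge1Dx//; move: beta2; lra.
  rewrite -expRM_natr mulNr; apply: (expRN_le L3 hE) => //.
  by rewrite ler_pM2r//; move: beta0; lra.
have h2 := n_le_pow R L3 nL.
have h3 : 2 * (2 * L%:R) ^+ 40 <= L%:R ^+ 41 :> R.
  by rewrite exprMn mulrA -exprS (exprS _ 40); apply: ler_wpM2r => //; exact: ltW.
have h4 : n%:R * (1 - beta) ^+ L <= (2 * L%:R) ^+ 40 * L%:R ^- 82 :> R.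
  apply: ler_pM => //; rewrite exprn_ge0//; move: beta2; lra.
have h5 : 2 * (2 * L%:R) ^+ 40 * L%:R ^- 82 <= L%:R ^+ 41 * L%:R ^- 82 :> R.
  by rewrite ler_pM2r ?invr_gt0.
have h6 : L%:R ^+ 41 * L%:R ^- 82 = L%:R ^- 41 :> R by field; rewrite gt_eqF.
by move: h4 h5; rewrite h6; lra.
Qed.

(** The Odlyzko events have codimension at least L, so at most 2n of them are negligible; the last L
    rows contribute L times 2 / L^42. *)
Lemma det_event : exists L0 : nat, forall L n m, (L0 <= L)%N ->
  (L ^ 40 <= n)%N -> (n < L.+1 ^ 40)%N ->
  Pr Q (okset n m (n%:R ^+ 2) `&` ~` detgood n m (n - L ^ 20) ((L ^ 20)%:R * (44 * ln n%:R + C0)))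
    <= 3 / L%:R ^+ 41.
Proof.
have beta1 : beta <= 1 by move: beta2; lra.
have [L1 hL1] := last_row_eventually iidQ alpha0 beta0 beta2 kappa0 NDG PAIR.
have [L2 hL2] := pow_le_expR (40 * 142) (divr_gt0 beta0 (ltr0n R 4)).
exists (maxn (maxn L1 L2) (maxn 3 (Num.truncn (2 ^+ 41 : R)).+1)) => L n m.
rewrite !geq_max => /andP[/andP[LL1 LL2] /andP[L3 L41]] Ln nL.
have L41R : 2 ^+ 41 <= L%:R :> R.
  by apply: (le_trans (ltW (truncnS_gt _))); rewrite ler_nat.
have L0 : (0 < L)%N by exact: leq_trans L3.
have L20 : (L < L ^ 20)%N by rewrite -[X in (X < _)%N]expn1 ltn_exp2l//; exact: leq_trans L3.
have L2040 : (L ^ 20 < L ^ 40)%N by rewrite ltn_exp2l//; exact: leq_trans L3.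
have Lltn : (L ^ 20 < n)%N by exact: leq_trans Ln.
have n2 : (2 <= n)%N by apply: leq_trans Lltn; rewrite ltnS expn_gt0 L0.
have n0 : 0 < n%:R :> R by rewrite ltr0n; exact: leq_trans n2.
have [p pE] : exists p, p.+1 = (n - L ^ 20)%N.
  by exists (n - L ^ 20).-1%N; rewrite prednK// subn_gt0.
have pn : (p < n)%N by rewrite pE leq_subr.
have pL : (p.+1 + L <= n)%N by rewrite pE -[X in (_ <= X)%N](subnK (ltnW Lltn)) leq_add2l ltnW.
have d20 : (n - p.+1 = L ^ 20)%N by rewrite pE subKn// ltnW.
rewrite -pE.
(* The largest threshold allowed in [Pr_smallrow]; [tau] is that of [last_row_eventually]. *)
set b1 := alpha ^+ 2 / n%:R; pose tau : R := n%:R^-1 ^+ 43.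
have b1n : b1 * n%:R <= alpha ^+ 2 by rewrite /b1 divfK// gt_eqF.
(* [F1]: a row before the last L is too close to the span of its predecessors. [F2]: one of the
   first p + 1 rows is too close to the span of the others. [F3]: one of the last L rows is too
   close to the span of its predecessors. *)
pose F1 (k : 'I_n) : set (Arr R) := if (k + L < n)%N then smallrow m n b1 (ord_max : 'I_k.+1) else set0.
pose F2 (i : 'I_p.+1) : set (Arr R) := smallrow m n b1 i.
pose E3 (k : nat) : set (Arr R) := okset n m (n%:R ^+ 2) `&`
    [set a | gramR (rowsm m k.+1 n a) < tau * gramR (rowsm m k n a)].
pose F3 (l : 'I_L) : set (Arr R) := E3 (n - l.+1)%N.
have mF1 k : measurable (F1 k) by rewrite /F1; case: ifP => _ //; exact: measurable_smallrow.
have mF2 i : measurable (F2 i) by exact: measurable_smallrow.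
have mF3 l : measurable (F3 l).
  apply: measurableI; first exact: measurable_okset.
  apply: measurable_ltRR; first by apply: measurable_gramR => *; exact: cmeas_rowsm.
  apply: measurable_funM; first exact: measurable_cst.
  by apply: measurable_gramR => *; exact: cmeas_rowsm.
have mU (I : finType) (F : I -> set (Arr R)) : (forall i, measurable (F i)) -> measurable [set a | exists i, F i a].
  move=> mF; rewrite (_ : [set a | _] = \bigcup_(i in [set: I]) F i).
    exact: fin_bigcup_measurable.
  by apply/seteqP; split => a [k]; exists k.
set U1 := [set a | exists k, F1 k a]; set U2 := [set a | exists k, F2 k a]; set U3 := [set a | exists k, F3 k a].
have sub : okset n m (n%:R ^+ 2) `&` ~` detgood n m p.+1 ((L ^ 20)%:R * (44 * ln n%:R + C0)) `<=`
    U1 `|` (U2 `|` U3).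
  move=> a [ok nd]; apply: contrapT => /not_orP[nU1 /not_orP[nU2 nU3]]; apply: nd.
  have [] := @ln_gram_bound R n L p m a (alpha ^+ 2) n2 L0 ok (exprn_gt0 _ alpha0) pL.
  - move=> k kL; rewrite leNgt; apply/negP => h; apply: nU1.
    have kn : (k < n)%N by apply: leq_ltn_trans kL; rewrite leq_addr.
    by exists (Ordinal kn); rewrite /F1 /= kL /smallrow /= row'_rowsm.
  - move=> k kn kL; rewrite leNgt; apply/negP => h; apply: nU3.
    have lL : (n - k.+1 < L)%N by rewrite ltn_subLR// ?ltnS// addSn ltnS.
    exists (Ordinal lL); rewrite /F3 /=.
    by rewrite subnSK// subKn ?(ltnW kn).
  - move=> i; rewrite leNgt; apply/negP => h; apply: nU2; by exists i.
  - by move=> h1 h2; split => //; rewrite d20 -!addrA in h2 *; rewrite /C0.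
have mU23 : measurable (U2 `|` U3) by apply: measurableU; exact: mU.
apply: (@le_trans _ _ (Pr Q (U1 `|` (U2 `|` U3)))).
  apply: le_Pr => //.
    by apply: measurableI; [exact: measurable_okset|apply: measurableC; exact: measurable_detgood].
  by apply: measurableU => //; exact: mU.
apply: (le_trans (Pr_setU _ _ mU23)); first exact: mU.
have b01 : 0 <= 1 - beta by move: beta1; lra.
have pw k : (L <= k)%N -> (1 - beta) ^+ k <= (1 - beta) ^+ L by move=> Lk; apply: ler_wiXn2l; rewrite // gerBl ltW.
have h1 : Pr Q U1 <= n%:R * (1 - beta) ^+ L.
  apply: (le_trans (Pr_bigcup _ mF1)); apply: (@le_trans _ _ (\sum_(k < n) (1 - beta) ^+ L)); last by rewrite sumr_const card_ord mulr_natl.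
  apply: ler_sum => k _; rewrite /F1; case: ifP => kL; last by rewrite /Pr measure0 exprn_ge0.
  apply: (le_trans (Pr_smallrow iidQ alpha0 beta0 beta1 NDG m ord_max (ltn_ord k) b1n)); apply: pw.
  by rewrite leq_subRL ?(ltnW (ltn_ord k))// ltnW.
have h2 : Pr Q U2 <= n%:R * (1 - beta) ^+ L.
  apply: (le_trans (Pr_bigcup _ mF2)); apply: (@le_trans _ _ (\sum_(k < p.+1) (1 - beta) ^+ L)); last first.
    by rewrite sumr_const card_ord -(mulr_natl ((1 - beta) ^+ L)) ler_wpM2r ?exprn_ge0// ler_nat.
  apply: ler_sum => i _; apply: (le_trans (Pr_smallrow iidQ alpha0 beta0 beta1 NDG m i pn b1n)); apply: pw.
  by rewrite leq_subRL ?(ltnW pn)//; apply: leq_trans pL; rewrite leq_add2r.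
have h3 : Pr Q U3 <= 2 / L%:R ^+ 41.
  apply: (le_trans (Pr_bigcup _ mF3)); apply: (@le_trans _ _ (\sum_(l < L) 2 / L%:R ^+ 42)); last first.
    rewrite sumr_const card_ord -mulr_natl le_eqVlt; apply/orP; left; apply/eqP.
    by field; rewrite gt_eqF// ltr0n.
  apply: ler_sum => l _; apply: hL1 => //.
    by rewrite ltn_subrL; apply: leq_trans n2.
  have := ltn_ord l; have := leq_sub2l n (ltn_ord l) => h4 h5.
  by rewrite -leq_subLR addnC || (rewrite addnC -leq_subLR; apply: leq_trans h4 _; rewrite leq_sub2l).
apply: (le_trans (lerD h1 (Pr_setU _ _ _))); try exact: mU.
have h4 := sum_small nL L41R L3 (hL2 L LL2).
apply: (@le_trans _ _ (n%:R * (1 - beta) ^+ L + (n%:R * (1 - beta) ^+ L + 2 / L%:R ^+ 41))).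
  by rewrite lerD2l; exact: lerD.
by move: h4; lra.
Qed.

End det_event.

(** * Bounded differences *)

Section concentration.
Context (R : realType) (Q : probability (Arr R) R) (Qi : indep_law Q).

Lemma expR_le_quad (x : R) : `|x| <= 2^-1 -> expR x <= 1 + x + 2 * x ^+ 2.
Proof.
rewrite ler_norml => /andP[x1 x2].
have h : expR (- x) * expR x = 1 by rewrite -expRD addNr expR0.
have e0 : 0 < expR x by exact: expR_gt0.
have h1 : 1 - x <= expR (- x) by exact: expR_ge1Dx.
have x1' : 0 < 1 - x by lra.
have h2 : expR x <= (1 - x)^-1.
  rewrite -(ler_pM2l x1') mulfV ?gt_eqF//.
  by apply: (@le_trans _ _ (expR (- x) * expR x)); [exact: (ler_wpM2r (ltW e0) h1)|rewrite h].
apply: (le_trans h2); rewrite -(ler_pM2l x1') mulfV ?gt_eqF//.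
have : 0 <= x ^+ 2 by exact: sqr_ge0.
by rewrite (_ : (1 - x) * (1 + x + 2 * x ^+ 2) = 1 + x ^+ 2 * (1 - 2 * x)); [move=> h3; rewrite lerDl mulr_ge0//; lra|ring].
Qed.

Definition rows_lt (k : nat) : pred (nat * nat) := fun x => (x.1 < k)%N.

Definition row_dep k (g : Arr R -> R) := forall a b : Arr R,
  (forall i j, (i < k)%N -> a i j = b i j) -> g a = g b.

Definition row_osc (c : R) (g : Arr R -> R) := forall (i : nat) (a b : Arr R),
  (forall i' j, i' != i -> a i' j = b i' j) -> `|g a - g b| <= c.

(** Induction on the number of rows. [h] averages row k over an independent copy and depends on k
    rows with the same oscillation. Given the first k rows, the difference from [h] is centred and
    bounded by [c], so the quadratic bound on the exponential costs one factor exp(2 (s c)^2). *)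
Lemma mcdiarmid_exp (c s : R) k (g : Arr R -> R) B : 0 <= c -> 0 <= s -> s * c <= 2^-1 ->
  measurable_fun setT g -> (forall a, `|g a| <= B) -> row_dep k g -> row_osc c g ->
  Ex Q (fun a => expR (s * g a)) <= expR (s * Ex Q g + 2 * (s * c) ^+ 2 * k%:R).
Proof.
move=> c0 s0 sc; elim: k g B => [|k IH] g B mg gB dg og.
  have gc a : g a = g (fun _ _ => (0 : R[i])) by exact: dg.
  rewrite (eq_Ex _ (g := fun=> expR (s * g (fun _ _ => (0 : R[i]))))); last by move=> a; rewrite gc.
  by rewrite Ex_cst (eq_Ex Q gc) Ex_cst mulr0 addr0.
pose S := rows_lt k.
have eB a : `|expR (s * g a)| <= expR (s * B).
  by rewrite ger0_norm ?expR_ge0// ler_expR ler_wpM2l// (le_trans (ler_norm _)).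
have me : measurable_fun setT (fun a => expR (s * g a)).
  apply: (measurableT_comp (f := @expR R)); first exact: measurable_expR.
  by apply: measurable_funM => //; exact: measurable_cst.
have ig : itg Q g by exact: itg_bounded gB.
have igm a : itg Q (fun b => g (amerge S (a, b))) by exact: itg_bounded_merge gB.
pose h a := Ex Q (fun b => g (amerge S (a, b))).
have ih : itg Q h by exact: Ex_merge_itg.
have Eh : Ex Q h = Ex Q g by rewrite -Ex_merge.
have gB' a b : `|g (amerge S (a, b))| <= B by exact: gB.
have hB a : `|h a| <= B.
  rewrite ler_norml; apply/andP; split.
    rewrite -[X in X <= _](Ex_cst Q); apply: le_Ex => //; first exact: itg_cst.
    by move=> b; have := gB' a b; rewrite ler_norml => /andP[].
  rewrite -[X in _ <= X](Ex_cst Q); apply: le_Ex => //; first exact: itg_cst.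
  by move=> b; have := gB' a b; rewrite ler_norml => /andP[].
have dh : row_dep k h.
  move=> a a' aa; apply: eq_Ex => b; apply: dg => i j _.
  by rewrite /amerge /S /rows_lt /=; case: ifP => // ik; exact: aa.
have oh : row_osc c h.
  move=> i a a' aa; rewrite -ExB//.
  have hd b : `|g (amerge S (a, b)) - g (amerge S (a', b))| <= c.
    by apply: (og i) => i' j ii; rewrite /amerge /S /rows_lt /=; case: ifP => // _; exact: aa.
  have id : itg Q (fun b => g (amerge S (a, b)) - g (amerge S (a', b))) by exact: itgB.
  rewrite ler_norml; apply/andP; split.
    rewrite -[X in X <= _](Ex_cst Q); apply: le_Ex => //; first exact: itg_cst.
    by move=> b; have := hd b; rewrite ler_norml => /andP[].
  rewrite -[X in _ <= X](Ex_cst Q); apply: le_Ex => //; first exact: itg_cst.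
  by move=> b; have := hd b; rewrite ler_norml => /andP[].
(* [b''] is [b] with row k taken from [b']; since [g] sees only rows up to k, it can stand for [b'],
   and one oscillation bound applies. *)
have win a b b' : `|g (amerge S (a, b)) - g (amerge S (a, b'))| <= c.
  pose b'' : Arr R := fun i j => if i == k then b' i j else b i j.
  have -> : g (amerge S (a, b')) = g (amerge S (a, b'')).
    apply: dg => i j; rewrite ltnS leq_eqVlt => /orP[/eqP ->|ik].
      by rewrite /amerge /S /rows_lt /b'' /= ltnn eqxx.
    by rewrite /amerge /S /rows_lt /= ik.
  apply: (og k) => i j ik; rewrite /amerge /S /rows_lt /b'' /=.
  by case: ifP => // _; rewrite (negbTE ik).
have hg a b : `|g (amerge S (a, b)) - h a| <= c.
  have -> : g (amerge S (a, b)) - h a = Ex Q (fun b' => g (amerge S (a, b)) - g (amerge S (a, b'))).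
    by rewrite ExB ?Ex_cst//; exact: itg_cst.
  have id : itg Q (fun b' => g (amerge S (a, b)) - g (amerge S (a, b'))).
    by apply: itgB => //; exact: itg_cst.
  rewrite ler_norml; apply/andP; split.
    rewrite -[X in X <= _](Ex_cst Q); apply: le_Ex => //; first exact: itg_cst.
    by move=> b'; have := win a b b'; rewrite ler_norml => /andP[].
  rewrite -[X in _ <= X](Ex_cst Q); apply: le_Ex => //; first exact: itg_cst.
  by move=> b'; have := win a b b'; rewrite ler_norml => /andP[].
have ie : itg Q (fun a => expR (s * g a)) by exact: itg_bounded eB.
have iem a : itg Q (fun b => expR (s * g (amerge S (a, b)))).
  exact: (itg_bounded_merge (f := fun a => expR (s * g a)) Q S a me eB).
rewrite (Ex_merge Qi (S := S) ie iem).
have mh : measurable_fun setT h by exact: itg_meas ih.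
have meh : measurable_fun setT (fun a => expR (s * h a)).
  apply: (measurableT_comp (f := @expR R)); first exact: measurable_expR.
  by apply: measurable_funM => //; exact: measurable_cst.
have ieh : itg Q (fun a => expR (s * h a)).
  apply: (@itg_bounded _ _ _ _ _ (expR (s * B))) => // a.
  by rewrite ger0_norm ?expR_ge0// ler_expR ler_wpM2l// (le_trans (ler_norm _)).
apply: (@le_trans _ _ (Ex Q (fun a => expR (2 * (s * c) ^+ 2) * expR (s * h a)))).
  apply: le_Ex; [exact: (Ex_merge_itg Qi ie iem)|exact: itgZ|move=> a].
  have bnd b : expR (s * g (amerge S (a, b))) <=
      expR (s * h a) * (1 + 2 * (s * c) ^+ 2) + (expR (s * h a) * s) * (g (amerge S (a, b)) - h a).
    set d := g _ - h a; have dc : `|d| <= c by exact: hg.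
    have -> : s * g (amerge S (a, b)) = s * h a + s * d by rewrite /d; ring.
    have sd : `|s * d| <= s * c by rewrite normrM ger0_norm// ler_wpM2l.
    rewrite expRD (_ : _ + _ = expR (s * h a) * (1 + s * d + 2 * (s * c) ^+ 2)); last by ring.
    rewrite ler_wpM2l ?expR_ge0//; apply: (le_trans (expR_le_quad (le_trans sd sc))).
    rewrite lerD2l ler_pM2l// -(real_normK (num_real (s * d))).
    by rewrite ler_sqr ?nnegrE ?mulr_ge0.
  have id : itg Q (fun b => g (amerge S (a, b)) - h a) by apply: itgB => //; exact: itg_cst.
  apply: (@le_trans _ _ (Ex Q (fun b => expR (s * h a) * (1 + 2 * (s * c) ^+ 2) + (expR (s * h a) * s) * (g (amerge S (a, b)) - h a)))).
    by apply: le_Ex => //; apply: itgD; [exact: itg_cst|exact: itgZ].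
  rewrite ExD; [|exact: itg_cst|exact: itgZ]; rewrite Ex_cst ExZ// ExB//; last exact: itg_cst.
  rewrite Ex_cst -/(h a) subrr mulr0 addr0 mulrC ler_wpM2r ?expR_ge0//.
  exact: expR_ge1Dx.
rewrite ExZ//; apply: (@le_trans _ _ (expR (2 * (s * c) ^+ 2) * expR (s * Ex Q h + 2 * (s * c) ^+ 2 * k%:R))).
  by rewrite ler_wpM2l ?expR_ge0//; apply: (IH h B).
by rewrite -expRD ler_expR Eh -natr1; lra.
Qed.

Lemma mcdiarmid_tail (c delta : R) (n k : nat) (g : Arr R -> R) B : 1 <= c -> 0 < delta -> delta <= 1 -> (k <= n)%N ->
  measurable_fun setT g -> (forall a, `|g a| <= B) -> row_dep k g -> row_osc c g ->
  Pr Q [set a | Ex Q g + delta * n%:R <= g a] <= expR (- (delta ^+ 2 * n%:R / (8 * c ^+ 2))).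
Proof.
move=> c1 d0 d1 kn mg gB dg og.
have c0 : 0 < c by exact: lt_le_trans c1.
(* This minimises 2 (s c)^2 - s delta over s. *)
pose s := delta / (4 * c ^+ 2).
have c2 : 0 < 4 * c ^+ 2 by rewrite mulr_gt0// exprn_gt0.
have s0 : 0 < s by rewrite divr_gt0.
have sc : s * c = delta / (4 * c) by rewrite /s; field; rewrite gt_eqF.
have sc2 : s * c <= 2^-1.
  by rewrite sc ler_pdivrMr ?mulr_gt0//; move: c1 d1; lra.
have me : measurable_fun setT (fun a => expR (s * g a)).
  apply: (measurableT_comp (f := @expR R)); first exact: measurable_expR.
  by apply: measurable_funM => //; exact: measurable_cst.
have ie : itg Q (fun a => expR (s * g a)).
  apply: (@itg_bounded _ _ _ _ _ (expR (s * B))) => // a.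
  by rewrite ger0_norm ?expR_ge0// ler_expR ler_wpM2l// ?(ltW s0)// (le_trans (ler_norm _)).
have E := mcdiarmid_exp (ltW c0) (ltW s0) sc2 mg gB dg og.
have t0 : 0 < expR (s * (Ex Q g + delta * n%:R)) by exact: expR_gt0.
have M := markovP ie (fun a => expR_ge0 _) t0.
have -> : [set a | Ex Q g + delta * n%:R <= g a] = [set a | expR (s * (Ex Q g + delta * n%:R)) <= expR (s * g a)].
  by apply/seteqP; split => a /=; rewrite ler_expR ler_pM2l.
rewrite ler_pdivlMr// in M; have {}M := le_trans M E.
rewrite -(ler_pM2r t0); apply: (le_trans M); rewrite -expRD ler_expR.
have kn' : k%:R <= n%:R :> R by rewrite ler_nat.
have h : 2 * (s * c) ^+ 2 * k%:R <= 2 * (s * c) ^+ 2 * n%:R by rewrite ler_wpM2l// mulr_ge0// sqr_ge0.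
have e1 : s * (delta * n%:R) - delta ^+ 2 * n%:R / (8 * c ^+ 2) = 2 * (s * c) ^+ 2 * n%:R.
  by rewrite sc /s; field; rewrite gt_eqF.
by move: h; rewrite mulrDr; move: e1; lra.
Qed.

Lemma mcdiarmid (c delta : R) (n k : nat) (g : Arr R -> R) B : 1 <= c -> 0 < delta -> delta <= 1 -> (k <= n)%N ->
  measurable_fun setT g -> (forall a, `|g a| <= B) -> row_dep k g -> row_osc c g ->
  Pr Q [set a | delta * n%:R <= `|g a - Ex Q g|] <= 2 * expR (- (delta ^+ 2 * n%:R / (8 * c ^+ 2))).
Proof.
move=> c1 d0 d1 kn mg gB dg og.
have ig : itg Q g by exact: itg_bounded gB.
have T1 := mcdiarmid_tail c1 d0 d1 kn mg gB dg og.
have mg' : measurable_fun setT (fun a => - g a) by exact: measurableT_comp.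
have T2 := @mcdiarmid_tail c delta n k (fun a => - g a) B c1 d0 d1 kn mg'.
have {}T2 := T2 _ _ _.
have m1 : measurable [set a | Ex Q g + delta * n%:R <= g a] by apply: measurable_leRR => //; exact: measurable_cst.
have m2 : measurable [set a | Ex Q (fun a => - g a) + delta * n%:R <= - g a].
  by apply: measurable_leRR => //; exact: measurable_cst.
rewrite mulr_natl mulr2n.
have -> : [set a | delta * n%:R <= `|g a - Ex Q g|] = [set a | Ex Q g + delta * n%:R <= g a] `|`
   [set a | Ex Q (fun a => - g a) + delta * n%:R <= - g a].
  apply/seteqP; split => a /=.
    rewrite ExN// ler_normr => /orP[h|h]; [left|right]; move: h; lra.
  by rewrite ExN// => -[h|h]; rewrite ler_normr; apply/orP; [left|right]; move: h; lra.
apply: (le_trans (Pr_setU _ m1 m2)); apply: lerD => //; apply: T2.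
- by move=> a; rewrite normrN.
- by move=> a b ab; rewrite (dg a b ab).
- by move=> i a b ab; rewrite -opprD normrN; exact: og ab.
Qed.

End concentration.

Lemma dist_le_width (R : realDomainType) (x y c : R) : 0 <= x <= c -> 0 <= y <= c -> `|x - y| <= c.
Proof. by move=> /andP[? ?] /andP[? ?]; rewrite ler_norml; apply/andP; split; lra. Qed.

Section lndet_concentration.
Context (R : realType) (n : nat) (m : nat -> nat -> R[i]).

Definition lnosc : R := ln (1 + n%:R ^+ 7).

Lemma rdet_row_remove (a : Arr R) p i : (i < p)%N ->
  rdet (crows n m a (iota 0 p)) = rdet (crows n m a (rem i (iota 0 p))) *
    (1 + rq (crows n m a (rem i (iota 0 p))) ((n%:R : R)%:C%C *: crow n m a i)).
Proof.
move=> ip; rewrite -rdet_cons.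
have h : perm_eq (iota 0 p) (i :: rem i (iota 0 p)) by apply: perm_to_rem; rewrite mem_iota.
by rewrite /rdet (gS_perm (perm_map _ h)).
Qed.

Lemma lndet_row_remove (a : Arr R) p i : (i < p)%N ->
  lndet n m a p = ln (rdet (crows n m a (rem i (iota 0 p)))) +
    ln (1 + rq (crows n m a (rem i (iota 0 p))) ((n%:R : R)%:C%C *: crow n m a i)).
Proof.
move=> ip; rewrite /lndet (rdet_row_remove _ ip) lnM// posrE ?rdet_gt0//.
by rewrite ltr_wpDr// rq_ge0.
Qed.

Lemma ln_rq_bounds (a : Arr R) s i : 0 <= ln (1 + rq s ((n%:R : R)%:C%C *: crow n m a i)) <= lnosc.
Proof.
have q0 := rq_ge0 s ((n%:R : R)%:C%C *: crow n m a i).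
rewrite ln_ge0 ?lerDl//= /lnosc ler_ln ?posrE ?ltr_wpDr ?exprn_ge0//.
by rewrite lerD2l (le_trans (rq_le _ _))// rnorm_crow.
Qed.

Lemma lnosc_ge0 : 0 <= lnosc.
Proof. by rewrite ln_ge0// lerDl exprn_ge0. Qed.

Lemma eq_crow (a b : Arr R) i : (forall j, a i j = b i j) -> crow n m a i = crow n m b i.
Proof.
move=> ab; have ok : rowok n m a i = rowok n m b i.
  by rewrite /rowok /ent; under eq_forall do rewrite ab.
rewrite /crow ok; case: asboolP => // _; apply/rowP => j; by rewrite !mxE /ent ab.
Qed.

Lemma eq_crows (a b : Arr R) l : (forall i j, i \in l -> a i j = b i j) -> crows n m a l = crows n m b l.
Proof.
by move=> ab; rewrite /crows; apply/eq_in_map => i il; rewrite (@eq_crow a b)// => j; exact: ab.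
Qed.

Lemma lndet_dep p : row_dep p (fun a => lndet n m a p).
Proof.
move=> a b ab; rewrite /lndet (@eq_crows a b)// => i j.
by rewrite mem_iota add0n => ip; exact: ab.
Qed.

(** Without row i the determinant is common to both arrays; row i adds ln (1 + q) with 0 <= q <=
    n^7. *)
Lemma lndet_osc p : row_osc lnosc (fun a => lndet n m a p).
Proof.
move=> i a b ab; have [ip|ip] := ltnP i p; last first.
  rewrite (@lndet_dep p a b) ?subrr ?normr0 ?lnosc_ge0// => i' j i'p; apply: ab.
  by apply/eqP => E; rewrite E ltnNge ip in i'p.
rewrite !(lndet_row_remove _ ip) (@eq_crows a b); last first.
  by move=> i' j; rewrite mem_rem_uniq ?iota_uniq// inE => /andP[i'i _]; exact: ab.
set s := crows _ _ _ _.
by rewrite opprD addrACA subrr add0r; apply: dist_le_width; exact: ln_rq_bounds.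
Qed.

Lemma lndet_ge0 (a : Arr R) p : 0 <= lndet n m a p.
Proof. by rewrite ln_ge0// rdet_ge1. Qed.

Lemma lndet_le (a : Arr R) p : lndet n m a p <= p%:R * lnosc.
Proof.
rewrite /lndet; elim: (p) => [|q IH].
  by rewrite /rdet /crows /= /gS big_nil addr0 det1 /= ln1 mul0r.
have h : perm_eq (iota 0 q.+1) (q :: iota 0 q) by rewrite -addn1 iotaD add0n perm_catC.
rewrite /rdet (gS_perm (perm_map _ h)) -/(rdet _) /= rdet_cons lnM ?posrE ?rdet_gt0//; last first.
  by rewrite ltr_wpDr// rq_ge0.
have /andP[_ h2] := ln_rq_bounds a (crows n m a (iota 0 q)) q.
by rewrite -natr1 mulrDl mul1r lerD.
Qed.

End lndet_concentration.

(** * Replacing one row *)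

Section pair_variance.
Context (R : realType) (mu : probability (borelC R) R) (Q : probability (Arr R) R).
Hypothesis iidQ : iid_law mu Q.
Let Qi : indep_law Q := iidQ.1.
Hypothesis sqi : itg mu (fun x : borelC R => cabs (x : R[i]) ^+ 2).
Variables (n : nat) (i : nat).

Definition dom2 (a : Arr R) : R := 1 + \sum_(j < n) cabs (ent a i j) ^+ 2.

Lemma dom2_ge1 a : 1 <= dom2 a.
Proof. by rewrite lerDl sumr_ge0// => j _; rewrite sqr_ge0. Qed.

Lemma itg_dom2 : itg Q dom2.
Proof.
apply: itgD; first exact: itg_cst.
by apply: itg_sum => j; have [] := Ex_coord iidQ i j sqi.
Qed.

Lemma dom2_merge l a b : dom2 (amerge (predC1 (i, l)) (a, b)) <= dom2 a + dom2 b.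
Proof.
have -> : dom2 a + dom2 b = 1 + (1 + \sum_(j < n) (cabs (ent a i j) ^+ 2 + cabs (ent b i j) ^+ 2)).
  by rewrite big_split /dom2 /=; ring.
rewrite lerD2l (@le_trans _ _ (\sum_(j < n) (cabs (ent a i j) ^+ 2 + cabs (ent b i j) ^+ 2)))//; last first.
  by rewrite lerDr.
apply: ler_sum => j _; rewrite ent_amerge; case: ifP => _.
  by rewrite lerDl sqr_ge0.
by rewrite lerDr sqr_ge0.
Qed.

(** Centring in a single entry, conditionally on all the others. Domination by [dom2], which is
    stable under merging, makes every section integrable. *)
Lemma Ex_vanish (F : Arr R -> R) (C : R) l : 0 <= C -> measurable_fun setT F ->
  (forall a, `|F a| <= C * dom2 a) ->
  (forall a, Ex Q (fun b => F (amerge (predC1 (i, l)) (a, b))) = 0) -> Ex Q F = 0.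
Proof.
move=> C0 mF hF h.
have iF : itg Q F by apply: itg_dom mF hF _; apply: itgZ; exact: itg_dom2.
rewrite (Ex_merge Qi (S := predC1 (i, l)) iF).
  by rewrite (eq_Ex _ (g := fun=> 0)) ?Ex_cst// => a; exact: h.
move=> a; apply: (itg_dom (g := fun b => C * (dom2 a + dom2 b))).
- by apply: measurableT_comp mF _; exact: measurable_merge_snd.
- by move=> b; apply: (le_trans (hF _)); rewrite ler_wpM2l// dom2_merge.
- by apply: itgZ; apply: itgD; [exact: itg_cst|exact: itg_dom2].
Qed.

Variable Y : 'I_n -> 'I_n -> borelC R -> borelC R -> R.
Variable C : R.
Hypothesis C0 : 0 <= C.
Hypothesis mY : forall j k, measurable_fun setT (fun a : Arr R => Y j k (a i j) (a i k)).
Hypothesis mY1 : forall j k v, measurable_fun setT (fun u => Y j k u v).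
Hypothesis mY2 : forall j k u, measurable_fun setT (fun v => Y j k u v).
Hypothesis mY3 : forall j, measurable_fun setT (fun u => Y j j u u).
Hypothesis bY : forall j k u v, `|Y j k u v| <= C * (1 + cabs (u : R[i]) + cabs (v : R[i])).
Hypothesis z1 : forall j k v, j != k -> Ex mu (fun u => Y j k u v) = 0.
Hypothesis z2 : forall j k u, j != k -> Ex mu (fun v => Y j k u v) = 0.
Hypothesis z3 : forall j, Ex mu (fun u => Y j j u u) = 0.

Let y (p : 'I_n * 'I_n) (a : Arr R) := Y p.1 p.2 (a i p.1) (a i p.2).

Let x2_le a (j : 'I_n) : cabs (ent a i j) ^+ 2 <= dom2 a.
Proof.
rewrite /dom2 (bigD1 j)//= addrCA lerDl addr_ge0// sumr_ge0// => k _; exact: sqr_ge0.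
Qed.

Let lin_sq (u v w : R) : 0 <= u -> 0 <= v -> u ^+ 2 <= w -> v ^+ 2 <= w -> 1 <= w ->
  (1 + u + v) ^+ 2 <= 9 * w.
Proof.
move=> _ _ uw vw w1; have h1 := sqr_ge0 (u - 1); have h2 := sqr_ge0 (v - 1); have h3 := sqr_ge0 (u - v).
by rewrite (_ : (1 + u + v) ^+ 2 = 3 * (1 + u ^+ 2 + v ^+ 2) - (u - 1) ^+ 2 - (v - 1) ^+ 2 - (u - v) ^+ 2); [lra|ring].
Qed.

Let y_le p a : `|y p a| <= C * (1 + cabs (ent a i p.1) + cabs (ent a i p.2)).
Proof. exact: bY. Qed.

Let y2_le p a : `|y p a| ^+ 2 <= C ^+ 2 * 9 * dom2 a.
Proof.
apply: (@le_trans _ _ ((C * (1 + cabs (ent a i p.1) + cabs (ent a i p.2))) ^+ 2)).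
  by rewrite ler_sqr ?nnegrE ?mulr_ge0 ?addr_ge0 ?cabs_ge0//; exact: y_le.
rewrite exprMn -mulrA ler_wpM2l ?sqr_ge0//.
by apply: lin_sq; rewrite ?cabs_ge0 ?x2_le ?dom2_ge1.
Qed.

Let yy_le p p' a : `|y p a * y p' a| <= C ^+ 2 * 9 * dom2 a.
Proof.
rewrite normrM; have := y2_le p a; have := y2_le p' a.
have : 0 <= (`|y p a| - `|y p' a|) ^+ 2 by exact: sqr_ge0.
by move: (`|y p a|) (`|y p' a|) (C ^+ 2 * 9 * dom2 a) => s t w; nra.
Qed.

Let yy_meas p p' : measurable_fun setT (fun a => y p a * y p' a).
Proof. by apply: measurable_funM; exact: mY. Qed.

Let yy_itg p p' : itg Q (fun a => y p a * y p' a).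
Proof.
apply: itg_dom (yy_meas p p') (yy_le p p') _; apply: itgZ; exact: itg_dom2.
Qed.

Let abs1 : itg mu (fun x : borelC R => 1 + cabs (x : R[i]) ^+ 2).
Proof. by apply: itgD => //; exact: itg_cst. Qed.

Let lin_itg (h : borelC R -> R) c1 c2 : 0 <= c1 -> 0 <= c2 -> measurable_fun setT h ->
  (forall u, `|h u| <= c1 * (c2 + cabs (u : R[i]))) -> itg mu h.
Proof.
move=> c10 c20 mh hh; apply: (itg_dom (g := fun u : borelC R => c1 * (c2 + (1 + cabs (u : R[i]) ^+ 2)))) => //.
  move=> u; apply: (le_trans (hh u)); rewrite ler_wpM2l// lerD2l.
  have : 0 <= (cabs (u : R[i]) - 1) ^+ 2 by exact: sqr_ge0.
  by have := sqr_ge0 (cabs (u : R[i])); nra.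
by apply: itgZ; apply: itgD; [exact: itg_cst|exact: abs1].
Qed.

Let Ey_section p (l : 'I_n) a : (p.1 == l) || (p.2 == l) ->
  Ex Q (fun b => y p (amerge (predC1 (i, (l : nat))) (a, b))) = 0 /\
  itg Q (fun b => y p (amerge (predC1 (i, (l : nat))) (a, b))).
Proof.
case: p => j k /= jk; rewrite /y /=.
have neq (j' : 'I_n) : j' != l -> predC1 (i, (l : nat)) (i, (j' : nat)).
  move=> h /=; apply/negP => /eqP[/val_inj E]; by rewrite E eqxx in h.
have e1 (j' : 'I_n) b : amerge (predC1 (i, (l : nat))) (a, b) i j' = if j' == l then b i l else a i j'.
  rewrite /amerge; case: eqVneq => [->|h]; first by rewrite /= eqxx.
  by rewrite (neq _ h).
have [jl|jl] := eqVneq j l; have [kl|kl] := eqVneq k l.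
- have -> : (fun b => Y j k (amerge (predC1 (i, (l : nat))) (a, b) i j) (amerge (predC1 (i, (l : nat))) (a, b) i k)) =
    fun b : Arr R => Y l l (b i l) (b i l).
    by apply/funext => b; rewrite !e1 jl kl eqxx.
  have [|h1 h2] := @Ex_coord _ _ _ iidQ i l (fun u => Y l l u u).
    apply: (lin_itg (c1 := C * 2) (c2 := 1)) => //; first by rewrite mulr_ge0.
    by move=> u; apply: (le_trans (bY _ _ _ _)); rewrite -mulrA ler_wpM2l//; have := cabs_ge0 (u : R[i]); lra.
  by rewrite h2 z3.
- have -> : (fun b => Y j k (amerge (predC1 (i, (l : nat))) (a, b) i j) (amerge (predC1 (i, (l : nat))) (a, b) i k)) =
    fun b : Arr R => Y l k (b i l) (a i k).
    by apply/funext => b; rewrite !e1 jl eqxx (negbTE kl).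
  have [|h1 h2] := @Ex_coord _ _ _ iidQ i l (fun u => Y l k u (a i k)).
    apply: (lin_itg (c1 := C) (c2 := 1 + cabs (ent a i k))) => //; first by rewrite addr_ge0 ?cabs_ge0.
    by move=> u; apply: (le_trans (bY _ _ _ _)); rewrite ler_wpM2l// addrAC.
  by rewrite h2 z1// eq_sym.
- have -> : (fun b => Y j k (amerge (predC1 (i, (l : nat))) (a, b) i j) (amerge (predC1 (i, (l : nat))) (a, b) i k)) =
    fun b : Arr R => Y j l (a i j) (b i l).
    by apply/funext => b; rewrite !e1 kl eqxx (negbTE jl).
  have [|h1 h2] := @Ex_coord _ _ _ iidQ i l (fun u => Y j l (a i j) u).
    by apply: (lin_itg (c1 := C) (c2 := 1 + cabs (ent a i j))) => //; rewrite addr_ge0 ?cabs_ge0.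
  by rewrite h2 z2.
- by rewrite (negbTE jl) (negbTE kl) in jk.
Qed.

Let vanish1 p p' (l : 'I_n) : (p.1 == l) || (p.2 == l) -> p'.1 != l -> p'.2 != l ->
  Ex Q (fun a => y p a * y p' a) = 0.
Proof.
move=> pl h1 h2.
have C90 : 0 <= C ^+ 2 * 9 by rewrite mulr_ge0// sqr_ge0.
apply: (Ex_vanish (l := l) C90 (yy_meas p p') (yy_le p p')) => a.
have [e0 ie] := Ey_section a pl.
have e2 b : y p' (amerge (predC1 (i, (l : nat))) (a, b)) = y p' a.
  have neq (j' : 'I_n) : j' != l -> predC1 (i, (l : nat)) (i, (j' : nat)).
    move=> h /=; apply/negP => /eqP[/val_inj E]; by rewrite E eqxx in h.
  by rewrite /y /amerge !neq.
rewrite (eq_Ex _ (g := fun b => y p' a * y p (amerge (predC1 (i, (l : nat))) (a, b)))).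
  by rewrite ExZ// e0 mulr0.
by move=> b; rewrite e2 mulrC.
Qed.

Let vanish p p' : p' != p -> p' != (p.2, p.1) -> Ex Q (fun a => y p a * y p' a) = 0.
Proof.
case: p p' => j k [j' k'] /=; rewrite !xpair_eqE => h1 h2.
have sym : Ex Q (fun a => y (j, k) a * y (j', k') a) = Ex Q (fun a => y (j', k') a * y (j, k) a).
  by apply: eq_Ex => a; rewrite mulrC.
have [|n1] := boolP ((j' != j) && (k' != j)).
  by move=> /andP[? ?]; apply: (vanish1 (l := j)); rewrite //= eqxx.
have [|n2] := boolP ((j' != k) && (k' != k)).
  by move=> /andP[? ?]; apply: (vanish1 (l := k)); rewrite //= eqxx orbT.
have [|n3] := boolP ((j != j') && (k != j')).
  by move=> /andP[? ?]; rewrite sym; apply: (vanish1 (l := j')); rewrite //= eqxx.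
have [|n4] := boolP ((j != k') && (k != k')).
  by move=> /andP[? ?]; rewrite sym; apply: (vanish1 (l := k')); rewrite //= eqxx orbT.
exfalso; move: n1 n2 n3 n4; rewrite !negb_and !negbK => n1 n2 n3 n4.
move/orP: n1 => [/eqP Ej|/eqP Ek]; subst.
  rewrite eqxx /= in h1; move: n4; rewrite (eq_sym k) (negbTE h1) orbF => /eqP Ej.
  by subst; move: n2; rewrite (negbTE h1).
rewrite eqxx andbT in h2; move: n3; rewrite (eq_sym k) (negbTE h2) orbF => /eqP Ej.
by subst; move: n2; rewrite (negbTE h2).
Qed.

(** Products of the terms at p and p' have mean 0 unless p' is p or its transpose, since otherwise
    some index occurs in only one of the two pairs and its entry is centred there. Transposed pairs
    are bounded by the arithmetic-geometric inequality, whence the factor 2. *)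
Lemma pair_variance :
  Ex Q (fun a => (\sum_j \sum_k Y j k (a i j) (a i k)) ^+ 2) <=
  2 * \sum_j \sum_k Ex Q (fun a => Y j k (a i j) (a i k) ^+ 2).
Proof.
rewrite (eq_Ex _ (g := fun a => \sum_p \sum_p' y p a * y p' a)); last first.
  by move=> a; rewrite pair_bigA /= expr2 big_distrlr.
rewrite Ex_sum; last by move=> p; apply: itg_sum => p'.
rewrite (eq_bigr (fun p => \sum_p' Ex Q (fun a => y p a * y p' a))); last by move=> p _; rewrite Ex_sum.
pose e p := Ex Q (fun a => y p a * y p a).
pose sw (p : 'I_n * 'I_n) := (p.2, p.1).
have e0 p : 0 <= e p by apply: Ex_ge0 => a; rewrite -expr2 sqr_ge0.
have cs p : Ex Q (fun a => y p a * y (sw p) a) <= (e p + e (sw p)) / 2.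
  rewrite mulrC -ExD// -ExZ; last by apply: itgD.
  apply: le_Ex => //; first by apply: itgZ; apply: itgD.
  by move=> a; have := sqr_ge0 (y p a - y (sw p) a); lra.
have hp p : \sum_p' Ex Q (fun a => y p a * y p' a) <= e p + (e p + e (sw p)) / 2.
  rewrite (bigD1 p)//= -/(e p) lerD2l.
  have [sp|sp] := eqVneq (sw p) p.
    rewrite big1; first by rewrite divr_ge0// addr_ge0.
    by move=> p' pp'; apply: vanish => //; rewrite -/(sw p) sp.
  rewrite (bigD1 (sw p))//= big1 ?addr0//.
  by move=> p' /andP[h1 h2]; exact: vanish.
apply: (@le_trans _ _ (\sum_p (e p + (e p + e (sw p)) / 2))); first exact: ler_sum.
have es : \sum_p e (sw p) = \sum_p e p.
  rewrite [RHS](reindex sw)//=; exists sw => p _; by case: p.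
have -> : \sum_j \sum_k Ex Q (fun a => Y j k (a i j) (a i k) ^+ 2) = \sum_p e p.
  by rewrite pair_bigA /=; apply: eq_bigr => p _; apply: eq_Ex => a; rewrite expr2.
rewrite !big_split /= -mulr_suml !big_split /= es.
by rewrite le_eqVlt; apply/orP; left; apply/eqP; field.
Qed.

End pair_variance.

(** * Quadratic forms of the resolvent *)

Section quadratic_form.
Context (R : realType) (n : nat) (s : seq 'rV[R[i]]_n).

Definition trQ : R := complex.Re (\tr (gQ s)).

Lemma rq_sum r : rq s r = \sum_j \sum_k complex.Re (gQ s j k * (r 0 j * Num.conj_op (r 0 k))).
Proof.
rewrite /rq dotE Re_sum exchange_big; apply: eq_bigr => k _.
rewrite mxE mulr_suml Re_sum; apply: eq_bigr => j _.
by congr complex.Re; ring.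
Qed.

Lemma rq_scale (c : R) r : rq s (c%:C%C *: r) = c ^+ 2 * rq s r.
Proof.
rewrite /rq -scalemxAl dotZl dotZr mulrA conjCE /= oppr0 -rmorphM /= -expr2 rqE -rmorphM /=.
by [].
Qed.

Lemma rqD r r' : rq s (r + r') = rq s r + 2 * complex.Re (dot r' (r *m gQ s)) + rq s r'.
Proof.
rewrite /rq mulmxDl !dotDl !dotDr !ReD.
have e1 : complex.Re (dot (r *m gQ s) r') = complex.Re (dot r' (r *m gQ s)).
  by rewrite -(dot_conj r' (r *m gQ s)); case: (dot r' _).
have e2 : complex.Re (dot (r' *m gQ s) r) = complex.Re (dot r' (r *m gQ s)).
  by rewrite dotM gQ_herm.
by rewrite e1 e2 mulr_natl mulr2n !addrA.
Qed.

Lemma rq_delta (j : 'I_n) : (rq s (dotdelta _ j : 'rV[R[i]]_n))%:C%C = gQ s j j.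
Proof.
rewrite -rqE /dot; have -> : hc (dotdelta _ j : 'rV[R[i]]_n) = delta_mx j 0.
  by apply/matrixP => a b; rewrite hcE !mxE andbC; case: andP; rewrite ?conjC1 ?conjC0.
rewrite /dotdelta -rowE mxE (bigD1 j)//= !mxE !eqxx mulr1 big1 ?addr0// => k kj.
by rewrite !mxE (negbTE kj) mulr0.
Qed.

Lemma trQ_sum : trQ = \sum_j complex.Re (gQ s j j).
Proof. by rewrite /trQ /mxtrace Re_sum. Qed.

Lemma trQ_ge0 : 0 <= trQ.
Proof. by rewrite trQ_sum sumr_ge0// => j _; rewrite -rq_delta rq_ge0. Qed.

Lemma trQ_le : trQ <= n%:R.
Proof.
rewrite trQ_sum -[X in _ <= X%:R]card_ord -sumr_const; apply: ler_sum => j _.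
rewrite -rq_delta; apply: (le_trans (rq_le _ _)).
by rewrite /rnorm dot_delta.
Qed.

Lemma trQ_ge : n%:R - (size s)%:R <= trQ.
Proof.
have := tr_gQ s; rewrite lecE => /andP[_]; rewrite /trQ => h; apply: le_trans h.
by rewrite ReD ReN -!(rmorph_nat (@real_complex R)).
Qed.

(** The left side is tr Q^2, and Q^2 <= Q by [gQ_ge]. *)
Lemma gQ_norm_le : \sum_j \sum_k cabs (gQ s j k) ^+ 2 <= trQ.
Proof.
rewrite trQ_sum; apply: ler_sum => j _; rewrite -rq_delta.
have [_ [h _]] := gQ_ge s (dotdelta _ j : 'rV[R[i]]_n); move: h; rewrite rnormE rqE lecR.
apply: le_trans; rewrite rnorm_sum le_eqVlt; apply/orP; left; apply/eqP; apply: eq_bigr => k _.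
by rewrite /dotdelta -rowE mxE.
Qed.

Lemma mulQ_norm_le r : \sum_j cabs ((r *m gQ s) 0 j) ^+ 2 <= rq s r.
Proof.
by rewrite -rnorm_sum -lecR -rnormE -rqE; have [_ []] := gQ_ge s r.
Qed.

End quadratic_form.

Section swap.
Context (R : realType) (mu : probability (borelC R) R) (Q : probability (Arr R) R).
Hypothesis iidQ : iid_law mu Q.
Let Qi : indep_law Q := iidQ.1.
Hypothesis sqi : itg mu (fun x : borelC R => cabs (x : R[i]) ^+ 2).
Hypothesis var1 : Ex mu (fun x : borelC R => cabs (x : R[i]) ^+ 2) = 1.

Definition centered (f : borelC R -> R[i]) := [/\ cmeas f,
  itg mu (fun x => cabs (f x) ^+ 2), Ex mu (fun x => complex.Re (f x)) = 0 & Ex mu (fun x => complex.Im (f x)) = 0].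

Lemma centered_itg f : centered f -> itg mu (fun x => complex.Re (f x)) /\ itg mu (fun x => complex.Im (f x)).
Proof.
move=> [[m1 m2] sq _ _].
have i1 : itg mu (fun x => 1 + cabs (f x) ^+ 2) by apply: itgD => //; exact: itg_cst.
have h (x : borelC R) (u : R) : `|u| <= cabs (f x) -> `|u| <= 1 + cabs (f x) ^+ 2.
  move/le_trans; apply; have := sqr_ge0 (cabs (f x) - 1); have := sqr_ge0 (cabs (f x)); nra.
split; apply: itg_dom i1 => // x; apply: h; [exact: Re_le_cabs|exact: Im_le_cabs].
Qed.

Lemma Ex_Re_mul f c : centered f ->
  itg mu (fun x => complex.Re (c * f x)) /\ Ex mu (fun x => complex.Re (c * f x)) = 0.
Proof.
move=> cf; have [i1 i2] := centered_itg cf; have [_ _ e1 e2] := cf.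
have E x : complex.Re (c * f x) = complex.Re c * complex.Re (f x) - complex.Im c * complex.Im (f x) by case: c => ? ?; case: (f x).
split; first by apply: (eq_itg (fun x => esym (E x))); apply: itgB; exact: itgZ.
rewrite (eq_Ex _ E) ExB; [|exact: itgZ|exact: itgZ]; by rewrite !ExZ// e1 e2; ring.
Qed.

Section row_swap.
Variables (n : nat) (m : nat -> nat -> R[i]) (i : nat) (s : seq 'rV[R[i]]_n).

Definition mrow : 'rV[R[i]]_n := \row_(j < n) m i j.
Definition frow (f : borelC R -> R[i]) (a : Arr R) : 'rV[R[i]]_n := \row_(j < n) f (a i j).

Lemma cmeas_coord (f : borelC R -> R[i]) (j : nat) : cmeas f -> cmeas (fun a : Arr R => f (a i j)).
Proof. by move=> [m1 m2]; split; [exact: (measurableT_comp m1 (@measurable_coord R i j))|exact: (measurableT_comp m2 (@measurable_coord R i j))]. Qed.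

Lemma measurable_rq (r : Arr R -> 'rV[R[i]]_n) : (forall j, cmeas (fun a => r a 0 j)) ->
  measurable_fun setT (fun a => rq s (r a)).
Proof.
move=> mr; rewrite (_ : (fun a => _) = fun a => complex.Re (\sum_j \sum_k gQ s j k * (r a 0 j * Num.conj_op (r a 0 k)))).
  suff [] : cmeas (fun a => \sum_j \sum_k gQ s j k * (r a 0 j * Num.conj_op (r a 0 k))) by [].
  apply: cmeas_sum => j; apply: cmeas_sum => k; apply: cmeasM; first exact: cmeas_cst.
  by apply: cmeasM => //; exact: cmeas_conj.
by apply/funext => a; rewrite rq_sum Re_sum; apply: eq_bigr => j _; rewrite Re_sum.
Qed.

Lemma Ex_offdiag f (j k : 'I_n) c c1 : centered f -> 0 <= c1 ->
  (forall u, cabs (f u) <= c1 * (1 + cabs (u : R[i]))) -> j != k ->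
  itg Q (fun a => complex.Re (c * (f (a i j) * Num.conj_op (f (a i k))))) /\
  Ex Q (fun a => complex.Re (c * (f (a i j) * Num.conj_op (f (a i k))))) = 0.
Proof.
move=> cf c10 hf jk; have [mf sf _ _] := cf.
have mF : measurable_fun setT (fun a : Arr R => complex.Re (c * (f (a i j) * Num.conj_op (f (a i k))))).
  suff [] : cmeas (fun a : Arr R => c * (f (a i j) * Num.conj_op (f (a i k)))) by [].
  by apply: cmeasM; [exact: cmeas_cst|apply: cmeasM; [exact: cmeas_coord|apply: cmeas_conj; exact: cmeas_coord]].
have bF (a : Arr R) : `|complex.Re (c * (f (a i j) * Num.conj_op (f (a i k))))| <= cabs c * c1 ^+ 2 * 2 * dom2 n i a.
  apply: (le_trans (Re_le_cabs _)); rewrite !cabsM cabs_conj.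
  apply: (@le_trans _ _ (cabs c * (c1 ^+ 2 * (2 * dom2 n i a)))); last by rewrite !mulrA.
  apply: ler_wpM2l; first exact: cabs_ge0.
  have h2 : (1 + cabs (ent a i j)) * (1 + cabs (ent a i k)) <= 2 * dom2 n i a.
    rewrite /dom2 (bigD1 j)//= (bigD1 k) 1?eq_sym//=.
    have : 0 <= \sum_(l < n | (l != j) && (l != k)) cabs (ent a i l) ^+ 2 by rewrite sumr_ge0// => l _; rewrite sqr_ge0.
    move: (cabs (ent a i j)) (cabs (ent a i k)) => u v S0.
    by have := sqr_ge0 (u - 1); have := sqr_ge0 (v - 1); have := sqr_ge0 (u - v); nra.
  apply: (@le_trans _ _ ((c1 * (1 + cabs (ent a i j))) * (c1 * (1 + cabs (ent a i k))))).
    by apply: ler_pM; rewrite ?cabs_ge0//; exact: hf.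
  by rewrite mulrACA -expr2; apply: ler_wpM2l; [exact: sqr_ge0|exact: h2].
have C0 : 0 <= cabs c * c1 ^+ 2 * 2 by rewrite !mulr_ge0 ?cabs_ge0 ?sqr_ge0.
split.
  by apply: (itg_dom mF bF); apply: itgZ; exact: (itg_dom2 iidQ sqi).
apply: (Ex_vanish iidQ sqi (l := j) C0 mF bF) => a.
have e1 b : amerge (predC1 (i, (j : nat))) (a, b) i j = b i j by rewrite /amerge /= eqxx.
have e2 b : amerge (predC1 (i, (j : nat))) (a, b) i k = a i k.
  by rewrite /amerge /=; case: eqP => // -[/val_inj E]; rewrite E eqxx in jk.
rewrite (eq_Ex _ (g := fun b : Arr R => complex.Re ((c * Num.conj_op (f (a i k))) * f (b i j)))).
  have [h1 h2] := Ex_Re_mul (c * Num.conj_op (f (a i k))) cf.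
  by have [_ ->] := Ex_coord iidQ i j h1.
by move=> b; rewrite e1 e2 mulrA mulrAC.
Qed.

(** Off-diagonal terms vanish by independence and centring, leaving the trace times the variance. *)
Lemma Ex_rq f c1 : centered f -> 0 <= c1 -> (forall u, cabs (f u) <= c1 * (1 + cabs (u : R[i]))) ->
  itg Q (fun a => rq s (frow f a)) /\ Ex Q (fun a => rq s (frow f a)) = trQ s * Ex mu (fun x => cabs (f x) ^+ 2).
Proof.
move=> cf c10 hf; have [mf sf _ _] := cf.
pose G j k (a : Arr R) := complex.Re (gQ s j k * (f (a i j) * Num.conj_op (f (a i k)))).
have E a : rq s (frow f a) = \sum_j \sum_k G j k a.
  by rewrite rq_sum; apply: eq_bigr => j _; apply: eq_bigr => k _; rewrite !mxE.
have diag j : itg Q (G j j) /\ Ex Q (G j j) = complex.Re (gQ s j j) * Ex mu (fun x => cabs (f x) ^+ 2).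
  have e a : G j j a = complex.Re (gQ s j j) * cabs (f (a i j)) ^+ 2.
    by rewrite /G mulJ_cabs; case: (gQ s j j) => p q /=; rewrite mulr0 subr0.
  have [h1 h2] := Ex_coord iidQ i j sf.
  split; first by apply: (eq_itg (fun a => esym (e a))); exact: itgZ.
  by rewrite (eq_Ex _ e) ExZ// h2.
have ig j k : itg Q (G j k).
  have [->|jk] := eqVneq j k; first by have [] := diag k.
  by have [] := Ex_offdiag (gQ s j k) cf c10 hf jk.
split.
  by apply: (eq_itg (fun a => esym (E a))); apply: itg_sum => j; apply: itg_sum.
rewrite (eq_Ex _ E) Ex_sum; last by move=> j; apply: itg_sum.
rewrite trQ_sum mulr_suml; apply: eq_bigr => j _.
rewrite Ex_sum// (bigD1 j)//= big1 ?addr0; first by have [_ ->] := diag j.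
by move=> k kj; have [|_ ->] := @Ex_offdiag f j k (gQ s j k) c1 cf c10 hf; rewrite // eq_sym.
Qed.

Lemma Ex_lin f (v : 'rV[R[i]]_n) : centered f ->
  itg Q (fun a => complex.Re (dot (frow f a) v)) /\ Ex Q (fun a => complex.Re (dot (frow f a) v)) = 0.
Proof.
move=> cf; have E a : complex.Re (dot (frow f a) v) = \sum_j complex.Re (Num.conj_op (v 0 j) * f (a i j)).
  by rewrite dotE Re_sum; apply: eq_bigr => j _; rewrite mxE mulrC.
have h j := Ex_Re_mul (Num.conj_op (v 0 j)) cf.
have h2 (j : 'I_n) := Ex_coord iidQ i j (h j).1.
split; first by apply: (eq_itg (fun a => esym (E a))); apply: itg_sum => j; have [] := h2 j.
rewrite (eq_Ex _ E) Ex_sum; last by move=> j; have [] := h2 j.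
by rewrite big1// => j _; have [_ ->] := h2 j; have [] := h j.
Qed.

End row_swap.
End swap.

Lemma prod_diff_alg (A : comNzRingType) (x p g q : A) :
  x * p - (x - g) * (p - q) = x * q + g * p - g * q.
Proof. by ring. Qed.

Lemma Wdev_arith (R : realDomainType) (q c y X f e : R) : 0 <= e ->
  q + c * y + (f - e + (2 * X - y * c)) <= q + 2 * X + f.
Proof. by move=> e0; lra. Qed.

Section truncated.
Context (R : realType) (mu : probability (borelC R) R) (Q : probability (Arr R) R).
Hypothesis iidQ : iid_law mu Q.
Hypothesis sqi : itg mu (fun x : borelC R => cabs (x : R[i]) ^+ 2).
Hypothesis var1 : Ex mu (fun x : borelC R => cabs (x : R[i]) ^+ 2) = 1.
Variables (n : nat) (m : nat -> nat -> R[i]) (i : nat) (s : seq 'rV[R[i]]_n).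
Local Notation centered := (centered mu).
Local Notation mrow := (mrow n m i).
Local Notation frow := (frow n i).
Variables (g : borelC R -> R[i]) (B t : R).
Hypothesis B0 : 0 <= B.
Hypothesis cid : centered (fun x : borelC R => (x : R[i])).
Hypothesis cg : centered g.
Hypothesis gB : forall u, cabs (g u) <= B.
Let h (u : borelC R) : R[i] := (u : R[i]) - g u.
Let tau := Ex mu (fun u => cabs (h u) ^+ 2).
Hypothesis tau_le : tau <= t.
Hypotheses (t0 : 0 < t) (t1 : t <= 1).

Let h_le u : cabs (h u) <= (1 + B) * (1 + cabs (u : R[i])).
Proof.
apply: (le_trans (cabs_triB _ _)); have := gB u; have := cabs_ge0 (u : R[i]); move: B0.
by move=> b0 u0 gu; have := mulr_ge0 b0 u0; lra.
Qed.

Let ch : centered h.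
Proof.
have [m1 s1 e1 e2] := cid; have [m2 s2 e3 e4] := cg.
have [r1 r2] := centered_itg cid; have [r3 r4] := centered_itg cg.
have mh : cmeas h by exact: cmeasB.
split => //.
- apply: (itg_dom (g := fun u : borelC R => (1 + B) ^+ 2 * (2 * (1 + cabs (u : R[i]) ^+ 2)))).
  + by apply: measurable_funX; exact: measurable_cabs.
  + move=> u; rewrite ger0_norm ?sqr_ge0//.
    apply: (@le_trans _ _ (((1 + B) * (1 + cabs (u : R[i]))) ^+ 2)).
      by rewrite ler_sqr ?nnegrE ?mulr_ge0 ?addr_ge0 ?cabs_ge0.
    rewrite exprMn ler_wpM2l ?sqr_ge0//.
    by have := sqr_ge0 (cabs (u : R[i]) - 1); lra.
  + by apply: itgZ; apply: itgZ; apply: itgD => //; exact: itg_cst.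
- rewrite (eq_Ex _ (g := fun u : borelC R => complex.Re (u : R[i]) - complex.Re (g u))).
    by rewrite ExB// e1 e3 subrr.
  by move=> u; rewrite /h ReD ReN.
- rewrite (eq_Ex _ (g := fun u : borelC R => complex.Im (u : R[i]) - complex.Im (g u))).
    by rewrite ExB// e2 e4 subrr.
  by move=> u; rewrite /h ImD ImN.
Qed.

Let tau0 : 0 <= tau. Proof. by apply: Ex_ge0 => u; exact: sqr_ge0. Qed.

Let v : 'rV[R[i]]_n := mrow *m gQ s.

(** With only two moments the quadratic form in x need not have a variance. Subtracting the form in
    the truncation error h leaves products with a bounded factor [g], see [prod_diff], and these
    have second moments. The diagonal carries the linear term of the shifted row and the centring
    constant. *)
Let Y (j k : 'I_n) (u w : borelC R) : R :=
  complex.Re (gQ s j k * ((u : R[i]) * Num.conj_op (w : R[i]) - h u * Num.conj_op (h w))) +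
  (if j == k then 2 * complex.Re (Num.conj_op (v 0 j) * (u : R[i])) - complex.Re (gQ s j j) * (1 - tau) else 0).

Let Kq := \sum_j \sum_k cabs (gQ s j k).
Let Kv := \sum_j cabs (v 0 j).

Let Kq_ge j k : cabs (gQ s j k) <= Kq.
Proof.
rewrite /Kq (bigD1 j)//= (bigD1 k)//= -addrA lerDl addr_ge0// sumr_ge0// => l _; rewrite ?cabs_ge0//.
by apply: sumr_ge0 => l' _; exact: cabs_ge0.
Qed.

Let Kv_ge j : cabs (v 0 j) <= Kv.
Proof. by rewrite /Kv (bigD1 j)//= lerDl sumr_ge0// => l _; exact: cabs_ge0. Qed.

Let prod_diff u w : cabs ((u : R[i]) * Num.conj_op (w : R[i]) - h u * Num.conj_op (h w)) <=
  B * cabs (u : R[i]) + B * cabs (w : R[i]) + B ^+ 2.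
Proof.
have -> : (u : R[i]) * Num.conj_op (w : R[i]) - h u * Num.conj_op (h w) =
    (u : R[i]) * Num.conj_op (g w) + g u * Num.conj_op (w : R[i]) - g u * Num.conj_op (g w).
  by rewrite /h rmorphB; exact: prod_diff_alg.
apply: (le_trans (cabs_triB _ _)); apply: lerD; last first.
  by rewrite cabsM cabs_conj expr2 ler_pM ?cabs_ge0.
apply: (le_trans (cabsD _ _)); apply: lerD; rewrite cabsM cabs_conj.
  by rewrite mulrC ler_wpM2r ?cabs_ge0.
by rewrite ler_wpM2r ?cabs_ge0.
Qed.

Let Y_le j k u w : `|Y j k u w| <=
  cabs (gQ s j k) * (B * cabs (u : R[i]) + B * cabs (w : R[i]) + (B ^+ 2 + 1)) +
  (if j == k then 2 * cabs (v 0 j) * cabs (u : R[i]) else 0).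
Proof.
have tt : `|1 - tau| <= 1 by rewrite ler_norml; move: tau0 tau_le t1; move: tau => z *; apply/andP; split; lra.
apply: (le_trans (ler_normD _ _)).
have h1 : `|complex.Re (gQ s j k * ((u : R[i]) * Num.conj_op (w : R[i]) - h u * Num.conj_op (h w)))| <=
    cabs (gQ s j k) * (B * cabs (u : R[i]) + B * cabs (w : R[i]) + B ^+ 2).
  by apply: (le_trans (Re_le_cabs _)); rewrite cabsM; apply: ler_wpM2l; [exact: cabs_ge0|exact: prod_diff].
rewrite !addrA (mulrDr _ _ 1) mulr1 -[X in _ <= X]addrA; apply: lerD h1 _.
case: eqVneq => [->|_]; last by rewrite normr0 addr0 cabs_ge0.
have g1 : `|complex.Re (gQ s k k) * (1 - tau)| <= cabs (gQ s k k).
  by rewrite normrM -[X in _ <= X]mulr1; apply: ler_pM => //; exact: Re_le_cabs.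
have g2 : `|2 * complex.Re (Num.conj_op (v 0 k) * (u : R[i]))| <= 2 * cabs (v 0 k) * cabs (u : R[i]).
  rewrite normrM ger0_norm// -mulrA; apply: ler_wpM2l => //; apply: (le_trans (Re_le_cabs _)).
  by rewrite cabsM cabs_conj.
by apply: (le_trans (ler_normB _ _)); rewrite addrC; exact: lerD.
Qed.

Let C2 := 8 * (2 * B ^+ 2 + B ^+ 4 + 1).

Let mYgen d (T : measurableType d) (U W : T -> borelC R) j k : measurable_fun setT U -> measurable_fun setT W ->
  measurable_fun setT (fun x => Y j k (U x) (W x)).
Proof.
move=> mU mW.
have [[c1 c2] _ _ _] := cid; have [[c3 c4] _ _ _] := ch.
have cU : cmeas (fun x => U x : R[i]) by split; [exact: (measurableT_comp c1 mU)|exact: (measurableT_comp c2 mU)].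
have cW : cmeas (fun x => W x : R[i]) by split; [exact: (measurableT_comp c1 mW)|exact: (measurableT_comp c2 mW)].
have chU : cmeas (fun x => h (U x)) by split; [exact: (measurableT_comp c3 mU)|exact: (measurableT_comp c4 mU)].
have chW : cmeas (fun x => h (W x)) by split; [exact: (measurableT_comp c3 mW)|exact: (measurableT_comp c4 mW)].
apply: measurable_funD.
  suff [] : cmeas (fun x => gQ s j k * ((U x : R[i]) * Num.conj_op (W x : R[i]) - h (U x) * Num.conj_op (h (W x)))) by [].
  apply: cmeasM; first exact: cmeas_cst.
  by apply: cmeasB; apply: cmeasM => //; exact: cmeas_conj.
case: (j == k); last exact: measurable_cst.
apply: measurable_funB; last exact: measurable_cst.
apply: measurable_funM; first exact: measurable_cst.
suff [] : cmeas (fun x => Num.conj_op (v 0 j) * (U x : R[i])) by [].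
by apply: cmeasM => //; exact: cmeas_cst.
Qed.

Let z1 j k w : j != k -> Ex mu (fun u => Y j k u w) = 0.
Proof.
move=> jk.
have [i1 e1] := Ex_Re_mul (gQ s j k * Num.conj_op (w : R[i])) cid.
have [i2 e2] := Ex_Re_mul (gQ s j k * Num.conj_op (h w)) ch.
rewrite (eq_Ex _ (g := fun u : borelC R => complex.Re (gQ s j k * Num.conj_op (w : R[i]) * (u : R[i])) -
   complex.Re (gQ s j k * Num.conj_op (h w) * h u))); first by rewrite ExB// e1 e2 subrr.
move=> u; rewrite /Y (negbTE jk) addr0 -ReN -ReD; congr complex.Re.
by move: (Num.conj_op (w : R[i])) (Num.conj_op (h w)) (h u) (u : R[i]) (gQ s j k) => p q r z x; ring.
Qed.

Let Re_conj (z w : R[i]) : complex.Re (z * Num.conj_op w) = complex.Re (Num.conj_op z * w).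
Proof. by case: z => a b; case: w => c d; rewrite !conjCE /= ?mulrN ?mulNr ?opprK. Qed.

Let z2 j k u : j != k -> Ex mu (fun w => Y j k u w) = 0.
Proof.
move=> jk.
have [i1 e1] := Ex_Re_mul (Num.conj_op (gQ s j k * (u : R[i]))) cid.
have [i2 e2] := Ex_Re_mul (Num.conj_op (gQ s j k * h u)) ch.
rewrite (eq_Ex _ (g := fun w : borelC R => complex.Re (Num.conj_op (gQ s j k * (u : R[i])) * (w : R[i])) -
   complex.Re (Num.conj_op (gQ s j k * h u) * h w))); first by rewrite ExB// e1 e2 subrr.
move=> w; rewrite /Y (negbTE jk) addr0 -!Re_conj -ReN -ReD; congr complex.Re.
by rewrite mulrBr !mulrA.
Qed.

Let z3 j : Ex mu (fun u => Y j j u u) = 0.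
Proof.
have [i1 e1] := Ex_Re_mul (Num.conj_op (v 0 j)) cid.
have [_ s2 _ _] := ch.
have sd : itg mu (fun u : borelC R => complex.Re (gQ s j j) * (cabs (u : R[i]) ^+ 2 - cabs (h u) ^+ 2)).
  by apply: itgZ; apply: itgB.
rewrite (eq_Ex _ (g := fun u : borelC R => (complex.Re (gQ s j j) * (cabs (u : R[i]) ^+ 2 - cabs (h u) ^+ 2) +
   (2 * complex.Re (Num.conj_op (v 0 j) * (u : R[i])) - complex.Re (gQ s j j) * (1 - tau))))).
  rewrite ExD//; last by apply: itgB; [exact: itgZ|exact: itg_cst].
  rewrite ExB; [|exact: itgZ|exact: itg_cst].
  rewrite Ex_cst ExZ; last by apply: itgB.
  by rewrite ExZ// ExB// e1 var1 -/tau; ring.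
move=> u; rewrite /Y eqxx !mulJ_cabs -rmorphB /=; congr (_ + _).
by case: (gQ s j j) => p q /=; rewrite mulr0 subr0.
Qed.

Let CY := Kq * (B + (B ^+ 2 + 1)) + 2 * Kv.

Let bY j k u w : `|Y j k u w| <= CY * (1 + cabs (u : R[i]) + cabs (w : R[i])).
Proof.
apply: (le_trans (Y_le _ _ _ _)).
have Kq0 : 0 <= Kq by apply: le_trans (Kq_ge j k); exact: cabs_ge0.
have Kv0 : 0 <= Kv by apply: le_trans (Kv_ge j); exact: cabs_ge0.
have u0 := cabs_ge0 (u : R[i]); have w0 := cabs_ge0 (w : R[i]).
have B20 : 0 <= B ^+ 2 by exact: sqr_ge0.
set p := cabs (u : R[i]) in u0 *; set q := cabs (w : R[i]) in w0 *.
have h1 : cabs (gQ s j k) * (B * p + B * q + (B ^+ 2 + 1)) <= Kq * ((B + (B ^+ 2 + 1)) * (1 + p + q)).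
  apply: ler_pM; [exact: cabs_ge0|by rewrite !addr_ge0 ?mulr_ge0|exact: Kq_ge|].
  have := mulr_ge0 B20 u0; have := mulr_ge0 B20 w0; have := mulr_ge0 B0 u0; have := mulr_ge0 B0 w0; move: B0; lra.
have h2 : (if j == k then 2 * cabs (v 0 j) * p else 0) <= 2 * Kv * (1 + p + q).
  case: ifP => _; last by rewrite !mulr_ge0 ?addr_ge0.
  apply: ler_pM; rewrite ?mulr_ge0 ?cabs_ge0 ?ler_pM2l// ?Kv_ge//; lra.
by apply: (le_trans (lerD h1 h2)); rewrite /CY le_eqVlt; apply/orP; left; apply/eqP; ring.
Qed.

Let sq_arith (x y z q k : R) : `|x| <= q * (B * y + B * z + (B ^+ 2 + 1)) + k -> 0 <= q -> 0 <= k -> 0 <= y -> 0 <= z ->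
  x ^+ 2 <= q ^+ 2 * (8 * (B ^+ 2 * y ^+ 2 + B ^+ 2 * z ^+ 2 + B ^+ 4 + 1)) + 2 * k ^+ 2.
Proof.
move=> hx q0 k0 y0 z0.
set e := B * y + B * z + (B ^+ 2 + 1) in hx *.
have e0 : 0 <= e by rewrite !addr_ge0 ?mulr_ge0 ?sqr_ge0.
have e2 : e ^+ 2 <= 4 * (B ^+ 2 * y ^+ 2 + B ^+ 2 * z ^+ 2 + B ^+ 4 + 1).
  have B4 : B ^+ 4 = (B ^+ 2) ^+ 2 by rewrite -exprM.
  rewrite B4 -!exprMn /e; move: (B * y) (B * z) (B ^+ 2) => a b c.
  have := sqr_ge0 (a - b); have := sqr_ge0 (a - c); have := sqr_ge0 (a - 1).
  have := sqr_ge0 (b - c); have := sqr_ge0 (b - 1); have := sqr_ge0 (c - 1); lra.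
have h1 : x ^+ 2 <= (q * e + k) ^+ 2.
  by rewrite -real_normK ?num_real// ler_sqr ?nnegrE ?addr_ge0 ?mulr_ge0.
have h2 : (q * e + k) ^+ 2 <= 2 * (q ^+ 2 * e ^+ 2) + 2 * k ^+ 2.
  by rewrite -exprMn; have := sqr_ge0 (q * e - k); lra.
have := ler_wpM2l (sqr_ge0 q) e2; lra.
Qed.

Let EY2 j k : Ex Q (fun a => Y j k (a i j) (a i k) ^+ 2) <=
  C2 * cabs (gQ s j k) ^+ 2 + (if j == k then 8 * cabs (v 0 j) ^+ 2 else 0).
Proof.
have [c1 c1'] := Ex_coord iidQ i j sqi; have [c2 c2'] := Ex_coord iidQ i k sqi.
pose b (a : Arr R) := cabs (gQ s j k) ^+ 2 * (8 * (B ^+ 2 * cabs (ent a i j) ^+ 2 + B ^+ 2 * cabs (ent a i k) ^+ 2 + B ^+ 4 + 1)) +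
   (if j == k then 8 * cabs (v 0 j) ^+ 2 else 0) * cabs (ent a i j) ^+ 2.
have bb (a : Arr R) : Y j k (a i j) (a i k) ^+ 2 <= b a.
  have H := Y_le j k (a i j) (a i k).
  have := sq_arith H (cabs_ge0 _) _ (cabs_ge0 _) (cabs_ge0 _).
  rewrite /b /ent; case: eqVneq => [->|_].
    by move=> /(_ _)/le_trans; apply; rewrite ?mulr_ge0 ?cabs_ge0// lerD2l !exprMn; lra.
  by move=> /(_ (lexx _)); rewrite expr0n /= mulr0 mul0r.
have ib1 : itg Q (fun a : Arr R => B ^+ 2 * cabs (ent a i j) ^+ 2 + B ^+ 2 * cabs (ent a i k) ^+ 2 + B ^+ 4 + 1).
  by apply: itgD; [apply: itgD; [apply: itgD; exact: itgZ|]|]; exact: itg_cst.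
have ib : itg Q b by apply: itgD; apply: itgZ => //; exact: itgZ.
have iY : itg Q (fun a => Y j k (a i j) (a i k) ^+ 2).
  apply: (itg_dom _ _ ib); last by move=> a; rewrite ger0_norm ?sqr_ge0// bb.
  apply: measurable_funX; apply: mYgen; exact: measurable_coord.
apply: (le_trans (le_Ex iY ib bb)).
have e1 : Ex Q (fun a => cabs (ent a i j) ^+ 2) = 1 by rewrite -var1.
have e2 : Ex Q (fun a => cabs (ent a i k) ^+ 2) = 1 by rewrite -var1.
rewrite /b ExD; [|by apply: itgZ; apply: itgZ|exact: itgZ].
rewrite !ExZ//; last by apply: itgZ.
rewrite e1 ExD; [|by apply: itgD; [apply: itgD; exact: itgZ|exact: itg_cst]|exact: itg_cst].
rewrite ExD; [|by apply: itgD; exact: itgZ|exact: itg_cst].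
rewrite ExD; [|exact: itgZ|exact: itgZ].
by rewrite !Ex_cst !ExZ// e1 e2 !mulr1 /C2; lra.
Qed.

Let Wdev (a : Arr R) := \sum_j \sum_k Y j k (a i j) (a i k).

(** By [pair_variance], [gQ_norm_le] and [mulQ_norm_le] the variance is linear in the quantity to
    which the deviation is compared, so the relative variance is small once the trace is large. *)
Lemma Wdev_var : Ex Q (fun a => Wdev a ^+ 2) <= 2 * C2 * (rq s mrow + trQ s).
Proof.
have CY0 : 0 <= CY.
  rewrite addr_ge0 ?mulr_ge0// ?sumr_ge0// ?addr_ge0 ?sqr_ge0// => j _; last exact: cabs_ge0.
  by apply: sumr_ge0 => k _; exact: cabs_ge0.
have H := @pair_variance _ _ _ iidQ sqi n i Y CY CY0 _ _ _ _ bY z1 z2 z3.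
apply: le_trans (H _ _ _ _) _.
- by move=> j k; apply: mYgen; exact: measurable_coord.
- by move=> j k w; apply: mYgen => //; exact: measurable_cst.
- by move=> j k w; apply: mYgen => //; exact: measurable_cst.
- by move=> j; apply: mYgen.
rewrite -mulrA ler_pM2l//.
apply: (@le_trans _ _ (\sum_j \sum_k (C2 * cabs (gQ s j k) ^+ 2 + (if j == k then 8 * cabs (v 0 j) ^+ 2 else 0)))).
  by apply: ler_sum => j _; apply: ler_sum => k _; exact: EY2.
have C28 : 8 <= C2 by rewrite /C2; have := sqr_ge0 B; have := sqr_ge0 (B ^+ 2); rewrite -exprM; lra.
have -> : \sum_j \sum_k (C2 * cabs (gQ s j k) ^+ 2 + (if j == k then 8 * cabs (v 0 j) ^+ 2 else 0)) =
   C2 * \sum_j \sum_k cabs (gQ s j k) ^+ 2 + 8 * \sum_j cabs (v 0 j) ^+ 2.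
  rewrite !mulr_sumr -big_split; apply: eq_bigr => j _ /=.
  rewrite big_split /= mulr_sumr; congr (_ + _).
  by rewrite (bigD1 j)//= eqxx big1 ?addr0// => k; rewrite eq_sym => /negbTE ->.
have g1 := gQ_norm_le s; have g2 := mulQ_norm_le s mrow.
have q0 := rq_ge0 s mrow; have tq := trQ_ge0 s.
have h1 := ler_wpM2l (_ : 0 <= C2) g1; have h2 := ler_wpM2l (_ : 0 <= 8) g2.
have C20 : 0 <= C2 by apply: le_trans C28.
have {}h1 := h1 C20; have {}h2 := h2 (ler0n _ 8); have h3 := ler_wpM2r q0 C28.
by rewrite mulrDr [X in _ <= X]addrC; exact: (lerD h1 (le_trans h2 h3)).
Qed.

(** The term left out is the form in h, which is nonnegative: a lower bound asks nothing of the tail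
    part beyond its variance [tau]. *)
Lemma Wdev_le (a : Arr R) : rq s mrow + (1 - tau) * trQ s + Wdev a <= rq s (mrow + frow (fun u => u) a).
Proof.
have -> : Wdev a = rq s (frow (fun u => u) a) - rq s (frow h a) +
    (2 * complex.Re (dot (frow (fun u => u) a) v) - trQ s * (1 - tau)).
  rewrite /Wdev /Y.
  have -> : \sum_j \sum_k (complex.Re (gQ s j k * ((a i j : R[i]) * Num.conj_op (a i k : R[i]) - h (a i j) * Num.conj_op (h (a i k)))) +
     (if j == k then 2 * complex.Re (Num.conj_op (v 0 j) * (a i j : R[i])) - complex.Re (gQ s j j) * (1 - tau) else 0)) =
     \sum_(j < n) \sum_(k < n) complex.Re (gQ s j k * ((a i j : R[i]) * Num.conj_op (a i k : R[i]) - h (a i j) * Num.conj_op (h (a i k)))) +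
     \sum_(j < n) (2 * complex.Re (Num.conj_op (v 0 j) * (a i j : R[i])) - complex.Re (gQ s j j) * (1 - tau)).
    rewrite -big_split; apply: eq_bigr => j _ /=; rewrite big_split /=; congr (_ + _).
    by rewrite (bigD1 j)//= eqxx big1 ?addr0// => k; rewrite eq_sym => /negbTE ->.
  congr (_ + _).
    rewrite !rq_sum -sumrB; apply: eq_bigr => j _; rewrite -sumrB; apply: eq_bigr => k _.
    by rewrite !mxE mulrBr ReD ReN.
  rewrite sumrB trQ_sum mulr_suml; congr (_ - _).
  rewrite dotE Re_sum mulr_sumr; apply: eq_bigr => j _.
  rewrite (_ : frow (fun u => u) a 0 j = a i j :> R[i]); last by rewrite mxE.
  by congr (2 * complex.Re _); rewrite mulrC.
rewrite rqD -/v; apply: Wdev_arith; exact: rq_ge0.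
Qed.

Lemma Wdev_itg : itg Q (fun a => Wdev a ^+ 2).
Proof.
have CY0 : 0 <= CY.
  rewrite addr_ge0 ?mulr_ge0// ?sumr_ge0// ?addr_ge0 ?sqr_ge0// => j _; last exact: cabs_ge0.
  by apply: sumr_ge0 => k _; exact: cabs_ge0.
have sq3 (x y : R) : 0 <= x -> 0 <= y -> 1 + x + y <= 3 + x ^+ 2 + y ^+ 2.
  by have := sqr_ge0 (x - 1); have := sqr_ge0 (y - 1); have := sqr_ge0 x; have := sqr_ge0 y; nra.
have mW : measurable_fun setT Wdev.
  by apply: measurable_fun_sumR => j; apply: measurable_fun_sumR => k; apply: mYgen; exact: measurable_coord.
have Yitg j k : itg Q (fun a => Y j k (a i j) (a i k) ^+ 2).
  have [c1 _] := Ex_coord iidQ i j sqi; have [c2 _] := Ex_coord iidQ i k sqi.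
  apply: (itg_dom (g := fun a : Arr R => CY ^+ 2 * (3 * (1 + cabs (ent a i j) ^+ 2 + cabs (ent a i k) ^+ 2)))).
  - by apply: measurable_funX; apply: mYgen; exact: measurable_coord.
  - move=> a; rewrite ger0_norm ?sqr_ge0//.
    apply: (@le_trans _ _ ((CY * (1 + cabs (ent a i j) + cabs (ent a i k))) ^+ 2)).
      have H := bY j k (a i j) (a i k).
      rewrite -real_normK ?num_real//; have HH := le_trans (normr_ge0 _) H.
      by apply: lerXn2r; rewrite ?nnegrE ?normr_ge0 ?HH.
    rewrite exprMn ler_wpM2l ?sqr_ge0//; move: (cabs _) (cabs _) => x y.
    by have := sqr_ge0 (x - 1); have := sqr_ge0 (y - 1); have := sqr_ge0 (x - y); lra.
  - by apply: itgZ; apply: itgZ; apply: itgD => //; apply: itgD => //; exact: itg_cst.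
apply: (itg_dom (g := fun a : Arr R => (n * n)%:R * \sum_j \sum_k Y j k (a i j) (a i k) ^+ 2)).
- exact: measurable_funX.
- move=> a; rewrite ger0_norm ?sqr_ge0// /Wdev !pair_bigA /=.
  have CSs (I : finType) (F : I -> R) : (\sum_p F p) ^+ 2 <= #|I|%:R * \sum_p F p ^+ 2.
    rewrite expr2 big_distrlr /=.
    apply: (@le_trans _ _ (\sum_p \sum_p' (F p ^+ 2 + F p' ^+ 2) / 2)).
      by apply: ler_sum => p _; apply: ler_sum => p' _; have := sqr_ge0 (F p - F p'); lra.
    rewrite (eq_bigr (fun p => #|I|%:R * F p ^+ 2 / 2 + (\sum_p' F p' ^+ 2) / 2)); last first.
      by move=> p _; rewrite -mulr_suml big_split /= sumr_const mulrDl mulr_natl.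
    rewrite big_split /= sumr_const -mulr_suml -mulr_sumr -[X in _ + X]mulr_natl.
    by rewrite le_eqVlt; apply/orP; left; apply/eqP; field.
  by apply: (le_trans (CSs _ _)); rewrite card_prod card_ord.
- by apply: itgZ; apply: itg_sum => j; apply: itg_sum => k.
Qed.

Hypothesis t2 : t < 2^-1.
Hypothesis n2 : (2 <= n)%N.
Hypothesis mB : forall j, (j < n)%N -> cabs (m i j) <= n%:R ^+ 2 / 2.
Variable K : R.
Hypotheses (K0 : 0 < K) (KQ : K <= trQ s).

Let V (a : Arr R) := ln (1 + rq s ((n%:R : R)%:C%C *: crow n m a i)).
Let T := n%:R ^- 2 + rq s mrow + trQ s.
Let n0 : 0 < n%:R :> R. Proof. by rewrite ltr0n; exact: leq_trans n2. Qed.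
Let n20 : 0 < n%:R ^+ 2 :> R. Proof. by rewrite exprn_gt0. Qed.
Let T0 : 0 < T. Proof. by rewrite ltr_wpDr ?trQ_ge0// ltr_wpDr ?rq_ge0// invr_gt0. Qed.
Let KT : K <= T.
Proof. by apply: (le_trans KQ); rewrite lerDr addr_ge0 ?rq_ge0// invr_ge0 ltW. Qed.
Let nT : n%:R ^+ 2 * T = 1 + n%:R ^+ 2 * (rq s mrow + trQ s).
Proof. by rewrite /T -addrA mulrDr mulfV ?gt_eqF. Qed.

Let mV : measurable_fun setT V.
Proof.
apply: (measurableT_comp (f := @ln R)); first exact: measurable_ln.
apply: measurable_funD; first exact: measurable_cst.
apply: measurable_rq => j; rewrite (_ : (fun a => _) = fun a => (n%:R : R)%:C%C * crow n m a i 0 j).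
  by apply: cmeasM; [exact: cmeas_cst|exact: cmeas_crow].
by apply/funext => a; rewrite mxE.
Qed.

Let iV : itg Q V.
Proof.
apply: (@itg_bounded _ _ _ _ _ (lnosc R n)) => // a.
by have /andP[h1 h2] := ln_rq_bounds m a s i; rewrite ger0_norm.
Qed.

Let x (a : Arr R) := frow (fun u => u) a.

Let crowE a : rowok n m a i -> crow n m a i = mrow + x a.
Proof. by move=> ok; rewrite /crow asboolT//; apply/rowP => j; rewrite !mxE. Qed.

Let ix : itg Q (fun a => rq s (mrow + x a)) /\ Ex Q (fun a => rq s (mrow + x a)) = rq s mrow + trQ s.
Proof.
have [i1 e1] := Ex_lin iidQ i v cid.
have [|i2 e2] := @Ex_rq _ _ _ iidQ sqi n i s _ 1 cid ler01.
  by move=> u; rewrite mul1r lerDr.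
have E a : rq s (mrow + x a) = rq s mrow + 2 * complex.Re (dot (x a) v) + rq s (x a) by rewrite rqD.
have i3 : itg Q (fun a => rq s mrow + 2 * complex.Re (dot (x a) v)).
  by apply: itgD; [exact: itg_cst|exact: itgZ].
split; first by apply: (eq_itg (fun a => esym (E a))); apply: itgD.
rewrite (eq_Ex _ E) ExD// ExD; [|exact: itg_cst|exact: itgZ].
by rewrite Ex_cst ExZ// e1 e2 var1 mulr0 addr0 mulr1.
Qed.

(** Jensen's inequality in tangent form, ln y <= ln b + y / b - 1 with b = n^2 T. Replacing an
    inadmissible row by 0 only lowers the value. *)
Lemma swap_upper : Ex Q V <= ln (n%:R ^+ 2 * T).
Proof.
have nT0 : 0 < n%:R ^+ 2 * T by rewrite mulr_gt0.
have [i1 e1] := ix.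
pose U a := ln (n%:R ^+ 2 * T) + ((n%:R ^+ 2 * T)^-1 * (1 + n%:R ^+ 2 * rq s (mrow + x a)) - 1).
have iU' : itg Q (fun a => 1 + n%:R ^+ 2 * rq s (mrow + x a)) by apply: itgD; [exact: itg_cst|exact: itgZ].
have iU : itg Q U.
  by apply: itgD; [exact: itg_cst|apply: itgB; [exact: itgZ|exact: itg_cst]].
have VU a : V a <= U a.
  set q := rq s (mrow + x a); have q0 : 0 <= q by exact: rq_ge0.
  have p0 : 0 < 1 + n%:R ^+ 2 * q by rewrite ltr_wpDr// mulr_ge0// ltW.
  apply: (@le_trans _ _ (ln (1 + n%:R ^+ 2 * q))).
    rewrite /V ler_ln ?posrE//; last by rewrite ltr_wpDr// rq_ge0.
    rewrite lerD2l rq_scale ler_pM2l//.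
    rewrite /crow; case: asboolP => ok; first by rewrite /q -(crowE ok) /crow asboolT.
    by rewrite /rq mul0mx /dot mul0mx mxE.
  rewrite /U -/q (mulrC _^-1) -lerBlDl -ln_div ?posrE//.
  set yy := (1 + _) / _; have hy := le_ln1Dx (x := yy - 1); rewrite (addrC 1) subrK in hy; apply: hy.
  by rewrite ltrBDr addrC subrr divr_gt0.
apply: (le_trans (le_Ex iV iU VU)).
rewrite /U ExD; [|exact: itg_cst|by apply: itgB; [exact: itgZ|exact: itg_cst]].
rewrite ExB; [|exact: itgZ|exact: itg_cst].
rewrite ExZ// ExD; [|exact: itg_cst|exact: itgZ].
by rewrite !Ex_cst ExZ// e1 -nT mulVf ?gt_eqF// subrr addr0.
Qed.

Let D : R := 8 * ln n%:R.

Let nT_le : n%:R ^+ 2 * T <= n%:R ^+ 8.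
Proof.
have n1 : 2 <= n%:R :> R by rewrite ler_nat.
have n11 : 1 <= n%:R :> R by lra.
have p k : 1 <= n%:R ^+ k :> R by exact: exprn_ege1.
have qm : rq s mrow <= n%:R ^+ 5 / 4.
  apply: (le_trans (rq_le _ _)); rewrite rnorm_sum.
  apply: (@le_trans _ _ (\sum_(j < n) n%:R ^+ 4 / 4)); last first.
    by rewrite sumr_const card_ord -(mulr_natl (n%:R ^+ 4 / 4)) mulrA -exprS.
  apply: ler_sum => j _; rewrite mxE.
  have h2 : cabs (m i j) ^+ 2 <= (n%:R ^+ 2 / 2) ^+ 2.
    by apply: lerXn2r; rewrite ?nnegrE ?cabs_ge0 ?divr_ge0 ?exprn_ge0 ?mB.
  by apply: (le_trans h2); rewrite le_eqVlt; apply/orP; left; apply/eqP; field.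
have tn := trQ_le s.
rewrite (_ : _ * T = 1 + n%:R ^+ 2 * (rq s mrow + trQ s)); last exact: nT.
apply: (@le_trans _ _ (1 + n%:R ^+ 2 * (n%:R ^+ 5 / 4 + n%:R))).
  by rewrite lerD2l ler_pM2l// lerD.
have -> : n%:R ^+ 2 * (n%:R ^+ 5 / 4 + n%:R) = n%:R ^+ 7 / 4 + n%:R ^+ 3 :> R by ring.
have h8 : 2 * n%:R ^+ 7 <= n%:R ^+ 8 :> R by rewrite exprS ler_wpM2r// exprn_ge0.
have h3 : n%:R ^+ 3 <= n%:R ^+ 7 / 4 :> R.
  have : 4 <= n%:R ^+ 4 :> R.
    apply: (@le_trans _ _ (2 ^+ 4)); first by rewrite -natrX ler_nat.
    by apply: lerXn2r; rewrite ?nnegrE.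
  rewrite (exprD _ 4 3) => h4; have := ler_pM2r (lt_le_trans ltr01 (p 3)) 4 (n%:R ^+ 4).
  by rewrite h4 => h5; rewrite ler_pdivlMr// mulrC.
by have := p 7%N; move: h8 h3; lra.
Qed.

(** [bad] adds the Markov functional of large entries and the Chebyshev functional of [Wdev]. Where
    it is below 1 the row is admissible and [Wdev] is at least - t T, so n^-2 plus the form is at
    least (1 - 2 t) T. Elsewhere [0 <= V a] suffices, because [D] is at least ln (n^2 T). *)
Lemma swap_lower : ln (n%:R ^+ 2 * T) + ln (1 - 2 * t) - D * (4 / n%:R ^+ 3 + 2 * C2 / (t ^+ 2 * K)) <= Ex Q V.
Proof.
have nT0 : 0 < n%:R ^+ 2 * T by rewrite mulr_gt0.
have D0 : 0 <= D by rewrite mulr_ge0// ln_ge0// ler1n; exact: leq_trans n2.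
have D1 : ln (n%:R ^+ 2 * T) <= D by rewrite /D -lnX_nat// ler_ln ?posrE ?exprn_gt0// nT_le.
have tp : 0 < 1 - 2 * t by move: t2; lra.
have lt0 : ln (1 - 2 * t) <= 0 by apply: ln_le0; move: t0; lra.
have tT : 0 < t * T by rewrite mulr_gt0.
pose bad (a : Arr R) := \sum_(j < n) 4 / n%:R ^+ 4 * cabs (ent a i j) ^+ 2 + (t * T) ^- 2 * Wdev a ^+ 2.
have i1 : itg Q (fun a : Arr R => \sum_(j < n) 4 / n%:R ^+ 4 * cabs (ent a i j) ^+ 2).
  by apply: itg_sum => j; apply: itgZ; have [] := Ex_coord iidQ i j sqi.
have ibad : itg Q bad by apply: itgD => //; apply: itgZ; exact: Wdev_itg.
have bad0 a : 0 <= bad a.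
  apply: addr_ge0; last by rewrite mulr_ge0 ?sqr_ge0// invr_ge0 sqr_ge0.
  by apply: sumr_ge0 => j _; rewrite mulr_ge0 ?sqr_ge0// divr_ge0// exprn_ge0.
have low a : ln (n%:R ^+ 2 * T) + ln (1 - 2 * t) - D * bad a <= V a.
  have V0 : 0 <= V a by have /andP[] := ln_rq_bounds m a s i.
  have [b1|b1] := leP 1 (bad a).
    have := ler_wpM2l D0 b1; move: V0 D1 lt0; lra.
  have ok : rowok n m a i.
    move=> j jn; rewrite leNgt; apply/negP => hj.
    have xj : n%:R ^+ 2 / 2 <= cabs (ent a i j).
      by have := cabsD (m i j) (ent a i j); have := mB jn; move: hj; lra.
    have : 1 <= 4 / n%:R ^+ 4 * cabs (ent a i j) ^+ 2.
      have := xj; rewrite -(@ler_pXn2r _ 2) ?nnegrE ?cabs_ge0 ?divr_ge0 ?exprn_ge0// expr_div_n -exprM => h2.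
      have n4 : 0 < n%:R ^+ 4 :> R by rewrite exprn_gt0.
      rewrite mulrAC ler_pdivlMr// mul1r.
      by move: h2; rewrite (_ : 2 ^+ 2 = 4 :> R); [move: (n%:R ^+ (2 * 2)) => z; lra|ring].
    move=> h1; have : 1 <= bad a.
      apply: (le_trans h1); rewrite /bad (bigD1 (Ordinal jn))//= -addrA lerDl addr_ge0//.
        by rewrite sumr_ge0// => l _; rewrite mulr_ge0 ?sqr_ge0 ?divr_ge0 ?exprn_ge0.
      by rewrite mulr_ge0 ?sqr_ge0// invr_ge0 sqr_ge0.
    by rewrite leNgt b1.
  have W1 : - (t * T) <= Wdev a.
    have : (t * T) ^- 2 * Wdev a ^+ 2 <= 1.
      apply: le_trans (ltW b1); rewrite /bad lerDr sumr_ge0// => l _.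
      by rewrite mulr_ge0 ?sqr_ge0 ?divr_ge0 ?exprn_ge0.
    rewrite mulrC ler_pdivrMr ?exprn_gt0// mul1r => hw.
    have : `|Wdev a| <= t * T by rewrite -(@ler_pXn2r _ 2) ?nnegrE ?(ltW tT)// real_normK ?num_real.
    by rewrite ler_norml => /andP[].
  have Q1 : (1 - 2 * t) * T <= n%:R ^- 2 + rq s (mrow + x a).
    have W2 := Wdev_le a; rewrite -/(x a) in W2.
    have tq := ler_wpM2r (trQ_ge0 s) tau_le.
    have tq2 : t * trQ s <= t * T by rewrite ler_pM2l// /T lerDr addr_ge0 ?rq_ge0// invr_ge0 ltW.
    move: W1 W2 tq tq2; rewrite /T; move: (n%:R ^- 2) => z; lra.
  rewrite /V (crowE ok) rq_scale; apply: (@le_trans _ _ (ln (n%:R ^+ 2 * T) + ln (1 - 2 * t))).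
    by rewrite gerBl mulr_ge0.
  have p0 : 0 < 1 + n%:R ^+ 2 * rq s (mrow + x a) by rewrite ltr_wpDr// mulr_ge0 ?rq_ge0// ltW.
  have p1 : 0 < n%:R ^+ 2 * T * (1 - 2 * t) by rewrite mulr_gt0.
  rewrite -lnM ?posrE// ler_ln ?posrE//.
  apply: (@le_trans _ _ (n%:R ^+ 2 * (n%:R ^- 2 + rq s (mrow + x a)))).
    by rewrite -mulrA ler_pM2l// mulrC.
  by rewrite mulrDr mulfV ?gt_eqF.
have iL : itg Q (fun a => ln (n%:R ^+ 2 * T) + ln (1 - 2 * t) - D * bad a).
  by apply: itgB; [exact: itg_cst|exact: itgZ].
apply: le_trans (le_Ex iL iV low).
rewrite ExB; [|exact: itg_cst|exact: itgZ]; rewrite Ex_cst ExZ// lerD2l lerN2 ler_wpM2l//.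
rewrite /bad ExD//; last by apply: itgZ; exact: Wdev_itg.
rewrite ExZ; last exact: Wdev_itg.
rewrite Ex_sum; last by move=> j; apply: itgZ; have [] := Ex_coord iidQ i j sqi.
apply: lerD.
  rewrite (eq_bigr (fun=> 4 / n%:R ^+ 4)); last first.
    by move=> j _; have [h1 h2] := Ex_coord iidQ i j sqi; rewrite ExZ// h2 var1 mulr1.
  rewrite sumr_const card_ord -(mulr_natl (4 / n%:R ^+ 4)) le_eqVlt; apply/orP; left; apply/eqP.
  by field; rewrite gt_eqF.
have WV := Wdev_var.
have C20 : 0 <= C2 by rewrite /C2 mulr_ge0// !addr_ge0 ?mulr_ge0 ?exprn_ge0.
apply: (@le_trans _ _ ((t * T) ^- 2 * (2 * C2 * T))).
  rewrite ler_wpM2l ?invr_ge0 ?sqr_ge0//; apply: (le_trans WV).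
  by apply: ler_wpM2l; [rewrite mulr_ge0|rewrite /T -addrA lerDr invr_ge0; exact: ltW].
rewrite (_ : (t * T) ^- 2 * (2 * C2 * T) = 2 * C2 / (t ^+ 2 * T)); last by field; rewrite !gt_eqF.
apply: ler_wpM2l; first by rewrite mulr_ge0.
rewrite lef_pV2 ?posrE ?mulr_gt0 ?exprn_gt0//.
by rewrite ler_pM2l ?exprn_gt0.
Qed.

End truncated.

Section good_laws.
Context (R : realType).

Definition small_ball (mu : probability (borelC R) R) (alpha beta : R) :=
  forall c : R[i], Pr mu [set x : borelC R | cabs ((x : R[i]) - c) <= alpha] <= 1 - beta.

(** The small-ball part feeds Odlyzko's argument. The pair part keeps the difference of two
    independent entries between two positive bounds with positive probability, as the symmetrised
    steps require. *)
Definition nondegenerate_law (mu : probability (borelC R) R) := exists alpha beta kappa : R,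
  [/\ 0 < alpha, 0 < beta, beta <= 2^-1, 0 < kappa &
   small_ball mu alpha beta /\ beta <= Pr (mu \x mu)%E (pairset alpha kappa)].

Definition truncatable (mu : probability (borelC R) R) := forall t : R, 0 < t ->
  exists (g : borelC R -> R[i]) (B : R), [/\ 0 <= B, centered mu g, (forall u, cabs (g u) <= B) &
    Ex mu (fun u => cabs ((u : R[i]) - g u) ^+ 2) <= t].

Definition good_law (mu : probability (borelC R) R) (Q : probability (Arr R) R) :=
  [/\ iid_law mu Q, nondegenerate_law mu, centered mu (fun x : borelC R => (x : R[i])),
   Ex mu (fun x : borelC R => cabs (x : R[i]) ^+ 2) = 1 & truncatable mu].

Definition rowfun n (m : nat -> nat -> R[i]) i (s : seq 'rV[R[i]]_n) (a : Arr R) : R :=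
  ln (1 + rq s ((n%:R : R)%:C%C *: crow n m a i)).

(** Depends on the mean row and the other rows but not on the law of the entries, so it is a common
    value to which both arrays are compared. *)
Definition rowref n (m : nat -> nat -> R[i]) i (s : seq 'rV[R[i]]_n) : R :=
  ln (n%:R ^+ 2 * (n%:R ^- 2 + rq s (mrow n m i) + trQ s)).

(** [C] depends on [t] and on the law only, through the truncation bound. The error disappears when
    the trace is much larger than ln n, up to ln (1 - 2 t), which is small with [t]. *)
Lemma row_expectation mu Q (t : R) : good_law mu Q -> 0 < t -> t < 2^-1 ->
  exists2 C : R, 0 <= C & forall n m i (s : seq 'rV[R[i]]_n) (K : R), (2 <= n)%N ->
   (forall j, (j < n)%N -> cabs (m i j) <= n%:R ^+ 2 / 2) -> 0 < K -> K <= trQ s ->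
   rowref m i s + ln (1 - 2 * t) - 8 * ln n%:R * (4 / n%:R ^+ 3 + C / K) <= Ex Q (rowfun m i s) <= rowref m i s.
Proof.
move=> [iidQ _ cid var1 tr] t0 t2.
have t1 : t <= 1 by lra.
have [g [B [B0 cg gB tau]]] := tr t t0.
have [_ sqi _ _] := cid.
pose C2 := 2 * (8 * (2 * B ^+ 2 + B ^+ 4 + 1)) / t ^+ 2.
exists C2; first by rewrite divr_ge0 ?sqr_ge0// !mulr_ge0// !addr_ge0 ?mulr_ge0 ?exprn_ge0.
move=> n m i s K n2 mB K0 KQ; apply/andP; split; last exact: (swap_upper iidQ sqi var1).
apply: le_trans (swap_lower iidQ sqi var1 B0 cid cg gB tau t0 t1 t2 n2 mB K0 KQ).
rewrite lerD2l lerN2 le_eqVlt; apply/orP; left; apply/eqP; congr (_ * (_ + _)).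
by rewrite /C2; field; rewrite !gt_eqF.
Qed.

End good_laws.

(** * Exchanging two laws row by row *)

Section hybrid.
Context (R : realType) (Q1 Q2 : probability (Arr R) R).
Hypotheses (Q1i : indep_law Q1) (Q2i : indep_law Q2).

Definition row_neq (k : nat) : pred (nat * nat) := fun x => x.1 != k.

Lemma merge_lt_neq k (a b b' : Arr R) :
  amerge (rows_lt k) (a, amerge (row_neq k) (b, b')) = amerge (row_neq k) (amerge (rows_lt k) (a, b), b').
Proof.
apply/funext => i; apply/funext => j; rewrite /amerge /rows_lt /row_neq /=.
by case: ltngtP.
Qed.

Lemma merge_ltS_neq k (a a' b : Arr R) :
  amerge (rows_lt k.+1) (amerge (row_neq k) (a, a'), b) = amerge (row_neq k) (amerge (rows_lt k) (a, b), a').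
Proof.
apply/funext => i; apply/funext => j; rewrite /amerge /rows_lt /row_neq /= ltnS.
by case: ltngtP.
Qed.

Lemma Ex_bounded d (T : measurableType d) (P : probability T R) (f : T -> R) B :
  itg P f -> (forall x, `|f x| <= B) -> `|Ex P f| <= B.
Proof.
move=> fi fB; rewrite ler_norml -[- B](Ex_cst P) -{2}[B](Ex_cst P); apply/andP; split; apply: le_Ex => //;
  by [exact: itg_cst|move=> x; have := fB x; rewrite ler_norml => /andP[]].
Qed.

Lemma row_average Q k (F : Arr R -> R) B : indep_law Q -> measurable_fun setT F -> (forall a, `|F a| <= B) ->
  measurable_fun setT (fun c => Ex Q (fun b => F (amerge (row_neq k) (c, b)))) /\
  (forall c, `|Ex Q (fun b => F (amerge (row_neq k) (c, b)))| <= B).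
Proof.
move=> Qi mF FB.
have i1 c : itg Q (fun b => F (amerge (row_neq k) (c, b))) by exact: (itg_bounded_merge Q (row_neq k) c mF FB).
have iF : itg Q F by exact: itg_bounded FB.
split; first exact: (itg_meas (Ex_merge_itg Qi iF i1)).
by move=> c; apply: Ex_bounded => // b; exact: FB.
Qed.

(** Resampling row k from its own law changes neither hybrid. Afterwards both are averages over the
    same merged array, one of [P1] and one of [P2], which the hypothesis compares pointwise. *)
Lemma hybrid_step (F : Arr R -> R) B eps k : measurable_fun setT F -> (forall a, `|F a| <= B) ->
  (forall c, `|Ex Q1 (fun b => F (amerge (row_neq k) (c, b))) - Ex Q2 (fun b => F (amerge (row_neq k) (c, b)))| <= eps) ->
  `|Ex Q1 (fun a => Ex Q2 (fun b => F (amerge (rows_lt k.+1) (a, b)))) -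
    Ex Q1 (fun a => Ex Q2 (fun b => F (amerge (rows_lt k) (a, b))))| <= eps.
Proof.
move=> mF FB h.
pose P1 c := Ex Q1 (fun b => F (amerge (row_neq k) (c, b))).
pose P2 c := Ex Q2 (fun b => F (amerge (row_neq k) (c, b))).
have [mP1 bP1] := row_average k Q1i mF FB; have [mP2 bP2] := row_average k Q2i mF FB.
have mm j : measurable_fun setT (fun ab => F (amerge (rows_lt j) ab)).
  by apply: measurableT_comp mF _; exact: measurable_merge.
have bm j ab : `|F (amerge (rows_lt j) ab)| <= B by exact: FB.
have mm1 : measurable_fun setT (fun ab => P1 (amerge (rows_lt k) ab)).
  by apply: measurableT_comp mP1 _; exact: measurable_merge.
have mm2 : measurable_fun setT (fun ab => P2 (amerge (rows_lt k) ab)).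
  by apply: measurableT_comp mP2 _; exact: measurable_merge.
have bm1 ab : `|P1 (amerge (rows_lt k) ab)| <= B by exact: bP1.
have bm2 ab : `|P2 (amerge (rows_lt k) ab)| <= B by exact: bP2.
have [_ i1 i2] := @Ex_prod _ _ _ _ _ Q1 Q2 _ _ (mm k) (bm k).
have e2 : Ex Q1 (fun a => Ex Q2 (fun b => F (amerge (rows_lt k) (a, b)))) =
    Ex Q1 (fun a => Ex Q2 (fun b => P2 (amerge (rows_lt k) (a, b)))).
  apply: eq_Ex => a.
  have im b : itg Q2 (fun b' => F (amerge (rows_lt k) (a, amerge (row_neq k) (b, b')))).
    apply: (@itg_bounded _ _ _ _ _ B); last by move=> b'; exact: FB.
    apply: (measurableT_comp (f := fun b => F (amerge (rows_lt k) (a, b)))); last exact: measurable_merge_snd.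
    by apply: measurableT_comp mF _; exact: measurable_merge_snd.
  apply: (etrans (Ex_merge Q2i (i1 a) im)); apply: eq_Ex => b; apply: eq_Ex => b'.
  by rewrite merge_lt_neq.
have [s1 j1 j2] := @Ex_prod_swap _ _ _ _ _ Q1 Q2 _ _ (mm k.+1) (bm k.+1).
have [s1' _ _] := @Ex_prod _ _ _ _ _ Q1 Q2 _ _ (mm k.+1) (bm k.+1).
have [s2 _ _] := @Ex_prod_swap _ _ _ _ _ Q1 Q2 _ _ mm1 bm1.
have [s2' i3 i4] := @Ex_prod _ _ _ _ _ Q1 Q2 _ _ mm1 bm1.
have [_ i5 i6] := @Ex_prod _ _ _ _ _ Q1 Q2 _ _ mm2 bm2.
have e1 : Ex Q1 (fun a => Ex Q2 (fun b => F (amerge (rows_lt k.+1) (a, b)))) =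
    Ex Q1 (fun a => Ex Q2 (fun b => P1 (amerge (rows_lt k) (a, b)))).
  apply: etrans (etrans (esym s1') s1) _; apply: etrans _ (etrans (esym s2) s2').
  apply: eq_Ex => b.
  have im a : itg Q1 (fun a' => F (amerge (rows_lt k.+1) (amerge (row_neq k) (a, a'), b))).
    apply: (@itg_bounded _ _ _ _ _ B); last by move=> a'; exact: FB.
    apply: (measurableT_comp (f := fun a => F (amerge (rows_lt k.+1) (a, b)))); last exact: measurable_merge_snd.
    by apply: measurableT_comp mF _; exact: measurable_merge_fst.
  apply: (etrans (Ex_merge Q1i (j1 b) im)); apply: eq_Ex => a; apply: eq_Ex => a'.
  by rewrite merge_ltS_neq.
rewrite e1 e2 -ExB//; apply: Ex_bounded; first exact: itgB.
move=> a; rewrite -ExB//; apply: Ex_bounded; first exact: itgB.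
by move=> b; exact: h.
Qed.

Lemma hybrid_bound (F : Arr R -> R) B eps p : measurable_fun setT F -> (forall a, `|F a| <= B) -> row_dep p F ->
  (forall k c, (k < p)%N ->
    `|Ex Q1 (fun b => F (amerge (row_neq k) (c, b))) - Ex Q2 (fun b => F (amerge (row_neq k) (c, b)))| <= eps) ->
  `|Ex Q1 F - Ex Q2 F| <= p%:R * eps.
Proof.
move=> mF FB dF h.
pose T k := Ex Q1 (fun a => Ex Q2 (fun b => F (amerge (rows_lt k) (a, b)))).
have T0 : T 0%N = Ex Q2 F.
  rewrite /T -[RHS](Ex_cst Q1); apply: eq_Ex => a; apply: eq_Ex => b.
  have -> : amerge (rows_lt 0) (a, b) = b by apply/funext => i; apply/funext => j.
  by [].
have Tp : T p = Ex Q1 F.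
  rewrite /T; apply: eq_Ex => a; rewrite -[RHS](Ex_cst Q2); apply: eq_Ex => b.
  by apply: dF => i j ip; rewrite /amerge /rows_lt /= ip.
rewrite -T0 -Tp; have : forall k, (k <= p)%N -> `|T k - T 0%N| <= k%:R * eps.
  elim=> [_|k IH kp]; first by rewrite subrr normr0 mul0r.
  apply: (@le_trans _ _ (`|T k.+1 - T k| + `|T k - T 0%N|)).
    exact: ler_distD.
  rewrite -natr1 mulrDl mul1r addrC; apply: lerD; first by apply: IH; exact: ltnW.
  by apply: (hybrid_step mF FB) => c; exact: h.
by apply.
Qed.

End hybrid.

Section lndet_compare.
Context (R : realType) (mu1 mu2 : probability (borelC R) R) (Q1 Q2 : probability (Arr R) R).
Hypotheses (g1 : good_law mu1 Q1) (g2 : good_law mu2 Q2).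

Lemma lndet_row_avg (Q : probability (Arr R) R) n (m : nat -> nat -> R[i]) p k (c : Arr R) : (k < p)%N ->
  Ex Q (fun b => lndet n m (amerge (row_neq k) (c, b)) p) =
  ln (rdet (crows n m c (rem k (iota 0 p)))) + Ex Q (rowfun m k (crows n m c (rem k (iota 0 p)))).
Proof.
move=> kp; set s := crows _ _ _ _.
have e b : lndet n m (amerge (row_neq k) (c, b)) p = ln (rdet s) + rowfun m k s b.
  rewrite (lndet_row_remove _ _ _ kp).
  have -> : crows n m (amerge (row_neq k) (c, b)) (rem k (iota 0 p)) = s.
    apply: eq_crows => i j; rewrite mem_rem_uniq ?iota_uniq// inE => /andP[ik _].
    by rewrite /amerge /row_neq /= ik.
  rewrite /rowfun (@eq_crow R n m (amerge (row_neq k) (c, b)) b)// => j.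
  by rewrite /amerge /row_neq /= eqxx.
rewrite (eq_Ex _ e) ExD ?Ex_cst//; first exact: itg_cst.
apply: (@itg_bounded _ _ _ _ _ (lnosc R n)).
  apply: (measurableT_comp (f := @ln R)); first exact: measurable_ln.
  apply: measurable_funD; first exact: measurable_cst.
  apply: measurable_rq => j; rewrite (_ : (fun a => _) = fun a => (n%:R : R)%:C%C * crow n m a k 0 j).
    by apply: cmeasM; [exact: cmeas_cst|exact: cmeas_crow].
  by apply/funext => a; rewrite mxE.
by move=> b; have /andP[h1 h2] := ln_rq_bounds m b s k; rewrite ger0_norm.
Qed.

(* Rows of one array are replaced by rows of the other one at a time. *)
Lemma lndet_compare (t : R) : 0 < t -> t < 2^-1 ->
  exists2 C : R, 0 <= C & forall n m p, (2 <= n)%N -> (p < n)%N ->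
   (forall i j, (i < n)%N -> (j < n)%N -> cabs (m i j) <= n%:R ^+ 2 / 2) ->
   `|Ex Q1 (fun a => lndet n m a p) - Ex Q2 (fun a => lndet n m a p)| <=
     p%:R * (- ln (1 - 2 * t) + 8 * ln n%:R * (4 / n%:R ^+ 3 + C / (n - p)%:R)).
Proof.
move=> t0 t2.
have [C1 C10 h1] := row_expectation g1 t0 t2; have [C2 C20 h2] := row_expectation g2 t0 t2.
exists (C1 + C2); first exact: addr_ge0.
move=> n m p n2 pn mB.
have [iid1 _ _ _ _] := g1; have [iid2 _ _ _ _] := g2.
apply: (hybrid_bound iid1.1 iid2.1 (B := p%:R * lnosc R n)).
- exact: measurable_lndet.
- by move=> a; rewrite ger0_norm ?lndet_ge0 ?lndet_le.
- exact: lndet_dep.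
move=> k c kp; rewrite !lndet_row_avg// opprD addrACA subrr add0r.
set s := crows _ _ _ _.
have np0 : 0 < (n - p)%:R :> R by rewrite ltr0n subn_gt0.
(* Only p - 1 other rows are present, so [trQ_ge] gives even n - p + 1. *)
have sz : (n - p)%:R <= trQ s.
  apply: le_trans (trQ_ge s).
  rewrite size_map size_rem ?mem_iota// size_iota natrB ?(ltnW pn)// lerD2l lerN2 ler_nat.
  exact: leq_pred.
have mk j : (j < n)%N -> cabs (m k j) <= n%:R ^+ 2 / 2 by move=> jn; apply: mB => //; exact: ltn_trans pn.
have /andP[a1 b1] := h1 n m k s _ n2 mk np0 sz; have /andP[a2 b2] := h2 n m k s _ n2 mk np0 sz.
have l0 : 0 <= 8 * ln n%:R :> R by rewrite mulr_ge0// ln_ge0// ler1n ltnW.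
have q1 : 8 * ln n%:R * (4 / n%:R ^+ 3 + C1 / (n - p)%:R) <= 8 * ln n%:R * (4 / n%:R ^+ 3 + (C1 + C2) / (n - p)%:R).
  by rewrite ler_wpM2l// lerD2l ler_pM2r ?invr_gt0// lerDl.
have q2 : 8 * ln n%:R * (4 / n%:R ^+ 3 + C2 / (n - p)%:R) <= 8 * ln n%:R * (4 / n%:R ^+ 3 + (C1 + C2) / (n - p)%:R).
  by rewrite ler_wpM2l// lerD2l ler_pM2r ?invr_gt0// lerDr.
move: a1 b1 a2 b2 q1 q2; move: (Ex Q1 _) (Ex Q2 _) (rowref _ _ _) (ln (1 - _)) => e1 e2 r l.
move: (_ * _) => z1; move: (8 * _ * _) => z2; move: (8 * _ * _) => z3 a1 b1 a2 b2 q1 q2.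
by rewrite ler_norml; apply/andP; split; lra.
Qed.

End lndet_compare.

(** * Almost sure asymptotics of log-determinants *)

Section block_series.
Context (R : realType).

Lemma powS_sub_le (x : R) k : 0 <= x -> (x + 1) ^+ k.+1 - x ^+ k.+1 <= k.+1%:R * (x + 1) ^+ k.
Proof.
move=> x0; have x1 : 0 <= x + 1 by rewrite addr_ge0.
elim: k => [|k IH]; first by rewrite !expr1 expr0 mulr1 addrAC subrr add0r.
have h1 := ler_wpM2l x1 IH.
have h2 : x ^+ k.+1 <= (x + 1) ^+ k.+1 by apply: lerXn2r; rewrite ?nnegrE// lerDl.
have e : (x + 1) ^+ k.+2 - x ^+ k.+2 = (x + 1) * ((x + 1) ^+ k.+1 - x ^+ k.+1) + x ^+ k.+1.
  by rewrite !(exprS _ k.+1); ring.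
have e2 : k.+2%:R * (x + 1) ^+ k.+1 = k.+1%:R * (x + 1) ^+ k.+1 + (x + 1) ^+ k.+1 by rewrite -natr1 mulrDl mul1r.
rewrite e e2; apply: lerD => //; apply: (le_trans h1).
by rewrite [(x + 1) ^+ k.+1]exprS mulrCA.
Qed.

Lemma root_exists n : exists L, (L ^ 40 <= n)%N && (n < L.+1 ^ 40)%N.
Proof.
elim: n => [|n [L /andP[h1 h2]]]; first by exists 0%N; rewrite exp0n//= exp1n.
have [h|h] := ltnP n.+1 (L.+1 ^ 40); first by exists L; rewrite h andbT leqW.
by exists L.+1; rewrite h /=; apply: (leq_ltn_trans h2); rewrite ltn_exp2r.
Qed.

(** The block of L has at most 40 * 2^39 * L^39 indices, so it contributes C' / L^2, which
    telescopes against 1 / (L - 1) - 1 / L. *)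
Lemma block_sum (u : nat -> R) (C : R) L0 : (2 <= L0)%N -> 0 <= C -> (forall n, 0 <= u n <= 1) ->
  (forall L n, (L0 <= L)%N -> (L ^ 40 <= n)%N -> (n < L.+1 ^ 40)%N -> u n <= C / L%:R ^+ 41) ->
  exists B, forall N, \sum_(n < N) u n <= B.
Proof.
move=> L02 C0 u1 hu.
pose C' := C * (40%:R * 2 ^+ 39).
have C'0 : 0 <= C' by rewrite mulr_ge0// mulr_ge0// exprn_ge0.
have S_ge0 N : 0 <= \sum_(n < N) u n by apply: sumr_ge0 => n _; have /andP[] := u1 n.
have main L : (L0 <= L)%N -> \sum_(n < L ^ 40) u n <= (L0 ^ 40)%:R + C' * (1 - (L.-1)%:R^-1).
  elim: L => [|L IH]; first by move: L02; case: L0 {hu}.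
  rewrite leq_eqVlt => /orP[/eqP <-|]; last rewrite ltnS => L0L.
    apply: (@le_trans _ _ (\sum_(n < L0 ^ 40) 1)).
      by apply: ler_sum => n _; have /andP[] := u1 n.
    rewrite sumr_const card_ord lerDl mulr_ge0// subr_ge0 invf_le1 ?ler1n ?ltr0n; move: L02; case: (L0) => [|[|k]] //.
  have L2 : (2 <= L)%N by exact: leq_trans L0L.
  have LS : (L ^ 40 <= L.+1 ^ 40)%N by rewrite leq_exp2r.
  have x0 : 0 < L%:R :> R by rewrite ltr0n; exact: leq_trans L2.
  rewrite -(subnKC LS) big_split_ord /=.
  have blk : \sum_(i < L.+1 ^ 40 - L ^ 40) u (L ^ 40 + i)%N <= C' / L%:R ^+ 2.
    apply: (@le_trans _ _ (\sum_(i < L.+1 ^ 40 - L ^ 40) C / L%:R ^+ 41)).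
      apply: ler_sum => i _; apply: hu => //; first exact: leq_addr.
      by rewrite -[X in (_ < X)%N](subnKC LS) ltn_add2l.
    rewrite sumr_const card_ord -(mulr_natl (C / _)) natrB// !natrX.
    have h := powS_sub_le 39 (ltW x0); rewrite natr1 in h.
    have h2 : (L.+1)%:R ^+ 39 <= (2 * L%:R) ^+ 39 :> R.
      by apply: lerXn2r; rewrite ?nnegrE ?mulr_ge0// -natrM ler_nat; move: L2; lia.
    have h3 : 0 <= C / L%:R ^+ 41 by rewrite divr_ge0// exprn_ge0.
    apply: (@le_trans _ _ (40%:R * (2 * L%:R) ^+ 39 * (C / L%:R ^+ 41))).
      by apply: ler_wpM2r => //; apply: (le_trans h); rewrite ler_wpM2l.
    rewrite le_eqVlt; apply/orP; left; apply/eqP; rewrite /C' exprMn.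
    by field; rewrite gt_eqF.
  have IH' := IH L0L.
  have x1 : 0 < (L.-1)%:R :> R by rewrite ltr0n; move: L2; case: (L) => [|[|k]].
  have tele : L%:R ^- 2 <= (L.-1)%:R^-1 - L%:R^-1 :> R.
    have -> : L%:R = (L.-1)%:R + 1 :> R by rewrite natr1 prednK// -(ltr0n R).
    move: (L.-1)%:R x1 => y y0; have y1 : 0 < y + 1 by rewrite addr_gt0.
    rewrite -subr_ge0 (_ : _ - _ = (y * (y + 1) ^+ 2)^-1).
      by rewrite invr_ge0 mulr_ge0 ?exprn_ge0 ?ltW.
    by field; rewrite !gt_eqF.
  have h5 := ler_wpM2l C'0 tele.
  apply: (le_trans (lerD IH' blk)); rewrite /=; move: h5.
  by rewrite -addrA lerD2l !mulrBr mulr1; lra.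
exists ((L0 ^ 40)%:R + C') => N.
have NL : (N <= (maxn L0 N) ^ 40)%N.
  apply: (@leq_trans (maxn L0 N)); first exact: leq_maxr.
  case: (maxn L0 N) => // k; rewrite -[X in (X <= _)%N]expn1 leq_pexp2l//.
apply: (@le_trans _ _ (\sum_(n < (maxn L0 N) ^ 40) u n)).
  rewrite -(subnKC NL) big_split_ord /= lerDl sumr_ge0// => i _.
  by have /andP[] := u1 (N + i)%N.
apply: (le_trans (main _ (leq_maxl _ _))); by rewrite lerD2l -[X in _ <= X]mulr1 ler_wpM2l// gerBl invr_ge0.
Qed.

Lemma borel_cantelli d (T : measurableType d) (P : probability T R) (F : nat -> set T) (C : R) L0 :
  (forall n, measurable (F n)) -> 0 <= C ->
  (forall L n, (L0 <= L)%N -> (L ^ 40 <= n)%N -> (n < L.+1 ^ 40)%N -> Pr P (F n) <= C / L%:R ^+ 41) ->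
  {ae P, forall w, \forall n \near \oo, ~ F n w}.
Proof.
move=> mF C0 h.
have [B hB] : exists B, forall N, \sum_(n < N) Pr P (F n) <= B.
  apply: (block_sum (u := fun n => Pr P (F n)) (C := C) (L0 := maxn 2 L0) (leq_maxl _ _) C0).
    by move=> n; rewrite Pr_ge0 Pr_le1.
  by move=> L n; rewrite geq_max => /andP[_ L0L]; exact: h.
have fin : (\sum_(n <oo) P (F n) < +oo)%E.
  apply: (@le_lt_trans _ _ B%:E); last exact: ltry.
  apply: lime_le; first exact: is_cvg_nneseries.
  apply: nearW => N; rewrite (eq_bigr (fun n => (Pr P (F n))%:E)); last by move=> n _; rewrite EFin_Pr.
  by rewrite sumEFin lee_fin big_mkord.
have Z := lim_sup_set_cvg0 mF fin.
exists (lim_sup_set F); split => //.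
  by apply: bigcap_measurable => // k _; apply: bigcup_measurable.
move=> w /= nh; rewrite /lim_sup_set => k _ /=.
apply: contrapT => hk; apply: nh; exists k => // n /= kn Fn; apply: hk; by exists n.
Qed.

End block_series.

Lemma ln_le_sub1 (R : realType) (y : R) : 0 < y -> ln y <= y - 1.
Proof.
move=> y0; have := le_ln1Dx (x := y - 1); rewrite (addrC 1) subrK; apply.
by rewrite ltrBDr addrC subrr.
Qed.

Lemma tail_alg (R : comNzRingType) (k x : R) : x * (8 * (k ^+ 2 * x ^+ 2)) = 8 * k ^+ 2 * x ^+ 3.
Proof. by ring. Qed.

Lemma dev_arith (R : realFieldType) (G F P EF E1 n d : R) :
  `|G - (F - P)| <= d / 3 * n -> `|F - EF| <= d * n -> `|EF - E1| <= d / 3 * n -> 0 <= d * n ->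
  `|G - (E1 - P)| <= 3 * d * n.
Proof.
rewrite !ler_norml => /andP[? ?] /andP[? ?] /andP[? ?] ?; apply/andP; split; lra.
Qed.

Section core.
Context (R : realType).

(** Markov's inequality for the sum of all squared moduli. The cutoff n^2 is high enough for the
    bound to be summable under two moments, and it enters the log-determinant only through ln n. *)
Lemma Pr_not_okset mu (Q : probability (Arr R) R) n (m : nat -> nat -> R[i]) : good_law mu Q -> (1 <= n)%N ->
  (forall i j, (i < n)%N -> (j < n)%N -> cabs (m i j) <= n%:R ^+ 2 / 2) ->
  Pr Q (~` okset n m (n%:R ^+ 2)) <= 4 / n%:R ^+ 2.
Proof.
move=> [iidQ _ cid var1 _] n1 mB; have [_ sqi _ _] := cid.
have n0 : 0 < n%:R :> R by rewrite ltr0n.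
pose f (a : Arr R) := \sum_(i < n) \sum_(j < n) cabs (ent a i j) ^+ 2.
have ii (i j : nat) := Ex_coord iidQ i j sqi.
have itf : itg Q f by apply: itg_sum => i; apply: itg_sum => j; exact: (ii i j).1.
have f0 a : 0 <= f a by apply: sumr_ge0 => i _; apply: sumr_ge0 => j _; exact: sqr_ge0.
have t0 : 0 < n%:R ^+ 4 / 4 :> R by rewrite divr_gt0// exprn_gt0.
have Ef : Ex Q f = n%:R ^+ 2.
  rewrite /f Ex_sum; last by move=> i; apply: itg_sum => j; exact: (ii i j).1.
  rewrite (eq_bigr (fun=> n%:R)); first by rewrite sumr_const card_ord -(mulr_natl (n%:R : R)) -expr2.
  move=> i _; rewrite Ex_sum; last by move=> j; exact: (ii i j).1.
  rewrite (eq_bigr (fun=> 1)); first by rewrite sumr_const card_ord.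
  by move=> j _; rewrite -var1; exact: (ii i j).2.
have H := markovP itf f0 t0; rewrite Ef in H.
apply: (@le_trans _ _ (n%:R ^+ 2 / (n%:R ^+ 4 / 4))); last first.
  by rewrite le_eqVlt; apply/orP; left; apply/eqP; field; rewrite gt_eqF.
apply: le_trans H; apply: le_Pr.
- by apply: measurableC; exact: measurable_okset.
- apply: measurable_leRR; [exact: measurable_cst|exact: itg_meas itf].
move=> a /= nok; rewrite leNgt; apply/negP => fa; apply: nok => i j iL jL.
rewrite leNgt; apply/negP => hij.
have xj : n%:R ^+ 2 / 2 < cabs (ent a i j).
  by have := cabsD (m i j) (ent a i j); have := mB i j iL jL; move: hij; lra.
have x2 : n%:R ^+ 4 / 4 <= cabs (ent a i j) ^+ 2.
  have -> : n%:R ^+ 4 / 4 = (n%:R ^+ 2 / 2) ^+ 2 :> R by field.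
  by apply: lerXn2r; rewrite ?nnegrE ?cabs_ge0 ?divr_ge0 ?exprn_ge0 ?ltW.
have : cabs (ent a i j) ^+ 2 <= f a.
  rewrite /f (bigD1 (Ordinal iL))//= (bigD1 (Ordinal jL))//= -addrA lerDl addr_ge0// sumr_ge0// => k _.
    exact: sqr_ge0.
  by apply: sumr_ge0 => l _; exact: sqr_ge0.
by move=> h; have := le_trans x2 h; rewrite leNgt fa.
Qed.

(** * Numerical conditions for large L *)

Section eventually.
Variables (delta C0 C1 K : R).
Hypotheses (K0 : 0 < K) (K640 : 640 <= K) (K3600 : 3600 <= K) (K3840 : 3840 <= K) (d0 : 0 < delta) (C00 : 0 <= C0) (C10 : 0 <= C1).
Variables (L n : nat).
Hypothesis (Ln : (L ^ 40 <= n)%N) (nL : (n < L.+1 ^ 40)%N).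
Hypothesis hexp : (2 * L%:R) ^+ 42 <= expR (1 * L%:R) :> R.
Let x := (L%:R : R).
Hypotheses (xC0 : K + C0 <= x) (xd1 : 3 <= delta * x) (xd2 : K * (4 + C1) <= delta * x)
  (xd3 : 8 * K ^+ 2 <= delta ^+ 2 * x).
Let xbig : 3600 <= x. Proof. by move: xC0 C00 K3600; lra. Qed.
Let x1 : 1 <= x. Proof. by move: xbig; lra. Qed.
Let x0 : 0 < x. Proof. exact: lt_le_trans x1. Qed.
Let xp k : 0 < x ^+ k. Proof. exact: exprn_gt0. Qed.
Let xle j k : (j <= k)%N -> x ^+ j <= x ^+ k. Proof. by move=> jk; exact: ler_weXn2l. Qed.
Let L3 : (3 <= L)%N. Proof. by rewrite -(ler_nat R); move: xbig; rewrite /x; lra. Qed.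
Let nx : x ^+ 40 <= n%:R. Proof. by rewrite /x -natrX ler_nat. Qed.
Let n0 : 0 < n%:R :> R. Proof. exact: lt_le_trans nx. Qed.
Let n1 : 1 <= n%:R :> R. Proof. by apply: le_trans nx; exact: exprn_ege1. Qed.

Lemma ev_ln : ln n%:R <= 80 * x :> R.
Proof.
have h := n_le_pow R L3 nL.
apply: (@le_trans _ _ (ln ((2 * x) ^+ 40))); first by rewrite ler_ln ?posrE ?exprn_gt0 ?mulr_gt0.
rewrite lnX_nat ?mulr_gt0//.
have h2 : ln (2 * x) <= 2 * x - 1 by apply: ln_le_sub1; rewrite mulr_gt0.
by move: h2 x0; lra.
Qed.

Lemma ev_ln0 : 0 <= ln n%:R :> R. Proof. by rewrite ln_ge0. Qed.

Lemma ev_det : (L ^ 20)%:R * (44 * ln n%:R + C0) <= delta / 3 * n%:R.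
Proof.
apply: (@le_trans _ _ (x ^+ 20 * x ^+ 2)).
  rewrite natrX ler_pM2l ?xp//; have l := ev_ln.
  have xC0' : 3600 + C0 <= x by move: xC0 K3600; lra.
  have h := ler_wpM2r (ltW x0) xC0'; have hc := ler_wpM2l C00 x1; rewrite -expr2 in h; move: l h hc x0; lra.
apply: le_trans (ler_wpM2l _ nx); last by rewrite divr_ge0// ltW.
rewrite -exprD; apply: (@le_trans _ _ (delta / 3 * x * x ^+ 22)).
  by rewrite -[X in X <= _]mul1r ler_pM2r ?xp//; move: xd1; lra.
by rewrite -mulrA -exprS ler_pM2l ?divr_gt0//; exact: xle.
Qed.

Lemma ev_cmp (p : nat) (l : R) : (p <= n)%N -> l <= delta / 6 ->
  p%:R * (l + 8 * ln n%:R * (4 / n%:R ^+ 3 + C1 / (L ^ 20)%:R)) <= delta / 3 * n%:R.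
Proof.
move=> pn hl.
have h3 : x ^+ 2 <= n%:R ^+ 3.
  apply: (@le_trans _ _ (x ^+ 40)); first exact: xle.
  by apply: (le_trans nx); rewrite -[X in X <= _]expr1; exact: ler_weXn2l.
have i1 : (n%:R ^+ 3)^-1 <= (x ^+ 2)^-1 :> R by rewrite lef_pV2 ?posrE ?exprn_gt0.
have i2 : ((L ^ 20)%:R)^-1 <= (x ^+ 2)^-1 :> R.
  by rewrite natrX lef_pV2 ?posrE ?exprn_gt0//; exact: (@xle 2 20).
have a1 : 4 / n%:R ^+ 3 + C1 / (L ^ 20)%:R <= (4 + C1) / x ^+ 2.
  by rewrite [X in _ <= X]mulrDl; apply: lerD; apply: ler_wpM2l.
have a0 : 0 <= 4 / n%:R ^+ 3 + C1 / (L ^ 20)%:R.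
  by rewrite addr_ge0// divr_ge0// exprn_ge0.
have a2 : 8 * ln n%:R * (4 / n%:R ^+ 3 + C1 / (L ^ 20)%:R) <= delta / 6.
  apply: (@le_trans _ _ (8 * (80 * x) * ((4 + C1) / x ^+ 2))).
    by apply: ler_pM => //; rewrite ?mulr_ge0 ?ev_ln0// ler_wpM2l// ev_ln.
  rewrite (_ : 8 * (80 * x) * ((4 + C1) / x ^+ 2) = 640 * (4 + C1) / x); last by field; rewrite gt_eqF.
  have C14 : 0 <= 4 + C1 by rewrite addr_ge0.
  by rewrite ler_pdivrMr//; have := ler_wpM2r C14 K3840; move: xd2; lra.
apply: (@le_trans _ _ (p%:R * (delta / 3))); first by rewrite ler_wpM2l//; move: hl a2; lra.
by rewrite mulrC ler_wpM2l ?divr_ge0 ?(ltW d0)// ler_nat.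
Qed.

Lemma ev_osc : lnosc R n <= K * x.
Proof.
have l := ev_ln.
apply: (@le_trans _ _ (8 * ln n%:R)); last first.
  by have := ler_wpM2r (ltW x0) K640; move: l; lra.
have n2 : 2 <= n%:R :> R by apply: le_trans nx; apply: le_trans (xle (isT : (1 <= 40)%N)); rewrite expr1; move: xbig; lra.
rewrite /lnosc -lnX_nat// ler_ln ?posrE ?exprn_gt0 ?ltr_wpDr ?exprn_ge0//.
have h7 := exprn_ege1 7 n1; rewrite (exprS _ 7).
have := ler_wpM2r (exprn_ge0 7 (ltW n0)) n2; move: h7; lra.
Qed.

Lemma ev_tail : delta <= 1 -> 2 * expR (- (delta ^+ 2 * n%:R / (8 * (K * x) ^+ 2))) <= x ^- 41.
Proof.
move=> d1; apply: (@le_trans _ _ (2 * expR (- (1 * x)))).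
  rewrite ler_pM2l// ler_expR lerN2 mul1r ler_pdivlMr; last by rewrite mulr_gt0// exprn_gt0// mulr_gt0.
  rewrite exprMn; apply: (@le_trans _ _ (delta ^+ 2 * x ^+ 40)); last by rewrite ler_pM2l ?exprn_gt0.
  rewrite (_ : x * _ = 8 * K ^+ 2 * x ^+ 3); last exact: tail_alg.
  apply: (@le_trans _ _ (delta ^+ 2 * x * x ^+ 3)).
    by rewrite ler_pM2r ?xp.
  by rewrite -mulrA -exprS ler_pM2l ?exprn_gt0//; exact: xle.
rewrite expRN; apply: (@le_trans _ _ (2 * ((2 * x) ^+ 42)^-1)).
  by rewrite ler_pM2l// lef_pV2 ?posrE ?expR_gt0 ?exprn_gt0 ?mulr_gt0.
rewrite exprS invfM mulrA -mulrA; apply: (@le_trans _ _ (x^-1 * ((2 * x) ^+ 41)^-1)).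
  by rewrite le_eqVlt; apply/orP; left; apply/eqP; field; rewrite !gt_eqF// mulr_gt0.
apply: (@le_trans _ _ (1 * (x ^+ 41)^-1)); last by rewrite mul1r.
apply: ler_pM; rewrite ?invr_ge0 ?exprn_ge0 ?mulr_ge0 ?(ltW x0)// ?invf_le1//.
rewrite lef_pV2 ?posrE ?exprn_gt0 ?mulr_gt0//; apply: lerXn2r; rewrite ?nnegrE ?mulr_ge0 ?(ltW x0)//.
by move: x0; lra.
Qed.

Lemma ev_ok : 4 / n%:R ^+ 2 <= x ^- 41.
Proof.
have h : x ^+ 42 <= n%:R ^+ 2.
  by apply: (@le_trans _ _ ((x ^+ 40) ^+ 2)); [rewrite -exprM; exact: xle|apply: lerXn2r; rewrite ?nnegrE ?exprn_ge0 ?(ltW x0) ?(ltW n0)].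
rewrite ler_pdivrMr ?exprn_gt0// mulrC ler_pdivlMr//; apply: le_trans h.
by rewrite (exprS _ 41) ler_pM2r//; move: xbig; lra.
Qed.

End eventually.

Definition detdev n (m : nat -> nat -> R[i]) (c delta : R) : set (Arr R) :=
  ~` [set a | 0 < gramR (rowsm m n n a) /\ `|ln (gramR (rowsm m n n a)) / n%:R - c| <= delta].

Lemma measurable_detdev n m c delta : measurable (detdev n m c delta).
Proof.
have mg : measurable_fun setT (fun a : Arr R => gramR (rowsm m n n a)).
  by apply: measurable_gramR => *; exact: cmeas_rowsm.
apply: measurableC; apply: measurableI; first by apply: measurable_ltRR => //; exact: measurable_cst.
apply: measurable_leRR; last exact: measurable_cst.
apply: measurableT_comp; first exact: normr_measurable.
apply: measurable_funB; last exact: measurable_cst.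
apply: measurable_funM; last exact: measurable_cst.
by apply: (measurableT_comp (f := @ln R)) => //; exact: measurable_ln.
Qed.

Definition logdet_center (Q1 : probability (Arr R) R) n (m : nat -> nat -> R[i]) p : R :=
  (Ex Q1 (fun a => lndet n m a p) - 2 * p%:R * ln n%:R) / n%:R.

End core.

Lemma sum_inv5 (F : fieldType) (y : F) : y^-1 + (3 / y + y^-1) = 5 / y.
Proof. by ring. Qed.

Section core_laws.
Context (R : realType).

(** Three failures add up to 5: an entry above the cutoff (1), a determinant far from its
    regularised part (3), a deviation from the mean (1). The centre is computed from [Q1] even for
    the array of law [Q], which is where the exchange of rows enters. *)
Lemma core_tail mu1 mu Q1 Q (delta : R) : good_law mu1 Q1 -> good_law mu Q -> 0 < delta -> delta <= 1 ->
  exists L0 : nat, forall L n m, (L0 <= L)%N -> (L ^ 40 <= n)%N -> (n < L.+1 ^ 40)%N ->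
  (forall i j, (i < n)%N -> (j < n)%N -> cabs (m i j) <= n%:R ^+ 2 / 2) ->
  Pr Q (detdev n m (logdet_center Q1 n m (n - L ^ 20)) delta) <= 5 / L%:R ^+ 41.
Proof.
move=> g1 g d0 d1.
have [iidQ [alpha [beta [kappa [a0 b0 b2 k0 [ND PAIR]]]]] cid var1 tr] := g.
have [L1 hL1] := det_event iidQ a0 b0 b2 k0 ND PAIR.
set C0 := `|ln (alpha ^+ 2)| + (alpha ^+ 2)^-1 in hL1.
have C00 : 0 <= C0 by rewrite addr_ge0// invr_ge0 sqr_ge0.
pose delta' := delta / 3.
have d'0 : 0 < delta' by rewrite divr_gt0.
have d'1 : delta' <= 1 by rewrite /delta'; lra.
pose t := delta' / 48.
have t0 : 0 < t by rewrite divr_gt0.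
have t2 : t < 2^-1 by rewrite /t; move: d'1; lra.
have lt : - ln (1 - 2 * t) <= delta' / 6.
  have tp : 0 < 1 - 2 * t by move: t2; lra.
  rewrite -lnV ?posrE//.
  apply: (@le_trans _ _ ((1 - 2 * t)^-1 - 1)); first by apply: ln_le_sub1; rewrite invr_gt0.
  rewrite lerBlDr -[X in X <= _]mul1r ler_pdivrMr// /t.
  by have := mulr_ge0 (ltW d'0) (ltW d'0); move: d'0 d'1; nra.
have [C1 C10 hC1] := lndet_compare g g1 t0 t2.
have [L2 hL2] := pow_le_expR 42 (ltr01 : 0 < 1 :> R).
(* The constants to dominate are 8 * 80, 44 * 80 and 6 * 8 * 80, where 80 comes from ln n <= 80 L;
   [K] is used through these bounds only. *)
have [K [K0 K640 K3600 K3840]] : exists K : R, [/\ 0 < K, 640 <= K, 3600 <= K & 3840 <= K].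
  by exists 3840; split; rewrite ?ltr0n ?ler_nat.
pose q1 := 3 / delta'; pose q2 := K * (4 + C1) / delta'; pose q3 := 8 * K ^+ 2 / delta' ^+ 2.
have q10 : 0 <= q1 by rewrite divr_ge0// ltW.
have q20 : 0 <= q2 by rewrite divr_ge0 ?(ltW d'0)// mulr_ge0 ?(ltW K0)// addr_ge0.
have q30 : 0 <= q3 by rewrite divr_ge0 ?sqr_ge0// mulr_ge0// sqr_ge0.
pose CC := K + C0 + (q1 + (q2 + q3)).
exists (maxn (maxn L1 L2) (maxn 3 (Num.truncn CC).+1)) => L n m.
rewrite !geq_max => /andP[/andP[LL1 LL2] /andP[L3 LC]] Ln nL mB.
have CCL : CC <= L%:R by apply: (le_trans (ltW (truncnS_gt CC))); rewrite ler_nat.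
have xC0 : K + C0 <= L%:R by apply: le_trans CCL; rewrite lerDl !addr_ge0.
have xq (q : R) : q <= q1 + (q2 + q3) -> q <= L%:R.
  by move=> h; apply: (le_trans h); apply: le_trans CCL; rewrite lerDr addr_ge0 ?(ltW K0).
have xd1 : 3 <= delta' * L%:R by rewrite mulrC -ler_pdivrMr//; apply: xq; rewrite lerDl addr_ge0.
have xd2 : K * (4 + C1) <= delta' * L%:R.
  by rewrite [X in _ <= X]mulrC -ler_pdivrMr//; apply: xq; rewrite addrCA lerDl addr_ge0.
have xd3 : 8 * K ^+ 2 <= delta' ^+ 2 * L%:R.
  by rewrite [X in _ <= X]mulrC -ler_pdivrMr ?exprn_gt0//; apply: xq; rewrite addrA lerDr addr_ge0.
have hx := hL2 L LL2.
have L0 : (0 < L)%N by exact: leq_trans L3.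
have L20 : (0 < L ^ 20)%N by rewrite expn_gt0 L0.
have L2040 : (L ^ 20 < L ^ 40)%N by rewrite ltn_exp2l//; exact: leq_trans L3.
have Lltn : (L ^ 20 < n)%N by exact: leq_trans Ln.
have n2 : (2 <= n)%N by apply: leq_ltn_trans Lltn.
have n0 : 0 < n%:R :> R by rewrite ltr0n ltnW.
set p := (n - L ^ 20)%N.
have pn : (p < n)%N by rewrite /p ltn_subrL L20 ltnW.
have np : (n - p = L ^ 20)%N by rewrite /p subKn// ltnW.
have e1 : (L ^ 20)%:R * (44 * ln n%:R + C0) <= delta' / 3 * n%:R by apply: (ev_det (K := K)); rewrite ?divr_gt0 ?d0 ?C00 ?K0 ?K3600.
have e2 l : l <= delta' / 6 -> p%:R * (l + 8 * ln n%:R * (4 / n%:R ^+ 3 + C1 / (L ^ 20)%:R)) <= delta' / 3 * n%:R.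
  move=> hl; apply: (ev_cmp (K := K) (C0 := C0)) => //; exact: ltnW.
have e3 : lnosc R n <= K * L%:R by apply: (ev_osc (C0 := C0)).
have e4 : 2 * expR (- (delta' ^+ 2 * n%:R / (8 * (K * L%:R) ^+ 2))) <= L%:R ^- 41 by apply: (ev_tail (C0 := C0)).
have e5 : 4 / n%:R ^+ 2 <= L%:R ^- 41 :> R by apply: (ev_ok (K := K) (C0 := C0)).
have cmp := hC1 n m p n2 pn mB; rewrite np in cmp.
pose F a := lndet n m a p.
have lnB a : `|F a| <= p%:R * lnosc R n by rewrite ger0_norm ?lndet_ge0 ?lndet_le.
have Fosc : row_osc (K * L%:R) F.
  move=> i a b ab; apply: le_trans e3.
  by have H := @lndet_osc R n m p; exact: H ab.
have c1 : 1 <= K * L%:R.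
  have h1 : 1 <= L%:R :> R by rewrite ler1n.
  have h2 : 1 <= K by apply: le_trans K640; rewrite ler1n.
  by rewrite -[X in X <= _]mulr1; apply: ler_pM.
have MD := mcdiarmid iidQ.1 c1 d'0 d'1 (ltnW pn) (measurable_lndet n m p) lnB (@lndet_dep _ n m p) Fosc.
set E := [set a | delta' * n%:R <= `|lndet n m a p - Ex Q (fun a => lndet n m a p)|] in MD.
set D := okset n m (n%:R ^+ 2) `&` ~` detgood n m p ((L ^ 20)%:R * (44 * ln n%:R + C0)).
have mE : measurable E.
  apply: measurable_leRR; first exact: measurable_cst.
  apply: measurableT_comp; first exact: normr_measurable.
  by apply: measurable_funB; [exact: measurable_lndet|exact: measurable_cst].
have mD : measurable D.
  by apply: measurableI; [exact: measurable_okset|apply: measurableC; exact: measurable_detgood].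
have mO : measurable (~` okset n m (n%:R ^+ 2) : set (Arr R)) by apply: measurableC; exact: measurable_okset.
have sub : detdev n m (logdet_center Q1 n m p) delta `<=` ~` okset n m (n%:R ^+ 2) `|` (D `|` E).
  move=> a dv; apply: contrapT => /not_orP[/contrapT ok /not_orP[nD nE]]; apply: dv.
  have [G0 hG] : detgood n m p ((L ^ 20)%:R * (44 * ln n%:R + C0)) a.
    by apply: contrapT => ng; apply: nD.
  split => //; move/negP: nE; rewrite -ltNge => hF.
  rewrite /logdet_center -mulrBl normrM (ger0_norm (_ : 0 <= n%:R^-1)) ?invr_ge0 ?(ltW n0)// ler_pdivrMr//.
  have {}cmp := le_trans cmp (e2 _ lt); have {}hG := le_trans hG e1.
  rewrite (_ : delta = 3 * delta'); last by rewrite /delta'; field.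
  apply: dev_arith hG (ltW hF) cmp _; exact: ltW (mulr_gt0 d'0 n0).
apply: (@le_trans _ _ (Pr Q (~` okset n m (n%:R ^+ 2) `|` (D `|` E)))).
  apply: le_Pr => //; first exact: measurable_detdev.
  by apply: measurableU => //; exact: measurableU.
have mDE : measurable (D `|` E) by exact: measurableU.
apply: (le_trans (Pr_setU _ mO mDE)).
have bb1 := le_trans (Pr_not_okset g (ltnW n2) mB) e5.
have bb2 := le_trans (Pr_setU Q mD mE) (lerD (hL1 L n m LL1 Ln nL) (le_trans MD e4)).
by apply: (le_trans (lerD bb1 bb2)); rewrite sum_inv5.
Qed.

Lemma core_as mu1 mu Q1 Q (m : nat -> nat -> nat -> R[i]) (c : nat -> R) : good_law mu1 Q1 -> good_law mu Q ->
  (\forall n \near \oo, forall i j, (i < n)%N -> (j < n)%N -> cabs (m n i j) <= n%:R ^+ 2 / 2) ->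
  (forall L n, (L ^ 40 <= n)%N -> (n < L.+1 ^ 40)%N -> c n = logdet_center Q1 n (m n) (n - L ^ 20)) ->
  {ae Q, forall a, forall k : nat, \forall n \near \oo, ~ detdev n (m n) (c n) (k.+1%:R^-1) a}.
Proof.
move=> g1 g [N _ mB] hc.
apply: ae_foralln => k.
have k0 : 0 < k.+1%:R^-1 :> R by rewrite invr_gt0.
have k1 : k.+1%:R^-1 <= 1 :> R by rewrite invf_le1// ler1n.
have [L0 hL0] := core_tail g1 g k0 k1.
apply: (@borel_cantelli R _ _ Q _ 5 (maxn L0 N)) => //.
  by move=> n; exact: measurable_detdev.
move=> L n; rewrite geq_max => /andP[L0L NL] Ln nL.
rewrite (hc L n Ln nL); apply: hL0 => //; apply: mB => /=.
apply: leq_trans Ln; case: L NL {L0L nL} => [|L] NL; first by move: NL; rewrite leqn0 => /eqP ->.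
by apply: (leq_trans NL); rewrite -[X in (X <= _)%N]expn1 leq_pexp2l.
Qed.

Lemma center_exists Q1 (m : nat -> nat -> nat -> R[i]) : exists c : nat -> R,
  forall L n, (L ^ 40 <= n)%N -> (n < L.+1 ^ 40)%N -> c n = logdet_center Q1 n (m n) (n - L ^ 20).
Proof.
have [Lr hLr] := choice root_exists.
exists (fun n => logdet_center Q1 n (m n) (n - Lr n ^ 20)) => L n Ln nL.
suff -> : Lr n = L by [].
have /andP[h1 h2] := hLr n; apply/eqP; rewrite eqn_leq -ltnS -[X in _ && X]ltnS.
rewrite -(@ltn_exp2r _ _ 40)// -[X in _ && X](@ltn_exp2r _ _ 40)//.
by rewrite (leq_ltn_trans h1 nL) (leq_ltn_trans Ln h2).
Qed.

End core_laws.

(** * Laws with zero mean and unit variance *)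

Section law_facts.
Context (R : realType) (mu : probability (borelC R) R).
Local Notation modulus x := (cabs (x : R[i])).
Hypothesis sqi : itg mu (fun x : borelC R => modulus x ^+ 2).
Hypothesis var1 : Ex mu (fun x : borelC R => modulus x ^+ 2) = 1.
Hypothesis re0 : Ex mu (fun x : borelC R => complex.Re (x : R[i])) = 0.
Hypothesis im0 : Ex mu (fun x : borelC R => complex.Im (x : R[i])) = 0.

Let mc : measurable_fun setT (fun x : borelC R => modulus x).
Proof. exact: measurable_cabs (@cmeas_borelC R). Qed.

Definition sq_tail (B : R) (x : borelC R) : R := cabs (x : R[i]) ^+ 2 * (B < cabs (x : R[i]))%R%:R.

Let measurable_ball B : measurable [set x : borelC R | B < cabs (x : R[i])].
Proof. by apply: measurable_ltRR => //; exact: measurable_cst. Qed.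

Lemma measurable_boolR d (T : measurableType d) (b : T -> bool) :
  measurable [set x | b x] -> measurable_fun setT (fun x => (b x)%:R : R).
Proof.
move=> mb; rewrite (_ : (fun x => _) = \1_[set x | b x]); first exact: measurable_indic.
by apply/funext => x; rewrite indicE; case: (boolP (b x)) => h; [rewrite mem_set|rewrite memNset//; apply/negP].
Qed.

Lemma sq_tail_bounds B x : 0 <= sq_tail B x <= modulus x ^+ 2.
Proof. by rewrite /sq_tail; case: (B < _); rewrite ?mulr1 ?mulr0 ?sqr_ge0 ?lexx. Qed.

Lemma itg_sq_tail B : itg mu (sq_tail B).
Proof.
apply: (@itg_dom _ _ _ _ _ (fun x : borelC R => modulus x ^+ 2)) => //.
  by apply: measurable_funM; [exact: measurable_funX|exact: measurable_boolR].
by move=> x; have /andP[h0 h1] := sq_tail_bounds B x; rewrite ger0_norm.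
Qed.

Lemma sq_tail_small (e : R) : 0 < e -> exists2 B : R, 1 <= B & Ex mu (sq_tail B) <= e.
Proof.
move=> e0.
have h : [sequence (\int[mu]_x (sq_tail n%:R x)%:E)%E]_n @ \oo --> (\int[mu]_(x in [set: borelC R]) 0)%E.
  apply: (@dominated_cvg _ _ R mu setT measurableT (fun n x => (sq_tail n%:R x)%:E) (fun=> 0%E) (fun x => (modulus x ^+ 2)%:E)).
  - by move=> n; apply/measurable_EFinP; exact: itg_meas (itg_sq_tail _).
  - move=> x _; apply: cvg_near_cst.
    exists (Num.truncn (modulus x)).+1 => // n /= xn; congr EFin.
    rewrite /sq_tail (_ : (_ < _) = false) ?mulr0//; apply/negbTE; rewrite -leNgt.
    by apply: (le_trans (ltW (truncnS_gt _))); rewrite ler_nat.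
  - by [].
  - exact: sqi.
  - by move=> n x _; rewrite /= lee_fin; have /andP[h0 h1] := sq_tail_bounds n%:R x; rewrite ger0_norm.
rewrite integral0 in h.
have h' : (fun n : nat => Ex mu (sq_tail n%:R)) @ \oo --> (0 : R).
  exact: (fine_cvg h).
move/cvgrPdist_le : h' => /(_ e e0) [N _ hN].
exists N.+1%:R; first by rewrite ler1n.
have := hN N.+1 (leqnSn N); rewrite /= sub0r normrN; apply: le_trans; exact: ler_norm.
Qed.

(** The positive part of [u] is at most m / 4 off the set and at most [B] on it, apart from moduli
    above [B], where [sq_tail B] dominates it. Integrating bounds the mass of the set from below. *)
Lemma positive_mass (u : borelC R -> R) (m B : R) : measurable_fun setT u ->
  (forall x, `|u x| <= modulus x) -> 0 < m -> m <= Ex mu (fun x => Num.max (u x) 0) -> 1 <= B ->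
  Ex mu (sq_tail B) <= m / 4 ->
  m / (2 * B) <= Pr mu [set x | m / 4 < u x /\ modulus x <= B].
Proof.
move=> mu_ ub m0 mE B1 hB; set E := [set x | _].
have B0 : 0 < B by exact: lt_le_trans B1.
have mE' : measurable E.
  by apply: measurableI; [apply: measurable_ltRR|apply: measurable_leRR] => //; exact: measurable_cst.
have i1 : itg mu (fun x => Num.max (u x) 0).
  apply: (@itg_dom _ _ _ _ _ (fun x : borelC R => 1 + modulus x ^+ 2)).
  - by apply: measurable_maxr => //; exact: measurable_cst.
  - move=> x; have := ub x; rewrite ler_norml => /andP[h1 h2].
    have h3 := sqr_ge0 (modulus x - 1); have h0 := cabs_ge0 (x : R[i]).
    rewrite ger0_norm ?le_max ?lexx ?orbT// ge_max; apply/andP; split.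
      by move: h3; rewrite sqrrB1; move: h2 h0; lra.
    by rewrite addr_ge0// sqr_ge0.
  - by apply: itgD => //; exact: itg_cst.
have i2 : itg mu (fun x => B * \1_E x) by apply: itgZ; exact: itg_indic.
have i3 : itg mu (fun x => m / 4 + B * \1_E x) by apply: itgD => //; exact: itg_cst.
have i4 := itgD i3 (itg_sq_tail B).
have pt x : Num.max (u x) 0 <= m / 4 + B * \1_E x + sq_tail B x.
  have /andP[h0 _] := sq_tail_bounds B x.
  have i0 : 0 <= B * \1_E x by rewrite mulr_ge0// ltW.
  rewrite ge_max; apply/andP; split; last by move: m0; lra.
  have [um|um] := leP (u x) (m / 4); first by move: h0 i0 um; lra.
  have := ub x; rewrite ler_norml => /andP[_ h2].
  have [xB|xB] := leP (modulus x) B.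
    have -> : \1_E x = 1 :> R by rewrite indicE mem_set.
    by rewrite mulr1; move: h2 m0 h0 xB; lra.
  have h4 : modulus x <= sq_tail B x.
    rewrite /sq_tail xB mulr1 expr2 ler_peMl ?cabs_ge0//; exact: ltW (le_lt_trans B1 xB).
  by move: h2 i0 m0 h4; lra.
have := le_Ex i1 i4 pt; rewrite (ExD i3 (itg_sq_tail B)) (ExD (itg_cst _ _) i2) Ex_cst ExZ; last exact: itg_indic.
rewrite -Pr_Ex// => h; rewrite ler_pdivrMr ?mulr_gt0//.
by move: h mE hB; lra.
Qed.

(** A centred [u] with second moment bounded below has E|u| bounded below, hence positive and
    negative parts of equal, positive mean. The law then charges both u > s and u < - s within
    modulus [B]: a ball of radius s misses one of these sets, and a pair drawn from both is
    separated. *)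
Lemma nondegenerate_coordinate (u : borelC R -> R) : measurable_fun setT u ->
  (forall x, `|u x| <= modulus x) -> (forall x y, u x - u y <= cabs ((x : R[i]) - y)) ->
  Ex mu u = 0 -> 2^-1 <= Ex mu (fun x => u x ^+ 2) -> nondegenerate_law mu.
Proof.
move=> mu_ ub ul u0 u2.
have q0 : 0 < 4^-1 :> R by rewrite invr_gt0.
have [B1 B11 hB1] := sq_tail_small q0.
have B10 : 0 < B1 by exact: lt_le_trans B11.
have iu2 : itg mu (fun x => u x ^+ 2).
  apply: (@itg_dom _ _ _ _ _ (fun x : borelC R => modulus x ^+ 2)) => //; first exact: measurable_funX.
  by move=> x; rewrite ger0_norm ?sqr_ge0// -(real_normK (num_real (u x))); apply: lerXn2r; rewrite ?nnegrE ?cabs_ge0.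
have iau : itg mu (fun x => `|u x|).
  apply: (@itg_dom _ _ _ _ _ (fun x : borelC R => 1 + modulus x ^+ 2)).
  - by apply: measurableT_comp => //; exact: normr_measurable.
  - move=> x; rewrite normr_id; apply: (le_trans (ub x)).
    by have := sqr_ge0 (modulus x - 1); rewrite sqrrB1; have := cabs_ge0 (x : R[i]); lra.
  - by apply: itgD => //; exact: itg_cst.
have iu : itg mu u by apply: (itg_dom mu_ _ iau).
pose m : R := (8 * B1)^-1.
have m0 : 0 < m by rewrite invr_gt0 mulr_gt0.
have Eau : 2 * m <= Ex mu (fun x => `|u x|).
  have i4 := itgD (itgZ B1 iau) (itg_sq_tail B1).
  have pt x : u x ^+ 2 <= B1 * `|u x| + sq_tail B1 x.
    have /andP[h0 _] := sq_tail_bounds B1 x.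
    have e : u x ^+ 2 = `|u x| * `|u x| by rewrite -expr2 real_normK ?num_real.
    have [xB|xB] := leP (modulus x) B1.
      rewrite e; apply: ler_wpDr => //; apply: ler_wpM2r => //; exact: le_trans (ub x) xB.
    apply: ler_wpDl; first by rewrite mulr_ge0// ltW.
    by rewrite /sq_tail xB mulr1 e expr2; apply: ler_pM.
  have := le_Ex iu2 i4 pt; rewrite (ExD (itgZ B1 iau) (itg_sq_tail B1)) ExZ// => h.
  have h5 : 4^-1 <= B1 * Ex mu (fun x => `|u x|) by move: h u2 hB1; lra.
  have -> : 2 * m = 4^-1 / B1 by rewrite /m; field; rewrite gt_eqF.
  by rewrite ler_pdivrMr// mulrC.
have half (v : borelC R -> R) : itg mu v -> itg mu (fun x => `|v x|) -> Ex mu v = 0 ->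
    2 * m <= Ex mu (fun x => `|v x|) -> m <= Ex mu (fun x => Num.max (v x) 0).
  move=> iv iav v0 h.
  have -> : Ex mu (fun x => Num.max (v x) 0) = Ex mu (fun x => 2^-1 * (v x + `|v x|)).
    apply: eq_Ex => x; case: (leP 0 (v x)) => hv; [rewrite ger0_norm//|rewrite ltr0_norm// subrr mulr0//].
    by field.
  by rewrite ExZ ?(ExD iv iav) ?v0; [move: h; lra|exact: itgD].
have m40 : 0 < m / 4 by rewrite divr_gt0.
have [B B1' hB] := sq_tail_small m40.
have B0 : 0 < B by exact: lt_le_trans B1'.
set s := m / 4 in hB m40.
set b := m / (2 * B).
have b0 : 0 < b by rewrite divr_gt0// mulr_gt0.
have hp : b <= Pr mu [set x | s < u x /\ modulus x <= B].
  by apply: positive_mass => //; exact: half.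
have hn : b <= Pr mu [set x | s < - u x /\ modulus x <= B].
  apply: (positive_mass (u := fun x => - u x)) => //.
  - exact: measurable_funN.
  - by move=> x; rewrite normrN.
  - apply: half; first exact: itgN.
    + by apply: eq_itg iau => x; rewrite normrN.
    + by rewrite ExN// u0 oppr0.
    + suff -> : Ex mu (fun x => `|- u x|) = Ex mu (fun x => `|u x|) by [].
      by apply: eq_Ex => x; rewrite normrN.
set Ep := [set x | s < u x /\ _] in hp; set En := [set x | s < - u x /\ _] in hn.
have mEp : measurable Ep.
  by apply: measurableI; [apply: measurable_ltRR|apply: measurable_leRR] => //; exact: measurable_cst.
have mEn : measurable En.
  by apply: measurableI; [apply: measurable_ltRR; [exact: measurable_cst|exact: measurable_funN]|apply: measurable_leRR => //; exact: measurable_cst].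
have b1 : b <= 1 := le_trans hp (Pr_le1 mu mEp).
have bb : b ^+ 2 <= b by rewrite expr2 ler_piMl// ltW.
(* The pair has probability at least b^2, which is below b; halving also meets [beta <= 2^-1]. *)
exists s, (b ^+ 2 / 2), (2 * B); split => //.
- by rewrite divr_gt0// exprn_gt0.
- by rewrite -[X in _ <= X]mul1r; apply: ler_wpM2r => //; exact: le_trans bb b1.
- by rewrite mulr_gt0.
split.
- move=> c.
  have mball : measurable [set x : borelC R | cabs ((x : R[i]) - c) <= s].
    apply: measurable_leRR; last exact: measurable_cst.
    by apply: measurable_cabs; apply: cmeasB; [exact: cmeas_borelC|exact: cmeas_cst].
  have far (E : set (borelC R)) : measurable E -> b <= Pr mu E ->
      (forall x, cabs ((x : R[i]) - c) <= s -> ~ E x) -> 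
      Pr mu [set x : borelC R | cabs ((x : R[i]) - c) <= s] <= 1 - b ^+ 2 / 2.
    move=> mE bE dis; apply: (@le_trans _ _ (Pr mu (~` E))).
      by apply: le_Pr => //; exact: measurableC.
    by rewrite Pr_setC//; move: bE bb b0; lra.
  have [uc|uc] := leP (u c) 0.
    apply: (far Ep) => // x xc [ux _]; have := ul x c; move: uc ux xc; lra.
  apply: (far En) => // x xc [ux _]; have := ul c x; rewrite cabsB; move: uc ux xc; lra.
- apply: (@le_trans _ _ (b ^+ 2)); first by move: (sqr_ge0 b); lra.
  apply: (@le_trans _ _ (Pr (mu \x mu)%E (Ep `*` En))).
    have -> : Pr (mu \x mu)%E (Ep `*` En) = Pr mu Ep * Pr mu En.
      rewrite /Pr; transitivity (fine (mu Ep * mu En)%E); first by congr fine; exact: product_measure1E.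
      by rewrite fineM// fin_num_measure.
    rewrite expr2; apply: ler_pM => //; exact: ltW.
  apply: le_Pr; [exact: measurableX|exact: measurable_pairset|].
  move=> [x y] /= [[ux xB] [uy yB]]; split => /=.
    by have := ul x y; move: m40 ux uy; lra.
  by apply: (le_trans (cabs_triB _ _)); move: xB yB; lra.
Qed.

Let mRe : measurable_fun setT (fun x : borelC R => complex.Re (x : R[i])). Proof. by have [] := @cmeas_borelC R. Qed.
Let mIm : measurable_fun setT (fun x : borelC R => complex.Im (x : R[i])). Proof. by have [] := @cmeas_borelC R. Qed.

Lemma unit_nondegenerate : nondegenerate_law mu.
Proof.
have i1 (u : borelC R -> R) : measurable_fun setT u -> (forall x, `|u x| <= modulus x) -> itg mu (fun x => u x ^+ 2).
  move=> mu_ ub; apply: (@itg_dom _ _ _ _ _ (fun x : borelC R => modulus x ^+ 2)) => //; first exact: measurable_funX.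
  by move=> x; rewrite ger0_norm ?sqr_ge0// -(real_normK (num_real (u x))); apply: lerXn2r; rewrite ?nnegrE ?cabs_ge0.
have iR := i1 _ mRe (fun x => Re_le_cabs (x : R[i])).
have iI := i1 _ mIm (fun x => Im_le_cabs (x : R[i])).
have sum1 : Ex mu (fun x : borelC R => complex.Re (x : R[i]) ^+ 2) + Ex mu (fun x : borelC R => complex.Im (x : R[i]) ^+ 2) = 1.
  by rewrite -(ExD iR iI) -var1; apply: eq_Ex => x; rewrite cabs_sqr.
have [h|h] := leP 2^-1 (Ex mu (fun x : borelC R => complex.Re (x : R[i]) ^+ 2)).
  apply: (nondegenerate_coordinate mRe) => //; first by move=> x; exact: Re_le_cabs.
  by move=> x y; rewrite -ReN -ReD; apply: le_trans (Re_le_cabs _); exact: ler_norm.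
apply: (nondegenerate_coordinate mIm) => //; first by move=> x; exact: Im_le_cabs.
  by move=> x y; rewrite -ImN -ImD; apply: le_trans (Im_le_cabs _); exact: ler_norm.
by move: sum1 h; lra.
Qed.

Lemma unit_centered : centered mu (fun x : borelC R => (x : R[i])).
Proof. by split => //; exact: cmeas_borelC. Qed.

(** Cut at modulus [B] and recentre. The discarded part [k] has mean opposite to the kept part,
    because the law is centred, so x - g is [k] minus its mean and its second moment is at most that
    of [k]. *)
Lemma unit_truncatable : truncatable mu.
Proof.
move=> t t0; have [B B1 hB] := sq_tail_small t0.
have B0 : 0 < B by exact: lt_le_trans B1.
pose chi (x : borelC R) : R := (B < cabs (x : R[i]))%R%:R.
have mchi : measurable_fun setT chi by exact: measurable_boolR.
have [iR iI] := centered_itg unit_centered.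
pose h (x : borelC R) : R[i] := (x : R[i]) * (1 - chi x)%:C%C.
pose g x : R[i] := h x - (Ex mu (fun x => complex.Re (h x)) +i* Ex mu (fun x => complex.Im (h x)))%C.
have mh : cmeas h.
  apply: cmeasM; first exact: cmeas_borelC.
  by apply: cmeas_real; apply: measurable_funB => //; exact: measurable_cst.
have hB' x : cabs (h x) <= B.
  rewrite /h /chi cabsM cabs_real; have [hx|hx] := ltP B (cabs (x : R[i])).
    by rewrite subrr normr0 mulr0 ltW.
  by rewrite subr0 normr1 mulr1.
have ihR : itg mu (fun x => complex.Re (h x)).
  by apply: (@itg_bounded _ _ _ _ _ B) => [|x]; [exact: mh.1|exact: le_trans (Re_le_cabs _) (hB' x)].
have ihI : itg mu (fun x => complex.Im (h x)).
  by apply: (@itg_bounded _ _ _ _ _ B) => [|x]; [exact: mh.2|exact: le_trans (Im_le_cabs _) (hB' x)].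
have bER (f : borelC R -> R) : itg mu f -> (forall x, `|f x| <= B) -> `|Ex mu f| <= B.
  move=> fi fB; rewrite ler_norml -[X in _ <= X <= _]/(Ex mu f) -[X in X <= _](Ex_cst mu) -[X in _ && (_ <= X)](Ex_cst mu).
  apply/andP; split; apply: le_Ex => //; try exact: itg_cst.
    by move=> x; have := fB x; rewrite ler_norml => /andP[].
  by move=> x; have := fB x; rewrite ler_norml => /andP[].
have mg : cmeas g by apply: cmeasB => //; exact: cmeas_cst.
have gB x : cabs (g x) <= 3 * B.
  rewrite /g; apply: (le_trans (cabs_triB _ _)).
  have -> : 3 * B = B + (B + B) by ring.
  apply: lerD => //; apply: (le_trans (cabs_le_ReIm _)) => /=; apply: lerD; apply: bER => // y.
    exact: le_trans (Re_le_cabs _) (hB' y).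
  exact: le_trans (Im_le_cabs _) (hB' y).
have B30 : 0 <= 3 * B by rewrite mulr_ge0// ltW.
exists g, (3 * B); split => //.
  split => //.
  - apply: (@itg_bounded _ _ _ _ _ ((3 * B) ^+ 2)); first by apply: measurable_funX; exact: measurable_cabs.
    by move=> x; rewrite ger0_norm ?sqr_ge0//; apply: lerXn2r; rewrite ?nnegrE ?cabs_ge0.
  - transitivity (Ex mu (fun x => complex.Re (h x) - Ex mu (fun x => complex.Re (h x)))); first by apply: eq_Ex => x; rewrite /g ReD ReN.
    by rewrite ExB//; [rewrite Ex_cst subrr|exact: itg_cst].
  - transitivity (Ex mu (fun x => complex.Im (h x) - Ex mu (fun x => complex.Im (h x)))); first by apply: eq_Ex => x; rewrite /g ImD ImN.
    by rewrite ExB//; [rewrite Ex_cst subrr|exact: itg_cst].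
have var_le (u v : borelC R -> R) : itg mu u -> itg mu v -> itg mu (fun x => v x ^+ 2) ->
    (forall x, v x = u x - (u x - v x)) -> Ex mu u = 0 ->
    Ex mu (fun x => (v x + Ex mu (fun y => u y - v y)) ^+ 2) <= Ex mu (fun x => v x ^+ 2).
  move=> iu iv iv2 _ u0; rewrite (ExB iu iv) u0 sub0r; set c := Ex mu v.
  have e : (fun x => (v x + - c) ^+ 2) =1 (fun x => (v x ^+ 2 + - 2 * c * v x) + c ^+ 2) by move=> x; ring.
  have i2 : itg mu (fun x => - 2 * c * v x) by exact: itgZ.
  rewrite (eq_Ex mu e) ExD; [|exact: itgD|exact: itg_cst].
  rewrite ExD// ExZ// Ex_cst -/c; have := sqr_ge0 c; rewrite expr2; lra.
pose k (x : borelC R) : R[i] := (x : R[i]) * (chi x)%:C%C.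
have kE x : (x : R[i]) - h x = k x by rewrite /h /k rmorphB /=; ring.
have tail x : cabs (k x) ^+ 2 = sq_tail B x.
  rewrite /k cabsM cabs_real /sq_tail exprMn /chi; case: (B < _); rewrite ?normr1 ?normr0 ?expr1n//.
  by rewrite expr0n.
have mk : cmeas k by apply: cmeasM; [exact: cmeas_borelC|exact: cmeas_real].
have ik2 (u : borelC R -> R) : measurable_fun setT u -> (forall x, `|u x| <= cabs (k x)) -> itg mu (fun x => u x ^+ 2).
  move=> mu_ ub; apply: (@itg_dom _ _ _ _ _ (sq_tail B)) => //; [exact: measurable_funX| |exact: itg_sq_tail].
  by move=> x; rewrite ger0_norm ?sqr_ge0// -tail -(real_normK (num_real (u x))); apply: lerXn2r; rewrite ?nnegrE ?cabs_ge0.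
have ikR2 := ik2 _ mk.1 (fun x => Re_le_cabs (k x)).
have ikI2 := ik2 _ mk.2 (fun x => Im_le_cabs (k x)).
have RkE x : complex.Re (k x) = complex.Re (x : R[i]) - complex.Re (h x) by rewrite -kE ReD ReN.
have IkE x : complex.Im (k x) = complex.Im (x : R[i]) - complex.Im (h x) by rewrite -kE ImD ImN.
have ikR : itg mu (fun x => complex.Re (k x)) by apply: eq_itg (itgB iR ihR) => x; rewrite RkE.
have ikI : itg mu (fun x => complex.Im (k x)) by apply: eq_itg (itgB iI ihI) => x; rewrite IkE.
apply: le_trans hB.
have -> : Ex mu (sq_tail B) = Ex mu (fun x => complex.Re (k x) ^+ 2) + Ex mu (fun x => complex.Im (k x) ^+ 2).
  by rewrite -(ExD ikR2 ikI2); apply: eq_Ex => x; rewrite -tail cabs_sqr.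
pose cR := Ex mu (fun y : borelC R => complex.Re (y : R[i]) - complex.Re (k y)).
pose cI := Ex mu (fun y : borelC R => complex.Im (y : R[i]) - complex.Im (k y)).
have isq (v : borelC R -> R) c : itg mu v -> itg mu (fun x => v x ^+ 2) -> itg mu (fun x => (v x + c) ^+ 2).
  move=> iv iv2; apply: (eq_itg (f := fun x => (v x ^+ 2 + 2 * c * v x) + c ^+ 2)); first by move=> x; ring.
  by apply: itgD; [apply: itgD => //; exact: itgZ|exact: itg_cst].
have -> : Ex mu (fun u : borelC R => cabs ((u : R[i]) - g u) ^+ 2) =
   Ex mu (fun x => (complex.Re (k x) + cR) ^+ 2) + Ex mu (fun x => (complex.Im (k x) + cI) ^+ 2).
  rewrite -ExD; [|exact: isq|exact: isq]; apply: eq_Ex => x; rewrite cabs_sqr.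
  have -> : cR = Ex mu (fun x => complex.Re (h x)) by apply: eq_Ex => y; rewrite RkE subKr.
  have -> : cI = Ex mu (fun x => complex.Im (h x)) by apply: eq_Ex => y; rewrite IkE subKr.
  have -> : (x : R[i]) - g x = k x + (Ex mu (fun x => complex.Re (h x)) +i* Ex mu (fun x => complex.Im (h x)))%C.
    by rewrite -kE /g; ring.
  by rewrite ReD ImD.
apply: lerD; apply: var_le => //; by move=> x; rewrite subKr.
Qed.

End law_facts.

Section distribution_law.
Context (R : realType) d (T : measurableType d) (P : probability T R).
Context dx (Tx : measurableType dx) (Px : probability Tx R).
Context (x : {RV Px >-> borelC R}) (X : nat -> nat -> {RV P >-> borelC R}).

Definition array_of (w : T) : Arr R := fun i j => X i j w.

Lemma measurable_array_of : measurable_fun setT array_of.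
Proof. by apply: measurable_to_Arr => i j. Qed.

HB.instance Definition _ := isMeasurableFun.Build _ _ _ _ array_of measurable_array_of.

Definition array_law : probability (Arr R) R := distribution P array_of.

Lemma array_law_iid : iid_copies X x -> iid_law (distribution Px x) array_law.
Proof.
move=> [ind idl]; split; last by move=> i j A mA; exact: idl.
by move=> J A mA; exact: ind.
Qed.

Lemma Ex_distribution (h : borelC R -> R) : measurable_fun setT h -> itg Px (fun w => h (x w)) ->
  itg (distribution Px x) h /\ Ex (distribution Px x) h = Ex Px (fun w => h (x w)).
Proof.
move=> mh ih; have i1 : itg (distribution Px x) h.
  apply/integrableP; split; first exact/measurable_EFinP.
  rewrite ge0_integral_distribution//; last by apply: measurableT_comp => //; exact/measurable_EFinP.
  by case/integrableP : ih.
split => //; apply: EFin_inj; rewrite !EFin_Ex// integral_distribution//.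
exact/measurable_EFinP.
Qed.

Lemma array_law_good : iid_copies X x -> zero_mean Px x -> unit_variance Px x ->
  good_law (distribution Px x) array_law.
Proof.
move=> iidX [mR mI]; rewrite /unit_variance unlock => v1.
have mc : measurable_fun setT (fun z : borelC R => cabs (z : R[i]) ^+ 2).
  by apply: measurable_funX; exact: measurable_cabs (@cmeas_borelC R).
have mcx : measurable_fun setT (fun w => cabs (x w : R[i]) ^+ 2) by exact: (measurableT_comp mc (measurable_funPT x)).
have i2 : itg Px (fun w => cabs (x w : R[i]) ^+ 2).
  apply/integrableP; split; first exact/measurable_EFinP.
  rewrite (eq_integral (fun w => (cabs (x w : R[i]) ^+ 2)%:E)) ?v1 ?ltry//.
  by move=> w _; rewrite /= ger0_norm// sqr_ge0.
have [sq sqE] := Ex_distribution mc i2.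
have var1 : Ex (distribution Px x) (fun z : borelC R => cabs (z : R[i]) ^+ 2) = 1.
  by rewrite sqE; apply: EFin_inj; rewrite EFin_Ex.
have lin (u : borelC R -> R) : measurable_fun setT u -> (forall z, `|u z| <= cabs (z : R[i])) ->
    ('E_Px[fun w => u (x w)] = 0%:E)%E -> Ex (distribution Px x) u = 0.
  move=> mu_ ub; rewrite unlock => u0.
  have iu : itg Px (fun w => u (x w)).
    apply: (@itg_dom _ _ _ _ _ (fun w => 1 + cabs (x w : R[i]) ^+ 2)).
    - exact: measurableT_comp.
    - move=> w; apply: (le_trans (ub _)); have := sqr_ge0 (cabs (x w : R[i]) - 1).
      by rewrite sqrrB1; have := cabs_ge0 (x w : R[i]); lra.
    - by apply: itgD => //; exact: itg_cst.
  by rewrite (Ex_distribution mu_ iu).2; apply: EFin_inj; rewrite EFin_Ex.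
have [mRe mIm] := @cmeas_borelC R.
have re0 := lin _ mRe (fun z => Re_le_cabs (z : R[i])) mR.
have im0 := lin _ mIm (fun z => Im_le_cabs (z : R[i])) mI.
split; [exact: array_law_iid|exact: unit_nondegenerate|exact: unit_centered|by []|exact: unit_truncatable].
Qed.

End distribution_law.

(** * From log-determinants to spectra *)

Lemma close_arith (F : realFieldType) (u v c n a b : F) : 0 < n -> `|u / n - c| <= a -> `|v / n - c| <= a ->
  a <= 2^-1 * b -> `|u - v| <= n * b.
Proof.
move=> n0 hu hv; rewrite (mulrC n b) => hab; rewrite -ler_pdivrMr//.
have -> : `|u - v| / n = `|u / n - v / n| by rewrite -mulrBl normrM (gtr0_norm (_ : 0 < n^-1)) ?invr_gt0.
by move: hu hv; rewrite !ler_norml => /andP[? ?] /andP[? ?]; apply/andP; split; lra.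
Qed.

Section log_determinant.
Context (R : realType).

Lemma char_polyE n (D : 'M[R[i]]_n) : char_poly D = \prod_(l <- eigenvalues D) ('X - l%:P).
Proof.
rewrite /eigenvalues; case: closed_field_poly_normal => s /= hs.
by rewrite {1}hs (monicP (char_poly_monic D)) scale1r.
Qed.

Lemma size_eigenvalues n (D : 'M[R[i]]_n) : size (eigenvalues D) = n.
Proof.
have := size_char_poly D; rewrite char_polyE size_prod_XsubC; exact: succn_inj.
Qed.

Lemma det_sub_eigenvalues n (D : 'M[R[i]]_n) z : cabs (\det (D - z%:M)) = \prod_(l <- eigenvalues D) cabs (z - l).
Proof.
have -> : \prod_(l <- eigenvalues D) cabs (z - l) = cabs (char_poly D).[z].
  rewrite char_polyE horner_prod cabs_prod; apply: eq_bigr => l _.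
  by rewrite !hornerE.
have -> : (char_poly D).[z] = \det (z%:M - D).
  rewrite /char_poly -[LHS]/(horner_eval z _) -det_map_mx; congr (\det _).
  by apply/matrixP => i j; rewrite !mxE -[LHS]/(_.[z]) hornerD hornerN hornerC hornerMn hornerX.
transitivity (cabs ((-1) ^+ n * \det (z%:M - D))); last by rewrite cabsM cabsX cabsN cabs1 expr1n mul1r.
by rewrite -detZ scaleN1r; congr (cabs (\det _)); rewrite opprB.
Qed.

Lemma ln_prod I (s : seq I) (f : I -> R) : (forall i, 0 <= f i) -> 0 < \prod_(i <- s) f i ->
  ln (\prod_(i <- s) f i) = \sum_(i <- s) ln (f i) /\ all (fun i => 0 < f i) s.
Proof.
move=> f0; elim: s => [|a s IH]; first by rewrite !big_nil ln1.
rewrite !big_cons => h.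
have a0 : 0 < f a by rewrite lt0r f0 andbT; apply/eqP => E; move: h; rewrite E mul0r ltxx.
have s0 : 0 < \prod_(i <- s) f i by rewrite -(pmulr_rgt0 _ a0).
have [e1 e2] := IH s0.
by rewrite lnM ?posrE// e1 /= a0 e2.
Qed.

Lemma gramR_square n (A : 'M[R[i]]_n) : gramR A = cabs (\det A) ^+ 2.
Proof. by rewrite /gramR gram_square mulJ_cabs. Qed.

Lemma hs_normE n (A : 'M[R[i]]_n) : hs_norm A ^+ 2 = \sum_i \sum_j cabs (A i j) ^+ 2.
Proof.
rewrite /hs_norm.
have -> : complex.Re (\tr (A *m (A ^t*)%sesqui)) = \sum_i \sum_j cabs (A i j) ^+ 2.
  rewrite Re_sum; apply: eq_bigr => i _; rewrite mxE Re_sum; apply: eq_bigr => j _.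
  by rewrite !mxE mulJ_cabs.
by rewrite sqr_sqrtr// sumr_ge0// => i _; rewrite sumr_ge0// => j _; exact: sqr_ge0.
Qed.

Lemma cabs_le_hs n (A : 'M[R[i]]_n) i j : cabs (A i j) ^+ 2 <= hs_norm A ^+ 2.
Proof.
rewrite hs_normE (bigD1 i)//= (bigD1 j)//= -addrA lerDl addr_ge0// sumr_ge0// => k _; first exact: sqr_ge0.
by apply: sumr_ge0 => l _; exact: sqr_ge0.
Qed.

(** Indexed by naturals, as the mean arrays of the determinant estimates. The n by n block is sqrt n
    times the shift by z of the normalised matrix. *)
Definition shifted (M : forall n : nat, 'M[R[i]]_n) (n : nat) (z : R[i]) (i j : nat) : R[i] :=
  (if (insub i, insub j) is (Some i', Some j') then M n i' j' else 0)
  - ((Num.sqrt n%:R)%:C%C * z) *+ (i == j).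

Lemma rowsm_shifted M n z (a : Arr R) :
  rowsm (shifted M n z) n n a = (M n + \matrix_(i < n, j < n) ent a i j) - ((Num.sqrt n%:R)%:C%C * z)%:M.
Proof.
apply/matrixP => i j; rewrite !mxE /shifted !valK /= [LHS]addrAC.
by congr (_ - _); rewrite -val_eqE.
Qed.

Lemma shifted_bound (M : forall n : nat, 'M[R[i]]_n) z :
  (ereal_sup (range (fun n => ((n%:R ^+ 2)^-1 * hs_norm (M n) ^+ 2)%:E)) < +oo)%E ->
  \forall n \near \oo, forall i j, (i < n)%N -> (j < n)%N -> cabs (shifted M n z i j) <= n%:R ^+ 2 / 2.
Proof.
set S := ereal_sup _ => Sfin.
have ub n : (((n%:R ^+ 2)^-1 * hs_norm (M n) ^+ 2)%:E <= S)%E by apply: ereal_sup_ubound; exists n.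
have SC : S = (fine S)%:E.
  rewrite fineK// ge0_fin_numE//; apply: le_trans (ub 0%N).
  by rewrite lee_fin mulr_ge0// ?invr_ge0 ?sqr_ge0.
set C := fine S in SC.
have {}ub n : hs_norm (M n) ^+ 2 <= C * n%:R ^+ 2.
  case: n => [|n]; first by rewrite hs_normE big_ord0 expr0n mulr0.
  have := ub n.+1; rewrite SC lee_fin ler_pdivrMl ?exprn_gt0// mulrC; apply.
have C0 : 0 <= C by have := ub 1%N; rewrite expr1n mulr1; apply: le_trans; exact: sqr_ge0.
exists (Num.truncn (2 * (Num.sqrt C + cabs z))).+1 => // n /= nN i j iL jL.
have n1 : (1 <= n)%N by apply: leq_trans nN.
have nn : 2 * (Num.sqrt C + cabs z) <= n%:R.
  by apply: (le_trans (ltW (truncnS_gt _))); rewrite ler_nat.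
have n0 : 1 <= n%:R :> R by rewrite ler1n.
have n00 : 0 <= n%:R :> R by [].
apply: (@le_trans _ _ ((Num.sqrt C + cabs z) * n%:R)); last first.
  by rewrite expr2 mulrAC; apply: ler_wpM2r => //; move: nn; lra.
apply: (le_trans (cabs_triB _ _)); rewrite mulrDl; apply: lerD.
  rewrite (insubT (fun k => k < n)%N iL) (insubT (fun k => k < n)%N jL) /=.
  have h := le_trans (cabs_le_hs (M n) (Ordinal iL) (Ordinal jL)) (ub n).
  rewrite -(@ler_pXn2r _ 2) ?nnegrE ?cabs_ge0 ?mulr_ge0 ?sqrtr_ge0//.
  by rewrite exprMn sqr_sqrtr.
case: (i == j); last by rewrite mulr0n cabs0 mulr_ge0 ?cabs_ge0.
rewrite mulr1n cabsM cabs_real ger0_norm ?sqrtr_ge0// mulrC ler_wpM2l ?cabs_ge0//.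
rewrite -[X in _ <= X]sqr_sqrtr// expr2 -[X in X <= _]mulr1; apply: ler_wpM2l; first exact: sqrtr_ge0.
by rewrite -[X in X <= _](sqrtr1 R); exact: ler_wsqrtr.
Qed.

Context d (T : measurableType d) (P : probability T R).

(** Positivity is demanded separately because [ln] has a default value at 0. *)
Definition logdet_close (M : forall n : nat, 'M[R[i]]_n) (X Y : nat -> nat -> {RV P >-> borelC R}) (z : R[i]) (w : T) :=
  forall k : nat, \forall n \near \oo,
    [/\ 0 < gramR (rowsm (shifted M n z) n n (array_of X w)), 0 < gramR (rowsm (shifted M n z) n n (array_of Y w)) &
     `|ln (gramR (rowsm (shifted M n z) n n (array_of X w))) - ln (gramR (rowsm (shifted M n z) n n (array_of Y w)))|
      <= n%:R * k.+1%:R^-1].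

Lemma ae_array (X : nat -> nat -> {RV P >-> borelC R}) (G : Arr R -> Prop) :
  {ae array_law X, forall a, G a} -> {ae P, forall w, G (array_of X w)}.
Proof.
move=> [N [mN N0 GN]]; exists (array_of X @^-1` N); split.
- by rewrite -[X in measurable X]setTI; exact: (measurable_array_of X).
- exact: N0.
- by move=> w /= nG; exact: (GN (array_of X w)).
Qed.

(* Both arrays are centred at the constants computed from the law of X. *)
Lemma logdet_close_as M X Y mux muy z : good_law mux (array_law X) -> good_law muy (array_law Y) ->
  (ereal_sup (range (fun n => ((n%:R ^+ 2)^-1 * hs_norm (M n) ^+ 2)%:E)) < +oo)%E ->
  {ae P, forall w, logdet_close M X Y z w}.
Proof.
move=> gX gY Mb; have mB := shifted_bound z Mb.
have [c hc] := center_exists (array_law X) (fun n => shifted M n z).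
have hX := ae_array (core_as gX gX mB hc); have hY := ae_array (core_as gX gY mB hc).
apply: filterS2 hX hY => w hX hY k.
have [N1 _ h1] := hX (2 * k.+1)%N; have [N2 _ h2] := hY (2 * k.+1)%N.
exists (maxn (maxn N1 N2) 1) => // n; rewrite /= !geq_max => /andP[/andP[n1 n2] n00].
have [gX0 lX] := contrapT (h1 n n1); have [gY0 lY] := contrapT (h2 n n2).
have n0 : 0 < n%:R :> R by rewrite ltr0n.
have k0 : (2 * k.+1).+1%:R^-1 <= 2^-1 * k.+1%:R^-1 :> R.
  by rewrite -invfM -natrM lef_pV2 ?posrE ?ltr0n// ler_nat.
by split; [exact: gX0|exact: gY0|exact: (close_arith n0 lX lY k0)].
Qed.

End log_determinant.

(** * Circle means of the logarithm *)

Section esd_integral.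
Context (R : realType).

Definition spec_mean n (D : 'M[R[i]]_n) (f : R[i] -> R) : R := n%:R^-1 * \sum_(l <- eigenvalues D) f l.

Let ge0_integral_esd n (D : 'M[R[i]]_n) (f : borelC R -> R) : measurable_fun setT f -> (forall z, 0 <= f z) ->
  (\int[esd D]_z (f z)%:E = (spec_mean D f)%:E)%E.
Proof.
move=> mf f0; have mE : measurable_fun setT (EFin \o f) by exact/measurable_EFinP.
have fE0 z : [set: borelC R] z -> (0 <= (f z)%:E)%E by rewrite lee_fin.
rewrite /esd ge0_integral_mscale// ge0_integral_measure_sum//.
rewrite (eq_bigr (fun i : 'I_n => (f ((eigenvalues D)`_i))%:E)); last first.
  by move=> i _; rewrite integral_dirac// diracT mul1e.
rewrite sumEFin -EFinM /spec_mean /= (big_nth 0) size_eigenvalues big_mkord.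
by [].
Qed.

Lemma Rintegral_esd n (D : 'M[R[i]]_n) (f : borelC R -> R) : measurable_fun setT f ->
  \int[esd D]_z f z = spec_mean D f.
Proof.
move=> mf; rewrite /Rintegral integralE.
rewrite (eq_integral (fun z => (Num.max (f z) 0)%:E)); last by move=> z _; rewrite funeposE EFin_max.
rewrite [X in (_ - X)%E](eq_integral (fun z => (Num.max (- f z) 0)%:E)); last first.
  by move=> z _; rewrite funenegE EFin_max EFinN.
rewrite !ge0_integral_esd.
- rewrite -EFinB /= /spec_mean -mulrBr -sumrB; congr (_ * _); apply: eq_bigr => l _.
  by case: (leP (f l) 0) => h; case: (leP (- f l) 0) => h'; move: h h'; rewrite ?oppr_le0 ?oppr_gt0 => h h'; lra.
- by apply: measurable_maxr; [exact: measurable_funN|exact: measurable_cst].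
- by move=> z; rewrite le_max lexx orbT.
- by apply: measurable_maxr => //; exact: measurable_cst.
- by move=> z; rewrite le_max lexx orbT.
Qed.

Lemma spec_meanB n (D : 'M[R[i]]_n) f g : spec_mean D (fun z => f z - g z) = spec_mean D f - spec_mean D g.
Proof. by rewrite /spec_mean sumrB mulrBr. Qed.

Lemma spec_meanD n (D : 'M[R[i]]_n) f g : spec_mean D (fun z => f z + g z) = spec_mean D f + spec_mean D g.
Proof. by rewrite /spec_mean big_split mulrDr. Qed.

Lemma spec_meanZ n (D : 'M[R[i]]_n) c f : spec_mean D (fun z => c * f z) = c * spec_mean D f.
Proof. by rewrite /spec_mean -mulr_sumr mulrCA. Qed.

Lemma spec_mean_sum n (D : 'M[R[i]]_n) I (s : seq I) (f : I -> R[i] -> R) :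
  spec_mean D (fun z => \sum_(i <- s) f i z) = \sum_(i <- s) spec_mean D (f i).
Proof. by rewrite /spec_mean exchange_big mulr_sumr. Qed.

Lemma spec_mean_le n (D : 'M[R[i]]_n) f g : (forall z, f z <= g z) -> spec_mean D f <= spec_mean D g.
Proof. by move=> fg; rewrite /spec_mean ler_wpM2l ?invr_ge0//; apply: ler_sum. Qed.

Lemma spec_mean_cst_le n (D : 'M[R[i]]_n) c : 0 <= c -> spec_mean D (fun=> c) <= c.
Proof.
move=> c0; rewrite /spec_mean big_const_seq count_predT size_eigenvalues iter_addr_0.
rewrite -(mulr_natl c) mulrA; case: n D => [|n] D; first by rewrite mulr0 mul0r.
by rewrite mulVf ?mul1r// pnatr_eq0.
Qed.

Lemma spec_mean_bound n (D : 'M[R[i]]_n) f c : 0 <= c -> (forall z, `|f z| <= c) -> `|spec_mean D f| <= c.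
Proof.
move=> c0 fc; apply: le_trans (spec_mean_cst_le D c0).
rewrite /spec_mean normrM (ger0_norm (_ : 0 <= n%:R^-1)) ?invr_ge0// ler_wpM2l ?invr_ge0//.
by apply: (le_trans (ler_norm_sum _ _ _)); apply: ler_sum.
Qed.

(** The variance is nonnegative. For n = 0 the mean of a constant is 0, so constants are handled by
    the inequality [spec_mean_cst_le]. *)
Lemma spec_mean_sqr n (D : 'M[R[i]]_n) f : spec_mean D f ^+ 2 <= spec_mean D (fun z => f z ^+ 2).
Proof.
set m := spec_mean D f; have := spec_mean_le D (fun z => sqr_ge0 (f z - m)).
rewrite {1}/spec_mean big1 ?mulr0//.
have -> : spec_mean D (fun z => (f z - m) ^+ 2) = spec_mean D (fun z => f z ^+ 2) - 2 * m * m + spec_mean D (fun=> m ^+ 2).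
  rewrite -[X in _ - _ * X]/(spec_mean D f) -spec_meanZ -spec_meanB -spec_meanD.
  by congr (_ * _); apply: eq_bigr => l _; ring.
by have := spec_mean_cst_le D (sqr_ge0 m); rewrite expr2; lra.
Qed.

End esd_integral.

Section radial_log.
Context (R : realType).

(* On the diagonal y = rho the logarithm takes the junk value ln 0 = 0. *)
Definition ell (y rho : R) : R := - ln (`|y - rho| / Num.max y rho).

Lemma ell_ge0 y rho : 0 <= y -> 0 < rho -> 0 <= ell y rho.
Proof.
move=> y0 r0; rewrite oppr_ge0; have m0 : 0 < Num.max y rho by rewrite lt_max r0 orbT.
have [->|e] := eqVneq (`|y - rho| / Num.max y rho) 0; first by rewrite ln0.
have h1 : y <= Num.max y rho by rewrite le_max lexx.
have h2 : rho <= Num.max y rho by rewrite le_max lexx orbT.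
apply: ln_le0; rewrite ler_pdivrMr// mul1r ler_norml; apply/andP; split.
  by move: h2 y0; lra.
by move: h1 r0; lra.
Qed.

(** The weights 2k + 1 turn a sum over layers into a square, for the second moment of [ell]. *)
Lemma sum_odd K : \sum_(k < K) (2 * (k%:R : R) + 1) = K%:R ^+ 2.
Proof.
elim: K => [|K IH]; first by rewrite big_ord0 expr0n.
by rewrite big_ord_recr /= IH -natr1; ring.
Qed.

Lemma sum_odd_geom K : \sum_(k < K) (2 * (k%:R : R) + 1) * 2 ^- k <= 6.
Proof.
suff -> : \sum_(k < K) (2 * (k%:R : R) + 1) * 2 ^- k = 6 - (4 * K%:R + 6) * 2 ^- K.
  by rewrite gerBl mulr_ge0// ?invr_ge0 ?exprn_ge0// addr_ge0// mulr_ge0.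
elim: K => [|K IH]; first by rewrite big_ord0 mulr0 add0r expr0 invr1 mulr1 subrr.
rewrite big_ord_recr /= IH -natr1 exprS.
by field; rewrite expf_neq0//.
Qed.

Lemma expRN_nat_le (k : nat) : expR (- k%:R) <= 2 ^- k :> R.
Proof.
rewrite expRN lef_pV2 ?posrE ?expR_gt0 ?exprn_gt0// -[k%:R]mulr1 expRM_natl.
apply: lerXn2r; rewrite ?nnegrE ?expR_ge0//; have := expR_ge1Dx (1 : R); lra.
Qed.

Definition unif : probability (measurableTypeR R) R := uniform_prob (@ltr01 R).
(* Clamping makes the bounds valid for all real u, although unif lives on [0, 1]. *)
Definition circ_rad (r tau u : R) := r + tau * Num.max 0 (Num.min u 1).

Lemma circ_rad_ge r tau u : 0 <= tau -> r <= circ_rad r tau u.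
Proof. by move=> t0; rewrite lerDl mulr_ge0// le_max lexx. Qed.

Lemma circ_rad_le r tau u : 0 <= tau -> circ_rad r tau u <= r + tau.
Proof. by move=> t0; rewrite lerD2l ler_piMr// ge_max ler01 ge_min lexx orbT. Qed.

Lemma measurable_circ_rad r tau : measurable_fun setT (circ_rad r tau : measurableTypeR R -> R).
Proof.
apply: measurable_funD; first exact: measurable_cst.
apply: measurable_funM; first exact: measurable_cst.
apply: measurable_maxr; first exact: measurable_cst.
by apply: measurable_minr => //; exact: measurable_cst.
Qed.

Lemma unif_small (A : set (measurableTypeR R)) c dl : measurable A -> 0 <= dl ->
  (forall u, 0 <= u <= 1 -> A u -> `|u - c| <= dl) -> Pr unif A <= 2 * dl.
Proof.
move=> mA d0 h; rewrite -lee_fin EFin_Pr//.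
rewrite [leLHS](_ : _ = \int[lebesgue_measure]_(x in A) (uniform_pdf 0 1 x)%:E)%E//.
have mI : measurable ([set` `[c - dl, c + dl]] : set (measurableTypeR R)) by exact: measurable_itv.
rewrite integral_uniform_pdf.
have mAI : measurable (A `&` `[0, 1] : set (measurableTypeR R)) by apply: measurableI => //; exact: measurable_itv.
have le1 : (\int[lebesgue_measure]_(x in A `&` `[0%R, 1%R]) (uniform_pdf 0 1 x)%:E <=
    \int[lebesgue_measure]_(x in A `&` `[0%R, 1%R]) (cst 1 x))%E.
  apply: ge0_le_integral => //.
  - by move=> x _; rewrite lee_fin uniform_pdf_ge0.
  - apply/measurable_EFinP; apply: measurable_funTS; exact: measurable_uniform_pdf.
  - by move=> x _; rewrite lee_fin /uniform_pdf; case: ifP; rewrite // subr0 invr1.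
apply: (le_trans le1).
rewrite integral_cst// mul1e.
apply: (@le_trans _ _ (lebesgue_measure ([set` `[c - dl, c + dl]] : set (measurableTypeR R)))).
  apply: le_measure; rewrite ?inE// => u [Au]; rewrite /= in_itv /= => u01.
  have := h u u01 Au; rewrite ler_norml in_itv /= => /andP[? ?]; apply/andP; split; lra.
rewrite lebesgue_measure_itv /= lte_fin; case: ifP => _; last by rewrite lee_fin mulr_ge0.
by rewrite -EFinB lee_fin; lra.
Qed.

Lemma measurable_ell y r tau : 0 < r -> 0 <= tau ->
  measurable_fun setT (fun u : measurableTypeR R => ell y (circ_rad r tau u)).
Proof.
move=> r0 t0.
have -> : (fun u => ell y (circ_rad r tau u)) =
    fun u => - ln (`|y - circ_rad r tau u| * expR (- ln (Num.max y (circ_rad r tau u)))).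
  apply/funext => u; rewrite /ell expRN lnK// posrE lt_max.
  by rewrite (lt_le_trans r0 (circ_rad_ge r u t0)) orbT.
apply: measurable_funN; apply: measurableT_comp; first exact: measurable_ln.
apply: measurable_funM.
  apply: measurableT_comp; first exact: normr_measurable.
  by apply: measurable_funB; [exact: measurable_cst|exact: measurable_circ_rad].
apply: measurableT_comp; first exact: measurable_expR.
apply: measurable_funN; apply: measurableT_comp; first exact: measurable_ln.
by apply: measurable_maxr; [exact: measurable_cst|exact: measurable_circ_rad].
Qed.

Section second_moment.
Variables (r tau y : R).
Hypotheses (r0 : 0 < r) (t0 : 0 < tau) (y0 : 0 <= y).
Let rho := circ_rad r tau.
Let rho0 u : 0 < rho u. Proof. exact: lt_le_trans (circ_rad_ge r u (ltW t0)). Qed.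
Let max0 u : 0 < Num.max y (rho u). Proof. by rewrite lt_max rho0 orbT. Qed.
Let C0 := 4 * ((r + tau) / tau).

(** Contains the event [k%:R <= ell y (rho u)], because exp(-k) <= 2^-k. *)
Let close (k : nat) : set (measurableTypeR R) := [set u | `|y - rho u| <= 2 ^- k * Num.max y (rho u)].

Let measurable_close k : measurable (close k).
Proof.
apply: measurable_leRR.
  apply: measurableT_comp; first exact: normr_measurable.
  by apply: measurable_funB; [exact: measurable_cst|exact: measurable_circ_rad].
apply: measurable_funM; first exact: measurable_cst.
by apply: measurable_maxr; [exact: measurable_cst|exact: measurable_circ_rad].
Qed.

Let Pr_close k : Pr unif (close k) <= C0 * 2 ^- k.
Proof.
have rt : 1 <= (r + tau) / tau by rewrite ler_pdivlMr// mul1r lerDr ltW.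
case: k => [|k].
  rewrite expr0 invr1 mulr1; apply: (le_trans (Pr_le1 _ (measurable_close 0))); rewrite /C0; lra.
have k0 : 0 < 2 ^- k.+1 :> R by rewrite invr_gt0 exprn_gt0.
have k2 : 2 ^- k.+1 <= 2^-1 :> R.
  by rewrite lef_pV2 ?posrE ?exprn_gt0// exprS ler_peMr// exprn_ege1// ler1n.
pose dl := 2 * (2 ^- k.+1 * ((r + tau) / tau)).
have -> : C0 * 2 ^- k.+1 = 2 * dl by rewrite /C0 /dl; ring.
apply: (unif_small (c := (y - r) / tau)) => //.
  by rewrite /dl mulr_ge0// mulr_ge0 ?(ltW k0)// divr_ge0 ?(ltW t0)// addr_ge0 ?(ltW r0) ?(ltW t0).
move=> u /andP[u0 u1]; rewrite /close /=.
have ru : rho u = r + tau * u.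
  by rewrite /rho /circ_rad (min_idPl _)// (max_idPr _).
have rle : rho u <= r + tau by rewrite circ_rad_le// ltW.
(* Closeness at level at least 1 makes y comparable with the radius, hence at most 2 (r + tau); this
   makes the bound uniform in y. *)
have mle : `|y - rho u| <= 2 ^- k.+1 * Num.max y (rho u) -> Num.max y (rho u) <= 2 * (r + tau).
  move=> h; have h1 := le_trans h (ler_wpM2r (ltW (max0 u)) k2).
  move: h1; rewrite ler_norml => /andP[_]; have [|] := leP y (rho u); move: rle r0 t0; lra.
move=> h; have h2 := le_trans h (ler_wpM2l (ltW k0) (mle h)).
have -> : u - (y - r) / tau = - ((y - rho u) / tau) by rewrite ru; field; rewrite gt_eqF.
rewrite normrN normrM (gtr0_norm (_ : 0 < tau^-1)) ?invr_gt0// ler_pdivrMr//.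
by apply: (le_trans h2); rewrite le_eqVlt; apply/orP; left; apply/eqP; rewrite /dl; move: (2 ^- k.+1) => q; field; rewrite gt_eqF.
Qed.

Let layer (u : measurableTypeR R) : ((ell y (rho u) ^+ 2)%:E <=
  \sum_(k <oo) ((2 * (k%:R : R) + 1) * \1_(close k) u)%:E)%E.
Proof.
have t_ge0 (k : nat) : (0 <= ((2 * (k%:R : R) + 1) * \1_(close k) u)%:E)%E.
  by rewrite lee_fin mulr_ge0// addr_ge0// mulr_ge0.
have [x0|xn0] := eqVneq (`|y - rho u| / Num.max y (rho u)) 0.
  by rewrite /ell x0 ln0// oppr0 expr0n; apply: nneseries_ge0 => k _ _; exact: t_ge0.
have xp : 0 < `|y - rho u| / Num.max y (rho u) by rewrite lt0r xn0 divr_ge0// ltW.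
have l0 := ell_ge0 y0 (rho0 u).
have /andP[h1 h2] := truncn_itv l0; set K := Num.truncn _ in h1 h2.
apply: le_trans (nneseries_lim_ge K.+1 _) => //.
rewrite big_mkord (eq_bigr (fun k : 'I_K.+1 => (2 * ((k : nat)%:R : R) + 1)%:E)).
  rewrite sumEFin lee_fin sum_odd; apply: lerXn2r; rewrite ?nnegrE//; exact: ltW.
move=> k _; congr EFin; rewrite indicE mem_set ?mulr1// /close /=.
rewrite -ler_pdivrMr//; apply: (le_trans _ (expRN_nat_le k)).
rewrite -[X in X <= _](lnK (x := _)) ?posrE// ler_expR lerNr.
by apply: le_trans h1; rewrite ler_nat -ltnS.
Qed.

(** Layer-cake integration: the square is at most the sum of 2 k + 1 over the sets [close k]
    containing u, whose probabilities decay like 2^-k uniformly in y. *)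
Lemma ell_second_moment : itg unif (fun u => ell y (rho u) ^+ 2) /\
  Ex unif (fun u => ell y (rho u) ^+ 2) <= 6 * C0.
Proof.
have mf : measurable_fun setT (fun u : measurableTypeR R => ell y (rho u) ^+ 2).
  by apply: measurable_funX; apply: measurable_ell => //; exact: ltW.
have main : (\int[unif]_u (ell y (rho u) ^+ 2)%:E <= (6 * C0)%:E)%E.
  have ms (k : nat) : measurable_fun setT (fun u : measurableTypeR R => ((2 * (k%:R : R) + 1) * \1_(close k) u)%:E).
    by apply/measurable_EFinP; apply: measurable_funM; [exact: measurable_cst|exact: measurable_indic].
  have s0 (k : nat) (u : measurableTypeR R) : setT u -> (0 <= ((2 * (k%:R : R) + 1) * \1_(close k) u)%:E)%E.
    by move=> _; rewrite lee_fin mulr_ge0// addr_ge0// mulr_ge0.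
  apply: (@le_trans _ _ (\int[unif]_u \sum_(k <oo) ((2 * (k%:R : R) + 1) * \1_(close k) u)%:E)%E).
    apply: ge0_le_integral => //; first by move=> u _; rewrite lee_fin sqr_ge0.
    - exact/measurable_EFinP.
    - by apply: (ge0_emeasurable_sum (P := xpredT)) => // k u *; exact: s0.
  rewrite integral_nneseries//.
  have tE (k : nat) : (\int[unif]_u ((2 * (k%:R : R) + 1) * \1_(close k) u)%:E = ((2 * (k%:R : R) + 1) * Pr unif (close k))%:E)%E.
    rewrite -EFin_Ex; last by apply: itgZ; exact: itg_indic.
    by rewrite ExZ ?Pr_Ex//; exact: itg_indic.
  apply: lime_le.
    by apply: is_cvg_nneseries => k _ _; apply: integral_ge0 => u _; exact: s0.
  apply: nearW => K; rewrite (eq_bigr (fun k => ((2 * (k%:R : R) + 1) * Pr unif (close k))%:E)); last by move=> k _; exact: tE.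
  rewrite sumEFin lee_fin big_mkord.
  have C00 : 0 <= C0 by rewrite mulr_ge0// divr_ge0 ?(ltW t0)// addr_ge0// ltW.
  apply: (@le_trans _ _ (\sum_(k < K) (2 * ((k : nat)%:R : R) + 1) * 2 ^- k * C0)).
    apply: ler_sum => k _; rewrite -mulrA; apply: ler_wpM2l; first by rewrite addr_ge0// mulr_ge0.
    by rewrite mulrC; exact: Pr_close.
  by rewrite -mulr_suml; apply: ler_wpM2r => //; exact: sum_odd_geom.
have i1 : itg unif (fun u => ell y (rho u) ^+ 2).
  apply/integrableP; split; first exact/measurable_EFinP.
  apply: le_lt_trans (ltry (6 * C0)); apply: le_trans main.
  rewrite le_eqVlt; apply/orP; left; apply/eqP; apply: eq_integral => u _.
  by rewrite /= ger0_norm// sqr_ge0.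
by split => //; rewrite -lee_fin EFin_Ex.
Qed.

End second_moment.

End radial_log.

Section vitali.
Context (R : realType) d (T : measurableType d) (P : probability T R).

Lemma bounded_cvg_Ex (g : nat -> T -> R) (M : R) : (forall n, measurable_fun setT (g n)) ->
  (forall n x, `|g n x| <= M) -> {ae P, forall x, g n x @[n --> \oo] --> (0 : R)} ->
  Ex P (g n) @[n --> \oo] --> (0 : R).
Proof.
move=> mg gM g0.
have hM : {ae P, forall x n, setT x -> (`|(g n x)%:E| <= M%:E)%E}.
  by apply: aeW => x n _; rewrite /= lee_fin.
have h0 : {ae P, forall x, setT x -> (g n x)%:E @[n --> \oo] --> 0%:E}.
  by apply: filterS g0 => x hx _; apply: cvg_EFin => //; exact: nearW.
have [_ _] := @dominated_convergence _ _ R P setT measurableT (fun n x => (g n x)%:E) (fun=> 0%:E) (fun=> M%:E)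
  (fun n => (measurable_EFinP _ _).2 (mg n)) (measurable_cst _) h0 (itg_cst P M) hM.
rewrite integral0 => h; exact: (fine_cvg h).
Qed.

(* Truncate at level 2 C / e: the second moment bounds the tail. *)
Lemma vitali (g : nat -> T -> R) (C : R) : (forall n, measurable_fun setT (g n)) ->
  (forall n, itg P (fun x => g n x ^+ 2)) -> (forall n, Ex P (fun x => g n x ^+ 2) <= C) ->
  {ae P, forall x, g n x @[n --> \oo] --> (0 : R)} -> Ex P (g n) @[n --> \oo] --> (0 : R).
Proof.
move=> mg ig2 gC g0.
have C0 : 0 <= C by apply: le_trans (gC 0%N); apply: Ex_ge0 => x; exact: sqr_ge0.
apply/cvgrPdist_le => e e0.
pose M := 2 * (C + 1) / e.
have M0 : 0 < M by rewrite divr_gt0// mulr_gt0// ltr_wpDl.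
pose h n x := Num.min `|g n x| M.
have mag n : measurable_fun setT (fun x => `|g n x|) by apply: measurableT_comp => //; exact: normr_measurable.
have mh n : measurable_fun setT (h n) by apply: measurable_minr => //; exact: measurable_cst.
have h0 n x : 0 <= h n x by rewrite le_min normr_ge0 ltW.
have hM n x : `|h n x| <= M by rewrite ger0_norm// ge_min lexx orbT.
have hg n x : h n x <= `|g n x| by rewrite ge_min lexx.
have hc : Ex P (h n) @[n --> \oo] --> (0 : R).
  apply: (bounded_cvg_Ex mh hM); apply: filterS g0 => x gx.
  have nx : `|g n x| @[n --> \oo] --> (0 : R) by rewrite -(normr0 R); exact: cvg_norm.
  apply: (squeeze_cvgr _ (cvg_cst (0 : R)) nx).
  by apply: nearW => n; rewrite h0 hg.
have e2 : 0 < e / 2 by rewrite divr_gt0.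
move/cvgrPdist_le : hc => /(_ _ e2); apply: filterS => n.
rewrite !sub0r !normrN => hn.
have ih : itg P (h n) by apply: (@itg_bounded _ _ _ _ _ M).
have i1 : itg P (fun x => h n x + M^-1 * g n x ^+ 2) by apply: itgD => //; exact: itgZ.
have pt x : `|g n x| <= h n x + M^-1 * g n x ^+ 2.
  rewrite /h; have [le|lt] := leP `|g n x| M.
    by rewrite lerDl mulr_ge0 ?sqr_ge0// invr_ge0 ltW.
  apply: ler_wpDl; first exact: ltW.
  rewrite -(real_normK (num_real (g n x))) mulrC ler_pdivlMr// expr2; apply: ler_wpM2l => //; exact: ltW.
have ia : itg P (fun x => `|g n x|) by apply: (itg_dom (mag n) _ i1) => x; rewrite normr_id.
have ig : itg P (g n) by exact: (itg_dom (mg n) _ ia).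
have up : `|Ex P (g n)| <= Ex P (fun x => `|g n x|).
  rewrite ler_norml -(ExN ia); apply/andP; split; apply: le_Ex => //; first exact: itgN.
    by move=> x; rewrite lerNl ler_normr lexx orbT.
  by move=> x; exact: ler_norm.
apply: (le_trans up); apply: (le_trans (le_Ex ia i1 pt)).
rewrite (ExD ih (itgZ _ (ig2 n))) ExZ//.
have hn' : Ex P (h n) <= e / 2 by apply: le_trans hn; exact: ler_norm.
have tl : M^-1 * Ex P (fun x => g n x ^+ 2) <= e / 2.
  rewrite mulrC ler_pdivrMr//; apply: (le_trans (gC n)).
  by rewrite /M mulrA (_ : e / 2 * (2 * (C + 1)) / e = C + 1) ?lerDl//; field; rewrite gt_eqF.
by move: hn' tl; lra.
Qed.

End vitali.

Lemma four_sq (F : realDomainType) (g a b : F) : (g + (a + b + 2)) ^+ 2 <= 4 * (g ^+ 2 + 4 + (a ^+ 2 + b ^+ 2)).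
Proof.
rewrite -subr_ge0 (_ : _ - _ = (g - a) ^+ 2 + (g - b) ^+ 2 + (g - 2) ^+ 2 + (a - b) ^+ 2 + (a - 2) ^+ 2 + (b - 2) ^+ 2).
  by rewrite !addr_ge0 ?sqr_ge0.
by ring.
Qed.

Lemma approx_arith (F : realFieldType) (a b A B e : F) : `|A - a| <= e / 4 -> `|B - b| <= e / 4 ->
  `|A - B| <= e / 2 -> `|a - b| <= e.
Proof. by rewrite !ler_norml => /andP[? ?] /andP[? ?] /andP[? ?]; apply/andP; split; lra. Qed.

Lemma sub_sub_swap (F : comNzRingType) (a b c d : F) : (a - b) - (c - d) = (a - c) - (b - d).
Proof. by ring. Qed.

Lemma sqrB_le (F : realDomainType) (a b A B : F) : a ^+ 2 <= A -> b ^+ 2 <= B -> (a - b) ^+ 2 <= 2 * (A + B).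
Proof. by move=> ha hb; have := sqr_ge0 (a + b); move: ha hb; rewrite sqrrB sqrrD; lra. Qed.

Lemma horner_XnB1 (F : comNzRingType) N (x : F) : ('X^N - 1 : {poly F}).[x] = x ^+ N - 1.
Proof. by rewrite !hornerE. Qed.

Section circle_kernel.
Context (R : realType).

Lemma prod_scale (F : comNzRingType) I (a : F) (q : seq I) (f : I -> F) :
  a ^+ size q * \prod_(i <- q) f i = \prod_(i <- q) (a * f i).
Proof.
elim: q => [|i q IH]; first by rewrite !big_nil mulr1.
by rewrite !big_cons -IH /= exprS; ring.
Qed.

Definition roots1 N : seq R[i] := sval (closed_field_poly_normal ('X^N - 1 : {poly R[i]})).

Lemma circle_prod N (v : R[i]) (rho : R) : (0 < N)%N -> 0 < rho ->
  cabs (v ^+ N - rho%:C%C ^+ N) = \prod_(z <- roots1 N) cabs (v - rho%:C%C * z).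
Proof.
move=> N0 r0; have rC : rho%:C%C != 0 :> R[i] by rewrite (inj_eq (@complexI R)) gt_eqF.
have pE : 'X^N - 1 = \prod_(z <- roots1 N) ('X - z%:P) :> {poly R[i]}.
  rewrite /roots1; case: closed_field_poly_normal => s /= hs.
  have hm : ('X^N - 1 : {poly R[i]}) \is monic by rewrite -[1]/(1%:P); exact: monicXnsubC.
  by rewrite {1}hs (monicP hm) scale1r.
have sN : size (roots1 N) = N.
  have := size_XnsubC (1 : R[i]) N0; rewrite -[1%:P]/(1 : {poly R[i]}) pE size_prod_XsubC; exact: succn_inj.
have h : (v / rho%:C%C) ^+ N - 1 = \prod_(z <- roots1 N) (v / rho%:C%C - z).
  by rewrite -horner_XnB1 pE horner_prod; apply: eq_bigr => z _; rewrite hornerXsubC.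
have -> : v ^+ N - rho%:C%C ^+ N = rho%:C%C ^+ N * ((v / rho%:C%C) ^+ N - 1).
  by rewrite mulrBr mulr1 exprMn exprVn mulrCA mulfV ?mulr1// expf_neq0.
rewrite h -{1}sN prod_scale cabs_prod.
by apply: eq_bigr => z _; rewrite mulrBr mulrCA mulfV ?mulr1.
Qed.

(* The value on the circle is chosen so that pot_close has no exception. *)
Definition pot N (v : R[i]) (rho : R) : R :=
  if cabs v == rho then ln rho else N%:R^-1 * ln (cabs (v ^+ N - rho%:C%C ^+ N)).

Lemma pow_gap N (x y : R) : 0 <= y -> y <= x -> (x - y) * x ^+ N <= x ^+ N.+1 - y ^+ N.+1.
Proof.
move=> y0 yx; rewrite mulrBl !exprS lerD2l lerN2; apply: ler_wpM2l => //.
by apply: lerXn2r; rewrite ?nnegrE// (le_trans y0).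
Qed.

(** The modulus of v^N - rho^N lies between |y - rho| m^(N - 1) and 2 m^N, where m is the larger of
    y and rho. Taking logarithms and dividing by N leaves ell / N and ln 2 / N. *)
Lemma pot_close N v rho : (0 < N)%N -> 0 < rho ->
  `|pot N v rho - ln (Num.max (cabs v) rho)| <= (ell (cabs v) rho + 1) / N%:R.
Proof.
move=> N0 r0; set y := cabs v; have y0 : 0 <= y by exact: cabs_ge0.
have l0 := ell_ge0 y0 r0; have NR : 0 < N%:R :> R by rewrite ltr0n.
set m := Num.max y rho; have m0 : 0 < m by rewrite lt_max r0 orbT.
rewrite /pot -/y; case: eqVneq => [e|ne].
  have -> : m = rho by rewrite /m e maxxx.
  by rewrite subrr normr0 divr_ge0 ?(ltW NR)// addr_ge0.
have d0 : 0 < `|y - rho| by rewrite normr_gt0 subr_eq0.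
set q := cabs (_ - _).
have up : q <= 2 * m ^+ N.
  rewrite /q; apply: (le_trans (cabs_triB _ _)); rewrite !cabsX cabs_real (gtr0_norm r0) (_ : 2 * m ^+ N = m ^+ N + m ^+ N); last by ring.
  by apply: lerD; apply: lerXn2r; rewrite ?nnegrE ?(ltW m0) ?(ltW r0)// le_max lexx ?orbT.
have low : `|y - rho| * m ^+ N.-1 <= q.
  have t1 : `|y ^+ N - rho ^+ N| <= q.
    rewrite ler_norml; have e1 : cabs (v ^+ N) = y ^+ N by rewrite cabsX.
    have e2 : cabs (rho%:C%C ^+ N) = rho ^+ N by rewrite cabsX cabs_real (gtr0_norm r0).
    have h1 := cabsD (v ^+ N - rho%:C%C ^+ N) (rho%:C%C ^+ N); rewrite subrK e1 e2 in h1.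
    have h2 := cabsD (rho%:C%C ^+ N - v ^+ N) (v ^+ N); rewrite subrK e1 e2 cabsB in h2.
    by apply/andP; split; move: h1 h2; rewrite -/q; lra.
  apply: le_trans t1; rewrite /m; case: N N0 {NR q up} => // N _ /=.
  have [yr|ry] := leP y rho.
    by rewrite distrC (ger0_norm (_ : 0 <= rho - y)) ?subr_ge0// (le_trans (pow_gap N y0 yr))// distrC ler_norm.
  rewrite (gtr0_norm (_ : 0 < y - rho)) ?subr_gt0//.
  by rewrite (le_trans (pow_gap N (ltW r0) (ltW ry)))// ler_norm.
have q0 : 0 < q by apply: lt_le_trans low; rewrite mulr_gt0// exprn_gt0.
have ln2 : ln 2 <= 1 :> R by have := ln_le_sub1 (ltr0n R 2); lra.
have hu : ln q <= 1 + N%:R * ln m.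
  have : ln q <= ln (2 * m ^+ N) by rewrite ler_ln ?posrE// mulr_gt0// exprn_gt0.
  by rewrite lnM ?posrE ?exprn_gt0// lnX_nat//; move: ln2; lra.
have hl : N%:R * ln m - ell y rho <= ln q.
  have : ln (`|y - rho| * m ^+ N.-1) <= ln q by rewrite ler_ln ?posrE// mulr_gt0// exprn_gt0.
  rewrite lnM ?posrE ?exprn_gt0// lnX_nat// /ell -/m ln_div ?posrE//.
  have -> : (N.-1)%:R = N%:R - 1 :> R by rewrite -{2}(prednK N0) -natr1 addrK.
  lra.
have -> : N%:R^-1 * ln q - ln m = (ln q - N%:R * ln m) / N%:R by field; rewrite gt_eqF.
rewrite normrM (gtr0_norm (_ : 0 < N%:R^-1)) ?invr_gt0// ler_wpM2r ?invr_ge0 ?(ltW NR)//.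
by rewrite ler_norml; apply/andP; split; move: hu hl l0; lra.
Qed.

Section kernels.
Variables (r s tau : R) (c : R[i]).
Hypotheses (r0 : 0 < r) (rs : r < s) (t0 : 0 < tau).
Let s0 : 0 < s. Proof. exact: lt_trans rs. Qed.
Let rr u : 0 < circ_rad r tau u. Proof. exact: lt_le_trans (circ_rad_ge r u (ltW t0)). Qed.
Let ss u : 0 < circ_rad s tau u. Proof. exact: lt_le_trans (circ_rad_ge s u (ltW t0)). Qed.

(** The radial profile: the log ratio of the radii inside the smaller circle, 0 outside the larger
    one. Its approximation [kern] involves finitely many logarithmic potentials, hence finitely many
    points z at a time. *)
Definition plateau (w : R[i]) (u : R) : R :=
  ln (Num.max (cabs (w - c)) (circ_rad s tau u)) - ln (Num.max (cabs (w - c)) (circ_rad r tau u)).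

Definition kern N (w : R[i]) (u : R) : R := pot N (w - c) (circ_rad s tau u) - pot N (w - c) (circ_rad r tau u).

Definition radial_bump (w : R[i]) : R := Ex (unif R) (plateau w).

Let gap : R := ln (s + tau) - ln r.

Lemma circ_rad_lt u : circ_rad r tau u < circ_rad s tau u.
Proof. by rewrite ltrD2r. Qed.

Lemma plateau_bounds w u : 0 <= plateau w u <= gap.
Proof.
set y := cabs (w - c); have y0 : 0 <= y by exact: cabs_ge0.
have m1 : 0 < Num.max y (circ_rad r tau u) by rewrite lt_max rr orbT.
have m2 : 0 < Num.max y (circ_rad s tau u) by rewrite lt_max ss orbT.
have ru := circ_rad_lt u.
apply/andP; split.
  rewrite subr_ge0 ler_ln ?posrE// ge_max !le_max lexx /=.
  by rewrite (ltW ru) orbT.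
have [h|h] := leP y (circ_rad s tau u); last first.
  rewrite /plateau -/y (max_idPl (ltW h)) (max_idPl (ltW (lt_trans ru h))) subrr subr_ge0 ler_ln ?posrE//; last by rewrite addr_gt0.
  by apply: (le_trans (ltW rs)); rewrite lerDl ltW.
rewrite /plateau -/y (max_idPr h); apply: lerB.
  by rewrite ler_ln ?posrE ?ss ?addr_gt0 ?circ_rad_le ?(ltW t0).
by rewrite ler_ln ?posrE// (le_trans (circ_rad_ge r u (ltW t0)))// le_max lexx orbT.
Qed.

Lemma gap_ge0 : 0 <= gap.
Proof. by have /andP[h1 h2] := plateau_bounds 0 0; exact: le_trans h1 h2. Qed.

Lemma plateau_norm w u : `|plateau w u| <= gap.
Proof. by have /andP[h1 h2] := plateau_bounds w u; rewrite ger0_norm. Qed.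

Lemma kern_close N w u : (0 < N)%N ->
  `|kern N w u - plateau w u| <= (ell (cabs (w - c)) (circ_rad s tau u) + ell (cabs (w - c)) (circ_rad r tau u) + 2) / N%:R.
Proof.
move=> N0; have h1 := pot_close (w - c) N0 (ss u); have h2 := pot_close (w - c) N0 (rr u).
have -> : kern N w u - plateau w u = (pot N (w - c) (circ_rad s tau u) - ln (Num.max (cabs (w - c)) (circ_rad s tau u)))
   - (pot N (w - c) (circ_rad r tau u) - ln (Num.max (cabs (w - c)) (circ_rad r tau u))) by exact: sub_sub_swap.
apply: (le_trans (ler_normB _ _)); apply: (le_trans (lerD h1 h2)).
by rewrite -mulrDl le_eqVlt; apply/orP; left; apply/eqP; congr (_ / _); ring.
Qed.

Lemma measurable_plateau w : measurable_fun setT (plateau w : measurableTypeR R -> R).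
Proof.
by apply: measurable_funB; (apply: measurableT_comp; first exact: measurable_ln);
  apply: measurable_maxr; (exact: measurable_cst || exact: measurable_circ_rad).
Qed.

Lemma measurable_eqRR d (T : measurableType d) (f g : T -> R) : measurable_fun setT f ->
  measurable_fun setT g -> measurable [set x | f x == g x].
Proof.
move=> mf mg; rewrite (_ : [set x | _] = [set x | f x <= g x] `&` [set x | g x <= f x]).
  by apply: measurableI; exact: measurable_leRR.
by apply/seteqP; split => x /=; [move/eqP->; split|move=> [h1 h2]; rewrite eq_le h1 h2].
Qed.

Lemma measurable_pot N v (a : R) : measurable_fun setT (fun u : measurableTypeR R => pot N v (circ_rad a tau u)).
Proof.
have mr : measurable_fun setT (fun u : measurableTypeR R => circ_rad a tau u) by exact: measurable_circ_rad.
have mb : measurable_fun setT (fun u : measurableTypeR R => ((cabs v == circ_rad a tau u)%R%:R : R)).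
  by apply: measurable_boolR; apply: measurable_eqRR => //; exact: measurable_cst.
have -> : (fun u : measurableTypeR R => pot N v (circ_rad a tau u)) = fun u =>
   (cabs v == circ_rad a tau u)%R%:R * ln (circ_rad a tau u) + (1 - (cabs v == circ_rad a tau u)%R%:R) *
     (N%:R^-1 * ln (cabs (v ^+ N - (circ_rad a tau u)%:C%C ^+ N))).
  by apply/funext => u; rewrite /pot; case: eqP => _; rewrite ?mul1r ?subrr ?mul0r ?addr0 ?subr0 ?add0r ?mul1r.
have mln d (T : measurableType d) (f : T -> R) : measurable_fun setT f -> measurable_fun setT (fun x => ln (f x)).
  by move=> mf; apply: measurableT_comp => //; exact: measurable_ln.
apply: measurable_funD; apply: measurable_funM => //.
- exact: mln.
- by apply: measurable_funB => //; exact: measurable_cst.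
- apply: measurable_funM; first exact: measurable_cst.
  apply: mln; apply: measurable_cabs; apply: cmeasB; first exact: cmeas_cst.
  have -> : (fun u : measurableTypeR R => (circ_rad a tau u)%:C%C ^+ N) = (fun u => \prod_(k < N) (circ_rad a tau u)%:C%C).
    by apply/funext => u; rewrite prodr_const card_ord.
  by apply: cmeas_prod => k; exact: cmeas_real.
Qed.

Lemma measurable_kern N w : measurable_fun setT (kern N w : measurableTypeR R -> R).
Proof. by apply: measurable_funB; exact: measurable_pot. Qed.

Let Cr : R := 6 * (4 * ((r + tau) / tau)).
Let Cs : R := 6 * (4 * ((s + tau) / tau)).
Let C2 : R := 4 * (gap ^+ 2 + 4 + (Cs + Cr)).

(** A majorant of [kern N w u ^+ 2] for all N >= 1 whose expectation is bounded in w: the second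
    moment bound that [vitali] requires. *)
Let sq_dom w u : R := 4 * (gap ^+ 2 + 4 + (ell (cabs (w - c)) (circ_rad s tau u) ^+ 2 + ell (cabs (w - c)) (circ_rad r tau u) ^+ 2)).

Let itg_sq_dom w : itg (unif R) (sq_dom w) /\ Ex (unif R) (sq_dom w) <= C2.
Proof.
have [i1 h1] := ell_second_moment s0 t0 (cabs_ge0 (w - c)).
have [i2 h2] := ell_second_moment r0 t0 (cabs_ge0 (w - c)).
have i3 := itgD i1 i2; have i4 := itgD (itg_cst (unif R) (gap ^+ 2 + 4)) i3.
split; first exact: itgZ.
rewrite /sq_dom ExZ// (ExD (itg_cst _ _) i3) Ex_cst ExD// /C2 ler_pM2l// lerD2l.
exact: lerD.
Qed.

Lemma kern_sq_dom N w u : (0 < N)%N -> kern N w u ^+ 2 <= sq_dom w u.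
Proof.
move=> N0; have hk := kern_close w u N0; have hp := plateau_norm w u.
have l1 := ell_ge0 (cabs_ge0 (w - c)) (ss u); have l2 := ell_ge0 (cabs_ge0 (w - c)) (rr u).
rewrite /sq_dom; set a := ell _ _ in hk l1 *; set b := ell _ _ in hk l2 *.
have g0 := gap_ge0.
have ab : `|kern N w u| <= gap + (a + b + 2).
  have -> : kern N w u = plateau w u + (kern N w u - plateau w u) by rewrite addrC subrK.
  apply: (le_trans (ler_normD _ _)); apply: lerD => //; apply: (le_trans hk).
  rewrite ler_pdivrMr ?ltr0n// ler_peMr ?ler1n//; move: l1 l2; lra.
rewrite -(real_normK (num_real (kern N w u))).
apply: (@le_trans _ _ ((gap + (a + b + 2)) ^+ 2)).
  by apply: lerXn2r; rewrite ?nnegrE//; move: g0 l1 l2; lra.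
exact: four_sq.
Qed.

Lemma itg_kern_sq N w : (0 < N)%N -> itg (unif R) (fun u => kern N w u ^+ 2).
Proof.
move=> N0; apply: (itg_dom _ _ (itg_sq_dom w).1); first by apply: measurable_funX; exact: measurable_kern.
by move=> u; rewrite ger0_norm ?sqr_ge0//; exact: kern_sq_dom.
Qed.

Lemma itg_kern N w : (0 < N)%N -> itg (unif R) (kern N w).
Proof.
move=> N0; apply: (itg_dom (measurable_kern N w) _ (itgD (itg_cst (unif R) 1) (itg_kern_sq w N0))) => u.
by rewrite -(real_normK (num_real (kern N w u))); have := sqr_ge0 (`|kern N w u| - 1); rewrite sqrrB1; have := normr_ge0 (kern N w u); lra.
Qed.

Lemma itg_plateau w : itg (unif R) (plateau w).
Proof. by apply: (@itg_bounded _ _ _ _ _ gap (measurable_plateau w)) => u; exact: plateau_norm. Qed.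

Let C1 : R := Cs + Cr + 4.

Lemma Ex_kern_close N w : (0 < N)%N -> `|Ex (unif R) (kern N w) - radial_bump w| <= C1 / N%:R.
Proof.
move=> N0; have NR : 0 < N%:R :> R by rewrite ltr0n.
have [i1 h1] := ell_second_moment s0 t0 (cabs_ge0 (w - c)).
have [i2 h2] := ell_second_moment r0 t0 (cabs_ge0 (w - c)).
pose D u := (ell (cabs (w - c)) (circ_rad s tau u) ^+ 2 + ell (cabs (w - c)) (circ_rad r tau u) ^+ 2) + 4.
have iD : itg (unif R) D by apply: itgD; [exact: itgD|exact: itg_cst].
have iD' := itgZ N%:R^-1 iD.
have id := itgB (itg_kern w N0) (itg_plateau w).
rewrite /radial_bump -(ExB (itg_kern w N0) (itg_plateau w)).
have pt u : `|kern N w u - plateau w u| <= N%:R^-1 * D u.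
  apply: (le_trans (kern_close w u N0)); rewrite mulrC ler_wpM2l ?invr_ge0 ?(ltW NR)// /D.
  have := sqr_ge0 (ell (cabs (w - c)) (circ_rad s tau u) - 1); have := sqr_ge0 (ell (cabs (w - c)) (circ_rad r tau u) - 1).
  have l1 := ell_ge0 (cabs_ge0 (w - c)) (ss u); have l2 := ell_ge0 (cabs_ge0 (w - c)) (rr u).
  by rewrite !sqrrB1; move: l1 l2; lra.
have up : Ex (unif R) (fun u => N%:R^-1 * D u) <= C1 / N%:R.
  rewrite ExZ// mulrC ler_wpM2r ?invr_ge0 ?(ltW NR)// /D ExD ?(ExD i1 i2) ?Ex_cst; [|exact: itgD|exact: itg_cst].
  by rewrite /C1 lerD2r; exact: lerD.
rewrite ler_norml; apply/andP; split.
  rewrite lerNl; apply: le_trans up; rewrite -(ExN id); apply: le_Ex => //; first exact: itgN.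
  by move=> u; apply: le_trans (pt u); rewrite -normrN ler_norm.
by apply: le_trans up; apply: le_Ex => // u; apply: le_trans (pt u); exact: ler_norm.
Qed.

Lemma Ex_spec_mean N n (D : 'M[R[i]]_n) : (0 < N)%N ->
  Ex (unif R) (fun u => spec_mean D (kern N ^~ u)) = spec_mean D (fun w => Ex (unif R) (kern N w)).
Proof.
move=> N0; rewrite /spec_mean ExZ; last by apply: itg_sum => w; exact: itg_kern.
by rewrite Ex_sum// => w; exact: itg_kern.
Qed.

Lemma Ex_spec_mean_close N n (D : 'M[R[i]]_n) : (0 < N)%N ->
  `|Ex (unif R) (fun u => spec_mean D (kern N ^~ u)) - spec_mean D radial_bump| <= C1 / N%:R.
Proof.
move=> N0; rewrite Ex_spec_mean// -spec_meanB; apply: spec_mean_bound => [|w]; last exact: Ex_kern_close.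
by apply: le_trans (Ex_kern_close 0 N0); exact: normr_ge0.
Qed.

(** For fixed N, [vitali] turns convergence for almost every u into convergence of the averages over
    u. These are within C1 / N of the bump means uniformly in n, so N can be fixed before n. *)
Lemma bump_cvg (DA DB : forall n, 'M[R[i]]_n) :
  (forall N, (0 < N)%N -> {ae (unif R), forall u, spec_mean (DA n) (kern N ^~ u) - spec_mean (DB n) (kern N ^~ u) @[n --> \oo] --> (0 : R)}) ->
  spec_mean (DA n) radial_bump - spec_mean (DB n) radial_bump @[n --> \oo] --> (0 : R).
Proof.
move=> hae.
have mm n (D : 'M[R[i]]_n) N : measurable_fun setT (fun u : measurableTypeR R => spec_mean D (kern N ^~ u)).
  apply: measurable_funM; first exact: measurable_cst.
  by apply: measurable_fun_sumR => w; exact: measurable_kern.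
have i2 n (D : 'M[R[i]]_n) N : (0 < N)%N -> itg (unif R) (fun u => spec_mean D (fun w => kern N w u ^+ 2)).
  by move=> N0; apply: itgZ; apply: itg_sum => w; exact: itg_kern_sq.
have C20 : 0 <= C2 by apply: le_trans (itg_sq_dom 0).2; apply: Ex_ge0 => u; apply: le_trans (kern_sq_dom 0 u (ltn0Sn 0)); exact: sqr_ge0.
have e2 n (D : 'M[R[i]]_n) N : (0 < N)%N -> Ex (unif R) (fun u => spec_mean D (fun w => kern N w u ^+ 2)) <= C2.
  move=> N0; rewrite /spec_mean ExZ; last by apply: itg_sum => w; exact: itg_kern_sq.
  rewrite Ex_sum; last by move=> w; exact: itg_kern_sq.
  apply: le_trans (spec_mean_cst_le D C20); rewrite /spec_mean ler_wpM2l ?invr_ge0//; apply: ler_sum => w _.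
  apply: le_trans (itg_sq_dom w).2; apply: le_Ex; [exact: itg_kern_sq|exact: (itg_sq_dom w).1|].
  by move=> u; exact: kern_sq_dom.
pose g N n u := spec_mean (DA n) (kern N ^~ u) - spec_mean (DB n) (kern N ^~ u).
have gN N : (0 < N)%N -> Ex (unif R) (g N n) @[n --> \oo] --> (0 : R).
  move=> N0; pose D n u := 2 * (spec_mean (DA n) (fun w => kern N w u ^+ 2) + spec_mean (DB n) (fun w => kern N w u ^+ 2)).
  have iD n : itg (unif R) (D n) by apply: itgZ; apply: itgD; exact: i2.
  have gD n u : g N n u ^+ 2 <= D n u.
    have h1 := spec_mean_sqr (DA n) (kern N ^~ u); have h2 := spec_mean_sqr (DB n) (kern N ^~ u).
    exact: (sqrB_le h1 h2).
  have mg n : measurable_fun setT (fun u : measurableTypeR R => g N n u) by apply: measurable_funB; exact: mm.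
  have ig2 n : itg (unif R) (fun u => g N n u ^+ 2).
    apply: (itg_dom _ _ (iD n)); first exact: measurable_funX.
    by move=> u; rewrite ger0_norm ?sqr_ge0.
  apply: (vitali (C := 2 * (C2 + C2))) => //; last exact: hae.
  move=> n; apply: (le_trans (le_Ex (ig2 n) (iD n) (gD n))).
  rewrite /D ExZ; last by apply: itgD; exact: i2.
  rewrite ExD; [|exact: i2|exact: i2].
  by rewrite ler_pM2l//; apply: lerD; exact: e2.
have igk n (D : 'M[R[i]]_n) N : (0 < N)%N -> itg (unif R) (fun u => spec_mean D (kern N ^~ u)).
  by move=> N0; apply: itgZ; apply: itg_sum => w; exact: itg_kern.
apply/cvgrPdist_le => e e0.
have C10 : 0 <= C1.
  by have := Ex_kern_close 0 (ltn0Sn 0); rewrite divr1; apply: le_trans; exact: normr_ge0.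
pose N := (Num.truncn (4 * C1 / e)).+1.
have NR : 0 < N%:R :> R by rewrite ltr0n.
have hN : C1 / N%:R <= e / 4.
  rewrite ler_pdivrMr//; have h : 4 * C1 / e <= N%:R by exact: ltW (truncnS_gt _).
  by move: h; rewrite ler_pdivrMr//; lra.
have e2' : 0 < e / 2 by rewrite divr_gt0.
move/cvgrPdist_le : (gN N isT) => /(_ _ e2'); apply: filterS => n; rewrite !sub0r !normrN.
rewrite /g ExB; [|exact: igk|exact: igk].
have hA := Ex_spec_mean_close (DA n) (isT : (0 < N)%N); have hB := Ex_spec_mean_close (DB n) (isT : (0 < N)%N).
exact: (approx_arith (le_trans hA hN) (le_trans hB hN)).
Qed.

End kernels.

End circle_kernel.

(** * Null sets and measurability under Fubini *)

Section ae_tools.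
Context (R : realType).

Lemma ae_S d (T : measurableType d) (P : probability T R) (A B : T -> Prop) :
  (forall x, A x -> B x) -> {ae P, forall x, A x} -> {ae P, forall x, B x}.
Proof. by move=> AB; apply: filterS. Qed.

Lemma ae_S2 d (T : measurableType d) (P : probability T R) (A B C : T -> Prop) :
  (forall x, A x -> B x -> C x) -> {ae P, forall x, A x} -> {ae P, forall x, B x} -> {ae P, forall x, C x}.
Proof. by move=> ABC; apply: filterS2. Qed.

Lemma ae_seq d (T : measurableType d) (P : probability T R) (I : eqType) (q : seq I) (G : I -> T -> Prop) :
  (forall i, {ae P, forall w, G i w}) -> {ae P, forall w, forall i, i \in q -> G i w}.
Proof.
move=> h; elim: q => [|i q IH]; first by apply: aeW.
apply: filterS2 (h i) IH => w hi hq j; rewrite inE => /orP[/eqP ->//|]; exact: hq.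
Qed.

(** The two iterated expectations of the indicator of the exceptional set agree and one is 0; a
    nonnegative function with zero integral vanishes almost everywhere. *)
Lemma ae_swap d1 d2 (T1 : measurableType d1) (T2 : measurableType d2) (P : probability T1 R)
  (Q : probability T2 R) (S : set (T1 * T2)) : measurable S ->
  (forall y, {ae P, forall x, S (x, y)}) -> {ae P, forall x, {ae Q, forall y, S (x, y)}}.
Proof.
move=> mS h.
have mC : measurable (~` S) by exact: measurableC.
pose f : T1 * T2 -> R := \1_(~` S).
have mf : measurable_fun setT f by exact: measurable_indic.
have f1 p : `|f p| <= 1 by rewrite /f indicE; case: (_ \in _); rewrite ?normr1 ?normr0.
have mx x : measurable [set y | (~` S) (x, y)].
  by rewrite -[X in measurable X]setTI; exact: (pair1_measurable x).
have my y : measurable [set x | (~` S) (x, y)].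
  by rewrite -[X in measurable X]setTI; exact: (pair2_measurable y).
have sx x : Ex Q (fun y => f (x, y)) = Pr Q [set y | (~` S) (x, y)].
  by rewrite Pr_Ex//; apply: eq_Ex => y; rewrite /f !indicE; congr (_%:R); apply/idP/idP; rewrite !inE.
have sy y : Ex P (fun x => f (x, y)) = 0.
  have -> : Ex P (fun x => f (x, y)) = Pr P [set x | (~` S) (x, y)].
    by rewrite Pr_Ex//; apply: eq_Ex => x; rewrite /f !indicE; congr (_%:R); apply/idP/idP; rewrite !inE.
  by rewrite /Pr (_ : P _ = 0%E)//; apply/negligibleP; [exact: my|exact: h].
have [_ fy iy] := Ex_prod P Q mf f1.
have e0 : Ex P (fun x => Ex Q (fun y => f (x, y))) = 0.
  have [<- _ _] := Ex_prod P Q mf f1; have [-> _ _] := Ex_prod_swap P Q mf f1.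
  by rewrite (eq_Ex Q sy) Ex_cst.
have h0 x : 0 <= Ex Q (fun y => f (x, y)) by rewrite sx Pr_ge0.
have : ae_eq P setT (EFin \o (fun x => Ex Q (fun y => f (x, y)))) (cst 0%E).
  apply/ae_eq_integral_abs => //; first exact: measurable_int iy.
  transitivity (\int[P]_x (Ex Q (fun y => f (x, y)))%:E)%E; last by rewrite -EFin_Ex// e0.
  by apply: eq_integral => x _; rewrite /= ger0_norm.
apply: filterS => x hx; have := EFin_inj (hx I); rewrite /= sx => px.
have p0 : Q [set y | (~` S) (x, y)] = 0%E by rewrite -EFin_Pr// px.
have : Q.-negligible [set y | (~` S) (x, y)] by apply/negligibleP.
by move=> [N [mN N0 SN]]; exists N; split.
Qed.

(** Tonelli's theorem applies to the positive and negative parts separately, so integrability is not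
    assumed: default values arise from measurable operations too. *)
Lemma measurable_Ex_param d1 d2 (T1 : measurableType d1) (T2 : measurableType d2) (Q : probability T2 R)
  (f : T1 * T2 -> R) : measurable_fun setT f -> measurable_fun setT (fun x => Ex Q (fun y => f (x, y))).
Proof.
move=> mf.
have mE : measurable_fun setT (EFin \o f) by exact/measurable_EFinP.
have -> : (fun x => Ex Q (fun y => f (x, y))) =
   (fun x => fine (\int[Q]_y ((EFin \o f)^\+%E (x, y)) - \int[Q]_y ((EFin \o f)^\-%E (x, y))))%E.
  apply/funext => x; rewrite /Ex /Rintegral integralE; congr (fine (_ - _)%E); apply: eq_integral => y _;
  by rewrite ?funeposE ?funenegE.
apply: (measurableT_comp (fine_measurable measurableT)); apply: emeasurable_funB.
  apply: (@measurable_fun_fubini_tonelli_F _ _ _ _ _ _ ((EFin \o f)^\+%E)) => [|p]; last exact: funepos_ge0.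
  exact: measurable_funepos.
apply: (@measurable_fun_fubini_tonelli_F _ _ _ _ _ _ ((EFin \o f)^\-%E)) => [|p]; last exact: funeneg_ge0.
exact: measurable_funeneg.
Qed.

Lemma cvg_sum_seq (I : Type) (q : seq I) (f : I -> nat -> R) : (forall i, f i n @[n --> \oo] --> (0 : R)) ->
  \sum_(i <- q) f i n @[n --> \oo] --> (0 : R).
Proof.
move=> h; elim: q => [|i q IH]; first by under eq_fun do rewrite big_nil; exact: cvg_cst.
rewrite (_ : (fun n => _) = fun n => f i n + \sum_(j <- q) f j n); last by apply/funext => n; rewrite big_cons.
by rewrite -[X in _ --> X](addr0 (0 : R)); apply: cvgD.
Qed.

End ae_tools.

(** * Spectral means of kernels as sums of log-determinants *)

Section stage1.
Context (R : realType) d (T : measurableType d) (P : probability T R).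
Variable M : forall n : nat, 'M[R[i]]_n.
Implicit Types X Y : nat -> nat -> {RV P >-> borelC R}.

Definition lngram X n (z : R[i]) (w : T) : R := ln (gramR (rowsm (shifted M n z) n n (array_of X w))).

Definition noisy X n (w : T) : 'M[R[i]]_n := div_sqrt (M n + random_mx X n w).

Lemma gramR_noisy X n z w : (0 < n)%N ->
  gramR (rowsm (shifted M n z) n n (array_of X w)) =
  n%:R ^+ n * (\prod_(l <- eigenvalues (noisy X n w)) cabs (z - l)) ^+ 2.
Proof.
move=> n0; have nR : 0 < n%:R :> R by rewrite ltr0n.
have s0 : 0 < Num.sqrt n%:R :> R by rewrite sqrtr_gt0.
rewrite rowsm_shifted.
have -> : M n + \matrix_(i < n, j < n) ent (array_of X w) i j - ((Num.sqrt n%:R)%:C%C * z)%:M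
   = (Num.sqrt n%:R)%:C%C *: (noisy X n w - z%:M).
  rewrite scalerBr /noisy /div_sqrt scalerA -rmorphM /= divff ?gt_eqF// rmorph1 scale1r.
  by rewrite scale_scalar_mx.
rewrite gramR_square detZ cabsM cabsX cabs_real (ger0_norm (ltW s0)) exprMn -exprM mulnC exprM sqr_sqrtr; last exact: ltW.
by rewrite det_sub_eigenvalues.
Qed.

Definition off_circles (r s tau : R) (c : R[i]) n (D : 'M[R[i]]_n) (u : R) :=
  forall l, l \in eigenvalues D -> cabs (l - c) != circ_rad r tau u /\ cabs (l - c) != circ_rad s tau u.

Lemma circle_null (a tau y : R) : 0 < tau -> {ae unif R, forall u, y != circ_rad a tau u}.
Proof.
move=> t0.
have mA : measurable [set u : measurableTypeR R | y == circ_rad a tau u].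
  by apply: measurable_eqRR; [exact: measurable_cst|exact: measurable_circ_rad].
have p0 : Pr (unif R) [set u : measurableTypeR R | y == circ_rad a tau u] <= 2 * 0.
  apply: (unif_small (c := (y - a) / tau)) => // u /andP[u0 u1] /= /eqP ->.
  rewrite /circ_rad (min_idPl _)// (max_idPr _)// addrAC subrr add0r mulrAC mulfV ?gt_eqF// mul1r.
  by rewrite subrr normr0.
exists [set u : measurableTypeR R | y == circ_rad a tau u]; split => //.
  rewrite -EFin_Pr//; congr EFin; apply/eqP; rewrite eq_le Pr_ge0 andbT; move: p0; by rewrite mulr0.
by move=> u /= /negP; rewrite negbK.
Qed.

Lemma off_circles_ae (r s tau : R) (c : R[i]) n (D : 'M[R[i]]_n) : 0 < tau ->
  {ae unif R, forall u, off_circles r s tau c D u}.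
Proof.
move=> t0; have := @ae_seq _ _ _ (unif R) _ (eigenvalues D) (fun l u => cabs (l - c) != circ_rad r tau u /\ cabs (l - c) != circ_rad s tau u).
by apply=> l; apply: ae_S2 (circle_null r (cabs (l - c)) t0) (circle_null s (cabs (l - c)) t0) => u; split.
Qed.

(** An eigenvalue at a vertex of the polygon would lie on the circle, so all factors are positive
    and logarithms of products may be summed over eigenvalues and vertices in either order. The term
    n ln n comes from the normalisation by sqrt n and cancels between two radii. *)
Lemma spec_mean_pot X n w N (c : R[i]) (rho : R) : (0 < n)%N -> (0 < N)%N -> 0 < rho ->
  (forall l, l \in eigenvalues (noisy X n w) -> cabs (l - c) != rho) ->
  spec_mean (noisy X n w) (fun z => pot N (z - c) rho) =
  (2 * n%:R * N%:R)^-1 * \sum_(z <- roots1 R N) (lngram X n (c + rho%:C%C * z) w - n%:R * ln n%:R).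
Proof.
move=> n0 N0 r0 hl; have nR : 0 < n%:R :> R by rewrite ltr0n.
have NR : 0 < N%:R :> R by rewrite ltr0n.
have pos l : l \in eigenvalues (noisy X n w) -> forall z, z \in roots1 R N -> 0 < cabs (l - c - rho%:C%C * z).
  move=> le z zN; rewrite lt0r cabs_ge0 andbT; apply/eqP => e0.
  have := circle_prod (l - c) N0 r0; rewrite (big_rem z zN) /= e0 mul0r => /eqP.
  rewrite cabs_eq0 subr_eq0 => /eqP /(congr1 (@cabs R)); rewrite !cabsX cabs_real (gtr0_norm r0) => /eqP.
  rewrite eqrXn2 ?cabs_ge0 ?(ltW r0)// => /eqP e; by have := hl l le; rewrite e eqxx.
have lnE z : z \in roots1 R N -> lngram X n (c + rho%:C%C * z) w - n%:R * ln n%:R =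
    2 * \sum_(l <- eigenvalues (noisy X n w)) ln (cabs (l - c - rho%:C%C * z)).
  move=> zN; rewrite /lngram gramR_noisy//.
  have cE l : cabs (c + rho%:C%C * z - l) = cabs (l - c - rho%:C%C * z) by rewrite cabsB opprD addrA.
  under eq_bigr do rewrite cE.
  have p0 : 0 < \prod_(l <- eigenvalues (noisy X n w)) cabs (l - c - rho%:C%C * z).
    by rewrite big_seq; apply: prodr_gt0 => l le; exact: pos.
  rewrite lnM ?posrE ?exprn_gt0// !lnX_nat// addrAC subrr add0r.
  by congr (_ * _); have [] := ln_prod (fun l => cabs_ge0 (l - c - rho%:C%C * z)) p0.
rewrite big_seq (eq_bigr _ lnE) -big_seq -mulr_sumr exchange_big /= /spec_mean.
have -> : \sum_(l <- eigenvalues (noisy X n w)) pot N (l - c) rho =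
   N%:R^-1 * \sum_(l <- eigenvalues (noisy X n w)) \sum_(z <- roots1 R N) ln (cabs (l - c - rho%:C%C * z)).
  rewrite mulr_sumr big_seq [RHS]big_seq; apply: eq_bigr => l le.
  rewrite /pot (negbTE (hl l le)) circle_prod//; congr (_ * _).
  apply: (ln_prod (fun z => cabs_ge0 (l - c - rho%:C%C * z)) _).1.
  by rewrite big_seq; apply: prodr_gt0 => z zN; exact: pos.
by rewrite !mulrA; congr (_ * _); field; rewrite !gt_eqF.
Qed.

(** The kernel mean expressed through Gram determinants. In this form joint measurability in (w, u)
    is accessible, whereas the eigenvalues come from a choice of roots; the two forms agree off the
    circles. *)
Definition kern_gram X (r s tau : R) (c : R[i]) N n (p : T * measurableTypeR R) : R :=
  (2 * n%:R * N%:R)^-1 * \sum_(z <- roots1 R N)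
    (lngram X n (c + (circ_rad s tau p.2)%:C%C * z) p.1 - lngram X n (c + (circ_rad r tau p.2)%:C%C * z) p.1).

Section radii.
Variables (r s tau : R) (c : R[i]).
Hypotheses (r0 : 0 < r) (rs : r < s) (t0 : 0 < tau).

Lemma spec_mean_kern X n w N u : (0 < n)%N -> (0 < N)%N -> off_circles r s tau c (noisy X n w) u ->
  spec_mean (noisy X n w) (kern r s tau c N ^~ u) = kern_gram X r s tau c N n (w, u).
Proof.
move=> n0 N0 off.
have rr : 0 < circ_rad r tau u by exact: lt_le_trans (circ_rad_ge r u (ltW t0)).
have ss : 0 < circ_rad s tau u by exact: lt_le_trans (lt_trans r0 rs) (circ_rad_ge s u (ltW t0)).
have e1 := spec_mean_pot n0 N0 ss (fun l hl => (off l hl).2).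
have e2 := spec_mean_pot n0 N0 rr (fun l hl => (off l hl).1).
transitivity (spec_mean (noisy X n w) (fun z => pot N (z - c) (circ_rad s tau u)) -
              spec_mean (noisy X n w) (fun z => pot N (z - c) (circ_rad r tau u))); first exact: spec_meanB.
refine (etrans (congr2 (fun a b : R => a - b) e1 e2) _).
rewrite /kern_gram /= -mulrBr -sumrB; congr (_ * _); apply: eq_bigr => z _.
by rewrite opprB addrA subrK.
Qed.

Let cmeas_z a (z : R[i]) : @cmeas R _ (T * measurableTypeR R)%type (fun p => c + (circ_rad a tau p.2)%:C%C * z).
Proof.
apply: cmeasD; first exact: cmeas_cst.
apply: cmeasM; last exact: cmeas_cst.
by apply: cmeas_real; apply: (measurableT_comp (measurable_circ_rad a tau)); exact: measurable_snd.
Qed.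

Let measurable_gram X n a z : measurable_fun setT
  (fun p : T * measurableTypeR R => gramR (rowsm (shifted M n (c + (circ_rad a tau p.2)%:C%C * z)) n n (array_of X p.1))).
Proof.
rewrite (_ : (fun p => _) = fun p : T * measurableTypeR R => complex.Re (gram
   (rowsm (shifted M n (c + (circ_rad a tau p.2)%:C%C * z)) n n (array_of X p.1))))//.
suff [] : @cmeas R _ (T * measurableTypeR R)%type (fun p => gram (rowsm (shifted M n (c + (circ_rad a tau p.2)%:C%C * z)) n n (array_of X p.1))) by [].
have me i j : @cmeas R _ (T * measurableTypeR R)%type (fun p => rowsm (shifted M n (c + (circ_rad a tau p.2)%:C%C * z)) n n (array_of X p.1) i j).
  rewrite (_ : (fun p => _) = fun p : T * measurableTypeR R => shifted M n (c + (circ_rad a tau p.2)%:C%C * z) i j + ent (array_of X p.1) i j); last by apply/funext => p; rewrite mxE.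
  apply: cmeasD; last first.
    exact: (cmeas_compl (cmeas_ent R i j) (measurableT_comp (measurable_array_of X) measurable_fst)).
  apply: cmeasB; first exact: cmeas_cst.
  case: (i == j :> nat); last by exact: cmeas_cst.
  by apply: cmeasM; [exact: cmeas_cst|exact: cmeas_z].
apply: cmeas_det => i j; apply: cmeas_mulmx => // k l.
rewrite (_ : (fun p => _) = fun p : T * measurableTypeR R => Num.conj_op (rowsm (shifted M n (c + (circ_rad a tau p.2)%:C%C * z)) n n (array_of X p.1) l k)); last first.
  by apply/funext => p; rewrite hcE.
exact: cmeas_conj.
Qed.

Let measurable_lngram X n a z : measurable_fun setT
  (fun p : T * measurableTypeR R => lngram X n (c + (circ_rad a tau p.2)%:C%C * z) p.1).
Proof. by apply: measurableT_comp; [exact: measurable_ln|exact: measurable_gram]. Qed.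

Lemma measurable_kern_gram X N n : measurable_fun setT (kern_gram X r s tau c N n).
Proof.
apply: measurable_funM; first exact: measurable_cst.
by apply: measurable_fun_sumR => z; apply: measurable_funB; exact: measurable_lngram.
Qed.

(** A limit in N of averages of [kern_gram] over u, which equal those of [kern] because almost every
    radius avoids the finitely many eigenvalues. For n = 0 the mean is 0. *)
Lemma measurable_spec_bump X n : measurable_fun setT (fun w => spec_mean (noisy X n w) (radial_bump r s tau c)).
Proof.
case: n => [|n]; first by rewrite /spec_mean invr0; under eq_fun do rewrite mul0r; exact: measurable_cst.
apply: (measurable_fun_cvg (h := fun N w => Ex (unif R) (fun u => kern_gram X r s tau c N.+1 n.+1 (w, u)))).
  by move=> N; apply: measurable_Ex_param; exact: measurable_kern_gram.
move=> w _.
have eN N : Ex (unif R) (fun u => kern_gram X r s tau c N.+1 n.+1 (w, u)) =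
    Ex (unif R) (fun u => spec_mean (noisy X n.+1 w) (kern r s tau c N.+1 ^~ u)).
  rewrite /Ex /Rintegral; congr fine; apply: ae_eq_integral => //.
  - apply/measurable_EFinP; apply: (measurableT_comp (measurable_kern_gram X N.+1 n.+1)); exact: pair1_measurable.
  - apply/measurable_EFinP; apply: measurable_funM; first exact: measurable_cst.
    by apply: measurable_fun_sumR => z; exact: measurable_kern.
  - apply: ae_S (off_circles_ae r s c (noisy X n.+1 w) t0) => u off _; congr EFin.
    by rewrite -spec_mean_kern.
have [C hC] : exists C : R, forall N, `|Ex (unif R) (fun u => kern_gram X r s tau c N.+1 n.+1 (w, u)) - spec_mean (noisy X n.+1 w) (radial_bump r s tau c)| <= C / N.+1%:R.
  by eexists => N; rewrite eN; exact: Ex_spec_mean_close.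
apply/cvgrPdist_le => e e0; exists (Num.truncn (C / e)).+1 => // N /= hN.
rewrite distrC; apply: (le_trans (hC N)); rewrite ler_pdivrMr ?ltr0n// mulrC -ler_pdivrMr//.
apply: (le_trans (ltW (truncnS_gt _))); rewrite ler_nat; exact: leq_trans hN (leqnSn N).
Qed.

Lemma measurable_logdet_close X Y a z :
  measurable [set p : T * measurableTypeR R | logdet_close M X Y (c + (circ_rad a tau p.2)%:C%C * z) p.1].
Proof.
pose E k n : set (T * measurableTypeR R) := [set p | 0 < gramR (rowsm (shifted M n (c + (circ_rad a tau p.2)%:C%C * z)) n n (array_of X p.1))]
  `&` [set p | 0 < gramR (rowsm (shifted M n (c + (circ_rad a tau p.2)%:C%C * z)) n n (array_of Y p.1))]
  `&` [set p | `|lngram X n (c + (circ_rad a tau p.2)%:C%C * z) p.1 - lngram Y n (c + (circ_rad a tau p.2)%:C%C * z) p.1| <= n%:R * k.+1%:R^-1].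
have -> : [set p : T * measurableTypeR R | logdet_close M X Y (c + (circ_rad a tau p.2)%:C%C * z) p.1] =
   \bigcap_(k : nat) \bigcup_(m : nat) \bigcap_(n in [set n | (m <= n)%N]) E k n.
  apply/seteqP; split => p /=.
    move=> h k _; have [m _ hm] := h k; exists m => // n /= mn.
    have [h1 h2 h3] := hm n mn; exact: (conj (conj h1 h2) h3).
  move=> h k; have [m _ hm] := h k I; exists m => // n /= mn.
  have [[h1 h2] h3] := hm n mn; exact: (And3 h1 h2 h3).
apply: bigcap_measurable => // k _; apply: bigcup_measurable => m _; apply: bigcap_measurable.
  by exists m => /=.
move=> n _; apply: measurableI; first (apply: measurableI; apply: measurable_ltRR => //; exact: measurable_cst).
apply: measurable_leRR; last exact: measurable_cst.
apply: measurableT_comp; first exact: normr_measurable.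
by apply: measurable_funB; exact: measurable_lngram.
Qed.

Lemma lngram_cvg X Y z w : logdet_close M X Y z w -> n%:R^-1 * (lngram X n z w - lngram Y n z w) @[n --> \oo] --> (0 : R).
Proof.
move=> h; apply/cvgrPdist_le => e e0.
pose k := Num.truncn (e^-1).
have ke : k.+1%:R^-1 <= e.
  by rewrite -[X in _ <= X]invrK lef_pV2 ?posrE ?ltr0n ?invr_gt0// ltW// truncnS_gt.
have [m _ hm] := h k; exists (maxn m 1) => // n; rewrite /= geq_max => /andP[mn n0].
have [_ _ hn] := hm n mn; have nR : 0 < n%:R :> R by rewrite ltr0n.
rewrite sub0r normrN normrM (gtr0_norm (_ : 0 < n%:R^-1)) ?invr_gt0// mulrC ler_pdivrMr// mulrC.
by apply: (le_trans hn); rewrite ler_wpM2l// ltW.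
Qed.

End radii.

End stage1.

Section bump_as.
Context (R : realType) d (T : measurableType d) (P : probability T R).
Variable M : forall n : nat, 'M[R[i]]_n.
Implicit Types X Y : nat -> nat -> {RV P >-> borelC R}.
Variables (r s tau : R) (c : R[i]).
Hypotheses (r0 : 0 < r) (rs : r < s) (t0 : 0 < tau).

(** [ae_swap] exchanges samples and radii: for almost every sample, almost every radius puts the
    polygon vertices at good points z. Each N has finitely many vertices and N is countable, so the
    exceptional sets stay null. *)
Lemma bump_as X Y : (forall z, {ae P, forall w, logdet_close M X Y z w}) ->
  {ae P, forall w, spec_mean (noisy M X n w) (radial_bump r s tau c) - spec_mean (noisy M Y n w) (radial_bump r s tau c) @[n --> \oo] --> (0 : R)}.
Proof.
move=> hae.
have hN : {ae P, forall w, forall N z, z \in roots1 R N -> {ae unif R, forall u,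
   logdet_close M X Y (c + (circ_rad r tau u)%:C%C * z) w /\ logdet_close M X Y (c + (circ_rad s tau u)%:C%C * z) w}}.
  apply/ae_foralln => N; apply: ae_seq => z.
  have h1 := ae_swap (unif R) (measurable_logdet_close M tau c X Y r z) (fun u => hae (c + (circ_rad r tau u)%:C%C * z)).
  have h2 := ae_swap (unif R) (measurable_logdet_close M tau c X Y s z) (fun u => hae (c + (circ_rad s tau u)%:C%C * z)).
  by refine (ae_S2 (fun w h1w h2w => _) h1 h2); exact: (ae_S2 (fun u a b => conj a b) h1w h2w).
apply: ae_S hN => w hN; apply: (bump_cvg r0 rs t0) => N N0.
have oX : {ae unif R, forall u, forall n, off_circles r s tau c (noisy M X n w) u}.
  by apply/ae_foralln => n; exact: off_circles_ae.
have oY : {ae unif R, forall u, forall n, off_circles r s tau c (noisy M Y n w) u}.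
  by apply/ae_foralln => n; exact: off_circles_ae.
have cl : {ae unif R, forall u, forall z, z \in roots1 R N -> 
   logdet_close M X Y (c + (circ_rad r tau u)%:C%C * z) w /\ logdet_close M X Y (c + (circ_rad s tau u)%:C%C * z) w}.
  have := @ae_seq _ _ _ (unif R) _ (roots1 R N) (fun z u => z \in roots1 R N ->
   logdet_close M X Y (c + (circ_rad r tau u)%:C%C * z) w /\ logdet_close M X Y (c + (circ_rad s tau u)%:C%C * z) w).
  move=> /(_ _)/wrap[].
    move=> z; case: (boolP (z \in roots1 R N)) => zN; last by apply: aeW => u.
    by apply: ae_S (hN N z zN) => u hu _.
  by apply: ae_S => u hu z zN; exact: hu.
apply: ae_S2 (ae_S2 (fun u a b => conj a b) oX oY) cl => u [offX offY] hu.
pose g n z := (n%:R^-1 * (lngram M X n (c + (circ_rad s tau u)%:C%C * z) w - lngram M Y n (c + (circ_rad s tau u)%:C%C * z) w)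
   - n%:R^-1 * (lngram M X n (c + (circ_rad r tau u)%:C%C * z) w - lngram M Y n (c + (circ_rad r tau u)%:C%C * z) w)).
have gc : (2 * N%:R)^-1 * (\sum_(z <- roots1 R N) if z \in roots1 R N then g n z else 0) @[n --> \oo] --> (0 : R).
  rewrite -[X in _ --> X](mulr0 (2 * N%:R)^-1); apply: cvgM; first exact: cvg_cst.
  apply: (@cvg_sum_seq R _ (roots1 R N) (fun z n => if z \in roots1 R N then g n z else 0)) => z; case: (boolP (z \in roots1 R N)) => zN; last exact: cvg_cst.
  by rewrite -[X in _ --> X](subr0 (0 : R)); have [h1 h2] := hu z zN; apply: cvgB; exact: lngram_cvg.
apply: cvg_trans gc; apply: near_eq_cvg; exists 1%N => // n /= n0.
rewrite !spec_mean_kern// /kern_gram /= -mulrBr -sumrB mulr_sumr [RHS]mulr_sumr [LHS]big_seq [RHS]big_seq.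
apply: eq_bigr => z zN; rewrite zN /g.
have nR : 0 < n%:R :> R by rewrite ltr0n.
have NR : 0 < N%:R :> R by rewrite ltr0n.
move: (lngram M X n _ w) (lngram M X n _ w) (lngram M Y n _ w) (lngram M Y n _ w) => a1 a2 a3 a4.
by field; rewrite !gt_eqF.
Qed.

End bump_as.

(** * Density of radial bumps *)

Lemma div_mul_le (F : realFieldType) (c b z q : F) : 0 < b -> 0 <= c -> b * q <= z -> c * q <= c / b * z.
Proof.
by move=> b0 c0 h; rewrite -mulrA ler_wpM2l// (mulrC _ z) ler_pdivlMr// mulrC.
Qed.

Section lattice.
Context (R : realType).

Lemma count_lt (n K : nat) : \sum_(j < n) ((j < K)%N%:R : R) = (minn n K)%:R.
Proof.
elim: n => [|n IH]; first by rewrite big_ord0 min0n.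
rewrite big_ord_recr /= IH -natrD; congr (_%:R).
by rewrite /minn; case: (ltnP n K) => h; case: (ltnP n.+1 K) => h'; rewrite /=; lia.
Qed.

Section one_dim.
Variables (h rho : R) (n : nat).
Hypothesis h0 : 0 < h.

(* Shifting by h drops one term and adds another one, and both vanish. *)
Lemma lattice_shift (f : R -> R) k x : (forall x, rho < `|x| -> f x = 0) -> rho <= x ->
  x + h * k%:R + rho <= h * n%:R ->
  \sum_(j < n.+1) f (x + h * k%:R - h * j%:R) = \sum_(j < n.+1) f (x - h * j%:R).
Proof.
move=> f0 rx; elim: k => [|k IH]; first by rewrite mulr0 addr0.
rewrite -natr1 mulrDr mulr1 => hn; rewrite -IH; last by move: hn h0; lra.
set y := x + h * k%:R; have ry : rho <= y by rewrite (le_trans rx)// lerDl mulr_ge0// ltW.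
have hy : y + h + rho <= h * n%:R by move: hn; rewrite /y; lra.
rewrite big_ord_recl [RHS]big_ord_recr /= mulr0 subr0 addrA.
have -> : f (x + h * k%:R + h) = 0.
  by apply: f0; apply: lt_le_trans (ler_norm _); move: ry h0; rewrite -/y; lra.
have -> : f (y - h * n%:R) = 0.
  by apply: f0; rewrite distrC; apply: lt_le_trans (ler_norm _); move: hy h0; lra.
rewrite add0r addr0; apply: eq_bigr => j _; congr f.
by rewrite /bump /= add1n -natr1 /y; ring.
Qed.

Lemma lattice_reduce x : rho <= x -> exists k : nat, rho <= x - h * k%:R < rho + h.
Proof.
move=> rx; exists (Num.truncn ((x - rho) / h)).
have q0 : 0 <= (x - rho) / h by rewrite divr_ge0 ?subr_ge0// ltW.
have /andP[h1 h2] := truncn_itv q0; move: h1 h2; rewrite ler_pdivlMr// ltr_pdivrMr// -natr1.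
by set k := (Num.truncn _)%:R => h1 h2; apply/andP; split; move: h1 h2; lra.
Qed.

End one_dim.

Section two_dim.
Variables (Phi : R -> R -> R) (dl Lp beta : R) (m n : nat).
Hypotheses (d0 : 0 < dl) (Lp0 : 0 <= Lp) (beta0 : 0 < beta) (m0 : (0 < m)%N) (nm : (9 * m <= n)%N).
Hypothesis Phi0 : forall x y, 0 <= Phi x y.
Hypothesis Phix : forall x y, 4 * dl < `|x| -> Phi x y = 0.
Hypothesis Phiy : forall x y, 4 * dl < `|y| -> Phi x y = 0.
Hypothesis PhiL : forall x y x' y', `|Phi x y - Phi x' y'| <= Lp * (`|x - x'| + `|y - y'|).
Hypothesis Phib : forall x y, `|x| <= dl / 2 -> `|y| <= dl / 2 -> beta <= Phi x y.
Let h := dl / (2 * m%:R).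
Let rho := 4 * dl.
Let mR : 0 < m%:R :> R. Proof. by rewrite ltr0n. Qed.
Let h0 : 0 < h. Proof. by rewrite divr_gt0// mulr_gt0. Qed.
Let dlE : dl = h * (2 * m%:R). Proof. by rewrite /h divfK// gt_eqF// mulr_gt0. Qed.

Definition lattice_sum (x y : R) := \sum_(j < n.+1) \sum_(l < n.+1) Phi (x - h * j%:R) (y - h * l%:R).

Let reduced x y : rho <= x -> x + rho <= h * n%:R -> rho <= y -> y + rho <= h * n%:R ->
  exists x1 y1, [/\ rho <= x1 < rho + h, rho <= y1 < rho + h & lattice_sum x y = lattice_sum x1 y1].
Proof.
move=> rx xn ry yn; have [k hk] := lattice_reduce h0 rx; have [k' hk'] := lattice_reduce h0 ry.
exists (x - h * k%:R), (y - h * k'%:R); split => //.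
have /andP[a1 _] := hk; have /andP[a2 _] := hk'.
have xE : x = x - h * k%:R + h * k%:R by rewrite subrK.
have yE : y = y - h * k'%:R + h * k'%:R by rewrite subrK.
transitivity (lattice_sum (x - h * k%:R) y).
  rewrite /lattice_sum exchange_big [RHS]exchange_big; apply: eq_bigr => l _ /=.
  rewrite {1}xE; apply: (@lattice_shift h rho n h0 (fun x => Phi x (y - h * l%:R)) k (x - h * k%:R)) => //; last by rewrite -xE.
  by move=> z; exact: Phix.
apply: eq_bigr => j _.
rewrite {1}yE; apply: (@lattice_shift h rho n h0 (fun y => Phi (x - h * k%:R - h * j%:R) y) k' (y - h * k'%:R)) => //; last by rewrite -yE.
by move=> z; exact: Phiy.
Qed.

Let far x (j : nat) : x < rho + h -> (18 * m <= j)%N -> rho < `|x - h * j%:R|.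
Proof.
move=> xr jm; have : h * (18 * m)%:R <= h * j%:R by rewrite ler_wpM2l ?(ltW h0)// ler_nat.
have hm : h <= h * m%:R by rewrite ler_peMr ?(ltW h0)// ler1n.
rewrite natrM mulrA (mulrC h) -mulrA => jh.
rewrite distrC; apply: lt_le_trans (ler_norm _).
move: xr jh hm h0; rewrite /rho dlE; move: (h * j%:R) => hj; rewrite (_ : h * (2 * m%:R) = 2 * (h * m%:R)); last by ring.
move: (h * m%:R) => hm; lra.
Qed.

Let Z := lattice_sum rho rho.

(** As 8 m h = 4 dl = rho, the m indices from 8 m to 9 m - 1 in each direction lie within dl / 2 of
    rho, where [Phi] is at least [beta]. *)
Lemma lattice_sum_lower : beta * m%:R ^+ 2 <= Z.
Proof.
pose I (j : nat) : R := (j < 9 * m)%N%:R - (j < 8 * m)%N%:R.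
have I01 j : I j = ((8 * m <= j) && (j < 9 * m))%N%:R.
  by rewrite /I; case: (ltnP j (9 * m)) => a; case: (ltnP j (8 * m)) => b; rewrite ?subr0 ?subrr //=; lia.
have sI : \sum_(j < n.+1) I j = m%:R.
  rewrite /I sumrB !count_lt -natrB; first by congr (_%:R); rewrite /minn; case: ltnP; case: ltnP; lia.
  by rewrite leq_min geq_minl /=; apply: leq_trans (geq_minr _ _) _; lia.
have -> : beta * m%:R ^+ 2 = \sum_(j < n.+1) \sum_(l < n.+1) beta * (I j * I l).
  under eq_bigr => j _ do rewrite -mulr_sumr -mulr_sumr sI.
  by rewrite -mulr_sumr -mulr_suml sI expr2.
apply: ler_sum => j _; apply: ler_sum => l _.
have close (k : nat) : (8 * m <= k)%N && (k < 9 * m)%N -> `|rho - h * k%:R| <= dl / 2.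
  move=> /andP[k1 k2].
  have a1 : h * (8 * m)%:R <= h * k%:R by rewrite ler_wpM2l ?(ltW h0)// ler_nat.
  have a2 : h * k%:R <= h * (9 * m)%:R by rewrite ler_wpM2l ?(ltW h0)// ler_nat ltnW.
  move: a1 a2; rewrite !natrM /rho dlE (_ : h * (8 * m%:R) = 8 * (h * m%:R)); last by ring.
  rewrite (_ : h * (9 * m%:R) = 9 * (h * m%:R)); last by ring.
  rewrite (_ : h * (2 * m%:R) = 2 * (h * m%:R)); last by ring.
  by move: (h * m%:R) (h * k%:R) => a b ? ?; rewrite ler_norml; apply/andP; split; lra.
rewrite !I01; case: (boolP ((8 * m <= j) && (j < 9 * m))%N) => hj; last by rewrite mul0r mulr0.
case: (boolP ((8 * m <= l) && (l < 9 * m))%N) => hl; last by rewrite !mulr0.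
by rewrite !mulr1; apply: Phib; exact: close.
Qed.

(** By [lattice_shift] only positions within one mesh of (rho, rho) matter. There at most 18 m
    indices per direction contribute, as 18 m h = 9 dl, and each term moves by at most 2 Lp h; this
    gives 648 = 2 * 18^2. The lower bound on [Z] makes the error relative. *)
Lemma lattice_sum_osc (C x y : R) : 648 <= C -> rho <= x -> x + rho <= h * n%:R -> rho <= y -> y + rho <= h * n%:R ->
  `|lattice_sum x y - Z| <= C * (Lp * h) / beta * Z.
Proof.
move=> hC rx xn ry yn; have [x1 [y1 [/andP[x1a x1b] /andP[y1a y1b] ->]]] := reduced rx xn ry yn.
have hZ := lattice_sum_lower.
have C0 : 0 <= C := le_trans (ler0n R 648) hC.
have Lh : 0 <= Lp * h := mulr_ge0 Lp0 (ltW h0).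
apply: (@le_trans _ _ (648 * (Lp * h) * m%:R ^+ 2)); last first.
  apply: le_trans (div_mul_le beta0 (mulr_ge0 C0 Lh) hZ).
  exact: (ler_wpM2r (exprn_ge0 2 (ltW mR)) (ler_wpM2r Lh hC)).
rewrite /Z /lattice_sum -sumrB; apply: (le_trans (ler_norm_sum _ _ _)).
pose J (j : nat) : R := (j < 18 * m)%N%:R.
have sJ : \sum_(j < n.+1) J j <= 18 * m%:R by rewrite count_lt -natrM ler_nat geq_minr.
have sJ0 : 0 <= \sum_(j < n.+1) J j by apply: sumr_ge0.
apply: (@le_trans _ _ (\sum_(j < n.+1) \sum_(l < n.+1) 2 * (Lp * h) * (J j * J l))).
  apply: ler_sum => j _; rewrite -sumrB; apply: (le_trans (ler_norm_sum _ _ _)); apply: ler_sum => l _.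
  rewrite /J; case: (ltnP j (18 * m)) => hj; last first.
    by rewrite !Phix ?subrr ?normr0 ?mul0r ?mulr0//; apply: far => //; rewrite ltrDl.
  case: (ltnP l (18 * m)) => hl; last first.
    by rewrite !Phiy ?subrr ?normr0 ?mul0r ?mulr0//; apply: far => //; rewrite ltrDl.
  rewrite !mulr1; apply: (le_trans (PhiL _ _ _ _)).
  rewrite (_ : x1 - h * j%:R - (rho - h * j%:R) = x1 - rho); last by ring.
  rewrite (_ : y1 - h * l%:R - (rho - h * l%:R) = y1 - rho); last by ring.
  rewrite !ger0_norm ?subr_ge0// (_ : 2 * (Lp * h) = Lp * (2 * h)); last by ring.
  by apply: ler_wpM2l => //; move: x1b y1b; lra.
under eq_bigr => j _ do rewrite -mulr_sumr -mulr_sumr.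
rewrite -mulr_sumr -mulr_suml (_ : 648 * (Lp * h) * m%:R ^+ 2 = 2 * (Lp * h) * ((18 * m%:R) * (18 * m%:R))); last by ring.
apply: ler_wpM2l; first by rewrite mulr_ge0// mulr_ge0// ltW.
exact: ler_pM.
Qed.

End two_dim.

End lattice.

Section compact_support.
Context (R : realType).

(** Test functions freed from the topology of [R[i]]: only these quantitative consequences of
    continuity and compact support enter the approximation. *)
Definition tame (f : R[i] -> R) := exists F B : R, [/\ 0 <= F, (forall z, `|f z| <= F), (forall z, B < cabs z -> f z = 0) &
  forall e : R, 0 < e -> exists2 eta : R, 0 < eta & forall z w, cabs (z - w) <= eta -> `|f z - f w| <= e].

Lemma nbhs_cabs (z : (R[i])^o) (A : set (R[i])^o) : nbhs z A <-> exists2 e : R, 0 < e & forall w, cabs (z - w) < e -> A w.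
Proof.
split.
  move/nbhs_ballP => [e /= e0 h]; exists (complex.Re e).
    by move: e0; rewrite ltcE /= => /andP[_].
  move=> w zw; apply: h; rewrite /ball /= cabs_normr.
  by move: e0; rewrite !ltcE /= => /andP[/eqP <- _]; rewrite eqxx.
move=> [e e0 h]; apply/nbhs_ballP; exists (e%:C%C) => /=; first by rewrite ltcR.
by move=> w; rewrite /ball /= cabs_normr ltcR; exact: h.
Qed.

(** Each bound holds locally and is made uniform on the compact support by near covering, with the
    sought constant as the filter variable. Two points outside the support need no continuity, and
    one inside suffices by symmetry. *)
Lemma Cc_tame (f : (R[i])^o -> R) : Cc f -> tame f.
Proof.
move=> [cf cK]; set K := closure _ in cK.
have fK z : ~ K z -> f z = 0.
  by move=> nK; apply/eqP; apply: contrapT => /negP fz; apply: nK; apply: subset_closure.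
have loc z e : 0 < e -> exists2 dl : R, 0 < dl & forall w, cabs (z - w) < dl -> `|f z - f w| < e.
  move=> e0; have /cvgrPdist_lt/(_ e e0) := cf z; by move/nbhs_cabs.
have NC := (compact_near_coveringP K).1 cK.
have [F [F0 hF]] : exists F : R, 0 <= F /\ forall z, K z -> `|f z| <= F.
  have := NC R (pinfty_nbhs R) (fun M z => `|f z| <= M) _.
  move=> /(_ _ _)/wrap[] //.
    move=> z _; have [dl dl0 hd] := loc z 1 ltr01.
    exists ([set w : (R[i])^o | cabs (z - w) < dl], [set M : R | `|f z| + 1 < M]) => /=.
      split; first by apply/nbhs_cabs; exists dl.
      by apply: nbhs_pinfty_gt; rewrite num_real.
    move=> [w M] /= [zw hM]; have := hd w zw; have := ler_normB (f z) (f z - f w).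
    rewrite subKr => h1 h2; move: h1 h2 hM; lra.
  move=> [M [_ hM]]; exists (Num.max 0 (M + 1)); split; first by rewrite le_max lexx.
  by move=> z Kz; rewrite le_max; apply/orP; right; apply: hM => //; rewrite ltrDl.
have [B hB] : exists B : R, forall z, K z -> cabs z <= B.
  have := NC R (pinfty_nbhs R) (fun M z => cabs z <= M) _.
  move=> /(_ _ _)/wrap[] //.
    move=> z _; exists ([set w : (R[i])^o | cabs (z - w) < 1], [set M : R | cabs z + 1 < M]) => /=.
      split; first by apply/nbhs_cabs; exists 1.
      by apply: nbhs_pinfty_gt; rewrite num_real.
    move=> [w M] /= [zw hM]; have := cabs_triB z (z - w); rewrite subKr => h; move: h zw hM; lra.
  by move=> [M [_ hM]]; exists (M + 1) => z Kz; apply: hM => //; rewrite ltrDl.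
exists F, B; split => //.
- by move=> z; case: (pselect (K z)) => [/hF//|/fK ->]; rewrite normr0.
- by move=> z Bz; apply: fK => /hB; rewrite leNgt Bz.
move=> e e0.
have [eta eta0 heta] : exists2 eta : R, 0 < eta & forall z w, K z -> cabs (z - w) <= eta -> `|f z - f w| <= e.
  have hloc : forall z, K z -> \forall z' \near z & eta \near 0^'+, forall w, cabs (z' - w) <= eta -> `|f z' - f w| <= e.
    move=> z _; have e2 : 0 < e / 2 by rewrite divr_gt0.
    have [dl dl0 hd] := loc z _ e2.
    exists ([set w : (R[i])^o | cabs (z - w) < dl / 2], [set M : R | M < dl / 2]) => /=.
      split; first by apply/nbhs_cabs; exists (dl / 2) => //; rewrite divr_gt0.
      by apply: nbhs_right_lt; rewrite divr_gt0.
    move=> [w M] /= [zw hM] v wv.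
    have h1 := hd w (lt_le_trans zw _); have h2 := hd v _.
    have zv : cabs (z - v) < dl by have := cabs_tri3 z v w; move: zw hM wv; lra.
    have zw' : cabs (z - w) < dl by move: zw dl0; lra.
    have {}h1 := hd w zw'; have {}h2 := hd v zv.
    have := ler_normB (f z - f v) (f z - f w); rewrite opprB addrC addrA subrK => h3.
    by move: h1 h2 h3; lra.
  pose A (eta : R) := K `<=` (fun z => forall w, cabs (z - w) <= eta -> `|f z - f w| <= e).
  have h : Filter (0^'+ : set_system R) -> (0^'+ : set_system R) A := fun F => NC R _ _ F hloc.
  have [eta [heta eta0]] := @filter_ex _ (0^'+ : set_system R) _ _ (@filterI _ (0^'+ : set_system R) _ A (fun x => 0 < x) (h _) (nbhs_right_gt (0 : R))).
  by exists eta; [exact: eta0|move=> z w Kz; exact: (heta z Kz w)].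
exists eta; first exact: eta0.
move=> z w zw; case: (pselect (K z)) => [Kz|nKz]; first exact: (heta z w Kz zw).
case: (pselect (K w)) => [Kw|nKw]; first by rewrite distrC; apply: (heta w z Kw); rewrite cabsB.
rewrite (fK z nKz) (fK w nKw) subrr normr0; exact: ltW.
Qed.

End compact_support.

Section bump_shape.
Context (R : realType).

Lemma Ex_dist d (T : measurableType d) (P : probability T R) (u v : T -> R) (K : R) : itg P u -> itg P v ->
  (forall x, `|u x - v x| <= K) -> `|Ex P u - Ex P v| <= K.
Proof.
move=> iu iv uv; rewrite -ExB// ler_norml -[X in - X](Ex_cst P K) -(ExN (itg_cst P K)) -[X in _ && (_ <= X)](Ex_cst P K).
by apply/andP; split; apply: le_Ex; rewrite ?itgB// ?itgN//; try exact: itg_cst; try exact: itgB;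
  move=> x; have := uv x; rewrite ler_norml => /andP[].
Qed.

Lemma ln_max_lip (r rho y y' : R) : 0 < r -> r <= rho ->
  `|ln (Num.max y rho) - ln (Num.max y' rho)| <= `|y - y'| / r.
Proof.
move=> r0 rr.
have half a b : ln (Num.max a rho) - ln (Num.max b rho) <= `|a - b| / r.
  have rb : r <= Num.max b rho by rewrite le_max rr orbT.
  have ra : r <= Num.max a rho by rewrite le_max rr orbT.
  have b0 := lt_le_trans r0 rb; have a0 := lt_le_trans r0 ra.
  rewrite -ln_div ?posrE//; apply: (le_trans (ln_le_sub1 _)); first by rewrite divr_gt0.
  have -> : Num.max a rho / Num.max b rho - 1 = (Num.max a rho - Num.max b rho) / Num.max b rho by field; rewrite gt_eqF.
  have ab : Num.max a rho - Num.max b rho <= `|a - b|.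
    have h1 : b <= Num.max b rho by rewrite le_max lexx.
    have h2 : rho <= Num.max b rho by rewrite le_max lexx orbT.
    rewrite lerBlDr ge_max; apply/andP; split; first by have := ler_norm (a - b); lra.
    by have := normr_ge0 (a - b); lra.
  apply: (@le_trans _ _ (`|a - b| / Num.max b rho)); first by rewrite ler_wpM2r// invr_ge0 ltW.
  by rewrite ler_wpM2l// lef_pV2.
rewrite ler_norml half andbT lerNl opprB distrC; exact: half.
Qed.

Section shape.
Variables (r s tau : R).
Hypotheses (r0 : 0 < r) (rs : r < s) (t0 : 0 < tau).

Lemma radial_bump_shift c w : radial_bump r s tau c w = radial_bump r s tau 0 (w - c).
Proof. by apply: eq_Ex => u; rewrite /plateau subr0. Qed.

Lemma radial_bump_ge0 c w : 0 <= radial_bump r s tau c w.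
Proof. by apply: Ex_ge0 => u; have /andP[] := plateau_bounds c r0 rs t0 w u. Qed.

Lemma radial_bump_out c w : s + tau <= cabs (w - c) -> radial_bump r s tau c w = 0.
Proof.
move=> h; rewrite /radial_bump -[RHS](Ex_cst (unif R)); apply: eq_Ex => u.
have h1 : circ_rad s tau u <= cabs (w - c) by apply: le_trans h; exact: circ_rad_le (ltW t0).
have h2 : circ_rad r tau u <= cabs (w - c) by apply: le_trans h1; exact: ltW (circ_rad_lt _ rs _).
by rewrite /plateau (max_idPl h1) (max_idPl h2) subrr.
Qed.

Lemma radial_bump_lip c w w' : `|radial_bump r s tau c w - radial_bump r s tau c w'| <= 2 / r * cabs (w - w').
Proof.
apply: Ex_dist; [exact: itg_plateau|exact: itg_plateau|move=> u].
have rs' := ltW rs.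
have h1 := ln_max_lip (cabs (w - c)) (cabs (w' - c)) r0 (le_trans rs' (circ_rad_ge s u (ltW t0))).
have h2 := ln_max_lip (cabs (w - c)) (cabs (w' - c)) r0 (circ_rad_ge r u (ltW t0)).
rewrite /plateau sub_sub_swap; apply: (le_trans (ler_normB _ _)).
apply: (le_trans (lerD h1 h2)).
have yy : `|cabs (w - c) - cabs (w' - c)| <= cabs (w - w').
  rewrite ler_norml; have a1 := cabs_tri3 w c w'; have a2 := cabs_tri3 w' c w; rewrite (cabsB w' w) in a2.
  by apply/andP; split; move: a1 a2; lra.
rewrite -mulrDl mulrAC ler_wpM2r ?invr_ge0 ?(ltW r0)//; move: yy; lra.
Qed.

End shape.

Lemma radial_bump_in (dl : R) c w : 0 < dl -> cabs (w - c) <= dl ->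
  ln (3 / 2) <= radial_bump dl (2 * dl) dl c w.
Proof.
move=> d0 wd; have dd : dl < 2 * dl by lra.
rewrite /radial_bump -[X in X <= _](Ex_cst (unif R)); apply: le_Ex; [exact: itg_cst|exact: itg_plateau|move=> u].
have h2 : dl <= circ_rad dl dl u by exact: circ_rad_ge (ltW d0).
have h3 := circ_rad_lt dl dd u; have h4 := circ_rad_le dl u (ltW d0).
rewrite /plateau (max_idPr (le_trans wd h2)) (max_idPr (le_trans wd (le_trans h2 (ltW h3)))).
have p1 := lt_le_trans d0 h2; have p2 := lt_trans p1 h3.
rewrite -ln_div ?posrE// ler_ln ?posrE ?divr_gt0// ler_pdivlMr//.
by move: h2 h4; rewrite /circ_rad; move: (dl * _) => q; lra.
Qed.

End bump_shape.

Section density.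
Context (R : realType).

(* k fixes the radius 1 / (k + 1), m the relative mesh and L the corner of the grid. *)
Definition lattice_center (k m L j l : nat) : R[i] :=
  ((k.+1%:R^-1 / (2 * m.+1%:R) * j%:R - L%:R) +i* (k.+1%:R^-1 / (2 * m.+1%:R) * l%:R - L%:R))%C.

Definition lattice_bump (k m L j l : nat) (w : R[i]) : R :=
  radial_bump k.+1%:R^-1 (2 * k.+1%:R^-1) k.+1%:R^-1 (lattice_center k m L j l) w.

(** In the application S is a weighted sum of values of f near w, T the total weight at w and Z the
    reference weight. The error splits into |f| |T - Z| / Z and the oscillation of f, carried by a
    weight T <= 2 Z. *)
Lemma dens_arith (a Z T S F e kappa : R) : 0 < Z -> `|a| <= F -> 0 <= kappa -> kappa <= 1 -> F * kappa <= e / 4 -> 0 < e ->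
  `|T - Z| <= kappa * Z -> `|a * T - S| <= e / 4 * T -> `|a - S / Z| <= e.
Proof.
move=> Z0 aF k0 k1 Fk e0 TZ aS.
have -> : a - S / Z = (a * (Z - T) + (a * T - S)) / Z by field; rewrite gt_eqF.
rewrite normrM (gtr0_norm (_ : 0 < Z^-1)) ?invr_gt0// ler_pdivrMr//.
apply: (le_trans (ler_normD _ _)); rewrite normrM distrC.
have h1 : `|a| * `|T - Z| <= F * (kappa * Z) by apply: ler_pM.
have h2 : T <= 2 * Z.
  by have kz := ler_wpM2r (ltW Z0) k1; move: TZ; rewrite ler_norml => /andP[_]; move: kz; lra.
have h3 := ler_wpM2r (ltW Z0) Fk.
have h4 : e / 4 * T <= e / 4 * (2 * Z) by apply: ler_wpM2l => //; rewrite divr_ge0// ltW.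
have h5 := mulr_gt0 e0 Z0.
rewrite mulrA in h1.
rewrite (_ : e / 4 * Z = e * Z / 4) in h3; last by rewrite mulrAC.
rewrite (_ : e / 4 * (2 * Z) = e * Z / 2) in h4; last by field.
move: h1 h3 h4 h5 aS.
move: (F * kappa * Z) (e / 4 * T) (`|a| * `|T - Z|) (`|a * T - S|) (e * Z) => p q t v x; lra.
Qed.

(** The lattice translates of one bump have nearly constant sum [Z] near the support of f. Divided
    by [Z] they form an approximate partition of unity, so the coefficients are the values of f at
    the lattice points over [Z]. *)
Lemma bump_dense (f : R[i] -> R) (e : R) : tame f -> 0 < e ->
  exists (k m L n : nat) (a : nat -> nat -> R), forall w,
    `|f w - \sum_(j < n.+1) \sum_(l < n.+1) a j l * lattice_bump k m L j l w| <= e.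
Proof.
move=> [F [B [F0 hF hB hu]]] e0.
have e4 : 0 < e / 4 by rewrite divr_gt0.
have [eta eta0 heta] := hu _ e4.
(* A bump is supported in radius 3 dl, which must stay within the modulus of continuity of f. *)
pose k := Num.truncn (3 / eta); pose dl : R := k.+1%:R^-1.
have d0 : 0 < dl by rewrite invr_gt0.
have d1 : dl <= 1 by rewrite invf_le1// ler1n.
have deta : 3 * dl <= eta.
  have h : 3 / eta <= k.+1%:R by exact: ltW (truncnS_gt _).
  by rewrite /dl ler_pdivrMr//; move: h; rewrite ler_pdivrMr// mulrC.
pose beta : R := ln (3 / 2).
have beta0 : 0 < beta by apply: ln_gt0; rewrite ltr_pdivlMr// mul1r ltr_nat.
have [C [C0 hC]] : exists C : R, 0 <= C /\ 648 <= C by exists 648; split; [exact: ler0n|exact: lexx].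
(* A mesh this fine gives [kappa <= 1] and [F * kappa <= e / 4] at once. *)
pose Q := C / beta * (1 + 4 * F / e).
have Q0 : 0 <= Q by rewrite mulr_ge0 ?divr_ge0 ?(ltW beta0)// addr_ge0// divr_ge0 ?(ltW e0)// mulr_ge0.
pose m := Num.truncn Q.
have mQ : Q <= m.+1%:R by exact: ltW (truncnS_gt _).
have m1 : 0 < m.+1%:R :> R by [].
pose h : R := dl / (2 * m.+1%:R).
have h0 : 0 < h by rewrite divr_gt0// mulr_gt0.
(* In each coordinate the lattice extends 8 beyond the disc of radius |B|: for w of modulus at most
   |B| + 4 a margin 4 >= 4 dl is left on every side. *)
pose L := (Num.truncn (`|B| + 8)).+1.
have LB : `|B| + 8 <= L%:R by exact: ltW (truncnS_gt _).
pose n := maxn (9 * m.+1) (Num.truncn (2 * L%:R / h)).+1.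
have nm : (9 * m.+1 <= n)%N by exact: leq_maxl.
have hn : 2 * L%:R <= h * n%:R.
  rewrite (mulrC h) -ler_pdivrMr//; apply: (le_trans (ltW (truncnS_gt _))); rewrite ler_nat.
  exact: leq_maxr.
pose Phi x y := radial_bump dl (2 * dl) dl 0 (x +i* y)%C.
have dd : dl < 2 * dl by lra.
have P0 x y : 0 <= Phi x y by exact: radial_bump_ge0.
have Pout x y : 3 * dl <= cabs (x +i* y)%C -> Phi x y = 0.
  by move=> hc; apply: radial_bump_out => //; rewrite subr0; move: hc; lra.
have Px x y : 4 * dl < `|x| -> Phi x y = 0.
  by move=> hx; apply: Pout; have := Re_le_cabs (x +i* y)%C; rewrite /=; lra.
have Py x y : 4 * dl < `|y| -> Phi x y = 0.
  by move=> hx; apply: Pout; have := Im_le_cabs (x +i* y)%C; rewrite /=; lra.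
have PL x y x' y' : `|Phi x y - Phi x' y'| <= 2 / dl * (`|x - x'| + `|y - y'|).
  apply: (le_trans (radial_bump_lip d0 dd d0 0 _ _)); apply: ler_wpM2l; first by rewrite divr_ge0// ltW.
  by have := cabs_le_ReIm ((x +i* y)%C - (x' +i* y')%C).
have Pb x y : `|x| <= dl / 2 -> `|y| <= dl / 2 -> beta <= Phi x y.
  move=> hx hy; apply: radial_bump_in => //; rewrite subr0; have := cabs_le_ReIm (x +i* y)%C; rewrite /=; lra.
have Lp0 : 0 <= 2 / dl by rewrite divr_ge0// ltW.
pose T := lattice_sum Phi dl m.+1 n.
pose Z := T (4 * dl) (4 * dl).
have Zlow : beta * m.+1%:R ^+ 2 <= Z by apply: lattice_sum_lower.
have Z0 : 0 < Z by apply: lt_le_trans Zlow; rewrite mulr_gt0// exprn_gt0.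
pose kappa := C * (2 / dl * h) / beta.
have kE : kappa = C / beta / m.+1%:R by rewrite /kappa /h; field; rewrite !gt_eqF.
have k0 : 0 <= kappa by rewrite kE !divr_ge0// ltW.
have kQ : kappa * (1 + 4 * F / e) <= 1.
  by rewrite kE mulrAC ler_pdivrMr// mul1r.
have Fe : 0 <= 4 * F / e by rewrite divr_ge0 ?(ltW e0)// mulr_ge0.
have k1 : kappa <= 1.
  by apply: le_trans kQ; rewrite ler_peMr// lerDl.
have Fk : F * kappa <= e / 4.
  have h1 : kappa * (4 * F / e) <= 1 by apply: le_trans kQ; rewrite ler_wpM2l// lerDr.
  have -> : F * kappa = kappa * (4 * F / e) * (e / 4) by field; rewrite gt_eqF.
  by rewrite -[X in _ <= X]mul1r ler_wpM2r// ltW.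
exists k, m, L, n, (fun j l => f (lattice_center k m L j l) / Z) => w.
pose x := complex.Re w + L%:R; pose y := complex.Im w + L%:R.
have wc j l : w - lattice_center k m L j l = ((x - h * j%:R) +i* (y - h * l%:R))%C.
  by rewrite /x /y /lattice_center -/dl -/h; case: (w) => a b /=; apply/eqP; rewrite eq_complex /=; apply/andP; split; apply/eqP; ring.
have bE j l : lattice_bump k m L j l w = Phi (x - h * j%:R) (y - h * l%:R).
  by rewrite /lattice_bump radial_bump_shift wc.
pose S := \sum_(j < n.+1) \sum_(l < n.+1) f (lattice_center k m L j l) * Phi (x - h * j%:R) (y - h * l%:R).
have -> : \sum_(j < n.+1) \sum_(l < n.+1) f (lattice_center k m L j l) / Z * lattice_bump k m L j l w = S / Z.
  rewrite /S mulr_suml; apply: eq_bigr => j _; rewrite mulr_suml; apply: eq_bigr => l _.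
  by rewrite bE mulrAC.
have [wB|wB] := leP (cabs w) (`|B| + 4).
  have re := Re_le_cabs w; have im := Im_le_cabs w.
  have hx : 4 * dl <= x by move: re; rewrite ler_norml /x => /andP[? ?]; lra.
  have hx2 : x + 4 * dl <= h * n%:R by move: re; rewrite ler_norml /x => /andP[? ?]; lra.
  have hy : 4 * dl <= y by move: im; rewrite ler_norml /y => /andP[? ?]; lra.
  have hy2 : y + 4 * dl <= h * n%:R by move: im; rewrite ler_norml /y => /andP[? ?]; lra.
  have osc := lattice_sum_osc d0 Lp0 beta0 (ltn0Sn m) nm P0 Px Py PL Pb hC hx hx2 hy hy2.
  apply: (dens_arith Z0 (hF w) k0 k1 Fk e0 osc).
  rewrite /lattice_sum mulr_sumr -sumrB mulr_sumr; apply: (le_trans (ler_norm_sum _ _ _)); apply: ler_sum => j _.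
  rewrite mulr_sumr -sumrB mulr_sumr; apply: (le_trans (ler_norm_sum _ _ _)); apply: ler_sum => l _.
  rewrite -mulrBl normrM (ger0_norm (P0 _ _)).
  have [hc|hc] := leP (3 * dl) (cabs (w - lattice_center k m L j l)).
    by rewrite (Pout (x - h * j%:R)) ?mulr0// -wc.
  by apply: ler_wpM2r; [exact: P0|apply: heta; exact: ltW (lt_le_trans hc deta)].
(* Far out f vanishes at w, and so does the sum: a lattice point where f is nonzero has modulus at
   most [B], too far from w for its bump to reach. *)
have fw : f w = 0 by apply: hB; apply: le_lt_trans wB; have := ler_norm B; lra.
have -> : S = 0.
  rewrite /S big1// => j _; rewrite big1// => l _.
  have [pB|pB] := leP (cabs (lattice_center k m L j l)) B; last by rewrite hB ?mul0r.
  rewrite Pout ?mulr0// -wc; have := cabsD (w - lattice_center k m L j l) (lattice_center k m L j l).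
  by rewrite subrK; have := ler_norm B; move: wB pB d1; lra.
by rewrite fw mul0r subrr normr0 ltW.
Unshelve. all: exact: (0 : R).
Qed.

End density.

(** * Conclusion *)

Lemma lt_double (F : realDomainType) (x : F) : 0 < x -> x < 2 * x.
Proof. by move=> x0; lra. Qed.

Section conclusion.
Context (R : realType) d (T : measurableType d) (P : probability T R).
Variable M : forall n : nat, 'M[R[i]]_n.
Implicit Types X Y : nat -> nat -> {RV P >-> borelC R}.

Lemma tame_approx (f : R[i] -> R) (e : R) : tame f -> 0 < e ->
  exists (I : finType) (a : I -> R) (b : I -> nat * nat * nat * nat * nat), forall w,
    `|f w - \sum_i a i * lattice_bump (b i).1.1.1.1 (b i).1.1.1.2 (b i).1.1.2 (b i).1.2 (b i).2 w| <= e.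
Proof.
move=> tf e0; have [k [m [L [n [a h]]]]] := bump_dense tf e0.
exists ('I_n.+1 * 'I_n.+1)%type, (fun p : 'I_n.+1 * 'I_n.+1 => a p.1 p.2), (fun p : 'I_n.+1 * 'I_n.+1 => (k, m, L, p.1 : nat, p.2 : nat)) => w.
by have := h w; rewrite pair_big.
Qed.

Lemma spec_mean_approx (f g : R[i] -> R) e n (D : 'M[R[i]]_n) : 0 <= e -> (forall z, `|f z - g z| <= e) ->
  `|spec_mean D f - spec_mean D g| <= e.
Proof. by move=> e0 h; rewrite -spec_meanB; exact: spec_mean_bound. Qed.

(** The bumps have countably many parameters and share one null set; uniform approximation then
    reaches all test functions off that set. *)
Lemma spec_mean_as X Y : (forall z, {ae P, forall w, logdet_close M X Y z w}) ->
  {ae P, forall w, forall f, tame f ->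
    spec_mean (noisy M X n w) f - spec_mean (noisy M Y n w) f @[n --> \oo] --> (0 : R)}.
Proof.
move=> hae.
have hb : {ae P, forall w, forall k m L j l,
    spec_mean (noisy M X n w) (lattice_bump k m L j l) - spec_mean (noisy M Y n w) (lattice_bump k m L j l) @[n --> \oo] --> (0 : R)}.
  apply/ae_foralln => k; apply/ae_foralln => m; apply/ae_foralln => L; apply/ae_foralln => j; apply/ae_foralln => l.
  have k0 : 0 < k.+1%:R^-1 :> R by rewrite invr_gt0.
  have kk : k.+1%:R^-1 < 2 * k.+1%:R^-1 :> R by exact: lt_double.
  exact: (bump_as (lattice_center R k m L j l) k0 kk k0 hae).
apply: ae_S hb => w hb f tf; apply/cvgrPdist_le => e e0.
have e4 : 0 < e / 4 by rewrite divr_gt0.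
have e2 : 0 < e / 2 by rewrite divr_gt0.
have [I [a [b hg]]] := tame_approx tf e4.
pose g w := \sum_i a i * lattice_bump (b i).1.1.1.1 (b i).1.1.1.2 (b i).1.1.2 (b i).1.2 (b i).2 w.
have gE n (D : 'M[R[i]]_n) : spec_mean D g =
    \sum_i a i * spec_mean D (lattice_bump (b i).1.1.1.1 (b i).1.1.1.2 (b i).1.1.2 (b i).1.2 (b i).2).
  by rewrite /g spec_mean_sum; apply: eq_bigr => i _; rewrite spec_meanZ.
have gc : spec_mean (noisy M X n w) g - spec_mean (noisy M Y n w) g @[n --> \oo] --> (0 : R).
  pose u i n := a i * (spec_mean (noisy M X n w) (lattice_bump (b i).1.1.1.1 (b i).1.1.1.2 (b i).1.1.2 (b i).1.2 (b i).2)
    - spec_mean (noisy M Y n w) (lattice_bump (b i).1.1.1.1 (b i).1.1.1.2 (b i).1.1.2 (b i).1.2 (b i).2)).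
  have hu i : u i n @[n --> \oo] --> (0 : R).
    by rewrite -[X in _ --> X](mulr0 (a i)); apply: cvgM; [exact: cvg_cst|exact: hb].
  rewrite (_ : (fun n => _) = fun n => \sum_(i <- index_enum I) u i n); first exact: cvg_sum_seq.
  by apply/funext => n; rewrite !gE -sumrB; apply: eq_bigr => i _; rewrite /u mulrBr.
move/cvgrPdist_le : gc => /(_ _ e2); apply: filterS => n; rewrite !sub0r !normrN.
have hX := spec_mean_approx (noisy M X n w) (ltW e4) hg; have hY := spec_mean_approx (noisy M Y n w) (ltW e4) hg.
rewrite distrC in hX; rewrite distrC in hY.
exact: (approx_arith hX hY).
Qed.

(** A uniform limit of combinations of bumps, each measurable by [measurable_spec_bump]; this avoids
    any measurable selection of eigenvalues. *)
Lemma measurable_spec_mean X n f : tame f -> measurable_fun setT (fun w => spec_mean (noisy M X n w) f).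
Proof.
move=> tf; have e0 (N : nat) : 0 < N.+1%:R^-1 :> R by rewrite invr_gt0.
have hg (N : nat) : exists g : R[i] -> R, measurable_fun setT (fun w => spec_mean (noisy M X n w) g) /\
    forall z, `|f z - g z| <= N.+1%:R^-1.
  have [I [a [b h]]] := tame_approx tf (e0 N).
  exists (fun w => \sum_i a i * lattice_bump (b i).1.1.1.1 (b i).1.1.1.2 (b i).1.1.2 (b i).1.2 (b i).2 w); split => //.
  under eq_fun do rewrite spec_mean_sum.
  apply: measurable_fun_sumR => i; under eq_fun do rewrite spec_meanZ.
  apply: measurable_funM; first exact: measurable_cst.
  have k0 : 0 < (b i).1.1.1.1.+1%:R^-1 :> R by rewrite invr_gt0.
  have kk : (b i).1.1.1.1.+1%:R^-1 < 2 * (b i).1.1.1.1.+1%:R^-1 :> R by exact: lt_double.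
  exact: (measurable_spec_bump M (lattice_center R _ _ _ _ _) k0 kk k0 X n).
have [g h] := choice hg.
apply: (measurable_fun_cvg (h := fun N w => spec_mean (noisy M X n w) (g N))) => [N|w _]; first exact: (h N).1.
apply/cvgrPdist_le => e ep; exists (Num.truncn e^-1) => // N /= hN.
apply: (le_trans (spec_mean_approx _ (ltW (e0 N)) (h N).2)).
rewrite -[X in _ <= X]invrK lef_pV2 ?posrE ?invr_gt0//.
by apply: (le_trans (ltW (truncnS_gt _))); rewrite ler_nat.
Qed.

(** Dominated convergence for the indicators of the deviation events, which are eventually 0 at
    almost every sample. *)
Lemma in_probability_of_as (g : nat -> T -> R) (e : R) : (forall n, measurable_fun setT (g n)) ->
  {ae P, forall w, g n w @[n --> \oo] --> (0 : R)} -> 0 < e ->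
  P [set w | e <= `|g n w|] @[n --> \oo] --> 0%E.
Proof.
move=> mg g0 e0.
have mA n : measurable [set w | e <= `|g n w|].
  by apply: measurable_leRR; [exact: measurable_cst|apply: measurableT_comp => //; exact: normr_measurable].
have h : Ex P (\1_[set w | e <= `|g n w|]) @[n --> \oo] --> (0 : R).
  apply: (@bounded_cvg_Ex R _ _ P (fun n => \1_[set w | e <= `|g n w|]) 1).
  - by move=> n; exact: measurable_indic.
  - by move=> n w; rewrite indicE; case: (_ \in _); rewrite ?normr1 ?normr0.
  apply: ae_S g0 => w gw; apply: cvg_near_cst.
  move/cvgrPdist_lt : gw => /(_ e e0); apply: filterS => n; rewrite sub0r normrN => hn.
  by rewrite indicE memNset//= leNgt hn.
have hE : (Ex P (\1_[set w | e <= `|g n w|]))%:E @[n --> \oo] --> 0%:E.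
  by apply: cvg_EFin => //; exact: nearW.
rewrite (_ : (fun n => P _) = fun n => (Ex P (\1_[set w | e <= `|g n w|]))%:E)//.
by apply/funext => n; rewrite -Pr_Ex// EFin_Pr.
Qed.

Lemma tame_measurable (f : (R[i])^o -> R) : Cc f -> measurable_fun setT (f : borelC R -> R).
Proof. by move=> [cf _]; exact: borelC_continuous. Qed.

End conclusion.

Theorem theorem1p7 (R : realType)
    (dx : measure_display) (Tx : measurableType dx) (Px : probability Tx R)
    (dy : measure_display) (Ty : measurableType dy) (Py : probability Ty R)
    (d : measure_display) (T : measurableType d) (P : probability T R)
    (x : {RV Px >-> borelC R}) (y : {RV Py >-> borelC R})
    (X Y : nat -> nat -> {RV P >-> borelC R})
    (M : forall n : nat, 'M[R[i]]_n)
    (x_mean : zero_mean Px x) (x_var : unit_variance Px x)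
    (y_mean : zero_mean Py y) (y_var : unit_variance Py y)
    (X_iid : iid_copies X x) (Y_iid : iid_copies Y y)
    (M_bound : (ereal_sup
      (range (fun n => ((n%:R ^+ 2)^-1 * hs_norm (M n) ^+ 2)%:E)) < +oo)%E) :
  let A n w := M n + random_mx X n w in
  let B n w := M n + random_mx Y n w in
  let muA n w := esd (div_sqrt (A n w)) in
  let muB n w := esd (div_sqrt (B n w)) in
  cvg_diff_in_probability P muA muB /\
  (ae_C (fun z => exists nu,
      vague_cvg (fun n => esd (shifted_gram (div_sqrt (M n)) z)) nu) ->
   cvg_diff_almost_surely P muA muB).

Proof.
move=> A B muA muB.
have gX := array_law_good X_iid x_mean x_var; have gY := array_law_good Y_iid y_mean y_var.
have close z : {ae P, forall w, logdet_close M X Y z w} := logdet_close_as z gX gY M_bound.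
have main := spec_mean_as close.
have muE f n w : Cc f -> \int[muA n w]_z f z - \int[muB n w]_z f z =
    spec_mean (noisy M X n w) f - spec_mean (noisy M Y n w) f.
  move=> cf; have mf := tame_measurable cf.
  exact: (congr2 (fun a b : R => a - b) (Rintegral_esd (noisy M X n w) mf) (Rintegral_esd (noisy M Y n w) mf)).
split=> [f cf e e0|_].
  have mg n : measurable_fun setT (fun w => spec_mean (noisy M X n w) f - spec_mean (noisy M Y n w) f).
    by apply: measurable_funB; apply: measurable_spec_mean; exact: Cc_tame cf.
  have h := in_probability_of_as mg (ae_S (fun w hw => hw f (Cc_tame cf)) main) e0.
  apply: cvg_trans h; apply: near_eq_cvg; apply: nearW => n.
  by congr (P _); apply/funext => w /=; rewrite (muE f n w cf).
refine (ae_S _ main) => w hw f cf.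
have h := hw f (Cc_tame cf).
apply: cvg_trans h; apply: near_eq_cvg; apply: nearW => n.
by rewrite (muE f n w cf).
Qed.
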